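(* Let $G$ be a finite-dimensional connected Lie group with identity $e$, Lie algebra $\mathfrak g$ and right-invariant Haar measure $\mu$, and let $V_1,\dots,V_d\in\mathfrak g$ be left-invariant vector fields on $G$ such that the Lie sub-algebra generated by $V_1,\dots,V_d$ is all of $\mathfrak g$. Let $\mathcal L=\frac12\sum_{i=1}^dV_i^2$, with associated semigroup $P_t$, carré du champ $\Gamma$, heat kernel $p_t=p(t,\cdot)$ and natural Ornstein–Uhlenbeck generators $\mathcal L^t$ as defined in the context. For a positive function $a:\mathbb R_{>0}\to\mathbb R_{>0}$, $t\mapsto a_t$, the following assertions are equivalent: (i) For all $t>0$, the operator $\mathcal L^t$ has a spectral gap of size $a_t$ on $L^2(p_t\,\mu)$. (ii) At one point $g\in G$ (and therefore at all points $g\in G$), the local estimate $$P_t(\Gamma(f,f))(g)\;\ge\;2a_t\bigl((P_tf^2)(g)-((P_tf)(g))^2\bigr)$$ holds for all test functions $f\in C_0^\infty(G)$ and all $t>0$. Furthermore, if there is a strictly positive locally integrable function $\phi:\mathbb R_{\ge0}\to\mathbb R_{>0}$ such that $$\Gamma(P_tf,P_tf)(e)\le\phi(t)\,P_t(\Gamma(f,f))(e)$$ for all $f\in C_0^\infty(G)$ and all $t\ge0$, then the two equivalent assertions hold true with $a_t$ given by $$a_t\int_0^t\phi(t-s)\,ds=\frac12,\qquad t>0 .$$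
   Context: Vector fields act as first-order differential operators; $C_0^\infty(G)$ denotes the smooth compactly supported real functions. $\Gamma(f,g)=\sum_{i=1}^d(V_if)(V_ig)$. $X^x$ is the solution of $dX^x_t=\sum_{i=1}^dV_i(X^x_t)\circ dB^i_t$, $X^x_0=x$, where $B$ is a $d$-dimensional Brownian motion; $P_tf(x)=\mathbf E(f(X^x_t))$; $p(t,\cdot)$ is the (smooth, positive) density of the law of $X^e_t$ with respect to $\mu$. Put $W_t=-\log p(t,\cdot)$ and $\mathcal L^t=\mathcal L-\frac12\Gamma(W_t,\cdot)$, which is symmetric on $L^2(p_t\,\mu)$. For $a>0$ and a finite measure $\nu=e^{-U}\mu$ with $U$ smooth, the operator $\mathcal L-\frac12\Gamma(U,\cdot)$ has a spectral gap (at $0$) of size $a$ on $L^2(\nu)$ if $\int_G\Gamma(f,f)\,d\nu\ge2a\int_Gf^2\,d\nu$ for all $f\in C_0^\infty(G)$ with $\int_Gf\,d\nu=0$. *)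

(* Defs.v *)
From HB Require Import structures.
From mathcomp Require Import all_boot all_order all_algebra.
From mathcomp Require Import all_classical all_reals all_analysis.
Set Implicit Arguments.
Unset Strict Implicit.
Unset Printing Implicit Defensive.
Import Order.TTheory GRing.Theory Num.Theory.
Import numFieldNormedType.Exports.
Local Open Scope classical_set_scope.
Local Open Scope ring_scope.

(* Only meant for open [U]. *)
Fixpoint Ck_on (R : realType) (V W : normedModType R) (k : nat)
    (U : set V) (h : V -> W) : Prop :=
  match k with
  | 0 => forall x, U x -> {for x, continuous h}
  | k'.+1 => (forall x, U x -> differentiable h x) /\
             (forall v, Ck_on k' U ('D_v h))
  end.

Definition smooth_on (R : realType) (V W : normedModType R)
    (U : set V) (h : V -> W) : Prop :=
  forall k, Ck_on k U h.

(* [chart_map] and [chart_inv] are meaningful only on [chart_dom] and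
   [chart_cod] respectively. *)
Record chart (R : realType) (n : nat) (G : topologicalType) := Chart {
  chart_dom : set G ;
  chart_map : G -> 'rV[R]_n ;
  chart_inv : 'rV[R]_n -> G }.

Definition chart_cod (R : realType) (n : nat) (G : topologicalType)
  (c : chart R n G) : set 'rV[R]_n := chart_map c @` chart_dom c.

Definition is_chart (R : realType) (n : nat) (G : topologicalType)
    (c : chart R n G) : Prop :=
  [/\ open (chart_dom c), open (chart_cod c),
      (forall x, chart_dom c x -> chart_inv c (chart_map c x) = x),
      {within chart_dom c, continuous (chart_map c)} &
      {within chart_cod c, continuous (chart_inv c)}].

(* The [Pointed] structure is required by the measurable types of the library;
   the distinguished point plays no role. *)
HB.mixin Record isLieGroup (R : realType) (n : nat) (G : Type)
    of PointedTopological G & Group G := {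
  lie_hausdorff : hausdorff_space G ;
  lie_second_countable : @second_countable G ;
  lie_atlas : set (chart R n G) ;
  lie_chart : forall c, lie_atlas c -> is_chart c ;
  lie_cover : forall x : G, exists2 c, lie_atlas c & chart_dom c x ;
  lie_compatible : forall c c', lie_atlas c -> lie_atlas c' ->
    smooth_on (chart_cod c `&` [set u | chart_dom c' (chart_inv c u)])
              (fun u => chart_map c' (chart_inv c u)) ;
  lie_mul_continuous : continuous (fun z : G * G => (z.1 * z.2)%g) ;
  lie_inv_continuous : continuous (fun x : G => (x^-1)%g) ;
  lie_mul_smooth : forall c1 c2 c3,
    lie_atlas c1 -> lie_atlas c2 -> lie_atlas c3 ->
    smooth_on
      [set z : 'rV[R]_n * 'rV[R]_n |
        [/\ chart_cod c1 z.1, chart_cod c2 z.2 &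
            chart_dom c3 (chart_inv c1 z.1 * chart_inv c2 z.2)%g]]
      (fun z => chart_map c3 (chart_inv c1 z.1 * chart_inv c2 z.2)%g) ;
  lie_inv_smooth : forall c c', lie_atlas c -> lie_atlas c' ->
    smooth_on (chart_cod c `&` [set u | chart_dom c' (chart_inv c u)^-1%g])
              (fun u => chart_map c' (chart_inv c u)^-1%g) }.

#[short(type="lieGroupType")]
HB.structure Definition LieGroup (R : realType) (n : nat) :=
  {G of PointedTopological G & Group G & isLieGroup R n G}.

Section LieGroupCalculus.
Context {R : realType} {n : nat} {G : lieGroupType R n}.

Definition smooth (f : G -> R) : Prop :=
  forall c : chart R n G, lie_atlas c ->
    smooth_on (chart_cod c) (fun u => f (chart_inv c u)).

Definition test_function (f : G -> R) : Prop :=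
  smooth f /\ compact (closure [set x | f x != 0]).

(* Vector fields are derivations of the algebra of smooth functions.  The
   values of such an operator on functions that are not smooth are junk. *)
Definition operator := (G -> R) -> G -> R.

Record left_invariant_vector_field (D : operator) : Prop := {
  vf_smooth : forall f, smooth f -> smooth (D f) ;
  vf_linear : forall (c : R) f h, smooth f -> smooth h ->
    forall x, D (fun y => c * f y + h y) x = c * D f x + D h x ;
  vf_leibniz : forall f h, smooth f -> smooth h ->
    forall x, D (fun y => f y * h y) x = f x * D h x + D f x * h x ;
  vf_left_invariant : forall g f, smooth f ->
    forall x, D (fun y => f (g * y)%g) x = D f (g * x)%g }.

Inductive lie_generated (d : nat) (V : 'I_d -> operator) : operator -> Prop :=
| LieGen i : lie_generated V (V i)
| LieZero : lie_generated V (fun _ _ => 0)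
| LieComb (c : R) D E : lie_generated V D -> lie_generated V E ->
    lie_generated V (fun f x => c * D f x + E f x)
| LieBracket D E : lie_generated V D -> lie_generated V E ->
    lie_generated V (fun f x => D (E f) x - E (D f) x).

Definition lie_generating (d : nat) (V : 'I_d -> operator) : Prop :=
  forall D, left_invariant_vector_field D ->
    exists2 E, lie_generated V E & forall f, smooth f -> forall x, D f x = E f x.

Definition Gamma (d : nat) (V : 'I_d -> operator) (f h : G -> R) : G -> R :=
  fun x => \sum_(i < d) V i f x * V i h x.

Definition borel := g_sigma_algebraType (@open G).

(* Regularity is not required: it is automatic since [G] is second countable
   and locally compact. *)
Record right_haar (mu : {measure set borel -> \bar R}) : Prop := {
  haar_invariant : forall (g : G) (A : set borel), measurable A ->
    mu [set x : G | A (x * g)%g] = mu A ;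
  haar_compact : forall K : set G, compact K -> (mu K < +oo)%E ;
  haar_nonzero : (0 < mu setT)%E }.

(* Spectral gap of size [a] of [L - Gamma(U, .) / 2] on [L^2(e^-U mu)], where
   [L = \sum_i V_i^2 / 2]: by symmetry of this operator its Dirichlet form is
   half the integral of [Gamma f f], so that it does not occur explicitly. *)
Definition ou_spectral_gap (d : nat) (V : 'I_d -> operator)
    (mu : {measure set borel -> \bar R}) (U : G -> R) (a : R) : Prop :=
  forall f, test_function f ->
    \int[mu]_x (f x * expR (- U x)) = 0 ->
    2 * a * \int[mu]_x (f x ^+ 2 * expR (- U x)) <=
    \int[mu]_x (Gamma V f f x * expR (- U x)).

End LieGroupCalculus.
Arguments operator {R n} G.
Arguments borel {R n} G.

(* Processes are indexed by all of [R]; their values at negative times are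
   irrelevant. *)

Section Processes.
Context {d : measure_display} {Omega : measurableType d} {R : realType}.
Variable P : probability Omega R.

Record filtration (F : R -> set (set Omega)) : Prop := {
  filtration_sigma : forall t, 0 <= t -> sigma_algebra setT (F t) ;
  filtration_sub : forall t, 0 <= t -> F t `<=` measurable ;
  filtration_homo : forall s t, 0 <= s -> s <= t -> F s `<=` F t }.

Variable F : R -> set (set Omega).

Definition adapted (d' : measure_display) (T : measurableType d')
    (Y : R -> Omega -> T) : Prop :=
  forall t, 0 <= t -> forall A, measurable A -> F t (Y t @^-1` A).

Definition continuous_paths (T : topologicalType) (Y : R -> Omega -> T) : Prop :=
  forall w, {within `[0, +oo[, continuous (Y ^~ w)}.

(* The last field says that [B_t - B_s] is independent of [F_s] with law
   N(0, (t - s) I). *)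
Record brownian_motion (m : nat) (B : 'I_m -> R -> Omega -> R) : Prop := {
  bm_adapted : forall i, adapted (B i) ;
  bm_continuous : forall i, continuous_paths (B i) ;
  bm_start : forall i w, B i 0 w = 0 ;
  bm_increments : forall s t, 0 <= s -> s < t ->
    forall A, F s A -> forall C : 'I_m -> set R, (forall i, measurable (C i)) ->
    P (A `&` [set w | forall i, C i (B i t w - B i s w)]) =
    (P A * \prod_(i < m) normal_prob 0 (Num.sqrt (t - s)) (C i))%E }.

Definition martingale (N : R -> Omega -> R) : Prop :=
  [/\ adapted N,
      (forall t, 0 <= t -> P.-integrable setT (EFin \o N t)) &
      forall s t, 0 <= s -> s <= t -> forall A, F s A ->
        (\int[P]_(w in A) (N t w)%:E = \int[P]_(w in A) (N s w)%:E)%E].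

Definition stopping_time (tau : Omega -> \bar R) : Prop :=
  (forall w, 0 <= tau w)%E /\
  (forall t, 0 <= t -> F t [set w | (tau w <= t%:E)%E]).

Definition stopped (M : R -> Omega -> R) (tau : Omega -> \bar R) :
    R -> Omega -> R :=
  fun t w => M (fine (Order.min (tau w) t%:E)) w.

Definition continuous_local_martingale (M : R -> Omega -> R) : Prop :=
  [/\ adapted M, continuous_paths M &
      exists tau : nat -> Omega -> \bar R,
        [/\ (forall k, stopping_time (tau k)),
            {ae P, forall w, {homo tau ^~ w : j k / (j <= k)%N >-> (j <= k)%E}},
            {ae P, forall w, tau ^~ w @ \oo --> +oo%E} &
            forall k, martingale (fun t w => stopped M (tau k) t w - M 0 w)]].

Definition continuous_finite_variation (A : R -> Omega -> R) : Prop :=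
  [/\ adapted A, continuous_paths A &
      forall t w, 0 <= t -> bounded_variation 0 t (A ^~ w)].

Definition continuous_semimartingale (Y : R -> Omega -> R) : Prop :=
  exists M A, [/\ continuous_local_martingale M,
    continuous_finite_variation A &
    {ae P, forall w, forall t, 0 <= t -> Y t w = M t w + A t w}].

(* As in the library, the initial point of a partition is left out of [s]. *)
Definition trapezoid_sum (Y Z : R -> Omega -> R) (s : seq R) (w : Omega) : R :=
  \sum_(k < size s)
    (Y (nth 0 (0 :: s) k) w + Y (nth 0 (0 :: s) k.+1) w) / 2 *
    (Z (nth 0 (0 :: s) k.+1) w - Z (nth 0 (0 :: s) k) w).

Definition mesh_le (s : seq R) (delta : R) : Prop :=
  forall k, (k < size s)%N ->
    nth 0 (0 :: s) k.+1 - nth 0 (0 :: s) k <= delta.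

(* [I] is (a version of) the Stratonovich integral of [Y] against [Z] over
   [0, t]: the limit in probability of the trapezoid sums as the mesh of the
   partition tends to 0.  [Y] and [Z] are meant to be continuous
   semimartingales. *)
Definition is_stratonovich_integral (Y Z : R -> Omega -> R) (t : R)
    (I : Omega -> R) : Prop :=
  measurable_fun setT I /\
  forall eps : R, 0 < eps -> exists2 delta : R, 0 < delta &
    forall s : seq R, itv_partition 0 t s -> mesh_le s delta ->
      (P [set w | (eps <= `|trapezoid_sum Y Z s w - I w|)%R] <= eps%:E)%E.

(* [X] is a solution of [dX = \sum_i V_i(X) o dB^i], [X_0 = x], in the usual
   sense for equations on manifolds, i.e. tested on functions. *)
Record sde_solution (n : nat) (G : lieGroupType R n) (m : nat)
    (V : 'I_m -> operator G) (B : 'I_m -> R -> Omega -> R)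
    (x : G) (X : R -> Omega -> G) : Prop := {
  sde_adapted : adapted (X : R -> Omega -> borel G) ;
  sde_continuous : continuous_paths X ;
  sde_start : forall w, X 0 w = x ;
  sde_semimartingale : forall f, test_function f ->
    continuous_semimartingale (fun t w => f (X t w)) ;
  sde_equation : forall f, test_function f -> forall t, 0 <= t ->
    exists2 I : 'I_m -> Omega -> R,
      (forall i, is_stratonovich_integral
                   (fun s w => V i f (X s w)) (B i) t (I i)) &
      {ae P, forall w, f (X t w) = f x + \sum_(i < m) I i w} }.

Definition semigroup (G : Type) (X : G -> R -> Omega -> G) (t : R)
    (f : G -> R) : G -> R :=
  fun x => \int[P]_w f (X x t w).

(* [p t] is the smooth positive density with respect to [mu] of the law of
   [X_t], where [X] starts from the identity. *)
Definition heat_kernel (n : nat) (G : lieGroupType R n)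
    (mu : {measure set borel G -> \bar R}) (X : R -> Omega -> G)
    (p : R -> G -> R) : Prop :=
  forall t, 0 < t ->
    [/\ smooth (p t), (forall x, 0 < p t x) &
        forall A : set (borel G), measurable A ->
          P (X t @^-1` A) = (\int[mu]_(x in A) (p t x)%:E)%E].

Definition local_estimate (n : nat) (G : lieGroupType R n) (m : nat)
    (V : 'I_m -> operator G) (X : G -> R -> Omega -> G) (a : R -> R)
    (g : G) : Prop :=
  forall f, test_function f -> forall t, 0 < t ->
    2 * a t * (semigroup X t (fun x => f x ^+ 2) g - semigroup X t f g ^+ 2)
    <= semigroup X t (Gamma V f f) g.

End Processes.

(* Main.v *)
(** Let [Z] solve the equation from the identity and let [f] be a test function.
    Then [u_t(z) = E f(z Z_t^-1)] solves the heat equation [du/dt = L u] with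
    [u_0 = f]: this is Dynkin's formula for [y |-> f(z y^-1)], on which the square
    of a left invariant field acts as it does on [f] in the variable [z].  For
    any solution [X] from [x], Dynkin's formula for [E rho^2 u_{t-s}(X_s)^2], with
    a cutoff [rho], bounds [E \int_0^t rho^2 Gamma(u_{t-s})(X_s) ds] uniformly in
    [rho] because the cross term is absorbed by Young's inequality.  Hence the
    cutoff can be removed from [E rho^2 u_{t-s}(X_s)], which gives
    [E f(X_t) = u_t(x)].  So [P_t] commutes with left translations and satisfies
    the Chapman-Kolmogorov equation.

    By translation the local estimates at all points are equivalent.  At the
    identity the local estimate is the spectral gap inequality for [f - P_t f(e)],
    which is approximated by test functions of mean 0 by means of cutoffs with
    uniformly bounded derivatives, namely averages of translates of a bump function over
    compact sets.  Under the gradient bound, the derivative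
    [E Gamma(P_{t-s} f)(X_s)] of [E (P_{t-s} f)^2(X_s)] is at most
    [phi(t-s) P_t Gamma(f, f)(e)].

    Since the Stratonovich integral is only given as a limit of trapezoid sums,
    Dynkin's formula is obtained by expanding these sums on a fine grid nested in
    a coarse one; the fine increments of the integrands, which are only known to
    be semimartingales, are controlled by the tightness of their sums of squares. *)
Require Import Defs.
From HB Require Import structures.
From mathcomp Require Import all_boot all_order all_algebra.
From mathcomp Require Import all_classical all_reals all_analysis.
From mathcomp Require Import measurable_realfun.
From mathcomp Require Import ring lra.
Set Implicit Arguments.
Unset Strict Implicit.
Unset Printing Implicit Defensive.
Import Order.TTheory GRing.Theory Num.Theory.
Import numFieldNormedType.Exports.
Local Open Scope classical_set_scope.
Local Open Scope ring_scope.

(** * Calculus of C^k functions *)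

Section frechet.
Context {R : realType} {V W : normedModType R}.
Implicit Types (f g : V -> W) (x v : V).

(** The inverse in [f (z * y^-1)] is what gives the heat equation. Dynkin's formula for [E f(z Z_t)]
    would put [L f] under the expectation, but a left invariant field acting on [z] does not commute
    with the right translation by [Z_t]. Moving [y] to [y exp(sV)] in [f (z * y^-1)] is moving [z]
    to [z exp(-sV)]: [V] in [y] is [-V] in [z], and the squares agree. That the result is again
    [P_t f] reflects the invariance of the driving noise under time reversal. It is not read off
    from laws: it comes out of the comparison of [u] with an arbitrary solution, and takes the place
    of uniqueness in law and of the Markov property.

    Vector fields are given as operators on smooth functions, without flows or tangent vectors.
    Hadamard's lemma recovers their expression in a chart, and every differentiation under an
    integral is done there.

    The equation is tested on functions of compact support only, whereas [u_t] has in general no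
    compact support and no global bound on its derivatives is at hand; this is why cutoffs and an
    energy bound enter. *)

Lemma differentiable_epsP f x (L : {linear V -> W}) : continuous L ->
  (forall e : R, 0 < e -> \forall h \near 0, `|f (h + x) - f x - L h| <= e * `|h|) ->
  differentiable f x /\ 'd f x = L :> (V -> W).
Proof.
move=> cL H.
have fL : f \o shift x = cst (f x) + L +o_ 0 id.
  apply/eqaddoP => e e0 /=.
  move: (H e e0); apply: filterS => h /=.
  by rewrite !fctE opprD addrA.
have dL := diff_unique cL fL.
by split=> //; apply/diff_locallyP; rewrite dL.
Qed.

Lemma diff_eps f x : differentiable f x ->
  forall e : R, 0 < e -> \forall h \near 0, `|f (h + x) - f x - 'd f x h| <= e * `|h|.
Proof.
move=> /diff_locally /eqaddoP H e e0.
by move: (H e e0); apply: filterS => h /=; rewrite !fctE opprD addrA.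
Qed.

Lemma near_eq_differentiable f g x : (\near x, f x = g x) ->
  differentiable f x -> differentiable g x.
Proof.
move=> fg df.
apply: (@proj1 _ _ (@differentiable_epsP g x ('d f x) _ _)).
  exact: diff_continuous.
move=> e e0; have := diff_eps df e0.
have fg0 : \forall h \near (0 : V), f (h + x) = g (h + x).
  move: fg; rewrite (near_shift 0 x); apply: filterS => h /=.
  by rewrite subr0.
have fx : f x = g x by exact: nbhs_singleton fg.
by apply: filterS2 fg0 => h /= <-; rewrite fx.
Qed.

End frechet.

Section Ck.
Context {R : realType}.
Implicit Types (V W : normedModType R).

Lemma Ck_onS V W k (U : set V) (h : V -> W) : Ck_on k.+1 U h -> Ck_on k U h.
Proof.
elim: k h => [|k IH] h [dh Dh]; last by split=> // v; exact: IH.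
by move=> x Ux; apply: differentiable_continuous; exact: dh.
Qed.

Lemma Ck_on_sub V W k (U U' : set V) (h : V -> W) : U' `<=` U ->
  Ck_on k U h -> Ck_on k U' h.
Proof.
move=> UU; elim: k h => [|k IH] h /=; first by move=> ch x /UU; exact: ch.
by move=> [dh Dh]; split=> [x /UU|v]; [exact: dh|exact: IH].
Qed.

(** [Ck_on] is a condition at each point of its set on a globally defined function, so it can be
    verified at each point separately. *)
Lemma Ck_on_local V W k (U : set V) (h : V -> W) :
  (forall x, U x -> exists2 U', U' x & Ck_on k U' h) -> Ck_on k U h.
Proof.
elim: k h => [|k IH] h H /=.
  by move=> x /H[U' U'x]; apply.
split=> [x /H[U' U'x] [+ _]|v]; first exact.
by apply: IH => x /H[U' U'x [_ /(_ v) ?]]; exists U'.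
Qed.

(** Openness of [U] makes the equality hold near each point, so that it passes to the
    derivatives. *)
Lemma Ck_on_eq V W k (U : set V) (h g : V -> W) : open U ->
  (forall x, U x -> h x = g x) -> Ck_on k U h -> Ck_on k U g.
Proof.
move=> oU; elim: k h g => [|k IH] h g hg.
  move=> ch x Ux.
  have nhg : {near x, h =1 g} by near=> y; apply: hg; near: y; exact: open_nbhs_nbhs.
  rewrite /prop_for /continuous_at -hg//.
  exact: cvg_trans (near_eq_cvg nhg) (ch _ Ux).
have nhg x : U x -> {near x, h =1 g}.
  by move=> Ux; near=> y; apply: hg; near: y; exact: open_nbhs_nbhs.
move=> [dh Dh]; split=> [x Ux|v].
  exact: near_eq_differentiable (nhg _ Ux) (dh _ Ux).
apply: IH (Dh v) => x Ux; exact: near_eq_derive (nhg _ Ux).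
Unshelve. all: by end_near. Qed.

Lemma Ck_on_cst V W k (U : set V) (c : W) : Ck_on k U (fun=> c).
Proof.
elim: k c => [|k IH] c; first by move=> x _; exact: cvg_cst.
split=> [x _|v]; first exact: differentiable_cst.
by rewrite (_ : 'D_v _ = fun=> 0)//; apply/funext => x; rewrite derive_cst.
Qed.

Lemma Ck_onD V W k (U : set V) (h g : V -> W) : open U ->
  Ck_on k U h -> Ck_on k U g -> Ck_on k U (fun x => h x + g x).
Proof.
move=> oU; elim: k h g => [|k IH] h g.
  by move=> ch cg x Ux; apply: cvgD; [exact: ch|exact: cg].
move=> [dh Dh] [dg Dg]; split=> [x Ux|v].
  by apply: differentiableD; [exact: dh|exact: dg].
apply: (Ck_on_eq oU _ (IH _ _ (Dh v) (Dg v))) => x Ux.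
by rewrite (deriveD (f:=h) (g:=g))//; apply: diff_derivable; [exact: dh|exact: dg].
Qed.

Lemma Ck_onM V k (U : set V) (h g : V -> R) : open U ->
  Ck_on k U h -> Ck_on k U g -> Ck_on k U (fun x => h x * g x).
Proof.
move=> oU; elim: k h g => [|k IH] h g.
  by move=> ch cg x Ux; apply: cvgM; [exact: ch|exact: cg].
move=> H G; have Ch := Ck_onS H; have Cg := Ck_onS G.
case: H G => dh Dh [dg Dg]; split=> [x Ux|v].
  by apply: differentiableM; [exact: dh|exact: dg].
apply: (Ck_on_eq oU _ (Ck_onD oU (IH _ _ Ch (Dg v)) (IH _ _ Cg (Dh v)))) => x Ux.
by rewrite (deriveM (f:=h) (g:=g))//; apply: diff_derivable; [exact: dh|exact: dg].
Qed.

Lemma Ck_onZ V k (U : set V) (c : R) (h : V -> R) : open U ->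
  Ck_on k U h -> Ck_on k U (fun x => c * h x).
Proof. by move=> oU; apply: Ck_onM => //; exact: Ck_on_cst. Qed.

Lemma Ck_on_sum V k (U : set V) I (r : seq I) (h : I -> V -> R) : open U ->
  (forall i, Ck_on k U (h i)) -> Ck_on k U (fun x => \sum_(i <- r) h i x).
Proof.
move=> oU H; elim: r => [|i r IH].
  by under eq_fun do rewrite big_nil; exact: Ck_on_cst.
by under eq_fun do rewrite big_cons; exact: Ck_onD.
Qed.

Lemma continuous_at_sum (X : topologicalType) I (r : seq I) (h : I -> X -> R) x :
  (forall i, {for x, continuous (h i)}) -> {for x, continuous (fun y => \sum_(i <- r) h i y)}.
Proof.
move=> H; elim: r => [|i r IH].
  by rewrite (_ : (fun y => _) = fun=> 0); [exact: cvg_cst|apply/funext => y; rewrite big_nil].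
rewrite (_ : (fun y => _) = fun y => h i y + \sum_(j <- r) h j y).
  by apply: cvgD; [exact: H|exact: IH].
by apply/funext => y; rewrite big_cons.
Qed.

Lemma derive_rV_coord V m (phi : V -> 'rV[R]_m) x v j : differentiable phi x ->
  'D_v (fun y => phi y 0 j) x = 'D_v phi x 0 j.
Proof. by move=> d; rewrite derive_mx ?mxE//; exact: diff_derivable. Qed.

Lemma Ck_on_coord V k m (U : set V) (phi : V -> 'rV[R]_m) j : open U ->
  Ck_on k U phi -> Ck_on k U (fun y => phi y 0 j).
Proof.
move=> oU; elim: k phi => [|k IH] phi.
  move=> c x Ux; apply: (cvg_comp phi (fun M : 'rV_m => M 0 j)); first exact: c.
  exact: coord_continuous.
move=> [d D]; split=> [x Ux|v].
  apply: (differentiable_comp (f := phi) (g := fun M : 'rV[R]_m => M 0 j : R)).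
    exact: d.
  exact: differentiable_coord.
apply: (Ck_on_eq oU _ (IH _ (D v))) => x Ux.
by rewrite derive_rV_coord//; exact: d.
Qed.

Lemma Ck_on_coord0 m (j : 'I_m) : Ck_on 0 setT (fun y : 'rV[R]_m => y 0 j : R).
Proof. by move=> x _; exact: coord_continuous. Qed.

Lemma diff_rV m (h : 'rV[R]_m -> R) y a : differentiable h y ->
  'd h y a = \sum_j a 0 j * 'D_(delta_mx 0 j) h y.
Proof.
move=> d; rewrite {1}(row_sum_delta a) linear_sum; apply: eq_bigr => j _.
by rewrite linearZ deriveE.
Qed.

Lemma derive_rV_comp V m (phi : V -> 'rV[R]_m) (h : 'rV[R]_m -> R) x v :
  differentiable phi x -> differentiable h (phi x) ->
  'D_v (fun y => h (phi y)) x =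
  \sum_j 'D_v phi x 0 j * 'D_(delta_mx 0 j) h (phi x).
Proof.
move=> dp dh.
rewrite deriveE; last exact: (differentiable_comp (f:=phi)).
rewrite diff_comp//= diff_rV//; apply: eq_bigr => j _.
by rewrite -deriveE.
Qed.

(** By the chain rule a derivative of the composite is a sum of products whose factors are one order
    less regular. The intermediate space consists of row vectors, so that the differential of [h]
    expands into partial derivatives with real coefficients. *)
Lemma Ck_on_comp V m k (U : set V) (U' : set 'rV[R]_m) (phi : V -> 'rV[R]_m)
    (h : 'rV[R]_m -> R) : open U ->
  (forall x, U x -> U' (phi x)) ->
  Ck_on k U phi -> Ck_on k U' h -> Ck_on k U (fun x => h (phi x)).
Proof.
move=> oU UU'; elim: k phi h UU' => [|k IH] phi h UU'.
  move=> cp ch x Ux; apply: (cvg_comp phi h); first exact: cp.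
  exact: ch (UU' _ Ux).
move=> P H; have Cp := Ck_onS P; case: P H => dp Dp [dh Dh]; split=> [x Ux|v].
  by apply: (differentiable_comp (f:=phi)); [exact: dp|exact/dh/UU'].
apply: (@Ck_on_eq _ _ _ _ (fun x => \sum_j 'D_v phi x 0 j * 'D_(delta_mx 0 j) h (phi x)) _ oU).
  by move=> x Ux; rewrite derive_rV_comp//; [exact: dp|exact/dh/UU'].
apply: Ck_on_sum => // j; apply: Ck_onM => //.
  exact: Ck_on_coord (Dp v).
exact: (IH phi ('D_(delta_mx 0 j) h) UU' Cp (Dh _)).
Qed.

(** The derivative of [phi] is the same at all points, hence ['D_v (h \o phi)] is ['D_(L v) h]
    composed with [phi]: the form of the composite is preserved by the induction. It serves for
    embeddings and projections of product spaces. *)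
Lemma Ck_on_comp_affine V V' W k (U : set V) (U' : set V') (phi : V -> V')
    (L : V -> V') (h : V' -> W) : open U ->
  (forall x, differentiable phi x) -> (forall x v, 'D_v phi x = L v) ->
  (forall x, U x -> U' (phi x)) ->
  Ck_on k U' h -> Ck_on k U (fun x => h (phi x)).
Proof.
move=> oU dp Dp UU'; elim: k h => [|k IH] h.
  move=> ch x Ux; apply: (cvg_comp phi h); first exact/differentiable_continuous/dp.
  exact: ch (UU' _ Ux).
move=> [dh Dh]; split=> [x Ux|v].
  by apply: (differentiable_comp (f:=phi)); [exact: dp|exact/dh/UU'].
apply: (Ck_on_eq oU _ (IH _ (Dh (L v)))) => x Ux.
rewrite [RHS]deriveE; last by apply: (differentiable_comp (f:=phi)) => //; exact/dh/UU'.
rewrite diff_comp//=; last exact/dh/UU'.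
by rewrite -(deriveE v (dp x)) Dp deriveE//; exact/dh/UU'.
Qed.

Lemma smooth_on_D V W (U : set V) (h : V -> W) v : smooth_on U h -> smooth_on U ('D_v h).
Proof. by move=> sh k; have [_] := sh k.+1; apply. Qed.

Lemma smooth_on_diff V W (U : set V) (h : V -> W) x : smooth_on U h -> U x ->
  differentiable h x.
Proof. by move=> sh Ux; have [+ _] := sh 1%N; exact. Qed.

Lemma smooth_on_cont V W (U : set V) (h : V -> W) x : smooth_on U h -> U x ->
  {for x, continuous h}.
Proof. by move=> sh Ux; exact: (sh 0%N). Qed.

End Ck.

(** * Domination and linearity for integrals of real functions *)

Section Rintegral_tools.
Context d {T : measurableType d} {R : realType}.
Variable mu : {measure set T -> \bar R}.
Implicit Types (D : set T) (f g : T -> R).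

Lemma dominated_cvg_Rintegral D (f_ : nat -> T -> R) f g : measurable D ->
  (forall k, measurable_fun D (f_ k)) ->
  (forall x, D x -> f_ ^~ x @ \oo --> f x) ->
  mu.-integrable D (EFin \o g) ->
  (forall k x, D x -> `|f_ k x| <= g x) ->
  mu.-integrable D (EFin \o f) /\
  \int[mu]_(x in D) f_ k x @[k --> \oo] --> \int[mu]_(x in D) f x.
Proof.
move=> mD mf cf ig fg.
have mf' k : measurable_fun D (fun x => (f_ k x)%:E) by exact/measurable_EFinP.
have cf' x : D x -> (f_ k x)%:E @[k --> \oo] --> (f x)%:E.
  by move=> Dx; apply/fine_cvgP; split; [exact: nearW|exact: cf].
have mff : measurable_fun D (fun x => (f x)%:E).
  exact: emeasurable_fun_cvg mf' cf'.
have bnd : {ae mu, forall x n, D x -> (`|(f_ n x)%:E| <= (EFin \o g) x)%E}.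
  by apply: aeW => x n Dx; rewrite lee_fin fg.
have [If _ H] := @dominated_convergence _ _ _ mu _ mD (fun k x => (f_ k x)%:E)
  (fun x => (f x)%:E) (EFin \o g) mf' mff (aeW _ cf') ig bnd.
split=> //; rewrite /Rintegral; apply: fine_cvg.
rewrite fineK; last exact: integrable_fin_num.
exact: H.
Qed.

Lemma integrable_bounded_by D f g : measurable D -> measurable_fun D f ->
  mu.-integrable D (EFin \o g) -> (forall x, D x -> `|f x| <= g x) ->
  mu.-integrable D (EFin \o f).
Proof.
move=> mD mf ig fg; apply: le_integrable ig => //; first exact/measurable_EFinP.
by move=> x Dx /=; rewrite lee_fin (le_trans (fg x Dx))// ler_norm.
Qed.

Lemma Rintegral_norm_le D f g : measurable D -> measurable_fun D f ->
  mu.-integrable D (EFin \o g) -> (forall x, D x -> `|f x| <= g x) ->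
  `|\int[mu]_(x in D) f x| <= \int[mu]_(x in D) g x.
Proof.
move=> mD mf ig fg.
have If := integrable_bounded_by mD mf ig fg.
apply: (le_trans (le_normr_Rintegral _ _)) => //.
apply: le_Rintegral => //.
by apply: integrable_bounded_by ig _ => // [|x Dx]; [exact: measurableT_comp|rewrite normr_id fg].
Qed.

Lemma integrableRD D f g : measurable D -> mu.-integrable D (EFin \o f) ->
  mu.-integrable D (EFin \o g) -> mu.-integrable D (EFin \o (fun x => f x + g x)).
Proof.
move=> mD If Ig; rewrite (_ : _ \o _ = (EFin \o f) \+ (EFin \o g))%E//.
exact: integrableD.
Qed.

Lemma integrableRB D f g : measurable D -> mu.-integrable D (EFin \o f) ->
  mu.-integrable D (EFin \o g) -> mu.-integrable D (EFin \o (fun x => f x - g x)).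
Proof.
move=> mD If Ig; rewrite (_ : _ \o _ = (EFin \o f) \- (EFin \o g))%E//.
exact: integrableB.
Qed.

Lemma integrableRZ D (c : R) f : measurable D -> mu.-integrable D (EFin \o f) ->
  mu.-integrable D (EFin \o (fun x => c * f x)).
Proof.
move=> mD If; rewrite (_ : _ \o _ = (fun x => c%:E * (EFin \o f) x))%E//.
exact: integrableZl.
Qed.

Lemma integrableR_sum D I (r : seq I) (h : I -> T -> R) : measurable D ->
  (forall i, mu.-integrable D (EFin \o h i)) ->
  mu.-integrable D (EFin \o (fun x => \sum_(i <- r) h i x)).
Proof.
move=> mD H; elim: r => [|i r IH].
  rewrite (_ : _ \o _ = cst 0%E); first exact: integrable0.
  by apply/funext => x; rewrite /= big_nil.
rewrite (_ : _ \o _ = EFin \o (fun x => h i x + \sum_(j <- r) h j x)).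
  exact: integrableRD.
by apply/funext => x; rewrite /= big_cons.
Qed.

Lemma Rintegral_sum D I (r : seq I) (h : I -> T -> R) : measurable D ->
  (forall i, mu.-integrable D (EFin \o h i)) ->
  \int[mu]_(x in D) (\sum_(i <- r) h i x) = \sum_(i <- r) \int[mu]_(x in D) h i x.
Proof.
move=> mD H; elim: r => [|i r IH].
  by under eq_Rintegral do rewrite big_nil; rewrite Rintegral_cst// mul0r big_nil.
under eq_Rintegral do rewrite big_cons.
by rewrite RintegralD// ?IH ?big_cons//; exact: integrableR_sum.
Qed.

Lemma Rintegral0 D : \int[mu]_(x in D) (0 : R) = 0.
Proof. by rewrite /Rintegral integral0. Qed.

End Rintegral_tools.

(** * Differentiation under the integral sign *)

Section parametric.
Context {R : realType} {n : nat} d {T : measurableType d}.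
Variables (nu : {measure set T -> \bar R}) (D : set T).
Hypothesis mD : measurable D.

Local Notation e_ j := (delta_mx 0 j : 'rV[R]_n).

(** The mean value theorem along the segment; the norm of row vectors is the maximum norm, so each
    coordinate of [v] is at most [|v|]. *)
Lemma segment_mean_value (h : 'rV[R]_n -> R) (w v : 'rV[R]_n) (c : 'I_n -> R) :
  (forall s : R, 0 <= s <= 1 -> differentiable h (w + s *: v)) ->
  (forall s : R, 0 <= s <= 1 -> forall j, `|'D_(e_ j) h (w + s *: v)| <= c j) ->
  `|h (w + v) - h w| <= `|v| * \sum_j c j.
Proof.
move=> dh bh.
pose g (s : R) := h (w + s *: v).
have dg (s : R) : 0 <= s <= 1 -> is_derive s 1 g ('d h (w + s *: v) v).
  move=> s01.
  have dl : is_diff s (fun s : R => w + s *: v) (fun s : R => s *: v).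
    by apply: is_diff_eq; rewrite add0r.
  have dgs : differentiable g s.
    by apply: (differentiable_comp (f := fun s : R => w + s *: v)) => //; exact: dh.
  apply: DeriveDef; first exact: diff_derivable.
  rewrite deriveE// /g diff_comp//=; last exact: dh.
  by rewrite diff_val scale1r.
have cg : {within `[(0:R), 1], continuous g}.
  apply: derivable_within_continuous => s; rewrite in_itv/= => s01.
  by have [] := dg _ s01.
have [s|s s01] := @MVT _ g (fun s => 'd h (w + s *: v) v) 0 1 ltr01 _ cg.
  by rewrite in_itv/= => /andP[s0 s1]; apply: dg; rewrite !ltW.
rewrite /g scale1r scale0r addr0 subr0 mulr1 => ->.
have {}s01 : 0 <= s <= 1 by move: s01; rewrite in_itv/= => /andP[/ltW -> /ltW ->].
rewrite diff_rV; last exact: dh.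
apply: (le_trans (ler_norm_sum _ _ _)); rewrite mulr_sumr; apply: ler_sum => j _.
rewrite normrM; apply: ler_pM => //; last exact: bh.
by rewrite [leRHS]/Num.Def.normr/= mx_normrE; exact: (le_bigmax _ _ (0, j)).
Qed.

Variables (U : set 'rV[R]_n) (Phi : 'rV[R]_n -> T -> R).
Hypothesis oU : open U.
Hypothesis diffPhi : forall w y, U w -> D y -> differentiable (Phi ^~ y) w.
Hypothesis iPhi : forall w, U w -> nu.-integrable D (EFin \o Phi w).
Hypothesis mDPhi : forall w j, U w -> measurable_fun D (fun y => 'D_(e_ j) (Phi ^~ y) w).
Hypothesis dominPhi : forall w j, U w -> exists2 r : R, 0 < r &
  exists2 g : T -> R, nu.-integrable D (EFin \o g) &
    forall w', `|w' - w| < r -> forall y, D y -> `|'D_(e_ j) (Phi ^~ y) w'| <= g y.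

(** The candidate differential [L] integrates the partial derivatives. The normalized remainders are
    dominated through the mean value inequality, and their integrals tend to 0 by dominated
    convergence. *)
Lemma Rintegral_param_diff w : U w ->
  differentiable (fun w => \int[nu]_(y in D) Phi w y) w /\
  forall v, 'D_v (fun w => \int[nu]_(y in D) Phi w y) w =
    \int[nu]_(y in D) 'D_v (Phi ^~ y) w.
Proof.
move=> Uw.
have [r0 r0_gt0 r0U] : exists2 r : R, 0 < r & forall w', `|w' - w| < r -> U w'.
  have /nbhs_ballP[r /= r0 rU] : nbhs w U by exact: open_nbhs_nbhs.
  by exists r => // w' ww; apply: rU; rewrite -ball_normE /ball_/= distrC.
have /choice[rg] : forall j, exists rg : R * (T -> R), [/\ 0 < rg.1,
    nu.-integrable D (EFin \o rg.2) & forall w', `|w' - w| < rg.1 ->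
    forall y, D y -> `|'D_(e_ j) (Phi ^~ y) w'| <= rg.2 y].
  by move=> j; have [r r0' [g ig H]] := dominPhi j Uw; exists (r, g).
move=> /all_and3[rg0 ig Hg].
pose r := \big[Num.min/r0]_j (rg j).1.
have r_gt0 : 0 < r by apply: lt_bigmin => // j _; exact: rg0.
have rU w' : `|w' - w| < r -> U w'.
  by move=> ww; apply: r0U; apply: (lt_le_trans ww); exact: bigmin_le_id.
have rB w' : `|w' - w| < r -> forall y, D y -> forall j, `|'D_(e_ j) (Phi ^~ y) w'| <= (rg j).2 y.
  move=> ww y Dy j; apply: Hg => //; apply: (lt_le_trans ww).
  exact: bigmin_le_cond.
pose G y := \sum_j (rg j).2 y.
have iG : nu.-integrable D (EFin \o G) by apply: integrableR_sum => // j; exact: ig.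
have iDPhi j : nu.-integrable D (EFin \o (fun y => 'D_(e_ j) (Phi ^~ y) w)).
  apply: (integrable_bounded_by mD (mDPhi j Uw) (ig j)) => y Dy.
  by apply: rB => //; rewrite subrr normr0.
have lipPhi h y : `|h| < r -> D y -> `|Phi (w + h) y - Phi w y| <= `|h| * G y.
  move=> hr Dy; apply: (@segment_mean_value (Phi ^~ y)) => s /andP[s0 s1].
  - apply: diffPhi => //; apply: rU; rewrite addrC addKr normrZ ger0_norm//.
    by apply: le_lt_trans hr; rewrite ler_piMl.
  - apply: rB => //; rewrite addrC addKr normrZ ger0_norm//.
    by apply: le_lt_trans hr; rewrite ler_piMl.
pose F w := \int[nu]_(y in D) Phi w y.
pose l j := \int[nu]_(y in D) 'D_(e_ j) (Phi ^~ y) w.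
pose L0 (h : 'rV[R]_n) : R := \sum_j h 0 j * l j.
have L0lin : linear L0.
  move=> a u v; rewrite /L0 scaler_sumr -big_split; apply: eq_bigr => j _ /=.
  by rewrite !mxE mulrDl -mulrA.
pose L : {linear 'rV[R]_n -> R} := HB.pack L0 (GRing.isLinear.Build R 'rV[R]_n R _ L0 L0lin).
have cL : continuous L.
  move=> h; rewrite /L/= /L0.
  apply: (@Ck_on_sum _ _ 0 setT _ (index_enum 'I_n) (fun j (h : 'rV[R]_n) => h 0 j * l j) openT) => // j.
  by apply: Ck_onM; [exact: openT|exact: Ck_on_coord0|exact: Ck_on_cst].
have LE h : L h = \int[nu]_(y in D) \sum_j h 0 j * 'D_(e_ j) (Phi ^~ y) w.
  rewrite Rintegral_sum//; last by move=> j; exact: integrableRZ.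
  by apply: eq_bigr => j _; rewrite RintegralZl.
have key : forall e : R, 0 < e -> \forall h \near (0 : 'rV[R]_n), `|F (h + w) - F w - L h| <= e * `|h|.
  (* Dominated convergence concerns sequences: if the estimate fails for [e], there are increments
     [hk] tending to 0 whose normalized remainders [q k] have integrals of absolute value larger
     than [e]. *)
  move=> e e0; apply: contrapT => nH.
  have /choice[hk hkP] : forall k : nat, exists h : 'rV[R]_n,
      `|h| < Num.min r k.+1%:R^-1 /\ e * `|h| < `|F (h + w) - F w - L h|.
    move=> k; apply: contrapT => nh; apply: nH.
    apply/nbhs_ballP; exists (Num.min r k.+1%:R^-1) => /=.
      by rewrite lt_min r_gt0/= invr_gt0.
    move=> h; rewrite -ball_normE /ball_/= sub0r normrN => hr.
    by rewrite leNgt; apply/negP => eh; apply: nh; exists h.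
  have hr k : `|hk k| < r by have [] := hkP k; rewrite lt_min => /andP[].
  have hk0 : hk @ \oo --> (0 : 'rV[R]_n).
    apply/cvgr0Pnorm_lt => eps eps0.
    near=> k; have [+ _] := hkP k; rewrite lt_min => /andP[_]; move/lt_trans; apply.
    by near: k; exact: near_infty_natSinv_lt (PosNum eps0).
  have hkn0 k : 0 < `|hk k|.
    rewrite normr_gt0; apply/eqP => hk0'; have [_] := hkP k.
    by rewrite hk0' add0r subrr sub0r linear0 oppr0 !normr0 mulr0 ltxx.
  pose q k y := `|hk k|^-1 * (Phi (hk k + w) y - Phi w y - \sum_j hk k 0 j * 'D_(e_ j) (Phi ^~ y) w).
  have Uhk k : U (hk k + w) by apply: rU; rewrite addrK.
  have iS h : nu.-integrable D (EFin \o (fun y => \sum_j h 0 j * 'D_(e_ j) (Phi ^~ y) w)).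
    by apply: integrableR_sum => // j; exact: integrableRZ.
  have iq0 k : nu.-integrable D (EFin \o (fun y => Phi (hk k + w) y - Phi w y - \sum_j hk k 0 j * 'D_(e_ j) (Phi ^~ y) w)).
    apply: integrableRB => //; apply: integrableRB => //; exact: iPhi.
  have iq k : nu.-integrable D (EFin \o q k) by exact: integrableRZ.
  have qE k : \int[nu]_(y in D) q k y = `|hk k|^-1 * (F (hk k + w) - F w - L (hk k)).
    rewrite RintegralZl//; congr (_ * _); rewrite RintegralB//; last first.
      apply: integrableRB => //; exact: iPhi.
    by rewrite RintegralB -?LE//; exact: iPhi.
  have [| | | |_] := @dominated_cvg_Rintegral _ _ _ nu D q (fun=> 0) (fun y => 2 * G y) mD.
  - by move=> k; apply/measurable_EFinP; exact: measurable_int (iq k).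
  - move=> y Dy; apply/cvgr0Pnorm_le => eps eps0.
    have /= := diff_eps (diffPhi Uw Dy) eps0.
    move=> /(hk0 _); rewrite /nbhs/= => H; move: H; apply: filterS => k /= H.
    rewrite normrM normfV normr_id ler_pdivrMl// mulrC.
    by rewrite -diff_rV//; exact: diffPhi.
  - exact: integrableRZ.
  (* One [G] bounds the increment of [Phi], the other its linear part. *)
  - move=> k y Dy; rewrite normrM normfV normr_id ler_pdivrMl//.
    apply: (le_trans (ler_normB _ _)); rewrite mulrCA mulr2n mulrDl !mul1r; apply: lerD.
      by rewrite (addrC (hk k)); exact: lipPhi.
    apply: (le_trans (ler_norm_sum _ _ _)); rewrite mulr_sumr; apply: ler_sum => j _.
    rewrite normrM; apply: ler_pM => //; last by apply: rB => //; rewrite subrr normr0.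
    by rewrite [leRHS]/Num.Def.normr/= mx_normrE; exact: (le_bigmax _ _ (0, j)).
  rewrite Rintegral0 => /cvgr0Pnorm_lt/(_ _ e0)[N _ /(_ N (leqnn N))] /=.
  rewrite qE normrM normfV normr_id ltr_pdivrMl// mulrC => lt1.
  by have [_] := hkP N => /(lt_trans lt1); rewrite ltxx.
have [dF DF] := differentiable_epsP cL key; split=> // v.
rewrite deriveE// DF LE; apply: eq_Rintegral => y /set_mem Dy.
by rewrite deriveE ?diff_rV//; exact: diffPhi.
Unshelve. all: by end_near. Qed.

End parametric.

Section parametric_smooth.
Context {R : realType} {n : nat} d {T : measurableType d}.
Variables (nu : {measure set T -> \bar R}) (D : set T) (U : set 'rV[R]_n).
Variable S : set ('rV[R]_n -> T -> R).
Hypotheses (mD : measurable D) (oU : open U).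
Hypothesis diffS : forall Phi w y, S Phi -> U w -> D y -> differentiable (Phi ^~ y) w.
Hypothesis derS : forall Phi v, S Phi -> S (fun w y => 'D_v (Phi ^~ y) w).
Hypothesis mS : forall Phi w, S Phi -> U w -> measurable_fun D (Phi w).
Hypothesis domS : forall Phi w, S Phi -> U w -> exists2 r : R, 0 < r &
  exists2 g : T -> R, nu.-integrable D (EFin \o g) &
    forall w', `|w' - w| < r -> forall y, D y -> `|Phi w' y| <= g y.

Lemma Rintegral_param_derive Phi w : S Phi -> U w ->
  differentiable (fun w => \int[nu]_(y in D) Phi w y) w /\
  forall v, 'D_v (fun w => \int[nu]_(y in D) Phi w y) w =
    \int[nu]_(y in D) 'D_v (Phi ^~ y) w.
Proof.
move=> SP Uw; apply: (@Rintegral_param_diff _ _ _ _ nu D mD U Phi oU) => //.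
- by move=> w' y; exact: diffS.
- move=> w' Uw'; have [r r0 [g ig gP]] := domS SP Uw'.
  apply: (integrable_bounded_by mD (mS SP Uw') ig) => y Dy.
  by apply: gP => //; rewrite subrr normr0.
- by move=> w' j Uw'; exact: (@mS (fun w y => 'D_(delta_mx 0 j) (Phi ^~ y) w) w' (derS _ SP) Uw').
- by move=> w' j Uw'; exact: (@domS (fun w y => 'D_(delta_mx 0 j) (Phi ^~ y) w) w' (derS _ SP) Uw').
Qed.

(** Induction on the order: as [S] is stable under differentiation, a derivative of the integral is
    the integral of another member of [S]. *)
Lemma Rintegral_param_smooth Phi : S Phi ->
  smooth_on U (fun w => \int[nu]_(y in D) Phi w y).
Proof.
move=> SP k; elim: k Phi SP => [|k IH] Phi SP.
  move=> w Uw; apply: differentiable_continuous.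
  by have [] := Rintegral_param_derive SP Uw.
split=> [w Uw|v]; first by have [] := Rintegral_param_derive SP Uw.
apply: (Ck_on_eq oU _ (IH (fun w y => 'D_v (Phi ^~ y) w) (derS v SP))) => w Uw.
by have [_ ->] := Rintegral_param_derive SP Uw.
Qed.

End parametric_smooth.

(** * Bump functions *)

Section flat.
Context {R : realType}.
Implicit Types (P : {poly R}) (x y : R).

(** From [1 + y / k <= expR (y / k)], raised to the power [k]. *)
Lemma exprn_expRN_le (k : nat) y : 0 < y -> y ^+ k * expR (- y) <= k%:R ^+ k.
Proof.
move=> y0; case: k => [|k].
  by rewrite !expr0 mul1r -expR0 ler_expR oppr_le0 ltW.
rewrite expRN ler_pdivrMr ?expR_gt0//.
have -> : expR y = expR (y / k.+1%:R) ^+ k.+1.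
  by rewrite -expRM_natl mulrC divfK// pnatr_eq0.
rewrite -exprMn lerXn2r ?nnegrE ?mulr_ge0 ?expR_ge0 ?(ltW y0)//.
rewrite mulrC -ler_pdivrMr//.
by apply: le_trans (expR_ge1Dx _); rewrite lerDr.
Qed.

Lemma horner_expRN_bounded P : exists2 C, 0 <= C &
  forall y, 0 < y -> `|P.[y]| * expR (- y) <= C.
Proof.
exists (\sum_(i < size P) `|P`_i| * i%:R ^+ i).
  by apply: sumr_ge0 => i _; rewrite mulr_ge0 ?exprn_ge0.
move=> y y0; rewrite horner_coef.
apply: (@le_trans _ _ (\sum_(i < size P) `|P`_i| * (y ^+ i * expR (- y)))).
  under [leRHS]eq_bigr do rewrite mulrA.
  rewrite -mulr_suml ler_wpM2r ?expR_ge0//.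
  apply: (le_trans (ler_norm_sum _ _ _)); apply: ler_sum => i _.
  by rewrite normrM (ger0_norm (exprn_ge0 _ _))// ltW.
by apply: ler_sum => i _; rewrite ler_wpM2l// exprn_expRN_le.
Qed.

(** The usual flat function [exp(-1/x)] with a polynomial factor in [1/x]. The derivative of such a
    function is the one for the polynomial [X^2 (P - P')], so smoothness of the whole family is
    proved by a single induction. *)
Definition flat P x : R := if 0 < x then P.[x^-1] * expR (- x^-1) else 0.

(** The boundedness of [y^2 P(y) exp(-y)] at [y = 1/x]. Being quadratic in [x], the bound forces the
    derivative at 0 to vanish. *)
Lemma flat_bound P : exists2 C, 0 <= C & forall x, `|flat P x| <= C * x ^+ 2.
Proof.
have [C C0 H] := horner_expRN_bounded ('X^2 * P).
exists C => // x; rewrite /flat; case: ltP => x0; last first.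
  by rewrite normr0 mulr_ge0 ?sqr_ge0.
have xi0 : 0 < x^-1 by rewrite invr_gt0.
have := H _ xi0; rewrite hornerM hornerXn normrM -mulrA.
rewrite (ger0_norm (exprn_ge0 _ (ltW xi0))) exprVn ler_pdivrMl ?exprn_gt0// mulrC.
by rewrite normrM (ger0_norm (expR_ge0 _)) (mulrC C) (mulrC (expR _)).
Qed.

Definition flat_deriv P := 'X^2 * (P - P^`()).

Lemma is_derive_flat P x : is_derive x 1 (flat P) (flat (flat_deriv P) x).
Proof.
have [x0|x0|->] := ltgtP x 0.
- have -> : flat (flat_deriv P) x = 0 by rewrite /flat ltNge (ltW x0).
  apply: (@near_eq_is_derive _ _ _ (cst 0) (flat P) x 1 0).
  near=> y; rewrite /flat ltNge.
  have -> // : y <= 0.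
  by near: y; exact: lt_le_nbhsl.
- have xn0 : x != 0 by rewrite gt_eqF.
  apply: (@near_eq_is_derive _ _ _ (fun y => P.[y^-1] * expR (- y^-1))).
    near=> y; rewrite /flat ifT//.
    by near: y; exact: lt_nbhsr.
  have dV : is_derive x 1 (fun y : R => y^-1) (- x ^- 2).
    have := @is_deriveV _ id x 1 1 xn0 (is_derive_id _ _).
    by rewrite [_%:A]mulr1.
  have dh : is_derive (x^-1) 1 (horner P) (P^`().[x^-1]).
    by rewrite derivE derive1E; apply: DeriveDef => //; exact: derivable_horner.
  have dP : is_derive x 1 (fun y => P.[y^-1]) (P^`().[x^-1] * - x ^- 2).
    exact: (@is_derive1_comp _ (horner P) (fun y => y^-1)).
  have dN : is_derive x 1 (fun y : R => - y^-1) (x ^- 2).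
    by have := is_deriveN dV; rewrite opprK.
  have dE : is_derive x 1 (fun y => expR (- y^-1)) (expR (- x^-1) * x ^- 2).
    exact: (@is_derive1_comp _ expR (fun y => - y^-1)).
  apply: is_derive_eq.
  rewrite /flat x0 /flat_deriv hornerM hornerXn hornerD hornerN exprVn.
  rewrite /GRing.scale/=; ring.
have [C C0 H] := flat_bound P.
have f0 Q : flat Q 0 = 0 by rewrite /flat ltxx.
rewrite f0.
have cv : h^-1 *: (flat P (h *: 1 + 0) - flat P 0) @[h --> 0^'] --> (0 : R).
  apply/cvgrPdist_le => e e0; near=> h.
  have h0 : h != 0 by near: h; exact: nbhs_dnbhs_neq.
  rewrite sub0r normrN f0 subr0 addr0 [h *: 1]mulr1 normrM normfV.
  rewrite ler_pdivrMl ?normr_gt0//.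
  apply: (le_trans (H h)); rewrite -(real_normK (num_real h)) expr2 mulrCA ler_wpM2l//.
  apply: (@le_trans _ _ ((C + 1) * `|h|)); first by rewrite ler_wpM2r// lerDl.
  rewrite -ler_pdivlMl ?ltr_wpDl//.
  near: h; apply: dnbhs0_le; rewrite mulr_gt0// invr_gt0 ltr_wpDl//.
apply: DeriveDef; first by apply/cvg_ex; exists 0.
exact: cvg_lim cv.
Unshelve. all: by end_near. Qed.

Lemma flat_ge0 P x : (forall y, 0 <= P.[y]) -> 0 <= flat P x.
Proof. by move=> P0; rewrite /flat; case: ifP => // _; rewrite mulr_ge0 ?expR_ge0. Qed.

Lemma smooth_on_flat (V : normedModType R) (U : set V) (g : V -> R) P : open U ->
  smooth_on U g -> smooth_on U (fun z => flat P (g z)).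
Proof.
move=> oU sg k; elim: k P => [|k IH] P.
  move=> x Ux; apply: (cvg_comp g (flat P)); first exact: smooth_on_cont Ux.
  apply: differentiable_continuous; apply/derivable1_diffP.
  by have [] := is_derive_flat P (g x).
have dflat y : differentiable (flat P) y.
  by apply/derivable1_diffP; have [] := is_derive_flat P y.
split=> [x Ux|v].
  by apply: (differentiable_comp (f := g)) => //; exact: smooth_on_diff Ux.
apply: (@Ck_on_eq _ _ _ _ _ (fun z : V => 'D_v g z * flat (flat_deriv P) (g z)) _ oU).
  move=> x Ux; have dg := smooth_on_diff sg Ux.
  rewrite [RHS]deriveE; last exact: (differentiable_comp (f := g)).
  rewrite diff_comp//= -(deriveE _ dg).
  rewrite deriv1E; last by have [] := is_derive_flat P (g x).
  by rewrite derive1E; have [_ ->] := is_derive_flat P (g x).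
apply: Ck_onM => //; exact: (smooth_on_D _ sg).
Qed.

End flat.

Section bump.
Context {R : realType} {n : nat}.
Implicit Types (a u : 'rV[R]_n) (r : R).

Lemma compact_norm_ball a r : 0 < r -> compact [set u | `|u - a| <= r].
Proof.
move=> r0; have -> : [set u | `|u - a| <= r] = closed_ball a r.
  by rewrite closed_ballE//; apply/seteqP; split=> u; rewrite /closed_ball_/= distrC.
apply: bounded_closed_compact; last exact: closed_ball_closed.
rewrite closed_ballE//; exists (`|a| + r); split; first exact: num_real.
move=> M Mr u; rewrite /closed_ball_/= => ur.
apply: le_trans (ltW Mr); rewrite -[u](subKr a).
by rewrite (le_trans (ler_normB _ _))// lerD2l.
Qed.

(** The Euclidean distance replaces the norm of row vectors, which is a maximum and hence not
    smooth. *)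
Definition sqdist a u := \sum_j (u 0 j - a 0 j) ^+ 2.

Definition rVbump a r u : R := flat 1 (r ^+ 2 - sqdist a u).

Lemma smooth_on_coord (j : 'I_n) : smooth_on setT (fun u : 'rV[R]_n => u 0 j : R).
Proof.
case=> [|k]; first exact: Ck_on_coord0.
split=> [x _|v]; first exact: differentiable_coord.
rewrite (_ : 'D_v _ = fun=> v 0 j); first exact: Ck_on_cst.
apply/funext => x; rewrite (derive_rV_coord (phi := id))//.
by rewrite derive_id.
Qed.

Lemma smooth_on_sqdist a : smooth_on setT (sqdist a).
Proof.
move=> k; apply: Ck_on_sum; first exact: openT.
move=> j; rewrite /=.
have c : Ck_on k setT (fun u : 'rV[R]_n => u 0 j + - a 0 j).
  apply: Ck_onD; [exact: openT|exact: smooth_on_coord|exact: Ck_on_cst].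
by under eq_fun do rewrite expr2; apply: Ck_onM; first exact: openT.
Qed.

Lemma smooth_on_rVbump a r : smooth_on setT (rVbump a r).
Proof.
apply: smooth_on_flat; first exact: openT.
move=> k; apply: Ck_onD; [exact: openT|exact: Ck_on_cst|].
rewrite (_ : (fun _ => _) = fun u => -1 * sqdist a u).
  by apply: Ck_onZ; [exact: openT|exact: smooth_on_sqdist].
by apply/funext => u; rewrite mulN1r.
Qed.

Lemma rVbump_ge0 a r u : 0 <= rVbump a r u.
Proof. by apply: flat_ge0 => y; rewrite hornerC. Qed.

Lemma rVbump_center a r : 0 < r -> 0 < rVbump a r a.
Proof.
move=> r0; rewrite /rVbump /sqdist big1 ?subr0.
  by rewrite /flat exprn_gt0// hornerC mul1r expR_gt0.
by move=> j _; rewrite subrr expr0n.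
Qed.

Lemma rVbump_support a r u : 0 < r -> rVbump a r u != 0 -> `|u - a| <= r.
Proof.
move=> r0; rewrite /rVbump /flat; case: ifP => [+ _|_]; last by rewrite eqxx.
rewrite subr_gt0 => sr.
rewrite [leLHS]/Num.Def.normr/= mx_normrE; apply: bigmax_le; first exact: ltW.
move=> [i j] _ /=; rewrite ord1 !mxE.
rewrite -(@ler_pXn2r _ 2)// ?nnegrE// ?(ltW r0)// -normrX ger0_norm ?sqr_ge0//.
apply: le_trans (ltW sr); rewrite /sqdist (bigD1 j)//= lerDl.
by apply: sumr_ge0 => k _; exact: sqr_ge0.
Qed.

End bump.

(** * Smooth functions on a Lie group *)

Section lie_smooth.
Context {R : realType} {n : nat} {G : lieGroupType R n}.
Implicit Types (c : chart R n G) (f h : G -> R) (x y g : G).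

Lemma chart_dom_open c : lie_atlas c -> open (chart_dom c).
Proof. by move=> /lie_chart[]. Qed.

Lemma chart_cod_open c : lie_atlas c -> open (chart_cod c).
Proof. by move=> /lie_chart[]. Qed.

Lemma chart_mapK c x : lie_atlas c -> chart_dom c x -> chart_inv c (chart_map c x) = x.
Proof. by move=> /lie_chart[_ _ + _ _]; exact. Qed.

Lemma chart_cod_map c x : chart_dom c x -> chart_cod c (chart_map c x).
Proof. by move=> cx; exists x. Qed.

Lemma chart_dom_inv c u : lie_atlas c -> chart_cod c u -> chart_dom c (chart_inv c u).
Proof. by move=> ac [x cx <-]; rewrite chart_mapK. Qed.

Lemma chart_invK c u : lie_atlas c -> chart_cod c u -> chart_map c (chart_inv c u) = u.
Proof. by move=> ac [x cx <-]; rewrite chart_mapK. Qed.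

Lemma chart_map_continuous c x : lie_atlas c -> chart_dom c x ->
  {for x, continuous (chart_map c)}.
Proof.
move=> ac cx; have [oD _ _ + _] := lie_chart _ ac.
by rewrite continuous_open_subspace// => /(_ x); apply; rewrite inE.
Qed.

Lemma chart_inv_continuous c u : lie_atlas c -> chart_cod c u ->
  {for u, continuous (chart_inv c)}.
Proof.
move=> ac cu; have [_ oC _ _ +] := lie_chart _ ac.
by rewrite continuous_open_subspace// => /(_ u); apply; rewrite inE.
Qed.

Lemma open_setI_preimage (X Y : topologicalType) (A : set X) (B : set Y) (k : X -> Y) :
  open A -> open B -> (forall z, A z -> {for z, continuous k}) ->
  open (A `&` [set z | B (k z)]).
Proof.
move=> oA oB kc; rewrite openE => z [Az Bz]; apply: filterI.
  exact: open_nbhs_nbhs.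
by apply: kc => //; exact: open_nbhs_nbhs.
Qed.

Lemma chart_preim_open c N : lie_atlas c -> open N ->
  open (chart_cod c `&` [set u | N (chart_inv c u)]).
Proof.
move=> ac oN; apply: open_setI_preimage => //; first exact: chart_cod_open.
by move=> u; exact: chart_inv_continuous.
Qed.

Lemma smooth_cst (k : R) : smooth (fun _ : G => k).
Proof. by move=> c _ m; exact: Ck_on_cst. Qed.

Lemma smoothD f h : smooth f -> smooth h -> smooth (fun x => f x + h x).
Proof. by move=> sf sh c ac m; apply: Ck_onD; [exact: chart_cod_open|exact: sf|exact: sh]. Qed.

Lemma smoothM f h : smooth f -> smooth h -> smooth (fun x => f x * h x).
Proof. by move=> sf sh c ac m; apply: Ck_onM; [exact: chart_cod_open|exact: sf|exact: sh]. Qed.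

Lemma smoothZ (k : R) f : smooth f -> smooth (fun x => k * f x).
Proof. exact: smoothM (smooth_cst k). Qed.

Lemma smoothB f h : smooth f -> smooth h -> smooth (fun x => f x - h x).
Proof.
move=> sf sh; rewrite (_ : (fun x => _) = fun x => f x + (-1) * h x).
  by apply: smoothD => //; exact: smoothZ.
by apply/funext => x; rewrite mulN1r.
Qed.

Lemma smooth_sum I (r : seq I) (F : I -> G -> R) : (forall i, smooth (F i)) ->
  smooth (fun x => \sum_(i <- r) F i x).
Proof.
move=> sF c ac m; apply: Ck_on_sum; first exact: chart_cod_open.
by move=> i; exact: sF.
Qed.

Lemma smooth_continuous f : smooth f -> continuous f.
Proof.
move=> sf x; have [c ac cx] := lie_cover x.
have H : {for x, continuous ((f \o chart_inv c) \o chart_map c)}.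
  apply: continuous_comp; first exact: chart_map_continuous.
  exact: (smooth_on_cont (sf c ac) (chart_cod_map cx)).
have E : {near x, (f \o chart_inv c) \o chart_map c =1 f}.
  near=> y => /=; rewrite chart_mapK//; near: y.
  by apply: open_nbhs_nbhs; split=> //; exact: chart_dom_open.
rewrite /continuous_at -[X in _ --> X](nbhs_singleton E).
exact: cvg_trans (near_eq_cvg E) H.
Unshelve. all: by end_near. Qed.

(** The transition maps are smooth, so the expression of [f] in any chart is locally the given one
    composed with a transition map. *)
Lemma smooth_local f :
  (forall x, exists2 c, lie_atlas c /\ chart_dom c x & exists N, [/\ open N, N x &
    smooth_on (chart_cod c `&` [set u | N (chart_inv c u)]) (fun u => f (chart_inv c u))]) ->
  smooth f.
Proof.
move=> H c' ac' m; apply: Ck_on_local => u cu.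
have [c [ac cx] [N [oN Nx sN]]] := H (chart_inv c' u).
pose N' := chart_dom c `&` N.
have oN' : open N' by apply: openI => //; exact: chart_dom_open.
exists (chart_cod c' `&` [set u | N' (chart_inv c' u)]) => //.
have oU := chart_preim_open ac' oN'.
apply: (@Ck_on_eq _ _ _ _ _ (fun u => (fun v => f (chart_inv c v)) (chart_map c (chart_inv c' u)))) => //.
  by move=> v [_ [cv _]]; rewrite /= chart_mapK.
apply: (@Ck_on_comp _ _ _ _ _ (chart_cod c `&` [set u | N (chart_inv c u)]) (fun u => chart_map c (chart_inv c' u)) (fun v => f (chart_inv c v))) => //.
- move=> v [cv' [cv Nv]]; split; first exact: chart_cod_map.
  by rewrite /= chart_mapK.
- have := @lie_compatible R n G c' c ac' ac m.
  by apply: Ck_on_sub => v [? []].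
Qed.

Lemma test_functionP f :
  test_function f <-> smooth f /\ exists2 K, compact K & forall x, ~ K x -> f x = 0.
Proof.
split=> [[sf cK]|[sf [K cK fK]]]; split=> //.
  exists (closure [set x | f x != 0]) => // x nK; apply: contrapT => fx; apply: nK.
  by apply: subset_closure => /=; apply/eqP.
have clK : closed K by apply: compact_closed => //; exact: lie_hausdorff.
apply: (subclosed_compact _ cK); first exact: closed_closure.
rewrite [X in _ `<=` X]((closure_id K).1 clK); apply: closure_subset => x /= fx.
by apply: contrapT => /fK fx0; rewrite fx0 eqxx in fx.
Qed.

Lemma test_smooth f : test_function f -> smooth f.
Proof. by case. Qed.

(** A bump of the model space is transported by a chart and extended by 0. Its support lies in the
    compact set [K], which is closed because [G] is Hausdorff; the chart domain and the complement
    of [K] cover [G], and the function is visibly smooth on each of them. *)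
Lemma exists_bump x (N : set G) : open N -> N x ->
  exists b : G -> R, [/\ smooth b, forall y, 0 <= b y, 0 < b x &
    exists K, [/\ compact K, K `<=` N & forall y, ~ K y -> b y = 0]].
Proof.
move=> oN Nx; have [c ac cx] := lie_cover x.
have oM : open (chart_cod c `&` [set u | N (chart_inv c u)]) by exact: chart_preim_open.
have : nbhs (chart_map c x) (chart_cod c `&` [set u | N (chart_inv c u)]).
  apply: open_nbhs_nbhs; split=> //; split; first exact: chart_cod_map.
  by rewrite /= chart_mapK.
move=> /nbhs_ballP[r0 /= r0_gt0 r0M].
pose r := r0 / 2; have r_gt0 : 0 < r by rewrite divr_gt0.
pose B := [set u | `|u - chart_map c x| <= r].
have BM : B `<=` chart_cod c `&` [set u | N (chart_inv c u)].
  move=> u Bu; apply: r0M; rewrite -ball_normE /ball_/= distrC (le_lt_trans Bu)//.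
  by rewrite /r ltr_pdivrMr// ltr_pMr// ltr1n.
have cB : compact B by exact: compact_norm_ball.
pose K := chart_inv c @` B.
have cK : compact K.
  apply: continuous_compact => //; apply/continuous_in_subspaceT => u /set_mem Bu.
  by apply: chart_inv_continuous => //; exact: (BM _ Bu).1.
have clK : closed K by apply: compact_closed => //; exact: lie_hausdorff.
pose b y : R := if `[< chart_dom c y >] then rVbump (chart_map c x) r (chart_map c y) else 0.
have bE u : chart_cod c u -> b (chart_inv c u) = rVbump (chart_map c x) r u.
  move=> cu; rewrite /b; case: asboolP => [_|nd]; first by rewrite chart_invK.
  by case: nd; exact: chart_dom_inv.
have bK y : ~ K y -> b y = 0.
  move=> nK; rewrite /b; case: asboolP => // cy; apply: contrapT => /eqP b0.
  apply: nK; exists (chart_map c y); last by rewrite chart_mapK.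
  by rewrite /B/=; exact: rVbump_support b0.
exists b; split.
- apply: smooth_local => y.
  have [cy|ncy] := pselect (chart_dom c y).
    exists c => //; exists setT; split=> //; first exact: openT.
    move=> m; apply: (@Ck_on_eq _ _ _ _ _ (rVbump (chart_map c x) r)).
    + exact: chart_preim_open openT.
    + by move=> u [cu _]; rewrite bE.
    + by apply: Ck_on_sub (smooth_on_rVbump _ _ m).
  have [c' ac' cy'] := lie_cover y.
  exists c' => //; exists (~` K); split=> //.
  + exact: closed_openC.
  + by move=> [u Bu uy]; apply: ncy; rewrite -uy; apply: chart_dom_inv => //; exact: (BM _ Bu).1.
  + move=> m; apply: (@Ck_on_eq _ _ _ _ _ (fun=> 0)).
    * by apply: chart_preim_open => //; exact: closed_openC.
    * by move=> u [_ /bK].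
    * exact: Ck_on_cst.
- by move=> y; rewrite /b; case: asboolP => // _; exact: rVbump_ge0.
- by rewrite /b; case: asboolP => // _; exact: rVbump_center.
- exists K; split=> // y [u Bu <-]; exact: (BM _ Bu).2.
Qed.

Lemma ex_test_bump x (N : set G) : open N -> N x ->
  exists b : G -> R, [/\ test_function b, forall y, 0 <= b y, 0 < b x & forall y, ~ N y -> b y = 0].
Proof.
move=> oN Nx; have [b [sb b0 bx [K [cK KN bK]]]] := exists_bump oN Nx.
exists b; split=> //; first by apply/test_functionP; split=> //; exists K.
by move=> y nN; apply: bK => /KN.
Qed.

End lie_smooth.

(** * Hadamard's lemma *)

Section hadamard.
Context {R : realType} {n : nat}.
Implicit Types (u v w : 'rV[R]_n).
Local Notation mu := (@lebesgue_measure R).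
Local Notation e_ j := (delta_mx 0 j : 'rV[R]_n).

Variables (u0 : 'rV[R]_n) (r0 : R).
Hypothesis r0_gt0 : 0 < r0.
Let U := [set u : 'rV[R]_n | `|u - u0| < r0].
Let seg w (s : R) : 'rV[R]_n := u0 + s *: (w - u0).

Lemma open_norm_ball : open U.
Proof.
rewrite (_ : U = ball u0 r0); first exact: ball_open.
by apply/seteqP; split=> u; rewrite -ball_normE /U /ball_/= distrC.
Qed.

Lemma seg_norm w s : 0 <= s <= 1 -> `|seg w s - u0| <= `|w - u0|.
Proof.
move=> /andP[s0 s1]; rewrite /seg [u0 + _]addrC addrK normrZ ger0_norm//.
by rewrite ler_piMl.
Qed.

Lemma seg_in w s : U w -> 0 <= s <= 1 -> U (seg w s).
Proof. by move=> Uw /(seg_norm w) /le_lt_trans; apply. Qed.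

Lemma is_diff_seg_w s w : is_diff w (fun w => seg w s) (fun v => s *: v).
Proof. by rewrite /seg; apply: is_diff_eq; rewrite subr0 add0r. Qed.

Lemma is_diff_seg_s s w : is_diff s (fun s => seg w s) (fun t : R => t *: (w - u0)).
Proof. by rewrite /seg; apply: is_diff_eq; rewrite add0r. Qed.

Lemma seg_continuous w : continuous (seg w).
Proof.
move=> s; apply: differentiable_continuous.
by have [] := is_diff_seg_s s w.
Qed.

Lemma smooth_on_seg_bounded (H : 'rV[R]_n -> R) (rho : R) : 0 < rho -> rho < r0 -> smooth_on U H ->
  exists M, forall w, `|w - u0| <= rho -> `|H w| <= M.
Proof.
move=> rho0 rr sH; pose K := [set u | `|u - u0| <= rho].
have cK : compact K by exact: compact_norm_ball.
have cHK : {within K, continuous H}.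
  apply/continuous_in_subspaceT => u /set_mem Ku.
  by apply: (smooth_on_cont sH); exact: le_lt_trans Ku rr.
have [M [_ HM]] := compact_bounded (continuous_compact cHK cK).
exists (M + 1) => w wr; apply: (HM (M + 1)); first by rewrite ltrDl.
by exists w.
Qed.

(** Differentiating [H (seg w s)] in [w] brings out a factor [s], which the powers [s ^+ k] absorb;
    hence the class is stable under differentiation. Members are constrained only on the ball and on
    the unit interval, where the integral is taken. *)
Let S : set ('rV[R]_n -> R -> R) := [set Phi | exists k (H : 'rV[R]_n -> R), smooth_on U H /\
  forall w s, U w -> 0 <= s <= 1 -> Phi w s = s ^+ k * H (seg w s)].

Lemma hadamard_diffS Phi w s : S Phi -> U w -> `[0, 1]%classic s -> differentiable (Phi ^~ s) w.
Proof.
move=> [k [H [sH E]]] Uw; rewrite /= in_itv/= => s01.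
apply: (@near_eq_differentiable _ _ _ (fun w => s ^+ k * H (seg w s))).
  near=> w'; rewrite E//; near: w'; exact: (open_nbhs_nbhs (conj open_norm_ball Uw)).
have dH : differentiable (fun w => H (seg w s)) w.
  apply: (differentiable_comp (f := fun w => seg w s)).
    by have [] := is_diff_seg_w s w.
  by apply: (smooth_on_diff sH); exact: seg_in.
exact: (@differentiableM _ _ (cst (s ^+ k))).
Unshelve. all: by end_near. Qed.

Lemma hadamard_derS Phi v : S Phi -> S (fun w s => 'D_v (Phi ^~ s) w).
Proof.
move=> [k [H [sH E]]]; exists k.+1, ('D_v H); split; first exact: smooth_on_D.
move=> w s Uw s01.
have nE : \near w, Phi w s = s ^+ k * H (seg w s).
  near=> w'; rewrite E//; near: w'; exact: (open_nbhs_nbhs (conj open_norm_ball Uw)).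
rewrite (near_eq_derive _ nE).
have [dseg Dseg] := is_diff_seg_w s w.
have dH : differentiable H (seg w s) by apply: (smooth_on_diff sH); exact: seg_in.
have dHs : differentiable (fun w => H (seg w s)) w.
  exact: (differentiable_comp (f := fun w => seg w s)).
rewrite (@deriveM _ _ (cst (s ^+ k)) (fun w => H (seg w s)))//; last exact: diff_derivable.
rewrite derive_cst scaler0 addr0 deriveE// diff_comp// Dseg /= linearZ -deriveE//.
by rewrite exprSr scalerA.
Unshelve. all: by end_near. Qed.

Lemma hadamard_mS Phi w : S Phi -> U w -> measurable_fun (`[0, 1] : set (measurableTypeR R)) (Phi w).
Proof.
move=> [k [H [sH E]]] Uw.
pose f (s : R) := s ^+ k * H (seg w s).
suff : measurable_fun (`[0, 1] : set (measurableTypeR R)) f.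
  apply: eq_measurable_fun.
  by move=> s /set_mem; rewrite /= in_itv/= => s01; rewrite E.
apply: subspace_continuous_measurable_fun => //.
apply/continuous_in_subspaceT => s /set_mem; rewrite /= in_itv/= => s01.
apply: cvgM; first exact: exprn_continuous.
apply: (cvg_comp (seg w) H).
  exact: seg_continuous.
by apply: (smooth_on_cont sH); exact: seg_in.
Qed.

Lemma hadamard_domS Phi w : S Phi -> U w -> exists2 r : R, 0 < r &
  exists2 g : R -> R, mu.-integrable `[0, 1] (EFin \o g) &
    forall w', `|w' - w| < r -> forall y, `[0, 1]%classic y -> `|Phi w' y| <= g y.
Proof.
move=> [k [H [sH E]]] Uw.
pose r := (r0 - `|w - u0|) / 2.
have r_gt0 : 0 < r by rewrite divr_gt0// subr_gt0.
have rr : `|w - u0| + r < r0.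
  by rewrite -ltrBrDl /r ltr_pdivrMr// ltr_pMr ?ltr1n// subr_gt0.
have [M HM] := smooth_on_seg_bounded (ltr_wpDl (normr_ge0 _) r_gt0) rr sH.
exists r => //; exists (cst M).
  apply: continuous_compact_integrable; first exact: segment_compact.
  by apply: continuous_subspaceT => ?; exact: cvg_cst.
move=> w' w'r s; rewrite /= in_itv/= => s01.
have w'B : `|w' - u0| <= `|w - u0| + r.
  rewrite -(subrKA w) addrC (le_trans (ler_normD _ _))//.
  by rewrite lerD2l ltW.
rewrite E//; last exact: le_lt_trans rr.
have /andP[s0 s1] := s01.
rewrite normrM normrX ger0_norm//; apply: (@le_trans _ _ (1 * `|H (seg w' s)|)).
  by rewrite ler_wpM2r// exprn_ile1.
rewrite mul1r; apply: HM; exact: le_trans (seg_norm _ s01) w'B.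
Qed.

(** The function [g j] is the mean of the partial derivative ['D_(e_ j) F] over the segment from
    [u0]; the expansion is the fundamental theorem of calculus along that segment. *)
Lemma hadamard (F : 'rV[R]_n -> R) : smooth_on U F ->
  exists g : 'I_n -> 'rV[R]_n -> R, [/\ forall j, smooth_on U (g j),
    forall u, U u -> F u = F u0 + \sum_j (u - u0) 0 j * g j u &
    forall j, g j u0 = 'D_(e_ j) F u0].
Proof.
move=> sF.
pose g j w := \int[mu]_(s in `[0, 1]) 'D_(e_ j) F (seg w s).
have SD j : S (fun w s => 'D_(e_ j) F (seg w s)).
  exists 0%N, ('D_(e_ j) F); split; first exact: smooth_on_D.
  by move=> w s _ _; rewrite expr0 mul1r.
have Uu0 : U u0 by rewrite /U/= subrr normr0.
exists g; split.
- move=> j; apply: (@Rintegral_param_smooth _ _ _ _ mu _ U S) => //.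
  + exact: open_norm_ball.
  + exact: hadamard_diffS.
  + exact: hadamard_derS.
  + exact: hadamard_mS.
  + exact: hadamard_domS.
- move=> u Uu.
  have intg j : mu.-integrable `[0, 1] (EFin \o (fun s => 'D_(e_ j) F (seg u s))).
    have [r r0' [h ih hP]] := hadamard_domS (SD j) Uu.
    apply: (integrable_bounded_by _ (hadamard_mS (SD j) Uu) ih) => //.
    by move=> s s01; apply: hP => //; rewrite subrr normr0.
  pose f s := \sum_j (u - u0) 0 j * 'D_(e_ j) F (seg u s).
  have gE : \sum_j (u - u0) 0 j * g j u = \int[mu]_(s in `[0, 1]) f s.
    under [LHS]eq_bigr do rewrite -RintegralZl//.
    by rewrite -Rintegral_sum// => j; exact: integrableRZ.
  rewrite gE /Rintegral.
  have dFs (s : R) : 0 <= s <= 1 -> is_derive s 1 (fun s => F (seg u s)) (f s).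
    move=> s01; have [dseg Dseg] := is_diff_seg_s s u.
    have dF : differentiable F (seg u s) by apply: (smooth_on_diff sF); exact: seg_in.
    have dFs : differentiable (fun s => F (seg u s)) s.
      exact: (differentiable_comp (f := fun s => seg u s)).
    apply: DeriveDef; first exact: diff_derivable.
    by rewrite deriveE// diff_comp// Dseg/= scale1r diff_rV.
  have cF (s : R) : 0 <= s <= 1 -> {for s, continuous (fun s => F (seg u s))}.
    move=> s01; apply: differentiable_continuous; apply/derivable1_diffP.
    by have [] := dFs _ s01.
  rewrite (@continuous_FTC2 _ f (fun s => F (seg u s))) //.
  + have -> : seg u 1 = u by rewrite /seg scale1r addrC subrK.
    have -> : seg u 0 = u0 by rewrite /seg scale0r addr0.
    by rewrite -EFinB /= addrC subrK.
  + apply/continuous_in_subspaceT => s /set_mem; rewrite /= in_itv/= => s01.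
    apply: continuous_at_sum => j; apply: cvgM; first exact: cvg_cst.
    apply: (cvg_comp (seg u) ('D_(e_ j) F)).
      exact: seg_continuous.
    apply: (smooth_on_cont (smooth_on_D _ sF)); exact: seg_in.
  + split.
    * by move=> s; rewrite in_itv/= => /andP[s0 s1]; have [] := dFs s; rewrite ?ltW.
    * by apply: cvg_at_right_filter; apply: cF; rewrite lexx ler01.
    * by apply: cvg_at_left_filter; apply: cF; rewrite lexx ler01.
  + move=> s; rewrite in_itv/= => /andP[s0 s1].
    by rewrite derive1E; have [|_ ->] := dFs s; rewrite ?ltW.
- move=> j; rewrite /g.
  transitivity (\int[mu]_(s in `[0, 1]) 'D_(e_ j) F u0).
    by apply: eq_Rintegral => s _; rewrite /seg subrr scaler0 addr0.
  by rewrite Rintegral_cst//= lebesgue_measure_itv/= lte_fin ltr01 sube0 mulr1.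
Qed.

End hadamard.

(** * Derivatives on product spaces *)

Section products.
Context {R : realType}.

Lemma open_fst_snd (X Y : topologicalType) (A : set X) (B : set Y) :
  open A -> open B -> open [set z : X * Y | A z.1 /\ B z.2].
Proof.
move=> oA oB; rewrite openE => -[a b] [/= Aa Bb].
by exists (A, B) => /=; [split; exact: open_nbhs_nbhs|move=> [a' b'] []].
Qed.

Lemma diff_pairl (V W : normedModType R) (w : W) (u : V) :
  is_diff u (fun u : V => (u, w)) (fun v : V => (v, 0 : W)).
Proof. exact: is_diff_pair. Qed.

Lemma is_diff_fst (V W : normedModType R) (z : V * W) : is_diff z fst fst.
Proof.
have lf : linear (fst : V * W -> V) by [].
pose L : {linear (V * W)%type -> V} := HB.pack (fst : V * W -> V) (GRing.isLinear.Build R (V * W)%type V _ fst lf).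
have cL : continuous L by move=> x; exact: cvg_fst.
have [d D] : differentiable fst z /\ 'd fst z = L :> (V * W -> V).
  apply: differentiable_epsP => // e e0; near=> h.
  by rewrite /L/= addrK subrr normr0 mulr_ge0// ltW.
exact: DiffDef.
Unshelve. all: by end_near. Qed.

Lemma is_diff_snd (V W : normedModType R) (z : V * W) : is_diff z snd snd.
Proof.
have lf : linear (snd : V * W -> W) by [].
pose L : {linear (V * W)%type -> W} := HB.pack (snd : V * W -> W) (GRing.isLinear.Build R (V * W)%type W _ snd lf).
have cL : continuous L by move=> x; exact: cvg_snd.
have [d D] : differentiable snd z /\ 'd snd z = L :> (V * W -> W).
  apply: differentiable_epsP => // e e0; near=> h.
  by rewrite /L/= addrK subrr normr0 mulr_ge0// ltW.
exact: DiffDef.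
Unshelve. all: by end_near. Qed.

Lemma is_diff_swap (V W : normedModType R) (z : V * W) :
  is_diff z (fun z => (z.2, z.1)) (fun z => (z.2, z.1)).
Proof. by have := is_diff_fst z; have := is_diff_snd z => ? ?; exact: is_diff_pair. Qed.

Lemma Ck_on_pairl (V W : normedModType R) k (U : set V) (U' : set (V * W)) (w : W) (h : V * W -> R) :
  open U -> (forall u, U u -> U' (u, w)) -> Ck_on k U' h -> Ck_on k U (fun u => h (u, w)).
Proof.
move=> oU UU'; apply: (@Ck_on_comp_affine _ _ _ _ k U U' (fun u => (u, w)) (fun v => (v, 0))) => //.
by move=> x v; have [d D] := diff_pairl w x; rewrite (deriveE v d) D.
Qed.

Lemma derive_pairl (V W : normedModType R) (w : W) (u v : V) (h : V * W -> R) :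
  differentiable h (u, w) -> 'D_v (fun u => h (u, w)) u = 'D_(v, 0) h (u, w).
Proof.
move=> dh; have [dp Dp] := diff_pairl w u.
rewrite deriveE; last exact: (differentiable_comp (f := fun u => (u, w))).
by rewrite diff_comp//= Dp deriveE.
Qed.

Lemma Ck_on_swap (V W : normedModType R) k (U : set (V * W)) (U' : set (W * V)) (h : W * V -> R) :
  open U -> (forall z, U z -> U' (z.2, z.1)) -> Ck_on k U' h -> Ck_on k U (fun z => h (z.2, z.1)).
Proof.
move=> oU UU'; apply: (@Ck_on_comp_affine _ _ _ _ k U U' (fun z => (z.2, z.1)) (fun z => (z.2, z.1))) => //.
  by move=> x; have [] := is_diff_swap x.
by move=> x v; have [d D] := is_diff_swap x; rewrite (deriveE v d) D.
Qed.

Lemma continuous_at_fst (X Y Z : topologicalType) (k : X -> Z) (z : X * Y) :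
  {for z.1, continuous k} -> {for z, continuous (fun z : X * Y => k z.1)}.
Proof. by move=> ck; apply: (@continuous_comp (X * Y)%type X Z fst k z); [exact: cvg_fst|exact: ck]. Qed.

Lemma continuous_at_snd (X Y Z : topologicalType) (k : Y -> Z) (z : X * Y) :
  {for z.2, continuous k} -> {for z, continuous (fun z : X * Y => k z.2)}.
Proof. by move=> ck; apply: (@continuous_comp (X * Y)%type Y Z snd k z); [exact: cvg_snd|exact: ck]. Qed.

Lemma continuous_at_pair (X Y Z : topologicalType) (f : X -> Y) (g : X -> Z) (x : X) :
  {for x, continuous f} -> {for x, continuous g} -> {for x, continuous (fun x => (f x, g x))}.
Proof. by move=> cf cg; apply: cvg_pair; [exact: cf|exact: cg]. Qed.

End products.

(** * Smooth functions of two variables, translations and test functions *)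

Section lie_smooth2.
Context {R : realType} {n : nat} {G : lieGroupType R n}.
Implicit Types (c : chart R n G) (f h : G -> R) (x y g : G) (H : G -> G -> R).

(** Smoothness on the product manifold, expressed through pairs of charts, so that [G * G] need not
    be made into a manifold. *)
Definition smooth2 H := forall c1 c2, lie_atlas c1 -> lie_atlas c2 ->
  smooth_on [set z : 'rV[R]_n * 'rV[R]_n | chart_cod c1 z.1 /\ chart_cod c2 z.2]
    (fun z => H (chart_inv c1 z.1) (chart_inv c2 z.2)).

Lemma open_cod2 c1 c2 : lie_atlas c1 -> lie_atlas c2 ->
  open [set z : 'rV[R]_n * 'rV[R]_n | chart_cod c1 z.1 /\ chart_cod c2 z.2].
Proof. by move=> a1 a2; apply: open_fst_snd; exact: chart_cod_open. Qed.

Lemma smooth2_mul f : smooth f -> smooth2 (fun x y => f (x * y)%g).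
Proof.
move=> sf c1 c2 a1 a2 k; apply: Ck_on_local => -[u1 u2] [/= cu1 cu2].
have [c3 a3 c3x] := lie_cover (chart_inv c1 u1 * chart_inv c2 u2)%g.
pose mu (z : 'rV[R]_n * 'rV[R]_n) := (chart_inv c1 z.1 * chart_inv c2 z.2)%g.
pose U' := [set z : 'rV[R]_n * 'rV[R]_n | [/\ chart_cod c1 z.1, chart_cod c2 z.2 & chart_dom c3 (mu z)]].
have oU' : open U'.
  rewrite (_ : U' = [set z | chart_cod c1 z.1 /\ chart_cod c2 z.2] `&` [set z | chart_dom c3 (mu z)]).
    apply: open_setI_preimage; [exact: open_cod2|exact: chart_dom_open|].
    move=> [v1 v2] [/= cv1 cv2].
    apply: (@continuous_comp _ _ _ (fun z => (chart_inv c1 z.1, chart_inv c2 z.2)) (fun z : G * G => (z.1 * z.2)%g)).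
      apply: continuous_at_pair; [apply: continuous_at_fst|apply: continuous_at_snd];
      exact: chart_inv_continuous.
    exact: lie_mul_continuous.
  by apply/seteqP; split=> z; [case|case=> -[]].
exists U' => //.
apply: (@Ck_on_eq _ _ _ _ _ (fun z => (fun v => f (chart_inv c3 v)) (chart_map c3 (mu z)))) => //.
  by move=> z [_ _ cz]; rewrite /= chart_mapK.
apply: (@Ck_on_comp _ _ _ _ _ (chart_cod c3) (fun z => chart_map c3 (mu z)) (fun v => f (chart_inv c3 v))) => //.
- by move=> z [_ _ cz]; exact: chart_cod_map.
- exact: (lie_mul_smooth _ _ _ a1 a2 a3 k).
- exact: sf.
Qed.

Lemma smooth2_swap H : smooth2 H -> smooth2 (fun x y => H y x).
Proof.
move=> sH c1 c2 a1 a2 k.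
have := sH c2 c1 a2 a1 k.
apply: (@Ck_on_swap _ _ _ k _ _ (fun z => H (chart_inv c2 z.1) (chart_inv c1 z.2))).
  exact: open_cod2.
by move=> z [].
Qed.

Lemma smooth2_fixr H y : smooth2 H -> smooth (H ^~ y).
Proof.
move=> sH c a k; have [c2 a2 c2y] := lie_cover y.
have := sH c c2 a a2 k.
move=> /(@Ck_on_pairl _ _ _ k (chart_cod c) _ (chart_map c2 y) _ (chart_cod_open a)) /=.
by rewrite chart_mapK//; apply=> u cu; split=> //; exact: chart_cod_map.
Qed.

Lemma smooth2_fixl H x : smooth2 H -> smooth (H x).
Proof. by move=> /smooth2_swap; exact: smooth2_fixr. Qed.

Lemma smooth2M H H' : smooth2 H -> smooth2 H' -> smooth2 (fun x y => H x y * H' x y).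
Proof. by move=> sH sH' c1 c2 a1 a2 k; apply: Ck_onM; [exact: open_cod2|exact: sH|exact: sH']. Qed.

Lemma chart2_continuous c1 c2 (F : 'rV[R]_n * 'rV[R]_n -> R) H x y :
  lie_atlas c1 -> lie_atlas c2 -> chart_dom c1 x -> chart_dom c2 y ->
  {for (chart_map c1 x, chart_map c2 y), continuous F} ->
  (\forall z \near (x, y), F (chart_map c1 z.1, chart_map c2 z.2) = H z.1 z.2) ->
  {for (x, y), continuous (fun z : G * G => H z.1 z.2)}.
Proof.
move=> a1 a2 cx cy cF E.
rewrite /prop_for /continuous_at -[X in _ --> X](nbhs_singleton E).
apply: cvg_trans (near_eq_cvg E) _.
apply: (@continuous_comp _ _ _ (fun z : G * G => (chart_map c1 z.1, chart_map c2 z.2)) F) => //.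
apply: continuous_at_pair; [apply: continuous_at_fst|apply: continuous_at_snd];
exact: chart_map_continuous.
Qed.

Lemma near_chart2 c1 c2 x y : lie_atlas c1 -> lie_atlas c2 -> chart_dom c1 x -> chart_dom c2 y ->
  \forall z \near (x, y), chart_dom c1 z.1 /\ chart_dom c2 z.2.
Proof.
move=> a1 a2 cx cy; apply: open_nbhs_nbhs; split=> //.
by apply: open_fst_snd; exact: chart_dom_open.
Qed.

Lemma smooth2_continuous H : smooth2 H -> continuous (fun z : G * G => H z.1 z.2).
Proof.
move=> sH [x y]; have [c1 a1 cx] := lie_cover x; have [c2 a2 cy] := lie_cover y.
apply: (@chart2_continuous c1 c2 (fun z => H (chart_inv c1 z.1) (chart_inv c2 z.2))) => //.
  apply: (smooth_on_cont (sH c1 c2 a1 a2)).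
  by split; exact: chart_cod_map.
apply: filterS (near_chart2 a1 a2 cx cy) => z [c1z c2z] /=.
by rewrite !chart_mapK.
Qed.

Lemma smooth_ltrans g f : smooth f -> smooth (fun x => f (g * x)%g).
Proof. by move=> /smooth2_mul; exact: smooth2_fixl. Qed.

Lemma smooth_rtrans g f : smooth f -> smooth (fun x => f (x * g)%g).
Proof. by move=> /smooth2_mul; exact: (@smooth2_fixr (fun x y => f (x * y)%g)). Qed.

Lemma smooth_inv f : smooth f -> smooth (fun x => f (x^-1)%g).
Proof.
move=> sf c a k; apply: Ck_on_local => u cu.
have [c3 a3 c3x] := lie_cover ((chart_inv c u)^-1)%g.
pose U' := chart_cod c `&` [set u | chart_dom c3 (chart_inv c u)^-1%g].
have oU' : open U'.
  apply: open_setI_preimage; [exact: chart_cod_open|exact: chart_dom_open|].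
  move=> v cv; apply: (@continuous_comp _ _ _ (chart_inv c) (fun x : G => x^-1)%g).
    exact: chart_inv_continuous.
  exact: lie_inv_continuous.
exists U' => //.
apply: (@Ck_on_eq _ _ _ _ _ (fun u => (fun v => f (chart_inv c3 v)) (chart_map c3 (chart_inv c u)^-1%g))) => //.
  by move=> z [_ cz]; rewrite /= chart_mapK.
apply: (@Ck_on_comp _ _ _ _ _ (chart_cod c3) (fun u => chart_map c3 (chart_inv c u)^-1%g) (fun v => f (chart_inv c3 v))) => //.
- by move=> z [_ cz]; exact: chart_cod_map.
- exact: (lie_inv_smooth _ _ a a3 k).
- exact: sf.
Qed.

Lemma ltrans_continuous g : continuous (fun x : G => (g * x)%g).
Proof.
move=> x; apply: (@continuous_comp _ _ _ (fun x : G => (g, x)) (fun z : G * G => (z.1 * z.2)%g)).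
  by apply: continuous_at_pair; [exact: cvg_cst|exact: cvg_id].
exact: lie_mul_continuous.
Qed.

Lemma rtrans_continuous g : continuous (fun x : G => (x * g)%g).
Proof.
move=> x; apply: (@continuous_comp _ _ _ (fun x : G => (x, g)) (fun z : G * G => (z.1 * z.2)%g)).
  by apply: continuous_at_pair; [exact: cvg_id|exact: cvg_cst].
exact: lie_mul_continuous.
Qed.

Lemma compact_image_continuous (f : G -> G) (K : set G) : continuous f -> compact K -> compact (f @` K).
Proof. by move=> cf cK; apply: continuous_compact => //; exact: continuous_subspaceT. Qed.

Lemma test_ltrans g f : test_function f -> test_function (fun x => f (g * x)%g).
Proof.
move=> /test_functionP[sf [K cK fK]]; apply/test_functionP; split; first exact: smooth_ltrans.
exists ((fun x : G => (g^-1 * x)%g) @` K).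
  by apply: compact_image_continuous => //; exact: ltrans_continuous.
by move=> x nK; apply: fK => Kx; apply: nK; exists (g * x)%g => //; rewrite mulKg.
Qed.

Lemma test_rtrans g f : test_function f -> test_function (fun x => f (x * g)%g).
Proof.
move=> /test_functionP[sf [K cK fK]]; apply/test_functionP; split; first exact: smooth_rtrans.
exists ((fun x : G => (x * g^-1)%g) @` K).
  by apply: compact_image_continuous => //; exact: rtrans_continuous.
by move=> x nK; apply: fK => Kx; apply: nK; exists (x * g)%g => //; rewrite mulgK.
Qed.

Lemma test_inv f : test_function f -> test_function (fun x => f (x^-1)%g).
Proof.
move=> /test_functionP[sf [K cK fK]]; apply/test_functionP; split; first exact: smooth_inv.
exists ((fun x : G => (x^-1)%g) @` K).
  by apply: compact_image_continuous => //; exact: lie_inv_continuous.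
by move=> x nK; apply: fK => Kx; apply: nK; exists (x^-1)%g => //; rewrite invgK.
Qed.

Lemma test_smoothM f h : test_function f -> smooth h -> test_function (fun x => f x * h x).
Proof.
move=> /test_functionP[sf [K cK fK]] sh; apply/test_functionP; split; first exact: smoothM.
by exists K => // x nK; rewrite fK// mul0r.
Qed.

Lemma testM f h : test_function f -> test_function h -> test_function (fun x => f x * h x).
Proof. by move=> tf [sh _]; exact: test_smoothM. Qed.

Lemma testD f h : test_function f -> test_function h -> test_function (fun x => f x + h x).
Proof.
move=> /test_functionP[sf [K cK fK]] /test_functionP[sh [K' cK' hK]].
apply/test_functionP; split; first exact: smoothD.
exists (K `|` K'); first exact: compactU.
by move=> x nK; rewrite fK ?hK ?addr0// => ?; apply: nK; [right|left].
Qed.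

Lemma testZ (k : R) f : test_function f -> test_function (fun x => k * f x).
Proof.
move=> /test_functionP[sf [K cK fK]]; apply/test_functionP; split; first exact: smoothZ.
by exists K => // x /fK ->; rewrite mulr0.
Qed.

Lemma test_sum I (r : seq I) (F : I -> G -> R) : (forall i, test_function (F i)) ->
  test_function (fun x => \sum_(i <- r) F i x).
Proof.
move=> tF; elim: r => [|i r IH].
  apply/test_functionP; split; first by apply: smooth_sum => i; exact: test_smooth.
  by exists set0; [exact: compact0|move=> x _; rewrite big_nil].
rewrite (_ : (fun x => _) = fun x => F i x + \sum_(j <- r) F j x); first exact: testD.
by apply/funext => x; rewrite big_cons.
Qed.

Lemma test_sqr f : test_function f -> test_function (fun x => f x ^+ 2).
Proof. by move=> tf; rewrite (_ : (fun x => _) = fun x => f x * f x)//; exact: testM. Qed.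

Lemma test_bounded f : test_function f -> exists M, 0 <= M /\ forall x, `|f x| <= M.
Proof.
move=> /test_functionP[sf [K cK fK]].
have cfK : {within K, continuous f} by apply: continuous_subspaceT; exact: smooth_continuous.
have [M [_ HM]] := compact_bounded (continuous_compact cfK cK).
exists (`|M| + 1); split; first by rewrite addr_ge0.
move=> x; have [Kx|nKx] := pselect (K x); last by rewrite fK// normr0 addr_ge0.
by apply: (HM (`|M| + 1)); [rewrite ltr_pwDr// ler_norm|exists x].
Qed.

End lie_smooth2.

(** * Derivations of the algebra of smooth functions *)

Lemma Ck_on_inv (R : realType) (V : normedModType R) k (U : set V) (h : V -> R) : open U ->
  (forall x, U x -> h x != 0) -> Ck_on k U h -> Ck_on k U (fun x => (h x)^-1).
Proof.
move=> oU h0; elim: k => [|k IH]; first by move=> ch x Ux; apply: cvgV; [exact: h0|exact: ch].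
move=> H; have Ch := Ck_onS H; case: H => dh Dh; split=> [x Ux|v].
  by apply: differentiableV; [exact: dh|exact: h0].
have C := Ck_onM oU (Ck_onZ (-1) oU (Dh v)) (Ck_onM oU (IH Ch) (IH Ch)).
apply: (Ck_on_eq oU _ C) => x Ux; rewrite (deriveV (f := h)); last 2 first.
- exact: h0.
- by apply: diff_derivable; exact: dh.
by rewrite /GRing.scale /= -exprVn expr2; ring.
Qed.

Section derivations.
Context {R : realType} {n : nat} {G : lieGroupType R n}.
Implicit Types (c : chart R n G) (f h : G -> R) (x y g : G) (H : G -> G -> R).
Local Notation e_ j := (delta_mx 0 j : 'rV[R]_n).

Variable D : operator G.
Hypothesis D_smooth : forall f, smooth f -> smooth (D f).
Hypothesis D_linear : forall (c : R) f h, smooth f -> smooth h ->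
  forall x, D (fun y => c * f y + h y) x = c * D f x + D h x.
Hypothesis D_leibniz : forall f h, smooth f -> smooth h ->
  forall x, D (fun y => f y * h y) x = f x * D h x + D f x * h x.

Lemma derivation0 x : D (fun=> 0) x = 0.
Proof.
have := D_linear 1 (smooth_cst 0) (smooth_cst 0) x.
rewrite (_ : (fun y : G => _) = fun=> 0); last by apply/funext => y; rewrite mul1r addr0.
by rewrite mul1r => /eqP; rewrite -subr_eq subrr => /eqP.
Qed.

Lemma derivationD f h x : smooth f -> smooth h -> D (fun y => f y + h y) x = D f x + D h x.
Proof.
move=> sf sh; have := D_linear 1 sf sh x; rewrite mul1r => <-.
by congr (D _ x); apply/funext => y; rewrite mul1r.
Qed.

Lemma derivationZ (k : R) f x : smooth f -> D (fun y => k * f y) x = k * D f x.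
Proof.
move=> sf; have := D_linear k sf (smooth_cst 0) x; rewrite derivation0 addr0 => <-.
by congr (D _ x); apply/funext => y; rewrite addr0.
Qed.

Lemma derivation1 x : D (fun=> 1) x = 0.
Proof.
have := D_leibniz (smooth_cst 1) (smooth_cst 1) x.
rewrite (_ : (fun y : G => _) = fun=> 1); last by apply/funext => y; rewrite mul1r.
by rewrite mul1r mulr1 => /eqP; rewrite -subr_eq subrr => /eqP.
Qed.

Lemma derivation_cst (k : R) x : D (fun=> k) x = 0.
Proof.
have := derivationZ k x (smooth_cst 1); rewrite derivation1 mulr0 => <-.
by congr (D _ x); apply/funext => y; rewrite mulr1.
Qed.

Lemma derivation_sum I (r : seq I) (F : I -> G -> R) x : (forall i, smooth (F i)) ->
  D (fun y => \sum_(i <- r) F i y) x = \sum_(i <- r) D (F i) x.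
Proof.
move=> sF; elim: r => [|i r IH].
  rewrite big_nil (_ : (fun y => _) = fun=> 0) ?derivation0//.
  by apply/funext => y; rewrite big_nil.
rewrite big_cons -IH -derivationD//; last exact: smooth_sum.
by congr (D _ x); apply/funext => y; rewrite big_cons.
Qed.

(* Only a bump function b with b(x) <> 0 is used, so that the components of the
   vector are D(b u_j)(x) / b(x) for the chart coordinates u_j centered at x. *)
Lemma derivation_chart c x : lie_atlas c -> chart_dom c x ->
  exists v : 'I_n -> R, forall f, smooth f ->
    D f x = \sum_j v j * 'D_(e_ j) (fun u => f (chart_inv c u)) (chart_map c x).
Proof.
move=> ac cx; pose u0 := chart_map c x.
have : nbhs u0 (chart_cod c).
  by apply: open_nbhs_nbhs; split; [exact: chart_cod_open|exact: chart_cod_map].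
move=> /nbhs_ballP[r0 /= r0_gt0 r0M].
pose U := [set u : 'rV[R]_n | `|u - u0| < r0].
have Ucod : U `<=` chart_cod c.
  by move=> u Uu; apply: r0M; rewrite -ball_normE /ball_/= distrC.
have oU : open U by exact: open_norm_ball.
have Uu0 : U u0 by rewrite /U/= subrr normr0.
pose N := chart_dom c `&` [set y | U (chart_map c y)].
have oN : open N.
  apply: open_setI_preimage => //; first exact: chart_dom_open.
  by move=> y; exact: chart_map_continuous.
have [b [sb b0 bx [K [cK KN bK]]]] := exists_bump oN (conj cx Uu0 : N x).
have clK : closed K by apply: compact_closed => //; exact: lie_hausdorff.
pose ext (k : 'rV[R]_n -> R) y := b y * k (chart_map c y).
have s_ext k : smooth_on U k -> smooth (ext k).
  move=> sk; apply: smooth_local => y.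
  have [Ny|nNy] := pselect (N y).
    exists c; first by case: Ny.
    exists N; split=> // m.
    have oM : open (chart_cod c `&` [set u | N (chart_inv c u)]) by exact: chart_preim_open.
    apply: (@Ck_on_eq _ _ _ _ _ (fun u => b (chart_inv c u) * k u)) => //.
      by move=> u [cu _]; rewrite /ext chart_invK.
    apply: Ck_onM => //.
      by apply: Ck_on_sub (sb c ac m) => u [].
    apply: Ck_on_sub (sk m) => u [cu [_ /=]]; by rewrite chart_invK.
  have [c' ac' cy'] := lie_cover y.
  exists c' => //; exists (~` K); split.
  + exact: closed_openC.
  + by move=> /KN.
  + move=> m; apply: (@Ck_on_eq _ _ _ _ _ (fun=> 0)).
    * by apply: chart_preim_open => //; exact: closed_openC.
    * by move=> u [_ /= nK]; rewrite /ext bK ?mul0r.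
    * exact: Ck_on_cst.
pose coord j (u : 'rV[R]_n) : R := (u - u0) 0 j.
have s_coord j : smooth_on U (coord j).
  move=> m; have -> : coord j = fun u => u 0 j + - u0 0 j.
    by apply/funext => u; rewrite /coord !mxE.
  apply: Ck_onD => //; last exact: Ck_on_cst.
  by apply: Ck_on_sub (smooth_on_coord j m).
exists (fun j => D (ext (coord j)) x / b x) => f sf.
have sF : smooth_on U (fun u => f (chart_inv c u)) by move=> m; exact: Ck_on_sub Ucod (sf c ac m).
have [g [sg Fg gu0]] := hadamard r0_gt0 sF.
have sbb : smooth (fun y => b y * b y) by exact: smoothM.
(* Hadamard's expansion multiplied by [b^2]: each factor of the products receives one [b] and
   becomes smooth on the whole group. Off [N] both sides vanish. *)
have E : (fun y => b y * b y * f y) =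
    (fun y => f x * (b y * b y) + \sum_j ext (coord j) y * ext (g j) y).
  apply/funext => y; have [Ny|nNy] := pselect (N y); last first.
    have by0 : b y = 0 by apply: bK => /KN.
    rewrite by0 !mul0r mulr0 add0r big1// => j _.
    by rewrite /ext by0 !mul0r.
  have [cy Uy] := Ny.
  have := Fg _ Uy; rewrite !chart_mapK// => ->.
  rewrite mulrDr mulrC; congr (_ + _); rewrite mulr_sumr; apply: eq_bigr => j _.
  by rewrite /ext /coord; ring.
have s2 j : smooth (fun y => ext (coord j) y * ext (g j) y).
  by apply: smoothM; apply: s_ext => //; exact: sg.
have := D_leibniz sbb sf x; rewrite E derivationD//; last 2 first.
- exact: smoothZ.
- exact: smooth_sum.
rewrite derivationZ// derivation_sum//.
rewrite addrC mulrC => /(congr1 (fun z => z - D (fun y => b y * b y) x * f x)).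
rewrite !addrK => Df.
have bxn : b x != 0 by rewrite gt_eqF.
apply: (mulfI (mulf_neq0 bxn bxn)); rewrite -Df mulr_sumr; apply: eq_bigr => j _.
rewrite D_leibniz; [|exact/s_ext|apply: s_ext; exact: sg].
rewrite /ext {1}/coord -/u0 subrr mxE mulr0 mul0r add0r gu0.
by rewrite -/(ext (coord j)); field.
Qed.

Lemma derivation_local f h (N : set G) x : open N -> N x -> smooth f -> smooth h ->
  (forall y, N y -> f y = h y) -> D f x = D h x.
Proof.
move=> oN Nx sf sh fh; have [c ac cx] := lie_cover x.
have [v vP] := derivation_chart ac cx; rewrite !vP//; apply: eq_bigr => j _.
congr (_ * _); apply: near_eq_derive.
have oM := chart_preim_open ac oN.
apply: filterS (open_nbhs_nbhs (conj oM _)).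
  by move=> u [_ /= Nu]; exact: fh.
by split; [exact: chart_cod_map|rewrite /= chart_mapK].
Qed.

Lemma derivation_support f (K : set G) x : smooth f -> closed K ->
  (forall y, ~ K y -> f y = 0) -> ~ K x -> D f x = 0.
Proof.
move=> sf cK fK nK.
rewrite (@derivation_local f (fun=> 0) (~` K))//; first exact: derivation_cst.
- exact: closed_openC.
- exact: smooth_cst.
Qed.

Lemma test_derivation f : test_function f -> test_function (D f).
Proof.
move=> /test_functionP[sf [K cK fK]]; apply/test_functionP; split; first exact: D_smooth.
exists K => // x; apply: derivation_support => //.
by apply: compact_closed => //; exact: lie_hausdorff.
Qed.

(* The vector of the previous lemma depends smoothly on the point, because
   it is determined by the values of D on finitely many smooth functions. *)
Lemma derivation_chart_smooth c x : lie_atlas c -> chart_dom c x ->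
  exists N (v : 'I_n -> G -> R), [/\ open N, N x, N `<=` chart_dom c,
    forall j, smooth_on (chart_cod c `&` [set u | N (chart_inv c u)]) (fun u => v j (chart_inv c u)) &
    forall f y, smooth f -> N y ->
      D f y = \sum_j v j y * 'D_(e_ j) (fun u => f (chart_inv c u)) (chart_map c y)].
Proof.
move=> ac cx.
have [b [sb b0 bx [K [cK KN bK]]]] := exists_bump (chart_dom_open ac) cx.
have clK : closed K by apply: compact_closed => //; exact: lie_hausdorff.
pose N := [set y | b y != 0].
have oN : open N.
  rewrite (_ : N = b @^-1` [set z | z != 0])//.
  apply: open_comp; last exact: open_neq.
  by move=> y _; exact: smooth_continuous.
have NK : N `<=` K by move=> y /= /eqP by0; apply: contrapT => /bK.
have Nc : N `<=` chart_dom c by move=> y /NK /KN.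
pose k j y := b y * chart_map c y 0 j.
have kE j u : chart_cod c u -> k j (chart_inv c u) = b (chart_inv c u) * u 0 j.
  by move=> cu; rewrite /k chart_invK.
have sbk j : smooth (k j).
  apply: smooth_local => y.
  have [cy|ncy] := pselect (chart_dom c y).
    exists c => //; exists (chart_dom c); split=> //; first exact: chart_dom_open.
    have oM := chart_preim_open ac (chart_dom_open ac).
    move=> m; apply: (@Ck_on_eq _ _ _ _ _ (fun u => b (chart_inv c u) * u 0 j)) => //.
      by move=> u [cu _]; rewrite kE.
    apply: Ck_onM => //.
      by apply: Ck_on_sub (sb c ac m) => u [].
    by apply: Ck_on_sub (smooth_on_coord j m).
  have [c' ac' cy'] := lie_cover y.
  exists c' => //; exists (~` K); split.
  + exact: closed_openC.
  + by move=> /KN.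
  + move=> m; apply: (@Ck_on_eq _ _ _ _ _ (fun=> 0)).
    * by apply: chart_preim_open => //; exact: closed_openC.
    * by move=> u [_ /= nK]; rewrite /k bK ?mul0r.
    * exact: Ck_on_cst.
(* The Leibniz rule for [k j], the product of [b] with the coordinate [j], solved for the derivative
   of that coordinate. *)
pose v j y := (D (k j) y - D b y * chart_map c y 0 j) / b y.
exists N, v; split=> //.
- by rewrite /N/= gt_eqF.
- move=> j m; have oM := chart_preim_open ac oN.
  have res f (sf : smooth f) : Ck_on m (chart_cod c `&` [set u | N (chart_inv c u)])
      (fun u => f (chart_inv c u)) by apply: Ck_on_sub (sf c ac m) => u [].
  apply: (@Ck_on_eq _ _ _ _ _ (fun u => (D (k j) (chart_inv c u) +
    -1 * (D b (chart_inv c u) * u 0 j)) * (b (chart_inv c u))^-1)) => //.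
    by move=> u [cu _]; rewrite /v chart_invK// mulN1r.
  apply: Ck_onM => //; last first.
    by apply: Ck_on_inv; [exact: oM|by move=> u [_]|exact: res].
  apply: Ck_onD => //; first exact/res/D_smooth/sbk.
  apply: Ck_onZ => //; apply: Ck_onM => //; first exact/res/D_smooth.
  exact: Ck_on_sub (smooth_on_coord j m).
- move=> f y sf Ny; have cy := Nc _ Ny.
  have [w wP] := derivation_chart ac cy; rewrite wP//; apply: eq_bigr => j _.
  congr (_ * _); rewrite /v !wP//.
  have cu := chart_cod_map cy.
  have db : differentiable (fun u => b (chart_inv c u)) (chart_map c y).
    exact: (smooth_on_diff (sb c ac)).
  have dc i : differentiable (fun u : 'rV[R]_n => u 0 i : R) (chart_map c y).
    exact: differentiable_coord.
  have Dk i : 'D_(e_ i) (fun u => k j (chart_inv c u)) (chart_map c y) =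
      b y * (i == j)%:R + chart_map c y 0 j * 'D_(e_ i) (fun u => b (chart_inv c u)) (chart_map c y).
    transitivity ('D_(e_ i) (fun u => b (chart_inv c u) * u 0 j) (chart_map c y)).
      apply: near_eq_derive; apply: filterS (open_nbhs_nbhs (conj (chart_cod_open ac) cu)).
      by move=> u; exact: kE.
    rewrite (@deriveM _ _ (fun u => b (chart_inv c u)) (fun u => u 0 j)); [|exact: diff_derivable..].
    rewrite chart_mapK//; congr (_ + _); congr (_ * _).
    rewrite (derive_rV_coord (phi := id))//.
    by rewrite derive_id mxE/= eq_sym.
  under eq_bigr do rewrite Dk mulrDr.
  rewrite big_split/= (bigD1 j)//= eqxx mulr1 big1 ?addr0; last first.
    by move=> i ij; rewrite (negbTE ij) !mulr0.
  rewrite mulr_suml -addrA -sumrB big1 ?addr0 ?mulfK//.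
  by move=> i _; ring.
Qed.

(** In charts, [D] acting on the first variable is a combination of the partial derivatives in the
    directions [(e_ j, 0)], with coefficients that are smooth near the given point. *)
Lemma smooth2_derivation H : smooth2 H -> smooth2 (fun x y => D (H ^~ y) x).
Proof.
move=> sH c1 c2 a1 a2 k; apply: Ck_on_local => -[u1 u2] [/= cu1 cu2].
have [N [v [oN Nx Nc sv vP]]] := derivation_chart_smooth a1 (chart_dom_inv a1 cu1).
have oM := chart_preim_open a1 oN.
pose U' := [set z : 'rV[R]_n * 'rV[R]_n |
  (chart_cod c1 `&` [set u | N (chart_inv c1 u)]) z.1 /\ chart_cod c2 z.2].
have oU' : open U' by apply: open_fst_snd => //; exact: chart_cod_open.
exists U' => //.
pose F j (z : 'rV[R]_n * 'rV[R]_n) := 'D_(e_ j, 0) (fun z => H (chart_inv c1 z.1) (chart_inv c2 z.2)) z.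
have sF j : smooth_on [set z : 'rV[R]_n * 'rV[R]_n | chart_cod c1 z.1 /\ chart_cod c2 z.2] (F j).
  by apply: smooth_on_D; exact: sH.
apply: (@Ck_on_eq _ _ _ _ _ (fun z => \sum_j v j (chart_inv c1 z.1) * F j z)) => //.
  move=> -[w1 w2] [[/= cw1 Nw1] cw2]; rewrite vP//; last exact: smooth2_fixr.
  apply: eq_bigr => j _; congr (_ * _).
  rewrite /F chart_invK// -(@derive_pairl _ _ _ w2 w1 (e_ j)
    (fun z => H (chart_inv c1 z.1) (chart_inv c2 z.2)))//.
  by apply: (smooth_on_diff (sH c1 c2 a1 a2)).
apply: Ck_on_sum => // j; apply: Ck_onM => //; last by apply: Ck_on_sub (sF j k) => z [[]].
apply: (@Ck_on_comp_affine _ _ _ _ k U' _ fst fst) (sv j k) => //.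
- by move=> z; have [] := is_diff_fst z.
- by move=> z w; have [d E] := is_diff_fst z; rewrite (deriveE w d) E.
- by move=> z [].
Qed.

(** The function [f (u * u^-1)] is constant. Its derivative at the identity vanishes and is the sum
    of the two partial derivatives of [K] at the identity, one of which is that of [f] and the other
    that of [f] after inversion. *)
Lemma derivation_inv f : smooth f -> D (fun x => f (x^-1)%g) 1%g = - D f 1%g.
Proof.
move=> sf; have [c ac c1] := lie_cover (1%g : G).
have [v vP] := derivation_chart ac c1.
rewrite (vP _ (smooth_inv sf)) (vP _ sf) -sumrN; apply: eq_bigr => j _.
rewrite -mulrN; congr (_ * _); set u0 := chart_map c 1%g.
have cu0 : chart_cod c u0 by exact: chart_cod_map.
have iu0 : chart_inv c u0 = 1%g by exact: chart_mapK.
pose K (z : 'rV[R]_n * 'rV[R]_n) := f (chart_inv c z.1 * chart_inv c z.2)%g.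
have dK : differentiable K (u0, u0) by exact: (smooth_on_diff (smooth2_mul sf ac ac)).
pose iota u := chart_map c (chart_inv c u)^-1%g.
pose U := chart_cod c `&` [set u | chart_dom c (chart_inv c u)^-1%g].
have Uu0 : U u0 by split=> //=; rewrite iu0 invg1.
have oU : open U.
  apply: open_setI_preimage; [exact: chart_cod_open|exact: chart_dom_open|].
  move=> u cu; apply: (@continuous_comp _ _ _ (chart_inv c) (fun x : G => x^-1)%g).
    exact: chart_inv_continuous.
  exact: lie_inv_continuous.
have nU := open_nbhs_nbhs (conj oU Uu0).
have di : differentiable iota u0 by exact: (smooth_on_diff (@lie_inv_smooth R n G c c ac ac)).
have i0 : iota u0 = u0 by rewrite /iota iu0 invg1.
have dp : is_diff u0 (fun u => (u, iota u)) (fun w => (w, 'd iota u0 w)).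
  by have := differentiableP di => ?; exact: is_diff_pair.
have dq : is_diff u0 (fun u => (u0, iota u)) (fun w => (0, 'd iota u0 w)).
  by have := differentiableP di => ?; exact: is_diff_pair.
have dK' : differentiable K (u0, iota u0) by rewrite i0.
have E0 : 'D_(e_ j) (fun u => K (u, iota u)) u0 = 0.
  rewrite -(derive_cst (f 1%g) u0 (e_ j)); apply: near_eq_derive; apply: filterS nU => u [cu iu].
  by rewrite /K/= /iota chart_mapK// mulgV.
have E1 : 'D_(e_ j) (fun u => f (chart_inv c u)) u0 = 'd K (u0, u0) (e_ j, 0).
  rewrite -deriveE// -derive_pairl//; apply: near_eq_derive; apply: filterS nU => u _.
  by rewrite /K/= iu0 mulg1.
have E2 : 'D_(e_ j) (fun u => f (chart_inv c u)^-1%g) u0 = 'd K (u0, u0) (0, 'd iota u0 (e_ j)).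
  transitivity ('D_(e_ j) (fun u => K (u0, iota u)) u0).
    apply: near_eq_derive; apply: filterS nU => u [cu iu].
    by rewrite /K/= /iota iu0 mul1g chart_mapK.
  have [d E] := dq; rewrite deriveE; last exact: (differentiable_comp (f := fun u => (u0, iota u))).
  by rewrite diff_comp//= E i0.
apply/eqP; rewrite E1 E2 -addr_eq0 addrC -linearD -[X in _ == X]E0; apply/eqP.
have [d E] := dp; rewrite deriveE; last exact: (differentiable_comp (f := fun u => (u, iota u))).
rewrite diff_comp//= E i0; congr ('d K _ _).
by congr pair; rewrite ?addr0 ?add0r.
Qed.

End derivations.

(** * Borel measures and convolutions *)

Lemma integrable_indic_lty d (T : measurableType d) (R : realType)
    (mu : {measure set T -> \bar R}) (A : set T) : measurable A -> (mu A < +oo)%E ->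
  mu.-integrable setT (EFin \o (\1_A : T -> R)).
Proof.
move=> mA muA; apply/integrableP; split; first exact/measurable_EFinP.
rewrite (eq_integral (fun x => (\1_A x)%:E)); last first.
  by move=> t _; rewrite gee0_abs// lee_fin.
by rewrite integral_indic// setIT.
Qed.

Section borel_measurable.
Context {R : realType} {n : nat} {G : lieGroupType R n}.
Implicit Types (f h : G -> R) (x y g : G) (H : G -> G -> R).

Lemma open_borel (A : set G) : open A -> measurable (A : set (borel G)).
Proof. by move=> oA; exact: sub_sigma_algebra. Qed.

Lemma closed_borel (A : set G) : closed A -> measurable (A : set (borel G)).
Proof. by move=> cA; rewrite -[A]setCK; apply: measurableC; apply: open_borel; exact: closed_openC. Qed.

Lemma compact_borel (A : set G) : compact A -> measurable (A : set (borel G)).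
Proof. by move=> cA; apply: closed_borel; apply: compact_closed => //; exact: (@lie_hausdorff R n G). Qed.

Lemma continuous_borel_map (f : G -> G) : continuous f ->
  measurable_fun setT (f : borel G -> borel G).
Proof.
move=> /continuousP cf; apply: (measurability (@open G : set (set (borel G)))) => //.
by move=> _ [A oA <-]; rewrite setTI; apply: open_borel; exact: cf.
Qed.

Lemma continuous_borel f : continuous f -> measurable_fun setT (f : borel G -> R).
Proof.
move=> /continuousP cf; apply: (measurability _ (RGenOpens.measurableE R)).
move=> _ [_ [a [b ->] <-]]; rewrite setTI; apply: open_borel; apply: cf.
exact: interval_open.
Qed.

Lemma integrable_compact (nu : {measure set (borel G) -> \bar R}) f (K : set G) :
  (forall K, compact K -> nu K < +oo)%E -> continuous f -> compact K ->
  (forall x, ~ K x -> f x = 0) -> nu.-integrable setT (EFin \o f).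
Proof.
move=> fnu cf cK fK.
have [M [_ HM]] := compact_bounded (continuous_compact (continuous_subspaceT cf) cK).
have mK := compact_borel cK.
apply: (@integrable_bounded_by _ _ _ nu setT f (fun x => (`|M| + 1) * \1_K x)) => //.
- exact: continuous_borel.
- apply: integrableRZ => //.
  by apply: integrable_indic_lty => //; exact: fnu.
- move=> x _; have [Kx|nKx] := pselect (K x).
    rewrite indicE mem_set// mulr1; apply: (HM (`|M| + 1)); last by exists x.
    by rewrite ltr_pwDr// ler_norm.
  by rewrite fK// normr0 mulr_ge0// addr_ge0.
Qed.

End borel_measurable.

(** * Integrals of properly supported functions of two variables *)

Section convolution.
Context {R : realType} {n : nat} {G : lieGroupType R n}.
Implicit Types (c : chart R n G) (f h : G -> R) (x y g : G) (H : G -> G -> R).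

(* Locally uniformly in the first variable, the second one ranges over a compact set. *)
Definition proper_support H := forall K : set G, compact K -> exists2 K' : set G,
  compact K' & forall x y, K x -> ~ K' y -> H x y = 0.

Variable nu : {measure set (borel G) -> \bar R}.
Variables (A : set (borel G)) (mA : measurable A).
Hypothesis nu_compact : forall K : set G, compact K -> (nu K < +oo)%E.

Section in_chart.
Variables (c : chart R n G) (ac : lie_atlas c).
Let U := chart_cod c.
Let oU : open U := chart_cod_open ac.

(** The integrands read in a chart: smooth jointly in both variables and, locally uniformly in the
    first one, zero off a compact set. Both properties pass to derivatives in the first variable,
    and together they give a constant dominating function on that compact set. *)
Let S : set ('rV[R]_n -> borel G -> R) := [set Phi |
  (forall c2, lie_atlas c2 -> smooth_on [set z : 'rV[R]_n * 'rV[R]_n | chart_cod c z.1 /\ chart_cod c2 z.2]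
     (fun z => Phi z.1 (chart_inv c2 z.2))) /\
  forall w, U w -> exists2 r : R, 0 < r & exists2 K : set G, compact K &
    forall w' y, `|w' - w| <= r -> U w' /\ (~ K y -> Phi w' y = 0)].

Lemma conv_diffS Phi w (y : borel G) : S Phi -> U w -> differentiable (Phi ^~ y) w.
Proof.
move=> [sPhi _] Uw; have [c2 a2 cy] := lie_cover (y : G).
have := @Ck_on_pairl _ _ _ 1 U _ (chart_map c2 y) _ oU _ (sPhi c2 a2 1%N).
rewrite /= chart_mapK// => H.
by have [dP _] := H (fun u Uu => conj Uu (chart_cod_map cy)); exact: dP.
Qed.

Lemma conv_derS Phi v : S Phi -> S (fun w y => 'D_v (Phi ^~ y) w).
Proof.
move=> [sPhi pPhi]; split.
  move=> c2 a2 k.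
  apply: (@Ck_on_eq _ _ _ _ _ ('D_(v, 0) (fun z => Phi z.1 (chart_inv c2 z.2)))).
  - exact: open_cod2.
  - move=> [w u] [/= cw cu].
    rewrite -(@derive_pairl _ _ _ u w v (fun z => Phi z.1 (chart_inv c2 z.2)))//.
    by apply: (smooth_on_diff (sPhi c2 a2)).
  - exact: (smooth_on_D _ (sPhi c2 a2)).
move=> w Uw; have [r r0 [K cK HK]] := pPhi w Uw.
(* With half the radius, [w'] is an interior point of the ball on which [Phi] vanishes off [K], so
   its derivative vanishes there too. *)
exists (r / 2); first by rewrite divr_gt0.
exists K => // w' y wr.
have wr' : `|w' - w| < r by rewrite (le_lt_trans wr)// ltr_pdivrMr// ltr_pMr// ltr1n.
split; first by have [] := HK w' y (ltW wr').
move=> nK.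
have -> : 'D_v (Phi ^~ y) w' = 'D_v (cst (0 : R)) w'; last by rewrite derive_cst.
apply: near_eq_derive.
have := open_nbhs_nbhs (conj (@open_norm_ball R n w r) wr').
by apply: filterS => w'' /= wr''; have [_ ->] := HK w'' y (ltW wr'').
Qed.

Lemma conv_continuous Phi : S Phi -> forall w y, U w ->
  {for (w, y), continuous (fun z : 'rV[R]_n * G => Phi z.1 z.2)}.
Proof.
move=> [sPhi _] w y Uw; have [c2 a2 cy] := lie_cover y.
pose F (z : 'rV[R]_n * 'rV[R]_n) := Phi z.1 (chart_inv c2 z.2).
have E : \forall z \near (w, y), F (z.1, chart_map c2 z.2) = Phi z.1 z.2.
  have : nbhs (w, y) [set z : 'rV[R]_n * G | setT z.1 /\ chart_dom c2 z.2].
    apply: open_nbhs_nbhs; split=> //; apply: open_fst_snd; first exact: openT.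
    exact: chart_dom_open.
  by apply: filterS => z [_ cz]; rewrite /F/= chart_mapK.
rewrite /prop_for /continuous_at -[X in _ --> X](nbhs_singleton E).
apply: cvg_trans (near_eq_cvg E) _.
apply: (@continuous_comp _ _ _ (fun z : 'rV[R]_n * G => (z.1, chart_map c2 z.2)) F).
  apply: continuous_at_pair; first exact: cvg_fst.
  by apply: (@continuous_at_snd _ _ _ (chart_map c2) (w, y)); exact: chart_map_continuous.
by apply: (smooth_on_cont (sPhi c2 a2)); split=> //=; exact: chart_cod_map.
Qed.

Lemma conv_mS Phi w : S Phi -> U w -> measurable_fun A (Phi w).
Proof.
move=> SP Uw; apply: measurable_funTS; apply: continuous_borel => y.
apply: (@continuous_comp _ _ _ (fun y : G => (w, y)) (fun z : 'rV[R]_n * G => Phi z.1 z.2)).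
  by apply: continuous_at_pair; [exact: cvg_cst|exact: cvg_id].
exact: conv_continuous.
Qed.

Lemma conv_domS Phi w : S Phi -> U w -> exists2 r : R, 0 < r &
  exists2 g : borel G -> R, nu.-integrable A (EFin \o g) &
    forall w', `|w' - w| < r -> forall y, A y -> `|Phi w' y| <= g y.
Proof.
move=> SP Uw; have [sPhi pPhi] := SP; have [r r0 [K cK HK]] := pPhi w Uw.
exists r => //.
pose B := [set u : 'rV[R]_n | `|u - w| <= r].
have cB : compact B by exact: compact_norm_ball.
have cBK := compact_setX cB cK.
have cF : {within B `*` K, continuous (fun z : 'rV[R]_n * G => Phi z.1 z.2)}.
  apply/continuous_in_subspaceT => -[u y] /set_mem[/= Bu Ky].
  by apply: conv_continuous => //; have [] := HK u y Bu.
have [M [_ HM]] := compact_bounded (continuous_compact cF cBK).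
exists (fun x => (`|M| + 1) * \1_K x).
  apply: (@integrableS _ _ _ _ setT) => //.
  apply: integrableRZ => //; apply: integrable_indic_lty; first exact: compact_borel.
  exact: nu_compact.
move=> w' /ltW wr y _; have [_ Kw] := HK w' y wr.
have [Ky|nKy] := pselect (K y).
  rewrite indicE mem_set// mulr1; apply: (HM (`|M| + 1)); first by rewrite ltr_pwDr// ler_norm.
  by exists (w', y).
by rewrite Kw// normr0 mulr_ge0// addr_ge0.
Qed.

Lemma conv_chartS H : smooth2 H -> proper_support H -> S (fun w y => H (chart_inv c w) y).
Proof.
move=> sH pH; split; first by move=> c2 a2; exact: sH.
move=> w Uw.
have /nbhs_ballP[r0 /= r0_gt0 r0M] : nbhs w U by exact: open_nbhs_nbhs.
pose r := r0 / 2; have r_gt0 : 0 < r by rewrite divr_gt0.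
have BU w' : `|w' - w| <= r -> U w'.
  move=> Bu; apply: r0M; rewrite -ball_normE /ball_/= distrC (le_lt_trans Bu)//.
  by rewrite /r ltr_pdivrMr// ltr_pMr// ltr1n.
pose B := [set u : 'rV[R]_n | `|u - w| <= r].
have cB : compact B by exact: compact_norm_ball.
have cK0 : compact (chart_inv c @` B).
  apply: continuous_compact => //; apply/continuous_in_subspaceT => u /set_mem Bu.
  by apply: chart_inv_continuous => //; exact: BU.
have [K' cK' HK'] := pH _ cK0.
exists r => //; exists K' => // w' y wr; split; first exact: BU.
by move=> nK; apply: HK' => //; exists w'.
Qed.

Lemma conv_in_chart H : smooth2 H -> proper_support H ->
  smooth_on U (fun w => \int[nu]_(y in A) H (chart_inv c w) y) /\
  forall w v, U w -> 'D_v (fun w => \int[nu]_(y in A) H (chart_inv c w) y) w =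
    \int[nu]_(y in A) 'D_v (fun w => H (chart_inv c w) y) w.
Proof.
move=> sH pH; have SH := conv_chartS sH pH.
have dS Phi w (y : borel G) : S Phi -> U w -> A y -> differentiable (Phi ^~ y) w.
  by move=> SP Uw _; exact: conv_diffS.
split.
  exact: (@Rintegral_param_smooth _ _ _ _ nu A U S mA oU dS conv_derS conv_mS conv_domS _ SH).
move=> w v Uw.
by have [_] := @Rintegral_param_derive _ _ _ _ nu A U S mA oU dS conv_derS conv_mS conv_domS _ _ SH Uw.
Qed.

Lemma conv_chart_integrable H w : smooth2 H -> proper_support H -> U w -> forall v,
  nu.-integrable A (EFin \o (fun y => 'D_v (fun w => H (chart_inv c w) y) w)).
Proof.
move=> sH pH Uw v; have SH := conv_derS v (conv_chartS sH pH).
have [r r0 [g ig gP]] := conv_domS SH Uw.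
apply: (integrable_bounded_by mA (conv_mS SH Uw) ig) => y Ay.
by apply: gP; rewrite // subrr normr0.
Qed.

End in_chart.

Lemma smooth_conv H : smooth2 H -> proper_support H -> smooth (fun x => \int[nu]_(y in A) H x y).
Proof. by move=> sH pH c ac; exact: (conv_in_chart ac sH pH).1. Qed.

Variable D : operator G.
Hypothesis D_smooth : forall f, smooth f -> smooth (D f).
Hypothesis D_linear : forall (c : R) f h, smooth f -> smooth h ->
  forall x, D (fun y => c * f y + h y) x = c * D f x + D h x.
Hypothesis D_leibniz : forall f h, smooth f -> smooth h ->
  forall x, D (fun y => f y * h y) x = f x * D h x + D f x * h x.

(** At the fixed point [x], [D] is a finite combination of partial derivatives in a chart, and these
    pass under the integral. *)
Lemma derivation_conv H x : smooth2 H -> proper_support H ->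
  D (fun x => \int[nu]_(y in A) H x y) x = \int[nu]_(y in A) D (H ^~ y) x.
Proof.
move=> sH pH; have [c ac cx] := lie_cover x.
have [v vP] := derivation_chart D_linear D_leibniz ac cx.
rewrite vP; last exact: smooth_conv.
have cu := chart_cod_map cx.
transitivity (\int[nu]_(y in A) \sum_j v j * 'D_(delta_mx 0 j) (fun u => H (chart_inv c u) y) (chart_map c x)).
  rewrite Rintegral_sum//; last first.
    by move=> j; apply: integrableRZ => //; exact: conv_chart_integrable.
  apply: eq_bigr => j _; rewrite RintegralZl//; last exact: conv_chart_integrable.
  by rewrite (conv_in_chart ac sH pH).2.
by apply: eq_Rintegral => y _; rewrite vP//; exact: smooth2_fixr.
Qed.

End convolution.

Section translation_support.
Context {R : realType} {n : nat} {G : lieGroupType R n}.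
Implicit Types (f h : G -> R) (x y : G) (H : G -> G -> R).

Lemma compact_mul_image (K K' : set G) (k : G * G -> G) : continuous k -> compact K -> compact K' ->
  compact (k @` (K `*` K')).
Proof.
move=> ck cK cK'; apply: continuous_compact; first exact: continuous_subspaceT.
exact: compact_setX.
Qed.

Lemma mulVl_continuous : continuous (fun z : G * G => (z.1^-1 * z.2)%g).
Proof.
move=> z; apply: (@continuous_comp _ _ _ (fun z : G * G => (z.1^-1%g, z.2)) (fun z : G * G => (z.1 * z.2)%g)).
  apply: continuous_at_pair; last exact: cvg_snd.
  by apply: (@continuous_at_fst _ _ _ (fun x : G => x^-1%g)); exact: lie_inv_continuous.
exact: lie_mul_continuous.
Qed.

Lemma mulVr_continuous : continuous (fun z : G * G => (z.2 * z.1^-1)%g).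
Proof.
move=> z; apply: (@continuous_comp _ _ _ (fun z : G * G => (z.2, z.1^-1%g)) (fun z : G * G => (z.1 * z.2)%g)).
  apply: continuous_at_pair; first exact: cvg_snd.
  by apply: (@continuous_at_fst _ _ _ (fun x : G => x^-1%g)); exact: lie_inv_continuous.
exact: lie_mul_continuous.
Qed.

Lemma proper_mul f : test_function f -> proper_support (fun x y => f (x * y)%g).
Proof.
move=> /test_functionP[sf [K cK fK]] K0 cK0.
exists ((fun z : G * G => (z.1^-1 * z.2)%g) @` (K0 `*` K)).
  by apply: compact_mul_image => //; exact: mulVl_continuous.
move=> x y Kx nK; apply: fK => Kxy; apply: nK; exists (x, x * y)%g => //=.
by rewrite mulKg.
Qed.

Lemma proper_mulC f : test_function f -> proper_support (fun x y => f (y * x)%g).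
Proof.
move=> /test_functionP[sf [K cK fK]] K0 cK0.
exists ((fun z : G * G => (z.2 * z.1^-1)%g) @` (K0 `*` K)).
  by apply: compact_mul_image => //; exact: mulVr_continuous.
move=> x y Kx nK; apply: fK => Kxy; apply: nK; exists (x, y * x)%g => //=.
by rewrite mulgK.
Qed.

Lemma compact_nbhd : exists N C : set G, [/\ open N, N 1%g, N `<=` C & compact C].
Proof.
have [b [sb b0 bx [C [cC _ bC]]]] := exists_bump openT (I : setT (1%g : G)).
exists [set y | b y != 0], C; split=> //.
- rewrite (_ : [set y | b y != 0] = b @^-1` [set z | z != 0])//.
  apply: open_comp; last exact: open_neq.
  by move=> y _; exact: smooth_continuous.
- by rewrite /= gt_eqF.
- by move=> y /= /eqP by0; apply: contrapT => /bC.
Qed.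

Variable D : operator G.
Hypothesis D_linear : forall (c : R) f h, smooth f -> smooth h ->
  forall x, D (fun y => c * f y + h y) x = c * D f x + D h x.
Hypothesis D_leibniz : forall f h, smooth f -> smooth h ->
  forall x, D (fun y => f y * h y) x = f x * D h x + D f x * h x.

(** The value of [D] at [x] depends on the function near [x] only. If [x] is in [K], this
    neighbourhood lies in the compact set [K C], with [C] a compact neighbourhood of the identity,
    and the support bound of [H] over [K C] applies. *)
Lemma proper_derivation H : smooth2 H -> proper_support H ->
  proper_support (fun x y => D (H ^~ y) x).
Proof.
move=> sH pH K cK; have [N [C [oN N1 NC cC]]] := compact_nbhd.
have cKC := compact_mul_image lie_mul_continuous cK cC.
have [K' cK' HK'] := pH _ cKC.
exists K' => // x y Kx nK'.
have xN : open [set z | N (x^-1 * z)%g].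
  by move: N oN {N1 NC} => N oN; apply: (continuousP (fun z : G => (x^-1 * z)%g)).1 => //; exact: ltrans_continuous.
rewrite (@derivation_local _ _ _ D D_linear D_leibniz (H ^~ y) (fun=> 0) _ x xN)//.
- exact: derivation_cst D_linear D_leibniz _ _.
- by rewrite /= mulVg.
- exact: smooth2_fixr.
- exact: smooth_cst.
- move=> z /= Nz; apply: HK' => //; exists (x, x^-1 * z)%g => /=; last by rewrite mulVKg.
  by split=> //; exact: NC.
Qed.

End translation_support.

Section proper_bounded.
Context {R : realType} {n : nat} {G : lieGroupType R n}.
Implicit Types (H : G -> G -> R).

Lemma proper_bounded H (K : set G) : continuous (fun z : G * G => H z.1 z.2) ->
  proper_support H -> compact K -> exists2 M, 0 <= M & forall x y, K x -> `|H x y| <= M.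
Proof.
move=> cH pH cK; have [K' cK' HK'] := pH _ cK.
have cKK := compact_setX cK cK'.
have [M [_ HM]] := compact_bounded (continuous_compact (continuous_subspaceT cH) cKK).
exists (`|M| + 1); first by rewrite addr_ge0.
move=> x y Kx; have [Ky|nKy] := pselect (K' y); last by rewrite HK'// normr0 addr_ge0.
by apply: (HM (`|M| + 1)); [rewrite ltr_pwDr// ler_norm|exists (x, y)].
Qed.

End proper_bounded.

(** * Haar integrals and cutoffs *)

Section law.
Context d1 d2 (X : measurableType d1) (Y : measurableType d2) (R : realType).
Variables (phi : X -> Y) (mphi : measurable_fun setT phi).
Variables (mu : {measure set X -> \bar R}) (nu : {measure set Y -> \bar R}).
(** The image measure enters through its values on measurable sets. The same lemmas then apply to
    the invariance of [mu], to the laws of processes and to joint laws. *)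
Hypothesis law_phi : forall A, measurable A -> mu (phi @^-1` A) = nu A.

Lemma ge0_integral_law (f : Y -> \bar R) : measurable_fun setT f -> (forall y, 0 <= f y)%E ->
  (\int[nu]_y f y = \int[mu]_x f (phi x))%E.
Proof.
move=> mf f0.
pose phi' : {mfun X >-> Y} := HB.pack phi (isMeasurableFun.Build _ _ _ _ _ mphi).
rewrite -(ge0_integral_pushforward (phi := phi) mphi mu measurableT mf)//.
rewrite (@eq_measure_integral _ _ _ _ (pushforward mu phi' : {measure set Y -> \bar R}))//.
by move=> A mA _; rewrite -law_phi.
Qed.

Lemma integrable_law (f : Y -> R) : nu.-integrable setT (EFin \o f) ->
  mu.-integrable setT (EFin \o (f \o phi)).
Proof.
move=> /integrableP[mf fi]; apply/integrableP; split.
  exact: (measurableT_comp mf mphi).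
rewrite -(ge0_integral_law (f := fun y => `|(f y)%:E|)%E)//.
exact: measurableT_comp.
Qed.

Lemma integrable_lawP (f : Y -> R) : measurable_fun setT f ->
  mu.-integrable setT (EFin \o (f \o phi)) -> nu.-integrable setT (EFin \o f).
Proof.
move=> mf /integrableP[_ fi]; have mEf : measurable_fun setT (fun y => (f y)%:E).
  exact/measurable_EFinP.
apply/integrableP; split => //.
rewrite (ge0_integral_law (f := fun y => `|(f y)%:E|)%E)//.
exact: measurableT_comp.
Qed.

Lemma Rintegral_law (f : Y -> R) : measurable_fun setT f ->
  \int[nu]_y f y = \int[mu]_x f (phi x).
Proof.
move=> mf; have mEf : measurable_fun setT (fun y => (f y)%:E) by exact/measurable_EFinP.
rewrite /Rintegral [in LHS]integralE [in RHS]integralE.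
congr (fine (_ - _)); rewrite ge0_integral_law//.
- by apply: eq_integral => x _; rewrite !funeposE.
- exact: measurable_funepos.
- by apply: eq_integral => x _; rewrite !funenegE.
- exact: measurable_funeneg.
Qed.

End law.

Section haar.
Context {R : realType} {n : nat} {G : lieGroupType R n}.
Variables (mu : {measure set (borel G) -> \bar R}) (mu_haar : right_haar mu).
Implicit Types (f : G -> R) (x y g : G).

Let mu_compact (K : set G) : compact K -> (mu K < +oo)%E.
Proof. exact: haar_compact. Qed.

Lemma rtrans_borel g : measurable_fun setT (fun x : borel G => (x * g)%g : borel G).
Proof. by apply: continuous_borel_map; exact: rtrans_continuous. Qed.

Lemma integrable_test f : test_function f -> mu.-integrable setT (EFin \o f).
Proof.
move=> /test_functionP[sf [K cK fK]].
exact: (integrable_compact mu_compact (smooth_continuous sf) cK fK).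
Qed.

Lemma Rintegral_rtrans g f : continuous f -> \int[mu]_x f (x * g)%g = \int[mu]_x f x.
Proof.
move=> cf; rewrite [RHS](@Rintegral_law _ _ _ _ _ (fun x : borel G => (x * g)%g : borel G) (rtrans_borel g) mu mu)//.
  by move=> A mA; exact: haar_invariant.
exact: continuous_borel.
Qed.

Section vector_field.
Variables (D : operator G) (D_left : left_invariant_vector_field D).

Let Dl := vf_linear D_left.
Let DL := vf_leibniz D_left.

Lemma test_vf f : test_function f -> test_function (D f).
Proof. exact: (test_derivation (vf_smooth D_left) Dl DL). Qed.

Lemma vf_translate f g x : smooth f -> D (fun y => f (g * y)%g) x = D f (g * x)%g.
Proof. by move=> sf; exact: vf_left_invariant. Qed.

(** By right invariance the integral of [f (y * x)] over [y] does not depend on [x]. Its derivative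
    under [D] at the identity, taken inside the integral, is the integral of [D f] by left
    invariance of [D]. *)
Lemma Rintegral_vf f : test_function f -> \int[mu]_x D f x = 0.
Proof.
move=> tf; have sf := test_smooth tf.
have s2 : smooth2 (fun x y => f (y * x)%g) by apply: smooth2_swap; exact: smooth2_mul.
have H := @derivation_conv R n G mu setT measurableT mu_compact D Dl DL _ 1%g s2 (proper_mulC tf).
rewrite /= in H.
transitivity (\int[mu]_y D (fun x => f (y * x)%g) 1%g).
  by apply: eq_Rintegral => y _; rewrite vf_translate// mulg1.
rewrite -H (_ : (fun x => _) = fun=> \int[mu]_y f y); last first.
  by apply/funext => x; rewrite Rintegral_rtrans//; exact: smooth_continuous.
exact: derivation_cst Dl DL _ _.
Qed.

Lemma integration_by_parts_vf f h : test_function f -> smooth h ->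
  \int[mu]_x (h x * D f x) = - \int[mu]_x (f x * D h x).
Proof.
move=> tf sh; have sf := test_smooth tf.
have sDf : smooth (D f) by exact: vf_smooth.
have sDh : smooth (D h) by exact: vf_smooth.
have i1 : mu.-integrable setT (EFin \o (fun x => h x * D f x)).
  apply: integrable_test; rewrite (_ : (fun x => _) = fun x => D f x * h x).
    by apply: test_smoothM => //; exact: test_vf.
  by apply/funext => x; rewrite mulrC.
have i2 : mu.-integrable setT (EFin \o (fun x => f x * D h x)).
  by apply: integrable_test; exact: test_smoothM.
apply/eqP; rewrite -addr_eq0 -RintegralD// -(Rintegral_vf (test_smoothM tf sh)); apply/eqP.
by apply: eq_Rintegral => x _; rewrite DL// addrC (mulrC (h x)).
Qed.

End vector_field.

(** A Lindelof argument: every basic open set contained in some translate of [N] is assigned one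
    such translate, and a basic neighbourhood of [x] inside the translate of [N] by [x] shows that
    [x] is covered. The translates are numbered by the injection of the base into [nat]. *)
Lemma lindelof_translates (N : set G) : open N -> N 1%g ->
  exists g : nat -> G, forall x, exists k, N (x * (g k)^-1)%g.
Proof.
move=> oN N1; have [B cB [Bo Bb]] := @lie_second_countable R n G.
have /countable_injP[f finj] := cB.
have /choice[g gP] : forall i : nat, exists g : G, forall U, B U -> f U = i ->
    (exists g', U `<=` [set z | N (z * g'^-1)%g]) -> U `<=` [set z | N (z * g^-1)%g].
  move=> i; have [[U [BU fU [g' Ug']]]|nE] := pselect (exists U, [/\ B U, f U = i &
      exists g', U `<=` [set z | N (z * g'^-1)%g]]); last first.
    (* A number that belongs to no suitable basic set receives an arbitrary value. *)
    by exists 1%g => U BU fU Ug; exfalso; apply: nE; exists U.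
  exists g' => U' BU' fU' _; suff -> : U' = U by [].
  by apply: finj; rewrite ?inE// fU'.
exists g => x.
have oNx : open [set z | N (z * x^-1)%g].
  by apply: (continuousP (fun z : G => (z * x^-1)%g)).1 => //; exact: rtrans_continuous.
have Nx : nbhs x [set z | N (z * x^-1)%g].
  by apply: open_nbhs_nbhs; split=> //=; rewrite mulgV.
have [U [BU Ux] UN] := Bb x _ Nx.
exists (f U); apply: (gP (f U) U) => //.
by exists x.
Qed.

(** Otherwise countably many translates of a null set would cover the group, against
    [haar_nonzero]. *)
Lemma haar_open_gt0 (N : set G) : open N -> N 1%g -> (0 < mu N)%E.
Proof.
move=> oN N1; rewrite lt0e measure_ge0 andbT; apply/negP => /eqP muN.
have [g gP] := lindelof_translates oN N1.
have mN := open_borel oN.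
have mNg k : measurable ([set x : G | N (x * (g k)^-1)%g] : set (borel G)).
  have := rtrans_borel (g k)^-1%g measurableT mN.
  by rewrite setTI.
have negl : mu.-negligible (\bigcup_k [set x : G | N (x * (g k)^-1)%g]).
  apply: negligible_bigcup => k; apply: (negligibleP _ (mNg k)).2.
  exact: (etrans (haar_invariant mu_haar (g k)^-1%g mN) muN).
have := haar_nonzero mu_haar; rewrite (_ : setT = \bigcup_k [set x : G | N (x * (g k)^-1)%g]).
  rewrite ((negligibleP _ (bigcupT_measurable _ mNg)).1 negl).
  by rewrite ltxx.
by apply/seteqP; split=> // x _; have [k ?] := gP x; exists k.
Qed.

Lemma compact_exhaustion : exists A : nat -> set G, (forall k, compact (A k)) /\
  forall x, \forall k \near \oo, A k x.
Proof.
have [N [C [oN N1 NC cC]]] := @compact_nbhd R n G.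
have [g gP] := lindelof_translates oN N1.
pose F k := (fun x : G => (x * g k)%g) @` C.
have cF k : compact (F k).
  by apply: compact_image_continuous => //; exact: rtrans_continuous.
exists (fun k => \big[setU/set0]_(i < k) F i); split.
  move=> k; elim: k => [|k IH]; first by rewrite big_ord0; exact: compact0.
  by rewrite big_ord_recr/=; exact: compactU.
move=> x; have [k Nk] := gP x; exists k.+1 => // m /= km.
rewrite (bigD1 (Ordinal km))//=; left.
by exists (x * (g k)^-1)%g; [exact: NC|rewrite mulgVK].
Qed.

Lemma Rintegral_test_gt0 f : test_function f -> (forall x, 0 <= f x) -> 0 < f 1%g ->
  0 < \int[mu]_x f x.
Proof.
move=> tf f0 f1; have cf := smooth_continuous (test_smooth tf).
pose N := [set x : G | f 1%g / 2 < f x].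
have f2 : 0 < f 1%g / 2 by rewrite divr_gt0.
have oN : open N.
  rewrite (_ : N = f @^-1` [set z | f 1%g / 2 < z])//.
  by apply: open_comp; [move=> y _; exact: cf|exact: open_gt].
have N1 : N 1%g by rewrite /N/= ltr_pdivrMr// ltr_pMr// ltr1n.
have mN := open_borel oN.
have i1 := integrable_test tf.
have [_ [K cK fK]] := (test_functionP f).1 tf.
have muN : (mu N < +oo)%E.
  apply: le_lt_trans (mu_compact cK); apply: le_measure; rewrite ?inE//.
    exact: compact_borel.
  move=> x Nx; apply: contrapT => /fK fx; move: Nx; rewrite /N/= fx.
  by rewrite ltNge ltW.
have iN : mu.-integrable setT (EFin \o (\1_N : G -> R)) by exact: integrable_indic_lty.
apply: (@lt_le_trans _ _ (f 1%g / 2 * \int[mu]_x \1_N x)).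
  rewrite mulr_gt0// /Rintegral integral_indic// setIT fine_gt0// muN.
  by rewrite haar_open_gt0.
rewrite -RintegralZl//; apply: le_Rintegral => //; first exact: integrableRZ.
move=> x _; rewrite indicE; have [xN|xN] := boolP (x \in N); last by rewrite mulr0.
by rewrite mulr1 ltW//; rewrite inE in xN.
Qed.

Section cutoff.
Variables (A : nat -> set (borel G)).
Hypothesis cA : forall k, compact (A k : set G).
Hypothesis AT : forall x, \forall k \near \oo, A k x.

Let mA k : measurable (A k). Proof. exact: compact_borel. Qed.

(** Left translates are averaged because left invariant fields commute with them, while right
    invariance of [mu] bounds the result by the integral of [|f|], uniformly in [k] and [x]. *)
Definition average k f : G -> R := fun x => \int[mu]_(h in A k) f (h * x)%g.

Let s2 f : smooth f -> smooth2 (fun x h => f (h * x)%g).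
Proof. by move=> sf; apply: smooth2_swap; exact: smooth2_mul. Qed.

Lemma test_average k f : test_function f -> test_function (average k f).
Proof.
move=> tf; have [sf [K cK fK]] := (test_functionP f).1 tf.
apply/test_functionP; split.
  exact: (smooth_conv (mA k) mu_compact (s2 sf) (proper_mulC tf)).
exists ((fun z : G * G => (z.1^-1 * z.2)%g) @` (A k `*` K)).
  by apply: compact_mul_image => //; exact: mulVl_continuous.
move=> x nK; rewrite /average -[RHS](Rintegral0 mu (A k)); apply: eq_Rintegral => h /set_mem Ah.
apply: fK => Khx; apply: nK; exists (h, h * x)%g => //=.
by rewrite mulKg.
Qed.

Lemma integrable_average f x : test_function f ->
  mu.-integrable setT (EFin \o (fun h => f (h * x)%g)).
Proof. by move=> tf; apply: integrable_test; exact: test_rtrans. Qed.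

Lemma average_bound k f x : test_function f -> `|average k f x| <= \int[mu]_h `|f h|.
Proof.
move=> tf; have cf := smooth_continuous (test_smooth tf).
have ic := integrable_average x tf.
rewrite -(Rintegral_rtrans x (f := fun h => `|f h|)); last first.
  by move=> y; apply: (@continuous_comp _ _ _ f); [exact: cf|exact: norm_continuous].
apply: (@le_trans _ _ (\int[mu]_(h in A k) `|f (h * x)%g|)).
  apply: le_normr_Rintegral => //; exact: integrableS ic.
have ia : mu.-integrable setT (EFin \o (fun h => `|f (h * x)%g|)).
  by have := integrable_abse ic.
rewrite Rintegral_mkcond; apply: le_Rintegral => //.
  rewrite -restrict_EFin; apply/(integrable_mkcond _ (mA k)).
  by apply: (@integrableS _ _ _ _ setT).
by move=> h _; rewrite patchE; case: ifP => // _; exact: normr_ge0.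
Qed.

Lemma average_cvg f x : test_function f -> average k f x @[k --> \oo] --> \int[mu]_h f h.
Proof.
move=> tf; have cf := smooth_continuous (test_smooth tf).
have ic := integrable_average x tf.
rewrite -(Rintegral_rtrans x cf).
have ia : mu.-integrable setT (EFin \o (fun h => `|f (h * x)%g|)).
  by have := integrable_abse ic.
under eq_fun do rewrite /average Rintegral_mkcond.
have [| | |//] := @dominated_cvg_Rintegral _ _ _ mu setT
  (fun k => (fun h => f (h * x)%g) \_ (A k)) (fun h => f (h * x)%g)
  (fun h => `|f (h * x)%g|) measurableT _ _ ia.
- move=> k; apply/(measurable_restrictT _ (mA k)).
  apply: measurable_funTS; apply/measurable_EFinP; exact: measurable_int ic.
- move=> h _; apply: cvg_near_cst; apply: filterS (AT h) => k Ah.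
  by rewrite patchE mem_set.
- by move=> k h _; rewrite patchE; case: ifP => // _; rewrite normr0.
Qed.

Lemma vf_average D k f x : left_invariant_vector_field D -> test_function f ->
  D (average k f) x = average k (D f) x.
Proof.
move=> vD tf; have sf := test_smooth tf.
rewrite (derivation_conv (mA k) mu_compact (vf_linear vD) (vf_leibniz vD) x (s2 sf) (proper_mulC tf)).
by apply: eq_Rintegral => h _; rewrite vf_translate.
Qed.

End cutoff.

(** The cutoffs are the averages of a bump [psi] of integral 1. They lie between 0 and 1 and tend to
    the integral of [psi]. Their derivatives are the averages of the derivatives of [psi]: these are
    bounded, and tend to 0 because a field has integral 0 on test functions. *)
Lemma exists_cutoff d (V : 'I_d -> operator G) : (forall i, left_invariant_vector_field (V i)) ->
  exists (chi : nat -> G -> R) (C : R), [/\ forall k, test_function (chi k),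
    forall k x, 0 <= chi k x <= 1,
    forall x, chi k x @[k --> \oo] --> (1 : R),
    forall k i x, `|V i (chi k) x| <= C /\ `|V i (V i (chi k)) x| <= C &
    forall i x, V i (chi k) x @[k --> \oo] --> (0 : R) /\
      V i (V i (chi k)) x @[k --> \oo] --> (0 : R)].
Proof.
move=> VL; have [A [cA AT]] := compact_exhaustion.
have [b [tb b0 b1 _]] := ex_test_bump openT (I : setT (1%g : G)).
have ib := Rintegral_test_gt0 tb b0 b1.
pose psi x := (\int[mu]_x b x)^-1 * b x.
have tpsi : test_function psi by exact: testZ.
have psi0 x : 0 <= psi x by rewrite mulr_ge0// invr_ge0 ltW.
have ipsi : \int[mu]_x psi x = 1.
  by rewrite RintegralZl ?mulVf ?gt_eqF//; exact: integrable_test.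
have tV i f : test_function f -> test_function (V i f) by exact: test_vf.
(* A sum over [i] of nonnegative terms, so that one constant serves for all fields and both
   orders. *)
pose C := \sum_i (\int[mu]_h `|V i psi h| + \int[mu]_h `|V i (V i psi) h|).
have nn (f : G -> R) : 0 <= \int[mu]_h `|f h| by apply: Rintegral_ge0.
have VE i k : V i (average A k psi) = average A k (V i psi).
  by apply/funext => x; exact: vf_average.
have VVE i k : V i (average A k (V i psi)) = average A k (V i (V i psi)).
  by apply/funext => x; apply: vf_average => //; exact: tV.
exists (fun k => average A k psi), C; split.
- by move=> k; exact: test_average.
- move=> k x; rewrite Rintegral_ge0//=.
  have := average_bound cA k x tpsi.
  under [in leRHS]eq_Rintegral do rewrite ger0_norm//.
  by rewrite ipsi; apply: le_trans; exact: ler_norm.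
- by move=> x; rewrite -ipsi; exact: average_cvg.
- move=> k i x; rewrite VE VVE; split.
    apply: (le_trans (average_bound cA k x (tV _ _ tpsi))).
    rewrite /C (bigD1 i)//= -addrA lerDl addr_ge0// sumr_ge0// => j _.
    by rewrite addr_ge0.
  apply: (le_trans (average_bound cA k x (tV _ _ (tV _ _ tpsi)))).
  rewrite /C (bigD1 i)//= [_ + \int[mu]_h `|V i (V i psi) h|]addrC -addrA lerDl addr_ge0// sumr_ge0// => j _.
  by rewrite addr_ge0.
- move=> i x; split.
    under eq_fun do rewrite VE; rewrite -(Rintegral_vf (VL i) tpsi).
    by apply: average_cvg => //; exact: tV.
  under eq_fun do rewrite VE VVE; rewrite -(Rintegral_vf (VL i) (tV i _ tpsi)).
  exact: (average_cvg cA AT x (tV _ _ (tV _ _ tpsi))).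
Qed.

End haar.

(** * Independence, densities and normal moments *)

Section product_integral.
Context d1 d2 (T1 : measurableType d1) (T2 : measurableType d2) (R : realType).
Variables (m1 : {sigma_finite_measure set T1 -> \bar R}) (m2 : {sigma_finite_measure set T2 -> \bar R}).

Lemma Rintegral_tensor (f : T1 -> R) (g : T2 -> R) : measurable_fun setT f -> measurable_fun setT g ->
  m1.-integrable setT (EFin \o f) -> m2.-integrable setT (EFin \o g) ->
  (m1 \x m2)%E.-integrable setT (EFin \o (fun z => f z.1 * g z.2)) /\
  \int[(m1 \x m2)%E]_z (f z.1 * g z.2) = (\int[m1]_x f x) * \int[m2]_y g y.
Proof.
move=> mf mg If Ig.
have mfg : measurable_fun setT (fun z : T1 * T2 => (f z.1 * g z.2)%:E).
  apply/measurable_EFinP; apply: measurable_funM; exact: measurableT_comp.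
have ifg : (m1 \x m2)%E.-integrable setT (EFin \o (fun z => f z.1 * g z.2)).
  apply: (integrable12ltyP m1 m2 mfg).2 => /=.
  under eq_integral => x _.
    under eq_integral do rewrite normrM EFinM.
    rewrite ge0_integralZl//; last by apply/measurable_EFinP; exact: measurableT_comp.
    over.
  have /fineK E2 := integrable_fin_num measurableT (integrable_norm Ig).
  rewrite /= in E2; rewrite -E2.
  rewrite ge0_integralZr//; last 2 first.
  - by apply/measurable_EFinP; exact: measurableT_comp.
  - by rewrite lee_fin; apply: Rintegral_ge0.
  apply: lte_mul_pinfty => //.
  - exact: integral_ge0.
  - exact: integrable_fin_num (integrable_norm If).
  - exact: ltry.
split=> //.
have E := integral12_prod_meas1 ifg.
rewrite /Rintegral -E /=.
under eq_integral => x _.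
  rewrite /fubini_F; under eq_integral do rewrite /= EFinM.
  rewrite integralZl//.
  over.
have /fineK E2 := integrable_fin_num measurableT Ig; rewrite /= in E2.
by rewrite /= -E2 integralZr// fineM//; exact: integrable_fin_num If.
Qed.

End product_integral.

Section independence.
Context d1 d2 (T1 : measurableType d1) (T2 : measurableType d2) d (Omega : measurableType d) (R : realType).
Variables (P : probability Omega R) (kappa : probability T2 R).
Variables (Y : Omega -> T1) (xi : Omega -> T2).
Hypotheses (mY : measurable_fun setT Y) (mxi : measurable_fun setT xi).
Hypothesis indep : forall A C, measurable A -> measurable C ->
  P (Y @^-1` A `&` xi @^-1` C) = (P (Y @^-1` A) * kappa C)%E.

Let Y' : {mfun Omega >-> T1} := HB.pack Y (isMeasurableFun.Build _ _ _ _ _ mY).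
Let YX w := (Y w, xi w).
Let mYX : measurable_fun setT YX. Proof. exact: measurable_fun_pair. Qed.
Let YX' : {mfun Omega >-> (T1 * T2)%type} := HB.pack YX (isMeasurableFun.Build _ _ _ _ _ mYX).

Lemma indep_law (A : set (T1 * T2)) : measurable A ->
  P (YX @^-1` A) = (distribution P Y' \x kappa)%E A.
Proof.
move=> mA; rewrite (@product_measure_unique _ _ _ _ _ (distribution P Y') kappa (distribution P YX'))//.
Qed.

Lemma indep_expectation (f : T1 -> R) (g : T2 -> R) :
  measurable_fun setT f -> measurable_fun setT g ->
  P.-integrable setT (EFin \o (f \o Y)) -> kappa.-integrable setT (EFin \o g) ->
  P.-integrable setT (EFin \o (fun w => f (Y w) * g (xi w))) /\
  \int[P]_w (f (Y w) * g (xi w)) = (\int[P]_w f (Y w)) * \int[kappa]_y g y.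
Proof.
move=> mf mg If Ig.
have lawY (A : set T1) : measurable A -> P (Y @^-1` A) = distribution P Y' A by [].
have mfg : measurable_fun setT (fun z : T1 * T2 => f z.1 * g z.2).
  by apply: measurable_funM; exact: measurableT_comp.
have [I E] := Rintegral_tensor mf mg (integrable_lawP mY lawY mf If) Ig.
have := integrable_law mYX indep_law I.
split=> //; rewrite -(Rintegral_law mYX indep_law mfg) E.
by rewrite (Rintegral_law mY lawY mf).
Qed.

End independence.

Section independent_pair.
Context d1 d2 (T1 : measurableType d1) (T2 : measurableType d2) d (Omega : measurableType d) (R : realType).
Variables (P : probability Omega R) (k1 : probability T1 R) (k2 : probability T2 R).
Variables (xi1 : Omega -> T1) (xi2 : Omega -> T2).
Hypotheses (mxi1 : measurable_fun setT xi1) (mxi2 : measurable_fun setT xi2).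

(** Both sides are finite measures of [E] that agree on rectangles. Conditioning on [A] is encoded
    by a restricted measure on the left and by the scalar [P A] on the right. *)
Lemma indep_pair (A : set Omega) (E : set (T1 * T2)) : measurable A -> measurable E ->
  (forall C1 C2, measurable C1 -> measurable C2 ->
    P (A `&` (xi1 @^-1` C1 `&` xi2 @^-1` C2)) = (P A * (k1 C1 * k2 C2))%E) ->
  P (A `&` (fun w => (xi1 w, xi2 w)) @^-1` E) = (P A * (k1 \x k2)%E E)%E.
Proof.
move=> mA mE H; pose xi w := (xi1 w, xi2 w).
have mxi : measurable_fun setT xi by exact: measurable_fun_pair.
pose xi' : {mfun Omega >-> (T1 * T2)%type} := HB.pack xi (isMeasurableFun.Build _ _ _ _ _ mxi).
have PA : P A \is a fin_num by exact: fin_num_measure.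
have r0 : 0 <= fine (P A) by exact: fine_ge0.
pose C : set (set (T1 * T2)) :=
  [set C | exists A, measurable A /\ exists B, measurable B /\ C = A `*` B].
pose g := fun _ : nat => [set: T1 * T2].
suff : pushforward (mrestr P mA) xi' E = mscale (NngNum r0) (k1 \x k2)%E E.
  by rewrite /pushforward /mrestr /mscale /= fineK// setIC.
apply: (measure_unique C g) => //.
- rewrite measurable_prod_measurableType //; congr (<<s _ >>).
  rewrite predeqE; split => [[U mU [V mV <-]]|[U [mU [V [mV ->]]]]].
    by exists U; split => //; exists V.
  by exists U => //; exists V.
- move=> _ _ [X1 [mX1 [X2 [mX2 ->]]]] [Y1 [mY1 [Y2 [mY2 ->]]]].
  rewrite -setXI; exists (X1 `&` Y1); split; first exact: measurableI.
  by exists (X2 `&` Y2); split => //; exact: measurableI.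
- by move=> k; exists setT; split => //; exists setT; split => //; rewrite setXTT.
- by rewrite bigcup_const.
- move=> _ [U [mU [V [mV ->]]]].
  rewrite [LHS](_ : _ = P (xi @^-1` (U `*` V) `&` A))//.
  rewrite [RHS](_ : _ = ((fine (P A))%:E * (k1 \x k2)%E (U `*` V))%E)//.
  by rewrite fineK// product_measure1E// -H// setIC.
- move=> k; rewrite [ltLHS](_ : _ = P (xi @^-1` setT `&` A))//.
  by rewrite preimage_setT setTI -ge0_fin_numE.
Qed.


Lemma indep_expectation2 d0 (T0 : measurableType d0) (Y : Omega -> T0) (h : T0 -> R) (f : T1 -> R) (g : T2 -> R) :
  measurable_fun setT Y -> measurable_fun setT h -> measurable_fun setT f -> measurable_fun setT g ->
  (forall A C1 C2, measurable A -> measurable C1 -> measurable C2 ->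
    P (Y @^-1` A `&` (xi1 @^-1` C1 `&` xi2 @^-1` C2)) = (P (Y @^-1` A) * (k1 C1 * k2 C2))%E) ->
  P.-integrable setT (EFin \o (h \o Y)) ->
  k1.-integrable setT (EFin \o f) -> k2.-integrable setT (EFin \o g) ->
  P.-integrable setT (EFin \o (fun w => h (Y w) * (f (xi1 w) * g (xi2 w)))) /\
  \int[P]_w (h (Y w) * (f (xi1 w) * g (xi2 w))) =
  (\int[P]_w h (Y w)) * ((\int[k1]_x f x) * \int[k2]_y g y).
Proof.
move=> mY mh mf mg H iY If Ig; have [I <-] := Rintegral_tensor mf mg If Ig.
pose xi w := (xi1 w, xi2 w).
have mxi : measurable_fun setT xi by exact: measurable_fun_pair.
have mfg : measurable_fun setT (fun z : T1 * T2 => f z.1 * g z.2).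
  by apply: measurable_funM; exact: measurableT_comp.
have [|I' E'] := @indep_expectation _ _ _ _ _ _ _ P [the probability (T1 * T2)%type R of (k1 \x k2)%E]
    Y xi mY mxi _ h (fun z => f z.1 * g z.2) mh mfg iY I; last by split.
move=> A C mA mC.
apply: indep_pair => //; last by move=> C1 C2 mC1 mC2; exact: H.
by rewrite -[X in measurable X]setTI; exact: mY.
Qed.

End independent_pair.

Section density.
Context d (T : measurableType d) (R : realType).
Variables (mu nu : {measure set T -> \bar R}) (p : T -> R).
Hypotheses (mp : measurable_fun setT p) (p_ge0 : forall x, 0 <= p x).
Hypothesis nuE : forall A, measurable A -> nu A = (\int[mu]_(x in A) (p x)%:E)%E.
Import HBNNSimple.

Let mEp : measurable_fun setT (fun x => (p x)%:E).
Proof. exact/measurable_EFinP. Qed.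

Lemma nnsfun_integral_density (h : {nnsfun T >-> R}) :
  (\int[nu]_x (h x)%:E = \int[mu]_x ((h x)%:E * (p x)%:E))%E.
Proof.
have hE (x : T) : (h x)%:E = (\sum_(y \in range h) (y * \1_(h @^-1` [set y]) x)%:E)%E.
  by rewrite fsumEFin// -fimfunE.
have mi (r : R) : measurable_fun setT (fun x => (r * \1_(h @^-1` [set r]) x)%:E).
  by apply/measurable_EFinP; exact: measurable_funM.
under eq_integral do rewrite hE.
under [RHS]eq_integral => x _.
  rewrite hE ge0_mule_fsuml => [|y]; last exact: nnfun_muleindic_ge0.
  over.
rewrite !ge0_integral_fsum//; last 3 first.
- by move=> y; apply: emeasurable_funM.
- by move=> y x _; rewrite mule_ge0 ?lee_fin// -lee_fin EFinM nnfun_muleindic_ge0.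
- by move=> y x _; exact: nnfun_muleindic_ge0.
apply: eq_fsbigr => r rh.
under eq_integral do rewrite EFinM.
rewrite integralZl_indic_nnsfun//=.
under [RHS]eq_integral do rewrite EFinM -muleA.
rewrite ge0_integralZl//.
- rewrite integral_indic// setIT nuE// integral_mkcond; congr (_ * _)%E.
  apply: eq_integral => x _; rewrite patchE muleC indicE /=.
  by case: ifPn => xr; rewrite ?mule1 ?mule0//; have [] := boolP (x \in _).
- by apply: emeasurable_funM => //; exact/measurable_EFinP.
- by move=> x _; rewrite mule_ge0 ?lee_fin.
- by move: rh; rewrite inE => -[x _ <-]; rewrite lee_fin.
Qed.

Lemma ge0_integral_density (f : T -> R) : measurable_fun setT f -> (forall x, 0 <= f x) ->
  (\int[nu]_x (f x)%:E = \int[mu]_x (f x * p x)%:E)%E.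
Proof.
move=> mf f0; have mEf : measurable_fun setT (fun x => (f x)%:E) by exact/measurable_EFinP.
pose h := nnsfun_approx measurableT mEf.
have hf x : (h k x)%:E @[k --> \oo] --> (f x)%:E by apply: cvg_nnsfun_approx => // y _; rewrite lee_fin.
have hnd x : {homo (fun k => (h k x)%:E) : a b / (a <= b)%N >-> (a <= b)%E}.
  by move=> a b ab; rewrite lee_fin; exact/lefP/nd_nnsfun_approx.
have hpnd x : {homo (fun k => ((h k x)%:E * (p x)%:E)%E) : a b / (a <= b)%N >-> (a <= b)%E}.
  by move=> a b ab; rewrite lee_wpmul2r ?lee_fin//; exact/lefP/nd_nnsfun_approx.
transitivity (lim ((fun k => \int[nu]_x (h k x)%:E)%E @ \oo)).
  rewrite -monotone_convergence//.
  - by apply: eq_integral => x _; apply/esym/cvg_lim.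
  - by move=> k; exact/measurable_EFinP.
  - by move=> k x _; rewrite lee_fin.
transitivity (lim ((fun k => \int[mu]_x ((h k x)%:E * (p x)%:E))%E @ \oo)).
  by under eq_fun do rewrite nnsfun_integral_density.
rewrite -monotone_convergence//.
- apply: eq_integral => x _; rewrite EFinM; apply/cvg_lim => //.
  by apply: cvgeZr.
- by move=> k; apply: emeasurable_funM => //; exact/measurable_EFinP.
- by move=> k x _; rewrite mule_ge0 ?lee_fin.
Qed.

Lemma Rintegral_density (f : T -> R) : measurable_fun setT f ->
  \int[nu]_x f x = \int[mu]_x (f x * p x).
Proof.
move=> mf; have mEf : measurable_fun setT (fun x => (f x)%:E) by exact/measurable_EFinP.
rewrite /Rintegral [in LHS]integralE [in RHS]integralE.
have fpE x : (fun y => (f y)%:E)^\+%E x = (Num.max (f x) 0)%:E by rewrite funeposE EFin_max.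
have fnE x : (fun y => (f y)%:E)^\-%E x = (Num.max (- f x) 0)%:E by rewrite funenegE EFin_max.
have m0 (u : T -> R) : measurable_fun setT u -> measurable_fun setT (fun x => Num.max (u x) 0).
  by move=> mu_; exact: measurable_maxr.
congr (fine (_ - _)).
- under eq_integral do rewrite fpE.
  rewrite ge0_integral_density; [|exact: m0|by move=> x; rewrite le_max lexx orbT].
  by apply: eq_integral => x _; rewrite funeposE maxr_pMl// mul0r EFin_max.
- under eq_integral do rewrite fnE.
  rewrite ge0_integral_density; [|exact/m0/measurableT_comp|by move=> x; rewrite le_max lexx orbT].
  by apply: eq_integral => x _; rewrite funenegE maxr_pMl// mul0r mulNr EFin_max.
Qed.

Lemma integrable_density (f : T -> R) : measurable_fun setT f ->
  mu.-integrable setT (fun x => (f x * p x)%:E) <-> nu.-integrable setT (EFin \o f).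
Proof.
move=> mf.
have E : (\int[nu]_x `|(f x)%:E| = \int[mu]_x `|(f x * p x)%:E|)%E.
  rewrite (ge0_integral_density (f := fun x => `|f x|))//; last exact: measurableT_comp.
  by apply: eq_integral => x _; rewrite /= normrM (ger0_norm (p_ge0 x)).
split=> /integrableP[m1 i1]; apply/integrableP; split.
- exact/measurable_EFinP.
- by rewrite E.
- by apply/measurable_EFinP; exact: measurable_funM.
- by rewrite -E.
Qed.

End density.

Section normal_moments.
Context {R : realType}.
Notation leb := (@lebesgue_measure R).

(** The fundamental theorem of calculus on symmetric intervals exhausting the line; the boundary
    terms tend to 0. *)
Lemma Rintegral_derivative0 (H h : R -> R) : (forall x : R, is_derive x 1 H (h x)) ->
  continuous h -> leb.-integrable setT (EFin \o h) ->
  H k%:R @[k --> \oo] --> (0 : R) -> H (- k%:R) @[k --> \oo] --> (0 : R) ->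
  \int[leb]_x h x = 0.
Proof.
move=> dH ch ih Hp Hm.
have cH : continuous H.
  by move=> x; apply/differentiable_continuous/derivable1_diffP; have [] := dH x.
pose I k : set (measurableTypeR R) := `[- k.+1%:R, k.+1%:R]%classic.
have mI k : measurable (I k) by exact: measurable_itv.
have FTC k : \int[leb]_(x in I k) h x = H k.+1%:R - H (- k.+1%:R).
  rewrite /Rintegral (@continuous_FTC2 _ h H)//.
  - by rewrite gtrN.
  - exact: continuous_subspaceT.
  - split; [by move=> x _; have [] := dH x| |].
    + exact/cvg_at_right_filter/cH.
    + exact/cvg_at_left_filter/cH.
  - by move=> x _; rewrite derive1E; have [_ ->] := dH x.
have [| | |_ C] := @dominated_cvg_Rintegral _ _ _ leb setT (fun k => h \_ (I k)) h
    (fun x => `|h x|) measurableT _ _ (integrable_norm ih).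
- move=> k; apply/(measurable_restrictT _ (mI k)); apply: measurable_funTS.
  by apply/measurable_EFinP; exact: measurable_int ih.
- move=> x _; apply/cvgrPdist_lt => e e0; near=> k; rewrite patchE ifT ?subrr ?normr0//.
  rewrite inE /I /= in_itv /= -ler_norml.
  have xk : `|x| <= k%:R by near: k; exact: nbhs_infty_ger.
  by rewrite (le_trans xk)// ler_nat.
- by move=> k x _; rewrite patchE; case: ifP => //=; rewrite normr0.
have C' : \int[leb]_x (h \_ (I k)) x @[k --> \oo] --> (0 : R).
  under eq_fun do rewrite -Rintegral_mkcond FTC.
  rewrite -(subr0 (0 : R)); apply: cvgB.
    by rewrite (cvg_shiftS (fun k => H k%:R)).
  by rewrite (cvg_shiftS (fun k => H (- k%:R))).
exact: (cvg_unique _ C C').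
Unshelve. all: by end_near. Qed.

Variables (s : R) (s_gt0 : 0 < s).
Let e := normal_pdf 0 s.
Let q := normal_pdf 0 (2 * s).
(** With [y = x^2 / (8 s^2)] the exponentials of [e] and [q] are [exp(-4y)] and [exp(-y)], and
    [x^4 = 64 s^4 y^2]. The two peaks restore the normalizations. *)
Let C : R := 64 * s ^+ 4 * normal_peak s / normal_peak (2 * s).

Let sn0 : s != 0. Proof. exact: lt0r_neq0. Qed.
Let s2n0 : 2 * s != 0. Proof. by rewrite mulf_neq0. Qed.

(** The bound reduces to [y exp(-y) <= 1]. Domination by a Gaussian of double width gives both the
    integrability of the moments up to order 4 and the decay of the boundary terms. *)
Lemma normal_pdf_pow4 x : x ^+ 4 * e x <= C * q x.
Proof.
rewrite /e /q /C !normal_pdfE//; set y := x ^+ 2 / (8 * s ^+ 2).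
have -> : normal_fun 0 s x = expR (- y) ^+ 4.
  by rewrite /normal_fun -expRM_natl; congr expR; rewrite /y; field.
have -> : normal_fun 0 (2 * s) x = expR (- y).
  by rewrite /normal_fun; congr expR; rewrite /y; field.
have p2 := normal_peak_gt0 s2n0.
rewrite [leRHS](_ : _ = normal_peak s * (64 * s ^+ 4) * expR (- y)); last first.
  by field; rewrite gt_eqF.
rewrite mulrCA -mulrA ler_wpM2l ?normal_peak_ge0//.
have y0 : 0 <= y by rewrite divr_ge0 ?sqr_ge0// mulr_ge0 ?sqr_ge0.
have -> : x ^+ 4 = 64 * s ^+ 4 * y ^+ 2 by rewrite /y; field.
rewrite -[leLHS]mulrA ler_wpM2l ?mulr_ge0 ?exprn_ge0 ?(ltW s_gt0)//.
have ey : y * expR (- y) <= 1.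
  rewrite expRN ler_pdivrMr ?expR_gt0// mul1r.
  by apply: le_trans (expR_ge1Dx y); rewrite ler_wpDl.
have e1 : expR (- y) <= 1 by rewrite -expR0 ler_expR oppr_le0.
have e0 := expR_ge0 (- y).
rewrite (_ : _ * _ = (y * expR (- y)) ^+ 2 * expR (- y) * expR (- y)); last by ring.
rewrite ler_piMl// mulr_ile1 ?sqr_ge0//.
by rewrite expr_le1// mulr_ge0.
Qed.

Lemma integrable_normal_pow k : (k <= 4)%N ->
  leb.-integrable setT (EFin \o (fun x => x ^+ k * e x)).
Proof.
move=> k4; have ie : leb.-integrable setT (EFin \o e) by exact: integrable_normal_pdf.
have iq : leb.-integrable setT (EFin \o q) by exact: integrable_normal_pdf.
apply: (@integrable_bounded_by _ _ _ leb setT _ (fun x => e x + C * q x)) => //.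
- apply: measurable_funM; first exact: measurable_funX.
  exact: measurable_normal_pdf.
- by apply: integrableRD => //; exact: integrableRZ.
- move=> x _; have e0 : 0 <= e x by exact: normal_pdf_ge0.
  rewrite normrM (ger0_norm e0) normrX.
  apply: (@le_trans _ _ ((1 + x ^+ 4) * e x)); last first.
    by rewrite mulrDl mul1r lerD2l normal_pdf_pow4.
  rewrite ler_wpM2r//.
  rewrite (_ : x ^+ 4 = `|x| ^+ 4); last by rewrite -normrX ger0_norm// exprn_even_ge0.
  have [x1|/ltW x1] := leP `|x| 1.
    by rewrite (@le_trans _ _ 1)// ?exprn_ile1// lerDl exprn_ge0.
  by rewrite (@le_trans _ _ (`|x| ^+ 4))// ?ler_weXn2l// lerDr.
Qed.

Lemma is_derive_normal_pdf (x : R) : is_derive x 1 e (- (x / s ^+ 2) * e x).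
Proof.
rewrite /e normal_pdfE// /normal_fun.
apply: is_derive_eq; rewrite /GRing.scale /=; field.
by rewrite sn0.
Qed.

Let continuous_e : continuous e.
Proof. exact: continuous_normal_pdf. Qed.

Lemma Rintegral_normal_pdf : \int[leb]_x e x = 1.
Proof. by rewrite /Rintegral integral_normal_pdf. Qed.

Let decay k (c : R) (u : R ^nat) : (k <= 3)%N -> (forall j, `|u j| = j%:R) ->
  c * (u j ^+ k * e (u j)) @[j --> \oo] --> (0 : R).
Proof.
move=> k3 uj; rewrite -(mulr0 c); apply: cvgMr.
apply/cvgr0Pnorm_le => eps eps0; near=> j.
have j1 : 1 <= j%:R :> R by near: j; exact: nbhs_infty_ger.
have j0 : 0 < j%:R :> R by exact: lt_le_trans j1.
have e0 : 0 <= e (u j) by exact: normal_pdf_ge0.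
rewrite normrM normrX uj (ger0_norm e0).
apply: (@le_trans _ _ (j%:R ^+ 3 * e (u j))).
  by rewrite ler_wpM2r// ler_weXn2l.
have C0 : 0 <= C by rewrite divr_ge0 ?normal_peak_ge0// !mulr_ge0 ?normal_peak_ge0// ltW.
have H : j%:R * (j%:R ^+ 3 * e (u j)) <= C * normal_peak (2 * s).
  rewrite mulrA -exprS -(uj j) -normrX ger0_norm ?exprn_even_ge0//.
  apply: (le_trans (normal_pdf_pow4 _)).
  by rewrite ler_wpM2l// normal_pdf_ub.
have : j%:R ^+ 3 * e (u j) <= (C * normal_peak (2 * s)) / j%:R.
  by rewrite ler_pdivlMr// mulrC.
move/le_trans; apply; rewrite ler_pdivrMr// -ler_pdivrMl//.
by near: j; exact: nbhs_infty_ger.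
Unshelve. all: by end_near. Qed.

Lemma Rintegral_normal_x : \int[leb]_x (x * e x) = 0.
Proof.
have i1 := @integrable_normal_pow 1 isT.
have E : \int[leb]_x (- (x / s ^+ 2) * e x) = 0.
  apply: (@Rintegral_derivative0 e).
  - exact: is_derive_normal_pdf.
  - move=> x; apply: cvgM; last exact: continuous_e.
    by apply: cvgN; apply: cvgMl; exact: cvg_id.
  - rewrite (_ : _ \o _ = EFin \o (fun x => - (s ^+ 2)^-1 * (x ^+ 1 * e x))).
      exact: integrableRZ.
    by apply/funext => x /=; congr EFin; rewrite expr1; ring.
  - have := @decay 0 1 (fun j => j%:R) isT (fun j => normr_nat _ j).
    by under eq_fun do rewrite mul1r expr0 mul1r.
  - have := @decay 0 1 (fun j => - j%:R) isT; under eq_fun do rewrite mul1r expr0 mul1r.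
    by apply=> j; rewrite normrN normr_nat.
have : - (s ^+ 2)^-1 * \int[leb]_x (x * e x) = 0.
  rewrite -E -RintegralZl//.
  by apply: eq_Rintegral => x _; ring.
move/eqP; rewrite mulf_eq0 oppr_eq0 invr_eq0 expf_eq0/= (negbTE sn0).
by move/eqP.
Qed.

(** The derivative of [x ^+ k.+1 * e x] has integral 0. *)
Let moment_step k : (k <= 2)%N -> \int[leb]_x (x ^+ k.+2 * e x) =
  s ^+ 2 * k.+1%:R * \int[leb]_x (x ^+ k * e x).
Proof.
move=> k2; have ik := integrable_normal_pow (leq_trans k2 (isT : (2 <= 4)%N)).
have ik2 := @integrable_normal_pow k.+2 k2.
have E : \int[leb]_x (k.+1%:R * (x ^+ k * e x) - (s ^+ 2)^-1 * (x ^+ k.+2 * e x)) = 0.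
  apply: (@Rintegral_derivative0 (fun x => x ^+ k.+1 * e x)).
  - move=> x; have de := is_derive_normal_pdf x.
    have dX : is_derive x 1 (fun y : R => y ^+ k.+1) (k.+1%:R * x ^+ k).
      rewrite (_ : (fun y : R => y ^+ k.+1) = (id : R -> R) ^+ k.+1); last first.
        by apply/funext => y; rewrite exprfctE.
      by apply: is_derive_eq; rewrite /GRing.scale /= mulr1.
    rewrite (_ : (fun y : R => y ^+ k.+1 * e y) = (fun y : R => y ^+ k.+1) * e)//.
    apply: is_derive_eq.
    by rewrite /GRing.scale /= !exprS; field; rewrite sn0.
  - move=> x; apply: cvgB; apply: cvgMr; apply: cvgM => //; try exact: continuous_e.
      exact: exprn_continuous.
    exact: exprn_continuous.
  - by apply: integrableRB => //; exact: integrableRZ.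
  - have := @decay k.+1 1 (fun j => j%:R) k2 (fun j => normr_nat _ j).
    by under eq_fun do rewrite mul1r.
  - have := @decay k.+1 1 (fun j => - j%:R) k2; under eq_fun do rewrite mul1r.
    by apply=> j; rewrite normrN normr_nat.
move: E; rewrite RintegralB//; [|exact: integrableRZ|exact: integrableRZ].
rewrite !RintegralZl// => /eqP; rewrite subr_eq0 => /eqP E.
by rewrite -mulrA E mulrA mulfV ?mul1r// expf_neq0.
Qed.

Lemma Rintegral_normal_sqr : \int[leb]_x (x ^+ 2 * e x) = s ^+ 2.
Proof.
rewrite moment_step//; under eq_Rintegral do rewrite expr0 mul1r.
by rewrite Rintegral_normal_pdf !mulr1.
Qed.

Lemma Rintegral_normal_pow4 : \int[leb]_x (x ^+ 4 * e x) = 3 * s ^+ 4.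
Proof. by rewrite moment_step// Rintegral_normal_sqr; ring. Qed.

Let normE (A : set (measurableTypeR R)) : measurable A -> normal_prob 0 s A = (\int[leb]_(x in A) (e x)%:E)%E.
Proof. by []. Qed.

Lemma integrable_normal k : (k <= 4)%N ->
  (normal_prob 0 s : probability _ _).-integrable setT (EFin \o (fun x : R => x ^+ k)).
Proof.
move=> k4; apply: (@integrable_density _ (measurableTypeR R) R leb (normal_prob 0 s) e _ _ normE _ _).1.
- exact: measurable_normal_pdf.
- by move=> x; exact: normal_pdf_ge0.
- exact: measurable_funX.
- exact: integrable_normal_pow.
Qed.

Lemma normal_density (f : R -> R) : measurable_fun setT f ->
  \int[normal_prob 0 s]_x f x = \int[leb]_x (f x * e x).
Proof.
apply: (@Rintegral_density _ (measurableTypeR R) R leb (normal_prob 0 s) e _ _ normE f).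
- exact: measurable_normal_pdf.
- by move=> x; exact: normal_pdf_ge0.
Qed.

Lemma normal_mean : \int[normal_prob 0 s]_x x = 0.
Proof. by rewrite normal_density// Rintegral_normal_x. Qed.

Lemma normal_second_moment : \int[normal_prob 0 s]_x (x ^+ 2) = s ^+ 2.
Proof. by rewrite normal_density ?Rintegral_normal_sqr//; exact: measurable_funX. Qed.

Lemma normal_fourth_moment : \int[normal_prob 0 s]_x (x ^+ 4) = 3 * s ^+ 4.
Proof. by rewrite normal_density ?Rintegral_normal_pow4//; exact: measurable_funX. Qed.

End normal_moments.

(** * Brownian increments *)

Section square_integrable.
Context d (Omega : measurableType d) (R : realType) (P : probability Omega R).
Implicit Types Y Z : Omega -> R.

Definition sqint Y := measurable_fun setT Y /\ P.-integrable setT (EFin \o (fun w => Y w ^+ 2)).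

Lemma integrable_of_bounded Y (M : R) : measurable_fun setT Y -> (forall w, `|Y w| <= M) ->
  P.-integrable setT (EFin \o Y).
Proof.
move=> mY YM; apply: (@integrable_bounded_by _ _ _ P setT _ (fun=> M)) => //.
exact: finite_measure_integrable_cst.
Qed.

Lemma Rintegral_cst_prob (c : R) : \int[P]_w c = c.
Proof. by rewrite Rintegral_cst//= probability_setT mulr1. Qed.

Lemma sqint_mul Y Z : sqint Y -> sqint Z -> P.-integrable setT (EFin \o (fun w => Y w * Z w)).
Proof.
move=> [mY iY] [mZ iZ].
apply: (@integrable_bounded_by _ _ _ P setT _ (fun w => Y w ^+ 2 + Z w ^+ 2)) => //.
- exact: measurable_funM.
- exact: integrableRD.
- move=> w _; rewrite ler_norml; apply/andP; split.
    by have := sqr_ge0 (Y w + Z w); have := sqr_ge0 (Y w); have := sqr_ge0 (Z w); nra.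
  by have := sqr_ge0 (Y w - Z w); have := sqr_ge0 (Y w); have := sqr_ge0 (Z w); nra.
Qed.

Lemma sqint_bounded Y (M : R) : measurable_fun setT Y -> (forall w, `|Y w| <= M) -> sqint Y.
Proof.
move=> mY YM; split=> //; apply: (@integrable_of_bounded _ (M ^+ 2)).
  exact: measurable_funX.
by move=> w; rewrite normrX lerXn2r// nnegrE (le_trans _ (YM w)).
Qed.

Lemma sqint_integrable Y : sqint Y -> P.-integrable setT (EFin \o Y).
Proof.
move=> sY; have s1 : sqint (fun=> 1).
  by apply: (@sqint_bounded _ 1) => // w; rewrite normr1.
rewrite (_ : EFin \o Y = EFin \o (fun w => Y w * 1)); first exact: sqint_mul.
by apply/funext => w /=; rewrite mulr1.
Qed.

Lemma sqintD Y Z : sqint Y -> sqint Z -> sqint (fun w => Y w + Z w).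
Proof.
move=> sY sZ; have iYZ := sqint_mul sY sZ; move: sY sZ => [mY iY] [mZ iZ].
split; first exact: measurable_funD.
rewrite (_ : _ \o _ = EFin \o (fun w => Y w ^+ 2 + (2 * (Y w * Z w) + Z w ^+ 2))).
  by apply: integrableRD => //; apply: integrableRD => //; exact: integrableRZ.
by apply/funext => w /=; congr EFin; ring.
Qed.

Lemma sqint_mulB Y Z (M : R) : sqint Y -> measurable_fun setT Z -> (forall w, `|Z w| <= M) ->
  sqint (fun w => Z w * Y w).
Proof.
move=> [mY iY] mZ ZM; split; first exact: measurable_funM.
apply: (@integrable_bounded_by _ _ _ P setT _ (fun w => M ^+ 2 * Y w ^+ 2)) => //.
- by apply: measurable_funX; exact: measurable_funM.
- exact: integrableRZ.
- move=> w _; rewrite exprMn normrM [X in _ * X]ger0_norm ?sqr_ge0//.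
  rewrite ler_wpM2r ?sqr_ge0// normrX lerXn2r// nnegrE.
  exact: le_trans (ZM w).
Qed.

Lemma sqintZ (c : R) Y : sqint Y -> sqint (fun w => c * Y w).
Proof. by move=> sY; apply: (@sqint_mulB _ _ `|c|). Qed.

Lemma sqint_normE Y Z : sqint Y -> sqint Z ->
  \int[P]_w ((Y w + Z w) ^+ 2) =
  \int[P]_w (Y w ^+ 2) + 2 * \int[P]_w (Y w * Z w) + \int[P]_w (Z w ^+ 2).
Proof.
move=> sY sZ; have iYZ := sqint_mul sY sZ; have [_ iY] := sY; have [_ iZ] := sZ.
under eq_Rintegral do rewrite sqrrD -mulr_natl.
by rewrite RintegralD// ?RintegralD// ?RintegralZl//; do ?[apply: integrableRD|apply: integrableRZ].
Qed.

Lemma sqint_normD_le Y Z : sqint Y -> sqint Z ->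
  \int[P]_w ((Y w + Z w) ^+ 2) <= 2 * \int[P]_w (Y w ^+ 2) + 2 * \int[P]_w (Z w ^+ 2).
Proof.
move=> sY sZ; have [_ iY] := sY; have [_ iZ] := sZ.
rewrite -!RintegralZl// -RintegralD//; [|exact: integrableRZ|exact: integrableRZ].
apply: le_Rintegral => //.
- by have [] := sqintD sY sZ.
- by apply: integrableRD => //; exact: integrableRZ.
- by move=> w _; have := sqr_ge0 (Y w - Z w); nra.
Qed.

End square_integrable.

Section brownian.
Context d (Omega : measurableType d) (R : realType) (P : probability Omega R).
Variables (F : R -> set (set Omega)) (FF : filtration F).
Implicit Types (Y Z : Omega -> R) (s t : R).

(** [F s] is a bare family of sets. Passing through the generated sigma-algebra, which is [F s]
    itself for nonnegative [s], makes the closure properties of measurable functions available. *)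
Definition Fmeas s Y := measurable_fun setT (Y : g_sigma_algebraType (F s) -> R).

Lemma Fmeas_preimage d' (T : measurableType d') s (Y : Omega -> T) : 0 <= s ->
  measurable_fun setT (Y : g_sigma_algebraType (F s) -> T) <->
  forall A, measurable A -> F s (Y @^-1` A).
Proof.
move=> s0; have E := measurable_g_measurableTypeE (filtration_sigma FF s0).
split=> [mY A mA|H _ A mA].
- by have := mY measurableT A mA; rewrite setTI E.
- by rewrite setTI E; exact: H.
Qed.

Lemma adapted_Fmeas (Y : R -> Omega -> R) s : adapted F Y -> 0 <= s -> Fmeas s (Y s).
Proof. by move=> aY s0; apply/Fmeas_preimage => // A mA; exact: aY. Qed.

Lemma Fmeas_le s t Y : 0 <= s -> s <= t -> Fmeas s Y -> Fmeas t Y.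
Proof.
move=> s0 st /(Fmeas_preimage _ s0) H; apply/Fmeas_preimage; first exact: le_trans st.
by move=> A mA; apply: (filtration_homo FF s0 st); exact: H.
Qed.

Lemma Fmeas_measurable s Y : 0 <= s -> Fmeas s Y -> measurable_fun setT Y.
Proof.
move=> s0 /(Fmeas_preimage _ s0) H _ A mA; rewrite setTI.
by apply: (filtration_sub FF s0); exact: H.
Qed.

Variables (m : nat) (B : 'I_m -> R -> Omega -> R) (BM : brownian_motion P F B).
Implicit Types i j : 'I_m.

Definition incr i s t w := B i t w - B i s w.

Lemma Fmeas_incr i s t : 0 <= s -> s <= t -> Fmeas t (incr i s t).
Proof.
move=> s0 st; have t0 := le_trans s0 st; apply: measurable_funB.
  exact: adapted_Fmeas (bm_adapted BM i) t0.
by apply: (Fmeas_le s0 st); exact: adapted_Fmeas (bm_adapted BM i) s0.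
Qed.

Lemma measurable_incr i s t : 0 <= s -> s <= t -> measurable_fun setT (incr i s t).
Proof.
by move=> s0 st; exact: Fmeas_measurable (le_trans s0 st) (Fmeas_incr i s0 st).
Qed.

Let N s t : probability (measurableTypeR R) R := normal_prob 0 (Num.sqrt (t - s)).

Let sqrt_gt0 s t : s < t -> 0 < Num.sqrt (t - s).
Proof. by move=> st; rewrite sqrtr_gt0 subr_gt0. Qed.

Let indep1 i s t Y A C : 0 <= s -> s < t -> Fmeas s Y -> measurable A -> measurable C ->
  P (Y @^-1` A `&` incr i s t @^-1` C) = (P (Y @^-1` A) * N s t C)%E.
Proof.
move=> s0 st /(Fmeas_preimage _ s0) H mA mC.
have := @bm_increments _ _ _ _ _ _ _ BM s t s0 st _ (H _ mA) (fun k => if k == i then C else setT).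
have -> : [set w | forall k, (if k == i then C else setT) (B k t w - B k s w)] =
    incr i s t @^-1` C.
  apply/seteqP; split=> w /= => [/(_ i)|Cw k]; first by rewrite eqxx.
  by case: eqP => // ->.
move=> ->; last by move=> k; case: eqP.
rewrite (bigD1 i)//= eqxx big1 ?mule1// => k /negPf ->.
exact: probability_setT.
Qed.

Let indep2 i j s t A C1 C2 : i != j -> 0 <= s -> s < t -> F s A -> measurable C1 -> measurable C2 ->
  P (A `&` (incr i s t @^-1` C1 `&` incr j s t @^-1` C2)) = (P A * (N s t C1 * N s t C2))%E.
Proof.
move=> ij s0 st FA mC1 mC2.
have := @bm_increments _ _ _ _ _ _ _ BM s t s0 st _ FA
  (fun k => if k == i then C1 else if k == j then C2 else setT).
have -> : [set w | forall k, (if k == i then C1 else if k == j then C2 else setT)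
     (B k t w - B k s w)] = incr i s t @^-1` C1 `&` incr j s t @^-1` C2.
  apply/seteqP; split=> w /= => [H|[C1w C2w] k].
    by split; [have := H i|have := H j]; rewrite ?eqxx// eq_sym (negPf ij).
  by case: eqP => [->//|_]; case: eqP => // ->.
move=> ->; last by move=> k; case: eqP => // _; case: eqP.
rewrite (bigD1 i)//= eqxx (bigD1 j)//=; last by rewrite eq_sym.
rewrite eq_sym (negPf ij) eqxx big1 ?mule1// => k /andP[/negPf -> /negPf ->].
exact: probability_setT.
Qed.

Lemma incr_pow_indep i s t Z k : 0 <= s -> s < t -> (k <= 4)%N -> Fmeas s Z ->
  P.-integrable setT (EFin \o Z) ->
  P.-integrable setT (EFin \o (fun w => Z w * incr i s t w ^+ k)) /\
  \int[P]_w (Z w * incr i s t w ^+ k) = (\int[P]_w Z w) * \int[N s t]_x (x ^+ k).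
Proof.
move=> s0 st k4 FZ iZ; apply: (@indep_expectation _ _ _ (measurableTypeR R) _ _ _ P (N s t)
  Z (incr i s t) _ _ _ idfun (fun x => x ^+ k)) => //.
- exact: Fmeas_measurable FZ.
- exact: measurable_incr (ltW st).
- by move=> A C mA mC; exact: indep1.
- exact: measurable_id.
- exact: integrable_normal (sqrt_gt0 st) _ k4.
Qed.

Lemma incr_mean i s t Z : 0 <= s -> s < t -> Fmeas s Z -> P.-integrable setT (EFin \o Z) ->
  P.-integrable setT (EFin \o (fun w => Z w * incr i s t w)) /\
  \int[P]_w (Z w * incr i s t w) = 0.
Proof.
move=> s0 st FZ iZ; have := incr_pow_indep i s0 st (isT : (1 <= 4)%N) FZ iZ.
by under eq_Rintegral do rewrite expr1; rewrite (normal_mean (sqrt_gt0 st)) mulr0.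
Qed.

Lemma incr_sqr i s t Z : 0 <= s -> s < t -> Fmeas s Z -> P.-integrable setT (EFin \o Z) ->
  P.-integrable setT (EFin \o (fun w => Z w * incr i s t w ^+ 2)) /\
  \int[P]_w (Z w * incr i s t w ^+ 2) = (\int[P]_w Z w) * (t - s).
Proof.
move=> s0 st FZ iZ; have := incr_pow_indep i s0 st (isT : (2 <= 4)%N) FZ iZ.
rewrite (normal_second_moment (sqrt_gt0 st)) sqr_sqrtr// subr_ge0.
exact: ltW.
Qed.

Lemma incr_fourth i s t : 0 <= s -> s < t ->
  P.-integrable setT (EFin \o (fun w => incr i s t w ^+ 4)) /\
  \int[P]_w (incr i s t w ^+ 4) = 3 * (t - s) ^+ 2.
Proof.
move=> s0 st; have i1 : P.-integrable setT (EFin \o (fun=> 1)).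
  exact: finite_measure_integrable_cst.
have F1 : Fmeas s (fun=> 1) by exact: measurable_cst.
have := incr_pow_indep i s0 st (isT : (4 <= 4)%N) F1 i1.
rewrite (normal_fourth_moment (sqrt_gt0 st)) Rintegral_cst_prob mul1r.
rewrite (_ : Num.sqrt _ ^+ 4 = (t - s) ^+ 2); last first.
  by rewrite (exprM _ 2 2) sqr_sqrtr// subr_ge0 ltW.
by under eq_Rintegral do rewrite mul1r; under eq_fun do rewrite mul1r.
Qed.

Lemma incr_cross i j s t Z : i != j -> 0 <= s -> s < t -> Fmeas s Z ->
  P.-integrable setT (EFin \o Z) ->
  P.-integrable setT (EFin \o (fun w => Z w * (incr i s t w * incr j s t w))) /\
  \int[P]_w (Z w * (incr i s t w * incr j s t w)) = 0.
Proof.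
move=> ij s0 st FZ iZ.
have iN : (N s t).-integrable setT (EFin \o (fun x : R => x)).
  have := integrable_normal (sqrt_gt0 st) (isT : (1 <= 4)%N).
  by rewrite (_ : (fun x : R => x ^+ 1) = (fun x => x))//; apply/funext => x; rewrite expr1.
have mi := measurable_incr i s0 (ltW st); have mj := measurable_incr j s0 (ltW st).
have [||||||||I E] := @indep_expectation2 _ _ (measurableTypeR R) (measurableTypeR R) _ _ _
    P (N s t) (N s t) _ _ mi mj _ _ Z idfun idfun idfun => //.
- exact: Fmeas_measurable FZ.
1-3: exact: measurable_id.
- move=> A C1 C2 mA mC1 mC2; apply: indep2 => //.
  exact: (Fmeas_preimage _ s0).1 FZ _ mA.
- by split=> //; rewrite E (normal_mean (sqrt_gt0 st)) !mulr0.
Qed.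

Lemma sqint_incr i s t Z : 0 <= s -> s < t -> Fmeas s Z -> sqint P Z ->
  sqint P (fun w => Z w * incr i s t w) /\
  \int[P]_w ((Z w * incr i s t w) ^+ 2) = (\int[P]_w (Z w ^+ 2)) * (t - s).
Proof.
move=> s0 st FZ [mZ iZ].
have FZ2 : Fmeas s (fun w => Z w ^+ 2) by exact: measurable_funX.
have [I E] := incr_sqr i s0 st FZ2 iZ.
have eq w : Z w ^+ 2 * incr i s t w ^+ 2 = (Z w * incr i s t w) ^+ 2 by rewrite exprMn.
split; last by rewrite -E; apply: eq_Rintegral => w _.
split; last by under eq_fun do rewrite -eq.
by apply: measurable_funM => //; exact: measurable_incr (ltW st).
Qed.

Variables (r : nat -> R) (r_ge0 : 0 <= r 0) (r_incr : forall l, r l < r l.+1).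

Lemma grid_le : {homo r : k l / (k <= l)%N >-> k <= l}.
Proof. by apply: homo_leq => // [x y z|l]; [exact: le_trans|exact/ltW]. Qed.

Lemma grid_ge0 l : 0 <= r l.
Proof. by apply: le_trans r_ge0 _; exact: grid_le. Qed.

Definition Bincr i l := incr i (r l) (r l.+1).

(** The discrete Ito isometry. The partial sum and the next coefficient are known before the next
    increment, which is centered and independent of them, so the cross term has mean 0 at every
    step. The first index [a] is arbitrary because the sums are also formed inside blocks. *)
Lemma discrete_ito i (Z : nat -> Omega -> R) a k :
  (forall l, Fmeas (r l) (Z l)) -> (forall l, sqint P (Z l)) ->
  let S w := \sum_(a <= l < a + k) Z l w * Bincr i l w in
  [/\ sqint P S, Fmeas (r (a + k)) S, \int[P]_w S w = 0 &
      \int[P]_w (S w ^+ 2) = \sum_(a <= l < a + k) (\int[P]_w (Z l w ^+ 2)) * (r l.+1 - r l)].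
Proof.
move=> FZ sZ S; rewrite {}/S; elim: k => [|k [IH1 IH2 IH3 IH4]].
  rewrite addn0; under eq_fun do rewrite big_geq//.
  split; [|exact: measurable_cst|exact: Rintegral_cst_prob|].
    by apply: (@sqint_bounded _ _ _ _ _ 0) => // w; rewrite normr0.
  by under eq_Rintegral do rewrite big_geq// expr0n/=; rewrite big_geq// Rintegral_cst_prob.
set S := fun w => \sum_(a <= l < a + k) Z l w * Bincr i l w.
have eS w : \sum_(a <= l < a + k.+1) Z l w * Bincr i l w =
    S w + Z (a + k)%N w * Bincr i (a + k) w.
  by rewrite addnS big_nat_recr ?leq_addr.
have -> : (fun w => \sum_(a <= l < a + k.+1) Z l w * Bincr i l w) =
    (fun w => S w + Z (a + k)%N w * Bincr i (a + k) w) by apply/funext.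
have -> : \int[P]_w ((\sum_(a <= l < a + k.+1) Z l w * Bincr i l w) ^+ 2) =
    \int[P]_w ((S w + Z (a + k)%N w * Bincr i (a + k) w) ^+ 2).
  by apply: eq_Rintegral => w _; rewrite eS.
have rl0 := grid_ge0 (a + k); have rlt := r_incr (a + k).
have [sI EI] := sqint_incr i rl0 rlt (FZ (a + k)%N) (sZ (a + k)%N).
have FS : Fmeas (r (a + k).+1) S by exact: Fmeas_le (ltW rlt) IH2.
have FSZ : Fmeas (r (a + k)) (fun w => S w * Z (a + k)%N w).
  exact: (measurable_funM IH2 (FZ (a + k)%N)).
have iSZ := sqint_mul IH1 (sZ (a + k)%N).
have [_ E0] := incr_mean i rl0 rlt FSZ iSZ.
have [_ E1] := incr_mean i rl0 rlt (FZ _) (sqint_integrable (sZ (a + k)%N)).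
split.
- exact: sqintD.
- rewrite addnS; apply: measurable_funD => //; apply: measurable_funM.
    by apply: Fmeas_le (FZ _) => //; exact: ltW.
  by apply: Fmeas_incr => //; exact: ltW.
- by rewrite RintegralD ?IH3 ?E1 ?addr0//; exact: sqint_integrable.
- rewrite (sqint_normE IH1 sI) IH4 EI [in RHS]addnS big_nat_recr ?leq_addr//=; congr (_ + _).
  rewrite (_ : \int[P]_w _ = 0) ?mulr0 ?addr0// -[RHS]E0.
  by apply: eq_Rintegral => w _; rewrite mulrA.
Qed.

End brownian.

(** * Sums of squared increments of semimartingales *)

Section bounded_in_probability.
Context d (Omega : measurableType d) (R : realType) (P : probability Omega R).
Implicit Types (Y Z : Omega -> R) (K e : R).

(** An explicit exceptional set lets such bounds be combined by unions, whatever the measurability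
    of [Y]. *)
Definition Pbound Y K e := exists A, [/\ measurable A, (P A <= e%:E)%E &
  forall w, ~ A w -> `|Y w| <= K].

Lemma Pbound_eq Y Z K e : (forall w, `|Z w| <= `|Y w|) -> Pbound Y K e -> Pbound Z K e.
Proof. by move=> ZY [A [mA PA H]]; exists A; split=> // w /H; exact: le_trans. Qed.

Lemma Pbound_le Y K e K' e' : K <= K' -> e <= e' -> Pbound Y K e -> Pbound Y K' e'.
Proof.
move=> KK ee [A [mA PA H]]; exists A; split=> //; last by move=> w /H /le_trans; apply.
by apply: (le_trans PA); rewrite lee_fin.
Qed.

Lemma Pbound2 (Y Z W : Omega -> R) K1 e1 K2 e2 K :
  (forall w, `|Y w| <= K1 -> `|Z w| <= K2 -> `|W w| <= K) ->
  Pbound Y K1 e1 -> Pbound Z K2 e2 -> Pbound W K (e1 + e2).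
Proof.
move=> H [A [mA PA HA]] [B [mB PB HB]]; exists (A `|` B); split.
- exact: measurableU.
- by rewrite EFinD; apply: (le_trans (measureU2 _ _ _)) => //; exact: leeD.
- by move=> w /not_orP[/HA yA /HB zB]; exact: H.
Qed.

Lemma PboundD Y Z K1 e1 K2 e2 : Pbound Y K1 e1 -> Pbound Z K2 e2 ->
  Pbound (fun w => Y w + Z w) (K1 + K2) (e1 + e2).
Proof. by apply: Pbound2 => w Yw Zw; rewrite (le_trans (ler_normD _ _))// lerD. Qed.

Lemma PboundZ Y K e c : Pbound Y K e -> Pbound (fun w => c * Y w) (`|c| * K) e.
Proof.
move=> [A [mA PA H]]; exists A; split=> // w /H Yw.
by rewrite normrM ler_wpM2l.
Qed.

Lemma Pbound_ae Y Z K e : {ae P, forall w, Y w = Z w} -> Pbound Y K e -> Pbound Z K e.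
Proof.
move=> [N [mN PN sN]] [A [mA PA H]]; exists (A `|` N); split.
- exact: measurableU.
- apply: (le_trans (measureU2 _ _ _)) => //.
  by rewrite -(adde0 e%:E); apply: leeD => //; rewrite le_eqVlt (introT eqP PN).
- move=> w /not_orP[nA nN]; have <- : Y w = Z w; last exact: H.
  by apply: contrapT => YZ; apply: nN; exact: sN.
Qed.

Lemma Pbound_sum I (r : seq I) (Y : I -> Omega -> R) K e : (forall i, Pbound (Y i) K e) ->
  Pbound (fun w => \sum_(i <- r) Y i w) ((size r)%:R * K) ((size r)%:R * e).
Proof.
move=> YP; elim: r => [|i r IH].
  exists set0; split=> //; first by rewrite measure0 mul0r.
  by move=> w _; rewrite big_nil normr0 mul0r.
apply: (@Pbound_eq (fun w => Y i w + \sum_(j <- r) Y j w)).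
  by move=> w; rewrite big_cons.
by rewrite /= -natr1 addrC !mulrDl !mul1r; exact: PboundD.
Qed.

Lemma Pbound_markov Y (M K : R) : P.-integrable setT (EFin \o Y) ->
  \int[P]_w `|Y w| <= M -> 0 < K -> Pbound Y K (M / K).
Proof.
move=> iY YM K0; have mY : measurable_fun setT Y.
  by apply/measurable_EFinP; exact: measurable_int iY.
have mN : measurable_fun setT (fun w => `|Y w|) by exact: measurableT_comp.
pose A := [set w | K < `|Y w|].
have mA : measurable A.
  by rewrite -[A]setTI; apply: measurable_fun_ltr => //; exact: measurable_cst.
exists A; split=> //; last by move=> w /negP; rewrite -leNgt.
have PA : P A \is a fin_num by exact: fin_num_measure.
rewrite -(fineK PA) lee_fin ler_pdivlMr//; apply: le_trans YM.
have -> : fine (P A) = \int[P]_w \1_A w.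
  by rewrite /Rintegral integral_indic// setIT.
have i1 : P.-integrable setT (EFin \o (\1_A : Omega -> R)).
  exact: integrable_indic_lty (le_lt_trans (probability_le1 _ mA) (ltry _)).
rewrite mulrC -RintegralZl//; apply: le_Rintegral => //.
- exact: integrableRZ.
- exact: integrable_norm.
- move=> w _; rewrite indicE; have [|] := boolP (w \in A); last by rewrite mulr0.
  by rewrite inE mulr1 => /ltW.
Qed.

(** Off the exceptional set [|Y| <= K], and everywhere [|Y| <= c Y^2 + 1/c]. Smallness in
    probability together with a bound in L2 thus makes the mean small. *)
Lemma Pbound_expectation Y (M K e c : R) : sqint P Y -> \int[P]_w (Y w ^+ 2) <= M ->
  0 <= K -> 0 < c -> Pbound Y K e -> `|\int[P]_w Y w| <= K + c * M + e / c.
Proof.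
move=> sY YM K0 c0 [A [mA PA H]]; have [mY iY2] := sY.
have i1 : P.-integrable setT (EFin \o (\1_A : Omega -> R)).
  exact: integrable_indic_lty (le_lt_trans (probability_le1 _ mA) (ltry _)).
have EA : \int[P]_w \1_A w <= e.
  rewrite /Rintegral integral_indic// setIT -lee_fin fineK//.
  exact: fin_num_measure.
have iK : P.-integrable setT (EFin \o (fun=> K)) by exact: finite_measure_integrable_cst.
apply: (@le_trans _ _ (\int[P]_w (K + (c * Y w ^+ 2 + c^-1 * \1_A w)))); last first.
  rewrite RintegralD// ?RintegralD//; try by do ?[apply: integrableRD|apply: integrableRZ].
  rewrite !RintegralZl// Rintegral_cst_prob -addrA lerD2l; apply: lerD; first by rewrite ler_wpM2l// ltW.
  by rewrite mulrC ler_wpM2r// ltW// invr_gt0.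
apply: Rintegral_norm_le => //; first by do ?[apply: integrableRD|apply: integrableRZ].
move=> w _; have s2 := sqr_ge0 (Y w).
rewrite indicE; have [/set_mem wA|/negP wA] := boolP (w \in A); last first.
  rewrite mulr0 addr0 (@le_trans _ _ K)//; last by rewrite lerDl mulr_ge0// ltW.
  by apply: H => Aw; apply: wA; rewrite inE.
rewrite /= mulr1 -[X in X <= _]add0r lerD//.
have yn : Y w ^+ 2 = `|Y w| ^+ 2 by rewrite real_normK// num_real.
have cV : 0 < c^-1 by rewrite invr_gt0.
have -> : c * Y w ^+ 2 + c^-1 = c^-1 * ((c * `|Y w|) ^+ 2 + 1).
  by rewrite yn; field; rewrite gt_eqF.
rewrite ler_pdivlMl//; set u := c * _; have : 0 <= (u - 1) ^+ 2 by exact: sqr_ge0.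
have : 0 <= u by rewrite mulr_ge0// ltW.
by nra.
Qed.

(** The events that some [V n] exceeds [k] decrease to the empty set as [k] grows, so their
    probabilities tend to 0. *)
Lemma Pbound_pointwise (V : nat -> Omega -> R) : (forall n, measurable_fun setT (V n)) ->
  (forall w, exists K, forall n, `|V n w| <= K) ->
  forall e, 0 < e -> exists K, forall n, Pbound (V n) K e.
Proof.
move=> mV bV e e0; pose A k := \bigcup_n [set w | k%:R < `|V n w|].
have mA k : measurable (A k).
  apply: bigcup_measurable => n _; rewrite -[X in measurable X]setTI.
  by apply: measurable_fun_ltr => //; exact: measurableT_comp.
have A0 : \bigcap_k A k = set0.
  apply/seteqP; split=> // w Aw; have [K VK] := bV w.
  have [n _ /=] := Aw (Num.trunc `|K|).+1 I.
  rewrite ltNge => /negP; apply; apply: (le_trans (VK n)).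
  by rewrite (le_trans (ler_norm _))// ltW// truncnS_gt.
have : P (A k) @[k --> \oo] --> P (\bigcap_k A k).
  apply: nonincreasing_cvg_mu => //.
  - exact: (le_lt_trans (probability_le1 _ (mA 0)) (ltry _)).
  - exact: bigcap_measurable.
  - move=> k l kl; apply/subsetPset => w [n _ /= lV]; exists n => //=.
    by apply: le_lt_trans lV; rewrite ler_nat.
rewrite A0 measure0 => /fine_cvgP[_ /cvgrPdist_le/(_ e e0)[k _ /(_ k (leqnn _))]].
rewrite /= sub0r normrN => Pk; exists k%:R => n; exists (A k); split=> //.
  rewrite -(@fineK _ (P (A k))); last exact: fin_num_measure.
  by rewrite lee_fin (le_trans (ler_norm _)).
by move=> w nA; rewrite leNgt; apply/negP => Vk; apply: nA; exists n.
Qed.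

End bounded_in_probability.

(** * Bounded martingale transforms *)

Section martingale_transform.
Context d (Omega : measurableType d) (R : realType) (P : probability Omega R).
Variables (F : R -> set (set Omega)) (FF : filtration F).
Implicit Types (Y Z : Omega -> R).
Import HBNNSimple.

Lemma martingale_increment (N : R -> Omega -> R) (s t : R) A : martingale P F N ->
  0 <= s -> s <= t -> F s A -> \int[P]_w ((N t w - N s w) * \1_A w) = 0.
Proof.
move=> [_ iN mN] s0 st FA; have mA := filtration_sub FF s0 FA.
have it := iN _ (le_trans s0 st); have is_ := iN _ s0.
have E := mN _ _ s0 st _ FA.
have mkA (f : Omega -> R) : \int[P]_w (f w * \1_A w) = \int[P]_(w in A) f w.
  rewrite [RHS]Rintegral_mkcond; apply: eq_Rintegral => w _.
  by rewrite patchE indicE; case: ifP => _; rewrite ?mulr1 ?mulr0.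
rewrite mkA RintegralB//; [|exact: integrableS it|exact: integrableS is_].
by rewrite /Rintegral E subrr.
Qed.

(** The martingale property is given on sets of [F s]. It extends to simple functions, then to
    bounded nonnegative [Z] by dominated convergence, and to bounded [Z] by adding the bound [M] and
    subtracting it again. *)
Lemma martingale_transform (N : R -> Omega -> R) (s t : R) Z (M : R) : martingale P F N ->
  0 <= s -> s <= t -> Fmeas F s Z -> (forall w, `|Z w| <= M) ->
  P.-integrable setT (EFin \o (fun w => (N t w - N s w) * Z w)) /\
  \int[P]_w ((N t w - N s w) * Z w) = 0.
Proof.
move=> mN s0 st; have [aN iN _] := mN.
have id_ : P.-integrable setT (EFin \o (fun w => N t w - N s w)).
  by apply: integrableRB => //; apply: iN => //; exact: le_trans st.
have md : measurable_fun setT (fun w => N t w - N s w).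
  by apply/measurable_EFinP; exact: measurable_int id_.
have pos Z' (M' : R) : Fmeas F s Z' -> (forall w, 0 <= Z' w <= M') ->
    P.-integrable setT (EFin \o (fun w => (N t w - N s w) * Z' w)) /\
    \int[P]_w ((N t w - N s w) * Z' w) = 0.
  move=> FZ ZM; have FEZ : measurable_fun setT ((EFin \o Z') : g_sigma_algebraType (F s) -> \bar R).
    exact/measurable_EFinP.
  pose h := nnsfun_approx measurableT FEZ.
  have hle k w : h k w <= Z' w.
    by rewrite -lee_fin nnsfun_approxE; apply: le_approx => // w' _; rewrite lee_fin; have /andP[] := ZM w'.
  have Fh k : Fmeas F s (h k) by exact: measurable_funPT.
  have mh k : measurable_fun setT (h k : Omega -> R) by exact: Fmeas_measurable (Fh k).
  have h0 k w : 0 <= h k w by [].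
  have [| | | |I E] := @dominated_cvg_Rintegral _ _ _ P setT (fun k w => (N t w - N s w) * h k w)
      (fun w => (N t w - N s w) * Z' w) (fun w => M' * `|N t w - N s w|) measurableT.
  - by move=> k; exact: measurable_funM.
  - move=> w _; apply: cvgMr; have : (h k w)%:E @[k --> \oo] --> (Z' w)%:E.
      by apply: cvg_nnsfun_approx => // w' _; rewrite lee_fin; have /andP[] := ZM w'.
    by move=> /fine_cvgP[_].
  - by apply: integrableRZ => //; exact: integrable_norm.
  - move=> k w _; rewrite normrM mulrC (ger0_norm (h0 _ _)) ler_wpM2r//.
    by apply: (le_trans (hle _ _)); have /andP[] := ZM w.
  split=> //; apply: (cvg_unique _ E) => //.
  have Eh k : \int[P]_w ((N t w - N s w) * h k w) = 0.
    pose hy (y : R) : set Omega := h k @^-1` [set y].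
    have hE (w : Omega) : (N t w - N s w) * h k w =
        \sum_(y <- finmap.enum_fset (fset_set (range (h k)))) y * ((N t w - N s w) * \1_(hy y) w).
      rewrite fimfunE fsbig_finite// big_distrr /=.
      by apply: eq_bigr => y _; rewrite mulrCA.
    under eq_Rintegral do rewrite hE.
    have Fy y : F s (hy y) by apply: ((Fmeas_preimage FF _ s0).1 (Fh k)).
    have iy y : P.-integrable setT (EFin \o (fun w => (N t w - N s w) * \1_(hy y) w)).
      apply: (@integrable_bounded_by _ _ _ P setT _ (fun w => `|N t w - N s w|)) => //.
      - apply: measurable_funM => //; apply: measurable_indic.
        exact: (filtration_sub FF s0).
      - exact: integrable_norm.
      - move=> w _; rewrite normrM ler_piMr// indicE.
        by case: (_ \in _); rewrite ?normr1 ?normr0.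
    rewrite Rintegral_sum//; last by move=> y; exact: integrableRZ.
    apply: big1 => y _; rewrite RintegralZl//.
    by rewrite (martingale_increment mN s0 st (Fy y)) mulr0.
  rewrite /= (_ : (fun k => _) = cst 0); first exact: cvg_cst.
  by apply/funext => k; exact: Eh.
move=> FZ ZM; have M0 (w : Omega) : 0 <= M by exact: le_trans (ZM w).
have [| |I1 E1] := pos (fun w => Z w + M) (M + M).
- by apply: measurable_funD => //; exact: measurable_cst.
- move=> w; have := ZM w; rewrite ler_norml => /andP[zl zu].
  by rewrite -lerBlDr sub0r zl lerD2r.
(* The constant is written [|M|] because [0 <= M] is known only in the presence of a point of
   [Omega]. *)
have [| |I2 E2] := pos (fun=> `|M|) `|M|; [exact: measurable_cst|by move=> w; rewrite normr_ge0 lexx|].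
have eq w : (N t w - N s w) * Z w = (N t w - N s w) * (Z w + M) - (N t w - N s w) * `|M|.
  by rewrite (ger0_norm (M0 w)); ring.
split.
  by under eq_fun do rewrite eq; exact: integrableRB.
by under eq_Rintegral do rewrite eq; rewrite RintegralB// E1 E2 subrr.
Qed.

End martingale_transform.

(** * Tightness of the sums of squared increments of a martingale *)

Section quadratic_variation_tight.
Context d (Omega : measurableType d) (R : realType) (P : probability Omega R).
Variables (F : R -> set (set Omega)) (FF : filtration F).
Variables (N : R -> Omega -> R) (mN : martingale P F N) (N0 : forall w, N 0 w = 0).
Variables (r : nat -> R) (r0 : r 0 = 0) (r_incr : forall l, r l < r l.+1).

Let r_ge0 l : 0 <= r l. Proof. by apply: grid_ge0 => //; rewrite r0. Qed.
Let r_le : {homo r : k l / (k <= l)%N >-> k <= l}. Proof. exact: grid_le. Qed.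

Variables (lam : R) (lam_gt0 : 0 < lam).

(** No exit from [[-lam, lam]] at the grid times up to [l]. Index 0 is free, as the martingale
    starts from 0. *)
Fixpoint below l w : bool :=
  if l is l'.+1 then below l' w && (`|N (r l) w| <= lam) else true.

Let eps l w : R := (below l w)%:R.

Let FN l : Fmeas F (r l) (N (r l)).
Proof. by have [aN _ _] := mN; exact: adapted_Fmeas. Qed.

Let iN l : P.-integrable setT (EFin \o N (r l)).
Proof. by have [_ iN _] := mN; exact: iN. Qed.

Let belowN l w : below l w -> `|N (r l) w| <= lam.
Proof. by case: l => [_|l /= /andP[]//]; rewrite r0 N0 normr0 ltW. Qed.

Let belowW k n w : (k <= n)%N -> below n w -> below k w.
Proof.
elim: n => [|n IH]; first by rewrite leqn0 => /eqP ->.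
by rewrite leq_eqVlt => /predU1P[-> //|kn] /= /andP[b _]; exact: IH.
Qed.

Let Fbelow l : Fmeas F (r l) (eps l).
Proof.
elim: l => [|l IH]; first exact: measurable_cst.
have E : eps l.+1 = (fun w => eps l w * \1_[set u | `|N (r l.+1) u| <= lam] w).
  apply/funext => w; rewrite /eps /= indicE -natrM mulnb; congr (_ && _)%:R.
  by apply/idP/idP; rewrite inE.
rewrite E; apply: (@measurable_funM _ (g_sigma_algebraType (F (r l.+1)))).
  by apply: Fmeas_le IH => //; exact: ltW.
apply: (@measurable_indic _ (g_sigma_algebraType (F (r l.+1)))).
rewrite -[X in measurable X]setTI; apply: measurable_fun_ler => //.
by apply: measurableT_comp => //; exact: FN.
Qed.

Let eps01 l w : 0 <= eps l w <= 1.
Proof. by rewrite /eps; case: below; rewrite ?lexx ?ler01. Qed.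

Let meps l : measurable_fun setT (eps l).
Proof. exact: (Fmeas_measurable FF (r_ge0 l) (@Fbelow l)). Qed.

Let mN' l : measurable_fun setT (N (r l)).
Proof. exact: (Fmeas_measurable FF (r_ge0 l) (@FN l)). Qed.

Let dN l w := N (r l.+1) w - N (r l) w.
Let U n w := \sum_(l < n) (eps l w - eps l.+1 w) * `|N (r l.+1) w| + eps n w * `|N (r n) w|.
Let Q n w := \sum_(l < n) eps l.+1 w * dN l w ^+ 2.
Let T n w := \sum_(l < n) dN l w * (eps l w * N (r l) w).

(* Stopping at the first exit from [-lam, lam]: [U n] is the absolute value of
   the stopped martingale and [Q n] the sum of the squared increments strictly
   before the exit. *)
Let pathwise n w : [/\ below n w -> Q n w + 2 * T n w = N (r n) w ^+ 2 /\ U n w = `|N (r n) w|,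
   Q n w + 2 * T n w <= 2 * lam * U n w, 0 <= U n w & ~~ below n w -> lam < U n w].
Proof.
rewrite /Q /T /U /eps; elim: n => [|n [IH1 IH2 IH3 IH4]].
  rewrite !big_ord0 /= !add0r mul1r r0 N0 normr0 !mulr0.
  by split=> //; rewrite expr0n.
rewrite !big_ord_recr /=; have [bn|bn] := boolP (below n w); last first.
  rewrite (negPf bn) /= in IH1 IH2 IH3 IH4 *.
  rewrite !mul0r subr0 mul0r mulr0 !addr0 in IH2 IH3 IH4 *.
  by split.
have [E1 E2] := IH1 bn; rewrite bn /= in E2 IH2 IH3 *.
have lN := belowN bn.
move: E1 E2; set q := \sum_(_ < n) _ * _ ^+ 2; set t := \sum_(_ < n) dN _ _ * _.
set u := \sum_(_ < n) _ * `|_| => E1 E2; rewrite !mul1r in E2 *.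
have u0 : u = 0 by move/eqP: E2; rewrite -subr_eq0 addrK => /eqP.
rewrite u0 add0r /dN.
have a2 (x : R) : x ^+ 2 = `|x| ^+ 2 by rewrite real_normK// num_real.
(* At the exit step the last squared increment is not counted, and [Q + 2 T] becomes
   [2 N_n N_(n+1) - N_n^2], at most [2 lam |N_(n+1)|]. The overshoot enters linearly, so a first
   moment of the martingale controls it. *)
have [ltN|ltN] := leP `|N (r n.+1) w| lam; rewrite /= ?subrr ?mul0r ?add0r ?mul1r ?subr0 ?addr0.
  have E : q + (N (r n.+1) w - N (r n) w) ^+ 2 + 2 * (t + (N (r n.+1) w - N (r n) w) * N (r n) w) =
     N (r n.+1) w ^+ 2.
    by rewrite (_ : q = N (r n) w ^+ 2 - 2 * t); [ring|rewrite -E1; ring].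
  split=> //; rewrite E a2; have := normr_ge0 (N (r n.+1) w); nra.
rewrite !mul1r; split=> //.
have -> : q + 2 * (t + (N (r n.+1) w - N (r n) w) * N (r n) w) =
    2 * (N (r n) w * N (r n.+1) w) - N (r n) w ^+ 2.
  by rewrite (_ : q = N (r n) w ^+ 2 - 2 * t); [ring|rewrite -E1; ring].
rewrite lerBlDr (le_trans _ (_ : 2 * lam * `|N (r n.+1) w| <= _))//; last first.
  by rewrite lerDl sqr_ge0.
rewrite -mulrA ler_wpM2l// (le_trans (ler_norm _))// normrM.
by rewrite ler_wpM2r.
Qed.

Let ieps l (f : Omega -> R) : P.-integrable setT (EFin \o f) ->
  P.-integrable setT (EFin \o (fun w => eps l w * f w)).
Proof.
move=> If; apply: (@integrable_bounded_by _ _ _ P setT _ (fun w => `|f w|)) => //.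
- by apply: measurable_funM => //; apply/measurable_EFinP; exact: measurable_int If.
- exact: integrable_norm.
- move=> w _; have /andP[e0 e1] := eps01 l w.
  by rewrite normrM (ger0_norm e0) ler_piMl.
Qed.

Let iT n : P.-integrable setT (EFin \o T n) /\ \int[P]_w T n w = 0.
Proof.
have H l : P.-integrable setT (EFin \o (fun w => dN l w * (eps l w * N (r l) w))) /\
    \int[P]_w (dN l w * (eps l w * N (r l) w)) = 0.
  apply: (martingale_transform (M := lam) FF mN) => //; first exact: ltW.
    exact: (@measurable_funM _ (g_sigma_algebraType (F (r l))) _ _ _ _ (@Fbelow l) (@FN l)).
  move=> w; rewrite /eps; have [b|_] := boolP (below l w); first by rewrite mul1r belowN.
  by rewrite mul0r normr0 ltW.
split; first by apply: integrableR_sum => // l; have [] := H l.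
rewrite Rintegral_sum//; last by move=> l; have [] := H l.
by apply: big1 => l _; have [_] := H l.
Qed.

(** Optional stopping for [|N|]. On the event of exit at step [l.+1], [|N|] is [N] times its sign;
    this sign is known at that time, so [N] may be replaced by its final value under the
    expectation, which is at most the final [|N|]. *)
Let EU n : P.-integrable setT (EFin \o U n) /\ \int[P]_w U n w <= \int[P]_w `|N (r n) w|.
Proof.
have iaN l : P.-integrable setT (EFin \o (fun w => `|N (r l) w|)) by exact: integrable_norm.
have ie l k : P.-integrable setT (EFin \o (fun w => eps l w * `|N (r k) w|)) by exact: ieps.
have ied l k : P.-integrable setT (EFin \o (fun w => (eps l w - eps l.+1 w) * `|N (r k) w|)).
  by under eq_fun do rewrite mulrBl; exact: integrableRB.
have iU : P.-integrable setT (EFin \o U n).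
  by apply: integrableRD => //; exact: integrableR_sum.
split=> //; rewrite /U RintegralD//; last exact: integrableR_sum.
rewrite Rintegral_sum//.
have E : \int[P]_w `|N (r n) w| = \sum_(l < n) \int[P]_w ((eps l w - eps l.+1 w) * `|N (r n) w|) +
    \int[P]_w (eps n w * `|N (r n) w|).
  rewrite -Rintegral_sum// -RintegralD//; last exact: integrableR_sum.
  apply: eq_Rintegral => w _; rewrite -big_distrl /= -mulrDl.
  rewrite (_ : \sum_(l < n) _ = 1 - eps n w) ?subrK ?mul1r//.
  elim: n {iU} => [|n IH]; first by rewrite big_ord0 /eps /= subrr.
  by rewrite big_ord_recr /= IH; ring.
rewrite E lerD2r; apply: ler_sum => l _.
pose Z w := (eps l w - eps l.+1 w) * Num.sg (N (r l.+1) w).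
have ln : r l.+1 <= r n by apply: r_le.
have e_mono w : 0 <= eps l w - eps l.+1 w <= 1.
  by rewrite /eps /=; case: (below l w) => /=; [case: (_ <= lam)|]; rewrite /= ?subrr ?subr0 ?lexx ?ler01.
have FZ : Fmeas F (r l.+1) Z.
  apply: (@measurable_funM _ (g_sigma_algebraType (F (r l.+1)))).
    apply: (@measurable_funB _ (g_sigma_algebraType (F (r l.+1)))) => //.
      by apply: Fmeas_le (@Fbelow l) => //; exact: ltW.
    exact: Fbelow.
  have msg : measurable_fun setT (Num.sg : R -> R).
    rewrite (_ : Num.sg = (fun x : R => \1_[set y : R | 0 < y] x - \1_[set y : R | y < 0] x)).
      apply: measurable_funB; apply: measurable_indic.
        by rewrite -[X in measurable X]setTI; apply: measurable_fun_ltr.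
      by rewrite -[X in measurable X]setTI; apply: measurable_fun_ltr.
    apply/funext => x; rewrite !indicE; case: (ltrgtP x 0) => x0.
    - by rewrite ltr0_sg// memNset ?mem_set//= ?sub0r//; move/ltW: x0; rewrite leNgt => /negP.
    - by rewrite gtr0_sg// mem_set// memNset ?subr0//=; move/ltW: x0; rewrite leNgt => /negP.
    - by rewrite x0 sgr0 !memNset ?subrr//= ltxx.
  by apply: measurableT_comp => //; exact: FN.
have Z1 w : `|Z w| <= eps l w - eps l.+1 w.
  have /andP[e0 e1] := e_mono w.
  rewrite normrM (ger0_norm e0) ler_piMr// normr_sg.
  by case: (_ != _).
have ZB w : `|Z w| <= 1 by apply: (le_trans (Z1 w)); have /andP[] := e_mono w.
have [IZ EZ] := martingale_transform FF mN (r_ge0 _) ln FZ ZB.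
have mZ : measurable_fun setT Z by exact: (Fmeas_measurable FF (r_ge0 l.+1) FZ).
have iZN k : P.-integrable setT (EFin \o (fun w => N (r k) w * Z w)).
  apply: (@integrable_bounded_by _ _ _ P setT _ (fun w => `|N (r k) w|)) => //.
    exact: measurable_funM.
  by move=> w _; rewrite normrM ler_piMr.
have E1 : \int[P]_w ((eps l w - eps l.+1 w) * `|N (r l.+1) w|) = \int[P]_w (N (r n) w * Z w).
  transitivity (\int[P]_w (N (r l.+1) w * Z w)).
    by apply: eq_Rintegral => w _; rewrite /Z normrEsg; ring.
  apply/esym/eqP; rewrite -subr_eq0 -RintegralB// -[X in _ == X]EZ; apply/eqP.
  by apply: eq_Rintegral => w _; rewrite mulrBl.
rewrite E1 (le_trans (ler_norm _))//; apply: Rintegral_norm_le => //.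
  exact: measurable_funM.
by move=> w _; rewrite normrM mulrC ler_wpM2r.
Qed.

(** Off an event of probability at most [M / lam] there is no exit, and the sum is [Q n]. As [T n]
    is centered, [Q n] has mean at most [2 * lam * M], and Markov's inequality gives the second
    term. *)
Lemma martingale_sqr_bound n (M K : R) : \int[P]_w `|N (r n) w| <= M -> 0 < K ->
  Pbound P (fun w => \sum_(l < n) dN l w ^+ 2) K (M / lam + 2 * lam * M / K).
Proof.
move=> NM K0; have [iTn ET] := iT n; have [iUn EUn] := EU n.
have iQ : P.-integrable setT (EFin \o Q n).
  apply: integrableR_sum => // l; apply: (@integrable_of_bounded _ _ _ _ _ ((2 * lam) ^+ 2)).
    by apply: measurable_funM => //; apply: measurable_funX; exact: measurable_funB.
  move=> w; rewrite /eps; have [/andP[b1 b2]|_] := boolP (below l.+1 w); last first.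
    by rewrite mul0r normr0 sqr_ge0.
  rewrite mul1r normrX lerXn2r ?nnegrE ?mulr_ge0 ?(ltW lam_gt0)//.
  rewrite (le_trans (ler_normB _ _))// mulrC mulr_natr mulr2n lerD//.
  exact: belowN.
have EQ : \int[P]_w `|Q n w| <= 2 * lam * M.
  have Q0 w : 0 <= Q n w.
    apply: sumr_ge0 => l _; rewrite mulr_ge0 ?sqr_ge0//; by have /andP[] := eps01 l.+1 w.
  under eq_Rintegral do rewrite ger0_norm//.
  have -> : \int[P]_w Q n w = \int[P]_w (Q n w + 2 * T n w).
    by rewrite RintegralD// ?RintegralZl// ?ET ?mulr0 ?addr0//; exact: integrableRZ.
  apply: (@le_trans _ _ (\int[P]_w (2 * lam * U n w))); last first.
    by rewrite RintegralZl// ler_wpM2l ?mulr_ge0 ?(ltW lam_gt0)// (le_trans EUn).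
  apply: le_Rintegral => //; [|exact: integrableRZ|].
    by apply: integrableRD => //; exact: integrableRZ.
  by move=> w _; have [] := pathwise n w.
have EUM : \int[P]_w `|U n w| <= M.
  have U0 w : 0 <= U n w by have [] := pathwise n w.
  by under eq_Rintegral do rewrite ger0_norm//; exact: le_trans NM.
have BQ := Pbound_markov iQ EQ K0.
have BU : Pbound P (fun w => (~~ below n w)%:R : R) 0 (M / lam).
  have [A [mA PA HA]] := Pbound_markov iUn EUM lam_gt0.
  exists A; split=> // w /HA; rewrite normr_le0 => UA; rewrite pnatr_eq0 eqb0 negbK.
  have [_ _ _ H] := pathwise n w; apply: contraLR UA => /H.
  by rewrite -ltNge => /lt_le_trans; apply; exact: ler_norm.
apply: Pbound2 BU BQ => w; rewrite normr_le0 pnatr_eq0 eqb0 negbK => b; apply: le_trans.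
suff <- : Q n w = \sum_(l < n) dN l w ^+ 2 by [].
apply: eq_bigr => l _; have -> : eps l.+1 w = 1; last by rewrite mul1r.
by rewrite /eps (belowW (ltn_ord l) b).
Qed.

End quadratic_variation_tight.

(** * Uniform grids *)

Section grid.
Context {R : realType}.
Implicit Types (delta : R).

Definition grid delta n : seq R := mkseq (fun l => l.+1%:R * delta) n.

Lemma nth_grid x0 delta n k : (k <= n)%N -> nth x0 (0 :: grid delta n) k = k%:R * delta.
Proof. by case: k => [_|k kn] /=; rewrite ?mul0r// nth_mkseq. Qed.

Lemma grid_partition delta n : 0 < delta -> itv_partition 0 (n%:R * delta) (grid delta n).
Proof.
move=> d0; split.
  apply/(pathP 0) => i; rewrite size_mkseq => i_n.
  rewrite nth_grid ?(ltnW i_n)// nth_mkseq// ltr_pM2r// ltr_nat//.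
by rewrite (last_nth 0) size_mkseq nth_grid.
Qed.

Lemma grid_mesh delta n : mesh_le (grid delta n) delta.
Proof.
move=> k; rewrite size_mkseq => kn.
by rewrite !nth_grid ?(ltnW kn)// -natr1 mulrDl mul1r addrAC subrr add0r.
Qed.

Lemma trapezoid_grid d (Omega : measurableType d) (Y Z : R -> Omega -> R) delta n w :
  trapezoid_sum Y Z (grid delta n) w = \sum_(k < n)
   (Y (k%:R * delta) w + Y (k.+1%:R * delta) w) / 2 * (Z (k.+1%:R * delta) w - Z (k%:R * delta) w).
Proof.
rewrite /trapezoid_sum size_mkseq; apply: eq_bigr => k _.
by rewrite !nth_grid ?(ltnW (ltn_ord k)).
Qed.

End grid.

(** * Tightness for continuous semimartingales *)

Section semimartingale.
Context d (Omega : measurableType d) (R : realType) (P : probability Omega R).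
Variables (F : R -> set (set Omega)) (FF : filtration F).

Definition sqvar (Y : R -> Omega -> R) delta n w :=
  \sum_(l < n) (Y (l.+1%:R * delta) w - Y (l%:R * delta) w) ^+ 2.

Definition tight_sqvar (Y : R -> Omega -> R) := forall t e, 0 < t -> 0 < e ->
  exists K, forall n (delta : R), 0 < delta -> n%:R * delta = t -> Pbound P (sqvar Y delta n) K e.

Lemma tight_sqvarD (Y Z W : R -> Omega -> R) :
  {ae P, forall w, forall t, 0 <= t -> W t w = Y t w + Z t w} ->
  tight_sqvar Y -> tight_sqvar Z -> tight_sqvar W.
Proof.
move=> WE tY tZ t e t0 e0; have e2 : 0 < e / 2 by rewrite divr_gt0.
have [K1 H1] := tY _ _ t0 e2; have [K2 H2] := tZ _ _ t0 e2.
exists (2 * K1 + 2 * K2) => n delta d0 nd; rewrite [e]splitr.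
apply: (@Pbound_ae _ _ _ _ (sqvar (fun t w => Y t w + Z t w) delta n)).
  case: WE => N [mN PN sN]; exists N; split=> // w /= Hw; apply: sN => /= WE; apply: Hw.
  by apply: eq_bigr => l _; rewrite !WE// mulr_ge0// ltW.
apply: Pbound2 (H1 n delta d0 nd) (H2 n delta d0 nd) => w.
rewrite !ger0_norm; try by apply: sumr_ge0 => l _; rewrite sqr_ge0.
move=> h1 h2; apply: (@le_trans _ _ (2 * sqvar Y delta n w + 2 * sqvar Z delta n w)); last first.
  by rewrite lerD// ler_wpM2l.
rewrite /sqvar !big_distrr -big_split /=; apply: ler_sum => l _.
set a := Y _ w; set b := Z _ w; set a' := Y _ w; set b' := Z _ w.
by have := sqr_ge0 ((a - a') - (b - b')); nra.
Qed.

(** The sum of squares is at most the square of the sum of absolute values, which the variation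
    bounds on each path. As [delta] is determined by [n] and [t], only a sequence of sums is
    involved. *)
Lemma tight_sqvar_fv (A : R -> Omega -> R) : continuous_finite_variation F A -> tight_sqvar A.
Proof.
move=> [aA _ bvA] t e t0 e0.
have mA s : 0 <= s -> measurable_fun setT (A s).
  by move=> s0; apply: (Fmeas_measurable FF s0); exact: adapted_Fmeas.
pose V n w := \sum_(l < n) `|A (l.+1%:R * (t / n%:R)) w - A (l%:R * (t / n%:R)) w|.
have [||K HK] := @Pbound_pointwise _ _ _ P V _ _ e e0.
- move=> n; apply: measurable_sum => l; apply: measurableT_comp => //.
  by apply: measurable_funB; apply: mA; rewrite mulr_ge0// divr_ge0// ltW.
- move=> w; have [K HK] := bvA t w (ltW t0); exists K => n.
  rewrite ger0_norm; last by apply: sumr_ge0.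
  have [->|n0] := posnP n.
    (* For [n = 0] the sum is empty, and [K] is nonnegative because it bounds the variation along
       some partition. *)
    rewrite /V big_ord0; have [x Vx] := variations_neq0 (A^~ w) t0.
    by apply: le_trans (HK _ Vx); case: Vx => s _ <-; exact: variation_ge0.
  have d0 : 0 < t / n%:R by rewrite divr_gt0// ltr0n.
  have nt : n%:R * (t / n%:R) = t by rewrite mulrC divfK// pnatr_eq0 -lt0n.
  have := grid_partition n d0; rewrite nt => gp.
  apply: HK; exists (grid (t / n%:R) n) => //.
  rewrite /variation /V size_mkseq big_mkord; apply: eq_bigr => l _.
  by rewrite !compE !nth_grid ?(ltnW (ltn_ord l)).
exists (K ^+ 2) => n delta d0 nt.
have n0 : (0 < n)%N by case: n nt => //; rewrite mul0r => t00; move: t0; rewrite -t00 ltxx.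
have dE : delta = t / n%:R by rewrite -nt mulrAC divff ?mul1r// pnatr_eq0 -lt0n.
case: (HK n) => N [mN PN HN]; exists N; split=> // w /HN Vw.
have V0 : 0 <= V n w by apply: sumr_ge0.
rewrite ger0_norm; last by apply: sumr_ge0 => l _; rewrite sqr_ge0.
rewrite ger0_norm// in Vw.
apply: (@le_trans _ _ (V n w ^+ 2)); last by rewrite lerXn2r// nnegrE (le_trans V0).
rewrite /sqvar /V dE; elim: n {n0 nt dE HK N mN PN HN V0 Vw} (t / n%:R) => [|n IH] u.
  by rewrite !big_ord0 expr0n.
rewrite !big_ord_recr /=.
set a := \sum_(_ < n) `|_|; set b := `|_|.
have a0 : 0 <= a by apply: sumr_ge0.
have -> : (A (n.+1%:R * u) w - A (n%:R * u) w) ^+ 2 = b ^+ 2 by rewrite /b real_normK ?num_real.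
have b0 : 0 <= b by exact: normr_ge0.
by rewrite sqrrD lerD2r (le_trans (IH u))// lerDl mulrn_wge0// mulr_ge0.
Qed.

(** For some [k] the localizing time [tau k] exceeds [t] off an event of probability at most
    [e / 2]. There the increments of [M] up to time [t] are those of the stopped martingale. *)
Lemma tight_sqvar_clm (M : R -> Omega -> R) : continuous_local_martingale P F M -> tight_sqvar M.
Proof.
move=> [aM cM [tau [st _ tauy mart]]] t e t0 e0.
have [Nu [mNu PNu sNu]] := tauy.
pose A k : set Omega := [set w | (tau k w <= t%:E)%E] `\` Nu.
have mA k : measurable (A k).
  apply: measurableD => //; apply: (filtration_sub FF (ltW t0)).
  by have [_] := st k; apply; exact: ltW.
have : \int[P]_w \1_(A k) w @[k --> \oo] --> \int[P]_w (0 : R).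
  have [| | | |//] := @dominated_cvg_Rintegral _ _ _ P setT (fun k => \1_(A k)) (fun=> 0) (fun=> 1) measurableT.
  - by move=> k; exact: measurable_indic.
  - move=> w _; have [wN|wN] := pselect (Nu w).
      apply: cvg_near_cst; apply: nearW => k; rewrite indicE memNset//.
      by move=> [_].
    have tw : tau ^~ w @ \oo --> +oo%E by apply: contrapT => H; apply: wN; exact: sNu.
    apply: cvg_near_cst; move/cvgeyPgt: tw => /(_ t); apply: filterS => k tk.
    by rewrite indicE memNset// => -[/=]; rewrite leNgt tk.
  - exact: finite_measure_integrable_cst.
  - by move=> k w _; rewrite indicE; case: (_ \in _); rewrite /= ?normr1 ?normr0.
have e2 : 0 < e / 2 by rewrite divr_gt0.
rewrite Rintegral0 => /cvgrPdist_le/(_ _ e2)[k _ /(_ k (leqnn _))] /=.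
rewrite sub0r normrN => PA.
have PAk : (P (A k `|` Nu) <= (e / 2)%:E)%E.
  apply: (le_trans (measureU2 _ _ _)) => //; rewrite -[leRHS]adde0; apply: leeD; last first.
    by rewrite le_eqVlt (introT eqP PNu).
  have fP : P (A k) \is a fin_num by exact: fin_num_measure.
  suff : (P (A k) <= (e / 2)%:E)%E by [].
  rewrite -(fineK fP) lee_fin (le_trans (ler_norm _))//; move: PA.
  by rewrite /Rintegral integral_indic// setIT.
have mk := mart k; pose N := (fun t w => stopped M (tau k) t w - M 0 w).
have N0 w : N 0 w = 0.
  rewrite /N /stopped; have [/(_ w) t0w _] := st k.
  by rewrite (min_idPr _)//= subrr.
have EN0 : 0 <= \int[P]_w `|N t w| by apply: Rintegral_ge0.
set EN := \int[P]_w `|N t w| in EN0.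
(* [lam] and then [K] are chosen so that the two error terms of [martingale_sqr_bound] are both
   [e / 4]. *)
pose lam := (EN + 1) / (e / 4).
have e4 : 0 < e / 4 by rewrite divr_gt0.
have EN1 : 0 < EN + 1 by rewrite ltr_wpDl.
have lam0 : 0 < lam by rewrite divr_gt0.
pose K := (2 * lam * (EN + 1)) / (e / 4).
have K0 : 0 < K by rewrite divr_gt0// mulr_gt0// mulr_gt0.
exists K => n delta d0 nt.
have rincr l : l%:R * delta < l.+1%:R * delta by rewrite ltr_pM2r// ltr_nat.
have rr0 : 0%:R * delta = 0 by rewrite mul0r.
have ENt : \int[P]_w `|N (n%:R * delta) w| <= EN + 1 by rewrite nt lerDl.
have BN := @martingale_sqr_bound _ _ _ _ _ FF N mk N0 (fun l => l%:R * delta) rr0 rincr _ lam0 n _ _ ENt K0.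
have Ee : (EN + 1) / lam + 2 * lam * (EN + 1) / K = e / 2.
  by rewrite /K /lam; field; rewrite !gt_eqF.
rewrite Ee in BN; case: BN => A' [mA' PA' HA'].
exists (A' `|` (A k `|` Nu)); split.
- by apply: measurableU => //; exact: measurableU.
- apply: (le_trans (measureU2 _ _ _)) => //; first exact: measurableU.
  by rewrite [e]splitr EFinD; exact: leeD.
- move=> w /not_orP[/HA' NK /not_orP[nA nN]].
  suff -> : sqvar M delta n w = \sum_(l < n) (N (l.+1%:R * delta) w - N (l%:R * delta) w) ^+ 2 by [].
  have tw : (t%:E < tau k w)%E.
    by rewrite ltNge; apply/negP => tw; apply: nA.
  have NE l : (l <= n)%N -> N (l%:R * delta) w = M (l%:R * delta) w - M 0 w.
    move=> ln; rewrite /N /stopped (min_idPr _)//= (le_trans _ (ltW tw))// lee_fin -nt.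
    by rewrite ler_pM2r// ler_nat.
  by apply: eq_bigr => l _; rewrite !NE ?(ltnW (ltn_ord l))//; congr (_ ^+ 2); ring.
Qed.

Lemma tight_sqvar_semimartingale (Y : R -> Omega -> R) :
  continuous_semimartingale P F Y -> tight_sqvar Y.
Proof.
move=> [M [A [cM cA YE]]].
by apply: tight_sqvarD YE _ _; [exact: tight_sqvar_clm|exact: tight_sqvar_fv].
Qed.

End semimartingale.

(** * Dynkin's formula *)

Section block_sums.
Context {R : comNzRingType}.
Implicit Types a b : nat -> R.

Lemma sum_shift a c q : \sum_(p < q) a (c + p)%N = \sum_(c <= p < c + q) a p.
Proof.
rewrite -(big_mkord predT (fun p => a (c + p)%N)) -{2}[c]add0n big_addn addKn.
by apply: eq_bigr => p _; rewrite addnC.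
Qed.

Lemma sum_blocks (a : nat -> R) N m :
  \sum_(k < N) \sum_(q < m) a (k * m + q)%N = \sum_(l < N * m) a l.
Proof.
elim: N => [|N IH]; first by rewrite mul0n !big_ord0.
rewrite big_ord_recr /= IH mulSn addnC -!(big_mkord predT) /=.
rewrite [RHS](big_cat_nat (n := (N * m)%N)) ?leq_addr//=; congr (_ + _).
exact: sum_shift.
Qed.

Lemma mul_sums a b m : (\sum_(q < m) a q) * (\sum_(q < m) b q) =
  \sum_(q < m) (a q * b q + (\sum_(p < q) a p) * b q + a q * (\sum_(p < q) b p)).
Proof.
elim: m => [|m IH]; first by rewrite !big_ord0 mul0r.
by rewrite !big_ord_recr /= -IH; ring.
Qed.

(** The block of length [m] containing [l] starts at [l %/ m * m]: this is the part of the block sum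
    strictly before [l], which is known at the grid time [l] when the summands are increments. *)
Definition block_partial a m l := \sum_(l %/ m * m <= p < l %/ m * m + l %% m) a p.

Lemma mul_block_sums a b N m :
  \sum_(k < N) (\sum_(q < m) a (k * m + q)%N) * (\sum_(q < m) b (k * m + q)%N) =
  \sum_(l < N * m) (a l * b l + block_partial a m l * b l + block_partial b m l * a l).
Proof.
rewrite -(sum_blocks (fun l => a l * b l + block_partial a m l * b l + block_partial b m l * a l)).
apply: eq_bigr => k _; rewrite (mul_sums (fun q => a (k * m + q)%N) (fun q => b (k * m + q)%N)).
apply: eq_bigr => q _; rewrite /block_partial.
have m0 : (0 < m)%N by apply: leq_ltn_trans (ltn_ord q).
rewrite divnMDl// divn_small// addn0 modnMDl modn_small// !sum_shift.
by rewrite [a _ * \sum_(_ <= _ < _) _]mulrC.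
Qed.

End block_sums.

(** The Cauchy-Schwarz inequality; the induction step expands the sum of the squares of
    [a l - a n]. *)
Lemma sqr_sum_le (R : realDomainType) (a : nat -> R) n :
  (\sum_(l < n) a l) ^+ 2 <= n%:R * \sum_(l < n) a l ^+ 2.
Proof.
elim: n => [|n IH]; first by rewrite !big_ord0 expr0n mul0r.
have E u : \sum_(l < n) (a l - u) ^+ 2 =
    \sum_(l < n) a l ^+ 2 - 2 * u * \sum_(l < n) a l + n%:R * u ^+ 2.
  elim: n {IH} => [|n IH]; first by rewrite !big_ord0; ring.
  by rewrite !big_ord_recr /= IH -natr1; ring.
have : 0 <= \sum_(l < n) (a l - a n) ^+ 2 by apply: sumr_ge0 => l _; exact: sqr_ge0.
rewrite E !big_ord_recr /= -natr1; move: (\sum_(l < n) a l) (\sum_(l < n) a l ^+ 2) IH => s t.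
by nra.
Qed.

(** * Mean square estimates on a fine grid *)

Section discrete_estimates.
Context d (Omega : measurableType d) (R : realType) (P : probability Omega R).
Variables (F : R -> set (set Omega)) (FF : filtration F).
Variables (m : nat) (B : 'I_m -> R -> Omega -> R) (BM : brownian_motion P F B).
Variables (delta : R) (delta_gt0 : 0 < delta).
Implicit Types (i j : 'I_m) (Z H : nat -> Omega -> R).

Let r l : R := l%:R * delta.
Let r0 : 0 <= r 0. Proof. by rewrite /r mul0r. Qed.
Let r_incr l : r l < r l.+1. Proof. by rewrite /r ltr_pM2r// ltr_nat. Qed.
Let r_ge0 l : 0 <= r l. Proof. by rewrite /r mulr_ge0// ltW. Qed.
Let rS l : r l.+1 - r l = delta. Proof. by rewrite /r -natr1 mulrDl mul1r addrAC subrr add0r. Qed.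
Let b i l w := Bincr B r i l w.

Let bE i l w : b i l w = B i (l.+1%:R * delta) w - B i (l%:R * delta) w. Proof. by []. Qed.

Lemma sum_incr i a q w : \sum_(a <= p < a + q) b i p w = B i (r (a + q)) w - B i (r a) w.
Proof. by rewrite telescope_sumr// leq_addr. Qed.

Lemma discrete_ito_bound i Z n (C : R) : (forall l, Fmeas F (r l) (Z l)) ->
  (forall l, sqint P (Z l)) -> (forall l, \int[P]_w (Z l w ^+ 2) <= C) ->
  let S w := \sum_(l < n) Z l w * b i l w in
  [/\ sqint P S, \int[P]_w S w = 0 & \int[P]_w (S w ^+ 2) <= C * (n%:R * delta)].
Proof.
move=> FZ sZ ZC S; have [sS _ ES ES2] := discrete_ito FF BM r0 r_incr i 0 n FZ sZ.
have SE w : \sum_(0 <= l < 0 + n) Z l w * Bincr B r i l w = S w by rewrite add0n big_mkord.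
move: sS ES ES2; rewrite (_ : (fun w => \sum_(0 <= l < 0 + n) _) = S); last exact/funext.
under [X in _ -> _ -> X = _ -> _]eq_Rintegral do rewrite SE.
move=> sS ES ES2; split=> //; rewrite ES2 add0n big_mkord.
apply: (@le_trans _ _ (\sum_(l < n) C * delta)); last first.
  by rewrite sumr_const card_ord -[leLHS]mulr_natl [leLHS]mulrCA.
by apply: ler_sum => l _; rewrite rS ler_wpM2r// ltW.
Qed.

Lemma block_partial_bound i Z q l (C : R) : (0 < q)%N -> (forall l, Fmeas F (r l) (Z l)) ->
  (forall l w, `|Z l w| <= C) ->
  let W w := block_partial (fun p => Z p w * b i p w) q l in
  [/\ Fmeas F (r l) W, sqint P W & \int[P]_w (W w ^+ 2) <= C ^+ 2 * (q%:R * delta)].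
Proof.
move=> q0 FZ ZC W.
have mZ k : measurable_fun setT (Z k) by exact: (Fmeas_measurable FF (r_ge0 k) (FZ k)).
have sZ k : sqint P (Z k) by apply: (@sqint_bounded _ _ _ _ _ C).
have [sW FW _ EW2] := discrete_ito FF BM r0 r_incr i (l %/ q * q) (l %% q) FZ sZ.
split; [by rewrite {1}(divn_eq l q)|exact: sW|].
rewrite [leLHS]EW2; apply: (@le_trans _ _ (\sum_(l %/ q * q <= p < l %/ q * q + l %% q) C ^+ 2 * delta)).
  apply: ler_sum => p _; rewrite rS ler_wpM2r ?(ltW delta_gt0)//.
  have [_ iZ2] := sZ p; rewrite -[leRHS](Rintegral_cst_prob P); apply: le_Rintegral => //.
    exact: finite_measure_integrable_cst.
  move=> w _; rewrite -[Z p w ^+ 2]ger0_norm ?sqr_ge0// normrX lerXn2r// nnegrE.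
  exact: le_trans (ZC p w).
rewrite big_const_nat iter_addr addr0 addKn -[leLHS]mulr_natl [leLHS]mulrCA.
rewrite ler_wpM2l ?sqr_ge0// ler_wpM2r ?(ltW delta_gt0)// ler_nat ltnW// ltn_pmod//.
Qed.

(* The off-diagonal part of a product of two block increments. *)
Lemma cross_term_bound i j H n q (C : R) : (0 < q)%N -> (forall l, Fmeas F (r l) (H l)) ->
  (forall l w, `|H l w| <= C) ->
  let S w := \sum_(l < n) (block_partial (fun p => H p w * b j p w) q l * b i l w +
      block_partial (fun p => b i p w) q l * (H l w * b j l w)) in
  [/\ sqint P S, \int[P]_w S w = 0 &
    \int[P]_w (S w ^+ 2) <= 4 * (C ^+ 2 * (q%:R * delta) * (n%:R * delta))].
Proof.
move=> q0 FH HC S.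
pose W1 l w := block_partial (fun p => H p w * b j p w) q l.
(* The factor 1 presents a partial sum of increments as a stochastic sum with constant coefficients,
   so that [block_partial_bound] applies. *)
pose W2 l w := H l w * block_partial (fun p => 1 * b i p w) q l.
have mH k : measurable_fun setT (H k) by exact: (Fmeas_measurable FF (r_ge0 k) (FH k)).
have B1 l := @block_partial_bound j H q l C q0 FH HC.
have F1 (l : nat) : Fmeas F (r l) (fun=> 1) by exact: measurable_cst.
have H1 (l : nat) (w : Omega) : `|1 : R| <= 1 by rewrite normr1.
have B2 l := @block_partial_bound i (fun _ _ => 1) q l 1 q0 F1 H1.
have [||| s1 E1 S1] := @discrete_ito_bound i W1 n (C ^+ 2 * (q%:R * delta)).
- by move=> l; have [] := B1 l.
- by move=> l; have [] := B1 l.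
- by move=> l; have [] := B1 l.
have [||| s2 E2 S2] := @discrete_ito_bound j W2 n (C ^+ 2 * (q%:R * delta)).
- by move=> l; have [FW _ _] := B2 l; exact: (@measurable_funM _ (g_sigma_algebraType (F (r l))) _ _ _ _ (@FH l) FW).
- by move=> l; have [_ sW _] := B2 l; exact: sqint_mulB sW (mH l) (HC l).
- move=> l; have [_ sW EW] := B2 l; have sHW := sqint_mulB sW (mH l) (HC l).
  rewrite expr1n mul1r in EW; have [_ iW2] := sW; have [_ iHW2] := sHW.
  apply: (@le_trans _ _ (C ^+ 2 * \int[P]_w (block_partial (fun p => 1 * b i p w) q l ^+ 2))); last first.
    by rewrite ler_wpM2l ?sqr_ge0.
  rewrite -RintegralZl//; apply: le_Rintegral => //; first exact: integrableRZ.
  move=> w _; rewrite exprMn ler_wpM2r ?sqr_ge0//.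
  by rewrite -[H l w ^+ 2]ger0_norm ?sqr_ge0// normrX lerXn2r// nnegrE (le_trans _ (HC l w)).
have SE w : S w = \sum_(l < n) W1 l w * b i l w + \sum_(l < n) W2 l w * b j l w.
  rewrite -big_split /=; apply: eq_bigr => l _; congr (_ + _).
  rewrite /W2 [in RHS]mulrAC mulrC; congr (_ * _).
  by rewrite /block_partial; apply: eq_bigr => p _; rewrite mul1r.
have -> : S = fun w => \sum_(l < n) W1 l w * b i l w + \sum_(l < n) W2 l w * b j l w.
  exact/funext.
split; first exact: sqintD.
- by rewrite RintegralD ?E1 ?E2 ?addr0//; exact: sqint_integrable.
- apply: (le_trans (sqint_normD_le s1 s2)).
  rewrite (_ : 4 * _ = 2 * (C ^+ 2 * (q%:R * delta) * (n%:R * delta)) +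
    2 * (C ^+ 2 * (q%:R * delta) * (n%:R * delta))); last by ring.
  by apply: lerD; rewrite ler_wpM2l.
Qed.

(* The term produced by the increments of the integrand: it is absorbed by the
   tight sum of squares, the remaining factor being small in mean. *)
Lemma integrand_increment_bound i j H N q (K s e eta : R) : (0 < q)%N -> 0 < eta -> 0 < s ->
  Pbound P (fun w => \sum_(l < N * q) (H l.+1 w - H l w) ^+ 2) K e ->
  Pbound P (fun w => \sum_(k < N) (\sum_(p < q) (H (k * q + p).+1 w - H (k * q + p)%N w) * b j (k * q + p) w) *
      (\sum_(p < q) b i (k * q + p) w))
    (eta * K + s / (4 * eta)) (e + 3 * (N%:R * q%:R * delta) * (q%:R * delta) / s).
Proof.
move=> q0 eta0 s0 PH.
pose D k w := B i (r (k * q + q)) w - B i (r (k * q)) w.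
have DE (k : nat) w : \sum_(p < q) b i (k * q + p) w = D k w.
  by rewrite (sum_shift (fun l => b i l w)) sum_incr.
pose G w := \sum_(k < N) \sum_(p < q) b j (k * q + p) w ^+ 2 * D k w ^+ 2.
have qr : 0 < q%:R :> R by rewrite ltr0n.
have IG k l : P.-integrable setT (EFin \o (fun w => b j l w ^+ 2 * D k w ^+ 2)) /\
    \int[P]_w (b j l w ^+ 2 * D k w ^+ 2) <= 3 * (q%:R * delta) * delta.
  have rk : r (k * q) < r (k * q + q) by rewrite /r ltr_pM2r// ltr_nat -addn1 leq_add2l.
  have [ib Eb] := incr_fourth FF BM j (r_ge0 l) (r_incr l).
  have [iD ED] := incr_fourth FF BM i (r_ge0 (k * q)) rk.
  rewrite rS in Eb; have rkE : r (k * q + q) - r (k * q) = q%:R * delta.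
    by rewrite /r natrD mulrDl addrAC subrr add0r.
  rewrite rkE in ED.
  have mb : measurable_fun setT (b j l) by apply: (measurable_incr FF BM) => //; exact: ltW.
  have mD : measurable_fun setT (D k) by apply: (measurable_incr FF BM) => //; exact: ltW.
  (* Young's inequality is used instead of independence, since the fine increment may be a part of
     the block increment [D k]. The weights balance the fourth moments [3 delta^2] and
     [3 (q delta)^2]. *)
  pose g w := q%:R / 2 * (b j l w ^+ 4) + (2 * q%:R)^-1 * (D k w ^+ 4).
  have bg w : b j l w ^+ 2 * D k w ^+ 2 <= g w.
    rewrite /g -subr_ge0 (_ : _ - _ = (2 * q%:R)^-1 * (q%:R * b j l w ^+ 2 - D k w ^+ 2) ^+ 2).
      by rewrite mulr_ge0 ?sqr_ge0// invr_ge0 mulr_ge0// ltW.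
    by field; rewrite gt_eqF.
  have ig : P.-integrable setT (EFin \o g) by apply: integrableRD => //; exact: integrableRZ.
  have mbD : measurable_fun setT (fun w => b j l w ^+ 2 * D k w ^+ 2).
    by apply: measurable_funM; exact: measurable_funX.
  have I : P.-integrable setT (EFin \o (fun w => b j l w ^+ 2 * D k w ^+ 2)).
    apply: (@integrable_bounded_by _ _ _ P setT _ g) => // w _.
    by rewrite ger0_norm// mulr_ge0// sqr_ge0.
  split=> //; apply: (@le_trans _ _ (\int[P]_w g w)); first exact: le_Rintegral.
  rewrite RintegralD//; [|exact: integrableRZ|exact: integrableRZ].
  rewrite !RintegralZl//.
  have -> : \int[P]_w (D k w ^+ 4) = 3 * (q%:R * delta) ^+ 2 by [].
  have -> : \int[P]_w (b j l w ^+ 4) = 3 * delta ^+ 2 by [].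
  rewrite (_ : _ + _ = 3 * (q%:R * delta) * delta)//.
  by field; rewrite gt_eqF.
have iG : P.-integrable setT (EFin \o G).
  by apply: integrableR_sum => // k; apply: integrableR_sum => // p; have [] := IG k (k * q + p)%N.
have G0 w : 0 <= G w.
  by apply: sumr_ge0 => k _; apply: sumr_ge0 => p _; rewrite mulr_ge0// sqr_ge0.
have EG : \int[P]_w `|G w| <= 3 * (N%:R * q%:R * delta) * (q%:R * delta).
  under eq_Rintegral do rewrite ger0_norm//.
  rewrite /G Rintegral_sum//; last first.
    by move=> k; apply: integrableR_sum => // p; have [] := IG k (k * q + p)%N.
  apply: (@le_trans _ _ (\sum_(k < N) \sum_(p < q) 3 * (q%:R * delta) * delta)).
    apply: ler_sum => k _; rewrite Rintegral_sum//; last by move=> p; have [] := IG k (k * q + p)%N.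
    by apply: ler_sum => p _; have [] := IG k (k * q + p)%N.
  rewrite !sumr_const !card_ord -[leLHS]mulrnA -[leLHS]mulr_natl natrM.
  by rewrite le_eqVlt; apply/orP; left; apply/eqP; ring.
apply: Pbound2 PH (Pbound_markov iG EG s0) => w.
rewrite (ger0_norm (G0 w)) ger0_norm; last by apply: sumr_ge0 => l _; rewrite sqr_ge0.
move=> HK Gs; under eq_bigr do rewrite DE.
(* Young's inequality for each product of an increment of [H] with [b * D]: the weight [eta] falls
   on the sum of squares and [1 / (4 eta)] on [G]. *)
apply: (@le_trans _ _ (eta * \sum_(l < N * q) (H l.+1 w - H l w) ^+ 2 + (4 * eta)^-1 * G w)); last first.
  apply: lerD; first by rewrite ler_wpM2l// ltW.
  by rewrite mulrC ler_wpM2r// invr_ge0 mulr_ge0// ltW.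
rewrite -(sum_blocks (fun l => (H l.+1 w - H l w) ^+ 2)) /G !big_distrr -big_split /=.
apply: (le_trans (ler_norm_sum _ _ _)); apply: ler_sum => k _.
rewrite big_distrl !big_distrr -big_split /=.
apply: (le_trans (ler_norm_sum _ _ _)); apply: ler_sum => p _.
set x := H _ w - _; set y := b j _ w; set z := D k w.
have H4 : 0 < 4 * eta by rewrite mulr_gt0.
rewrite -mulrA -exprMn; set u := y * z.
rewrite -(ler_pM2l H4) (_ : 4 * eta * (_ + _) = (2 * eta * x) ^+ 2 + u ^+ 2); last first.
  by field; rewrite gt_eqF.
rewrite normrM (_ : 4 * eta * (_ * _) = 2 * (`|2 * eta * x| * `|u|)); last first.
  have -> : `|2 * eta * x| = 2 * eta * `|x| by rewrite normrM ger0_norm// mulr_ge0// ltW.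
  by ring.
rewrite -[(_ * x) ^+ 2]real_normK ?num_real// -[u ^+ 2]real_normK ?num_real//.
by have := sqr_ge0 (`|2 * eta * x| - `|u|); nra.
Qed.

(** This term carries the Stratonovich correction: for [i = j] its mean is a Riemann sum of the
    means of [H]. The second moment bound is not small; it is meant for [small2_expectation], where
    a uniform bound in L2 is required. *)
Lemma diagonal_term_bound i j H n (C : R) : (forall l, Fmeas F (r l) (H l)) ->
  (forall l w, `|H l w| <= C) ->
  let S w := \sum_(l < n) (H l w * b j l w) * b i l w in
  [/\ sqint P S,
      \int[P]_w S w = if i == j then \sum_(l < n) (\int[P]_w H l w) * delta else 0 &
      \int[P]_w (S w ^+ 2) <= 3 * (C * (n%:R * delta)) ^+ 2].
Proof.
move=> FH HC S.
have mH k : measurable_fun setT (H k) by exact: (Fmeas_measurable FF (r_ge0 k) (FH k)).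
have iH k : P.-integrable setT (EFin \o H k) by exact: (integrable_of_bounded P (mH k) (HC k)).
have mb k l : measurable_fun setT (b k l) by apply: (measurable_incr FF BM) => //; exact: ltW.
have ib4 k l := incr_fourth FF BM k (r_ge0 l) (r_incr l).
have mS : measurable_fun setT S.
  by apply: measurable_sum => l; apply: measurable_funM => //; exact: measurable_funM.
have Hb l : P.-integrable setT (EFin \o (fun w => (H l w * b j l w) * b i l w)) /\
    \int[P]_w ((H l w * b j l w) * b i l w) = if i == j then (\int[P]_w H l w) * delta else 0.
  have -> : (fun w => H l w * b j l w * b i l w) = (fun w => H l w * (b j l w * b i l w)).
    by apply/funext => w; rewrite mulrA.
  have [->|ij] := eqVneq i j.
    have -> : (fun w => H l w * (b j l w * b j l w)) = (fun w => H l w * b j l w ^+ 2).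
      by apply/funext => w; rewrite expr2.
    by have := incr_sqr FF BM j (r_ge0 l) (r_incr l) (@FH l) (iH l); rewrite rS.
  by rewrite eq_sym in ij; exact: (incr_cross FF BM ij (r_ge0 l) (r_incr l) (@FH l) (iH l)).
pose g w := (C ^+ 2 * n%:R / 2) * \sum_(l < n) (b i l w ^+ 4 + b j l w ^+ 4).
have ig1 : P.-integrable setT (EFin \o (fun w => \sum_(l < n) (b i l w ^+ 4 + b j l w ^+ 4))).
  apply: integrableR_sum => // l; apply: integrableRD => //.
    by have [] := ib4 i l.
  by have [] := ib4 j l.
have ig : P.-integrable setT (EFin \o g) by exact: integrableRZ.
have Sg w : S w ^+ 2 <= g w.
  have C0 (l : nat) : 0 <= C by exact: le_trans (HC l w).
  have S1 : `|S w| <= C * \sum_(l < n) `|b i l w * b j l w|.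
    rewrite big_distrr /=; apply: (le_trans (ler_norm_sum _ _ _)); apply: ler_sum => l _.
    rewrite -mulrA [b j l w * _]mulrC normrM ler_wpM2r//.
  rewrite -[S w ^+ 2]real_normK ?num_real//.
  apply: (@le_trans _ _ ((C * \sum_(l < n) `|b i l w * b j l w|) ^+ 2)).
    by rewrite lerXn2r// nnegrE mulr_ge0 ?(C0 0)// sumr_ge0.
  rewrite /g exprMn -[_ * n%:R / 2 * _]mulrA -[C ^+ 2 * n%:R * _]mulrA ler_wpM2l ?sqr_ge0//.
  apply: (@le_trans _ _ (n%:R * \sum_(l < n) `|b i l w * b j l w| ^+ 2)); last first.
    rewrite ler_wpM2l// big_distrr /=; apply: ler_sum => l _.
    rewrite real_normK ?num_real// exprMn -subr_ge0.
    rewrite (_ : _ - _ = 2^-1 * (b i l w ^+ 2 - b j l w ^+ 2) ^+ 2); first by rewrite mulr_ge0// sqr_ge0.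
    by field.
  exact: (sqr_sum_le (fun l => `|b i l w * b j l w|)).
have sS : sqint P S.
  split=> //; apply: (@integrable_bounded_by _ _ _ P setT _ g) => //.
    exact: measurable_funX.
  by move=> w _; rewrite ger0_norm// sqr_ge0.
split=> //.
- rewrite /S Rintegral_sum//; last by move=> l; have [] := Hb l.
  under eq_bigr do rewrite (Hb _).2.
  by case: eqP => // _; rewrite big1.
- apply: (@le_trans _ _ (\int[P]_w g w)); first by apply: le_Rintegral => //; have [] := sS.
  rewrite RintegralZl// Rintegral_sum//; last first.
    by move=> l; apply: integrableRD => //; [have [] := ib4 i l|have [] := ib4 j l].
  rewrite (eq_bigr (fun=> 6 * delta ^+ 2)); last first.
    move=> l _; have [i1 E1] := ib4 i l; have [i2 E2] := ib4 j l.
    by rewrite RintegralD// E1 E2 rS; ring.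
  rewrite sumr_const card_ord -mulr_natl le_eqVlt; apply/orP; left; apply/eqP.
  by field.
Qed.

End discrete_estimates.

(** * Iterated limits in probability *)

Section double_limits.
Context d (Omega : measurableType d) (R : realType) (P : probability Omega R).
Implicit Types (Z : nat -> nat -> Omega -> R).

(* Convergence to 0 in probability of an iterated limit. *)
Definition small2 Z := forall e : R, 0 < e ->
  \forall N \near \oo, \forall q \near \oo, Pbound P (Z N q) e e.

Lemma small2D Z1 Z2 : small2 Z1 -> small2 Z2 -> small2 (fun N q w => Z1 N q w + Z2 N q w).
Proof.
move=> S1 S2 e e0; have e2 : 0 < e / 2 by rewrite divr_gt0.
apply: filterS2 (S1 _ e2) (S2 _ e2) => N; apply: filterS2 => q P1 P2.
by rewrite [e]splitr; exact: PboundD.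
Qed.

Lemma small2Z (c : R) Z : small2 Z -> small2 (fun N q w => c * Z N q w).
Proof.
move=> S e e0; have c1 : 0 < `|c| + 1 by rewrite ltr_wpDl.
have e2 : 0 < e / (`|c| + 1) by rewrite divr_gt0.
apply: filterS (S _ e2) => N; apply: filterS => q PZ.
apply: Pbound_le (PboundZ c PZ).
  by rewrite mulrCA ler_piMr ?(ltW e0)// ler_pdivrMr// mul1r lerDl.
by rewrite ler_pdivrMr// ler_peMr ?(ltW e0)// lerDr.
Qed.

Lemma small2_sum I (r : seq I) (Z : I -> nat -> nat -> Omega -> R) : (forall i, small2 (Z i)) ->
  small2 (fun N q w => \sum_(i <- r) Z i N q w).
Proof.
move=> SZ; elim: r => [|i r IH].
  move=> e e0; apply: nearW => N; apply: nearW => q; exists set0; split=> //.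
    by rewrite measure0 lee_fin ltW.
  by move=> w _; rewrite big_nil normr0 ltW.
move=> e e0; apply: filterS (small2D (SZ i) IH e0) => N; apply: filterS => q.
by apply: Pbound_eq => w; rewrite big_cons.
Qed.

Lemma small2_eq Z1 Z2 : (forall N q w, (0 < N)%N -> (0 < q)%N -> Z1 N q w = Z2 N q w) ->
  small2 Z1 -> small2 Z2.
Proof.
move=> E S e e0; apply: filterS2 (nbhs_infty_gt 0) (S e e0) => N N0.
apply: filterS2 (nbhs_infty_gt 0) => q q0.
by apply: Pbound_eq => w; rewrite E.
Qed.

(** A uniform bound in L2 turns convergence to 0 in probability into convergence of the means. *)
Lemma small2_expectation Z (M : R) : small2 Z ->
  (forall N q, (0 < N)%N -> (0 < q)%N -> sqint P (Z N q) /\ \int[P]_w (Z N q w ^+ 2) <= M) ->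
  forall e : R, 0 < e -> \forall N \near \oo, \forall q \near \oo, `|\int[P]_w Z N q w| <= e.
Proof.
move=> SZ ZM e e0.
have M1 : 0 < `|M| + 1 by rewrite ltr_wpDl.
(* [c] and [e'] make each of the three terms of [Pbound_expectation] at most [e / 3]. *)
pose c := e / 3 / (`|M| + 1); have c0 : 0 < c by rewrite !divr_gt0.
pose e' := Num.min (e / 3) (c * (e / 3)).
have e'0 : 0 < e' by rewrite lt_min !divr_gt0//= mulr_gt0// divr_gt0.
apply: filterS2 (nbhs_infty_gt 0) (SZ _ e'0) => N N0.
apply: filterS2 (nbhs_infty_gt 0) => q q0 PZ.
have [sZ EZ] := ZM N q N0 q0.
apply: (le_trans (Pbound_expectation sZ EZ (ltW e'0) c0 PZ)).
have -> : e = e / 3 + e / 3 + e / 3 by field.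
apply: lerD; first apply: lerD; first by rewrite ge_min lexx.
  rewrite /c mulrAC ler_pdivrMr// ler_wpM2l ?divr_ge0 ?(ltW e0)//.
  by rewrite (le_trans (ler_norm M))// lerDl.
by rewrite ler_pdivrMr// [X in _ <= X]mulrC ge_min lexx orbT.
Qed.

Lemma Pbound_sqrt (Y : Omega -> R) (M K : R) : sqint P Y -> \int[P]_w (Y w ^+ 2) <= M -> 0 < K ->
  Pbound P Y K (M / K ^+ 2).
Proof.
move=> [mY iY] YM K0; have K2 : 0 < K ^+ 2 by rewrite exprn_gt0.
have YM' : \int[P]_w `|Y w ^+ 2| <= M by under eq_Rintegral do rewrite ger0_norm ?sqr_ge0//.
have [A [mA PA HA]] := Pbound_markov iY YM' K2; exists A; split=> // w /HA.
by rewrite normrX ler_sqr// nnegrE ltW.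
Qed.

End double_limits.

Lemma near_right_seq (R : realType) (Q : R -> Prop) (t : R) : 0 < t ->
  (\forall u \near 0^'+, Q u) -> \forall N \near \oo, Q (t / N%:R).
Proof.
move=> t0 [e /= e0 H]; near=> N.
have N0 : 0 < N%:R :> R by rewrite ltr0n; near: N; exact: nbhs_infty_gt.
apply: H; last by rewrite divr_gt0.
rewrite /ball_/= sub0r normrN gtr0_norm ?divr_gt0// ltr_pdivrMr// -ltr_pdivrMl//.
by near: N; exact: nbhs_infty_gtr.
Unshelve. all: by end_near. Qed.

(** * Expansion of a solution on nested grids *)

Section sde.
Context {R : realType} {n : nat} {G : lieGroupType R n}.
Variables (m : nat) (V : 'I_m -> operator G).
Hypothesis V_left : forall i, left_invariant_vector_field (V i).
Context d (Omega : measurableType d) (P : probability Omega R).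
Variables (F : R -> set (set Omega)) (FF : filtration F).
Variables (B : 'I_m -> R -> Omega -> R) (BM : brownian_motion P F B).
Variables (x : G) (X : R -> Omega -> G) (SX : sde_solution P F V B x X).
Implicit Types (f u : G -> R) (t s : R).

Definition sublap f y := 2^-1 * \sum_(i < m) V i (V i f) y.

Lemma test_V i f : test_function f -> test_function (V i f).
Proof. exact: test_vf. Qed.

Lemma test_sublap f : test_function f -> test_function (sublap f).
Proof. by move=> tf; apply: testZ; apply: test_sum => i; do 2 apply: test_V. Qed.

Lemma Fmeas_sde u s : continuous u -> 0 <= s -> Fmeas F s (fun w => u (X s w)).
Proof.
move=> cu s0; apply/(Fmeas_preimage FF _ s0) => A mA.
have mu_ := continuous_borel cu measurableT mA; rewrite setTI in mu_.
exact: (sde_adapted SX s0 mu_).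
Qed.

Lemma measurable_sde u s : continuous u -> 0 <= s -> measurable_fun setT (fun w => u (X s w)).
Proof. by move=> cu s0; exact: (Fmeas_measurable FF s0 (Fmeas_sde cu s0)). Qed.

Lemma test_continuous f : test_function f -> continuous f.
Proof. by move=> [sf _]; exact: smooth_continuous. Qed.

Lemma integrable_sde f s : test_function f -> 0 <= s ->
  P.-integrable setT (EFin \o (fun w => f (X s w))).
Proof.
move=> tf s0; have [M [M0 fM]] := test_bounded tf.
by apply: (@integrable_of_bounded _ _ _ P _ M) => //; exact: measurable_sde (test_continuous tf) s0.
Qed.

Lemma measurable_B i s : 0 <= s -> measurable_fun setT (B i s).
Proof. by move=> s0; apply: (Fmeas_measurable FF s0); exact: adapted_Fmeas (bm_adapted BM i) s0. Qed.

Lemma stratonovich_grid (Y Z : R -> Omega -> R) T (I : Omega -> R) :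
  is_stratonovich_integral P Y Z T I ->
  (forall s, 0 <= s -> measurable_fun setT (Y s)) -> (forall s, 0 <= s -> measurable_fun setT (Z s)) ->
  forall e, 0 < e -> \forall delta \near 0^'+, forall k, k%:R * delta = T ->
    Pbound P (fun w => trapezoid_sum Y Z (grid delta k) w - I w) e e.
Proof.
move=> [mI HI] mY mZ e e0; have [d0 d00 H] := HI e e0.
near=> delta => k kT.
have dl0 : 0 < delta by near: delta; exact: nbhs_right_gt.
have part : itv_partition 0 T (grid delta k) by rewrite -kT; exact: grid_partition.
have mesh : mesh_le (grid delta k) d0.
  move=> l lk; apply: le_trans (grid_mesh lk) _.
  by near: delta; exact: nbhs_right_le.
have PA := H _ part mesh; set A := [set w | _] in PA.
exists A; split=> //; last by move=> w /negP; rewrite -ltNge => /ltW.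
rewrite /A -[X in measurable X]setTI.
have mT : measurable_fun setT (fun w => trapezoid_sum Y Z (grid delta k) w - I w).
  apply: measurable_funB => //.
  rewrite (_ : trapezoid_sum Y Z (grid delta k) = fun w => \sum_(l < k)
   (Y (l%:R * delta) w + Y (l.+1%:R * delta) w) / 2 * (Z (l.+1%:R * delta) w - Z (l%:R * delta) w)).
    have p (l : nat) : 0 <= l%:R * delta by rewrite mulr_ge0// ltW.
    apply: measurable_sum => l; apply: measurable_funM; last first.
      by apply: measurable_funB; apply: mZ.
    by apply: measurable_funM => //; apply: measurable_funD; apply: mY.
  by apply/funext => w; rewrite trapezoid_grid.
by apply: measurable_fun_ler => //; exact: measurableT_comp.
Unshelve. all: by end_near. Qed.

Lemma sde_grid f T : test_function f -> 0 <= T -> forall e, 0 < e ->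
  \forall delta \near 0^'+, forall k, k%:R * delta = T -> Pbound P (fun w => f (X T w) - f x -
    \sum_(i < m) trapezoid_sum (fun s w => V i f (X s w)) (B i) (grid delta k) w) e e.
Proof.
move=> tf T0 e e0; have [I strat fE] := sde_equation SX tf T0.
(* The tolerance is shared among the [m] integrals; [m.+1] keeps the share well defined when [m] is
   0. *)
have m1 : 0 < m.+1%:R :> R by rewrite ltr0n.
have em : 0 < e / m.+1%:R by rewrite divr_gt0.
have H : \forall delta \near 0^'+, forall i k, k%:R * delta = T ->
    Pbound P (fun w => trapezoid_sum (fun s w => V i f (X s w)) (B i) (grid delta k) w - I i w)
      (e / m.+1%:R) (e / m.+1%:R).
  apply: filter_forall => i; apply: stratonovich_grid (strat i) _ _ _ em => s s0.
    by apply: measurable_sde => //; exact/test_continuous/test_V.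
  exact: measurable_B.
apply: filterS H => delta H k kT.
apply: (@Pbound_ae _ _ _ _ (fun w => - 1 * \sum_(i < m) (trapezoid_sum
    (fun s w => V i f (X s w)) (B i) (grid delta k) w - I i w))).
  case: fE => N [mN PN sN]; exists N; split=> // w /= Hw; apply: sN => /= fE; apply: Hw.
  by rewrite fE sumrB mulN1r opprB [f x + _]addrC addrK.
have sm : size (index_enum 'I_m) = m by rewrite -sum1_size sum_nat_const card_ord muln1.
have := PboundZ (-1) (Pbound_sum (index_enum 'I_m) (fun i => H i k kT)).
rewrite normrN1 mul1r sm; apply: Pbound_le.
  by rewrite mulrA ler_pdivrMr// mulrC ler_wpM2l ?(ltW e0)// ler_nat.
by rewrite mulrA ler_pdivrMr// mulrC ler_wpM2l ?(ltW e0)// ler_nat.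
Qed.

Section expansion.
Variables (f : G -> R) (tf : test_function f) (t : R) (t_gt0 : 0 < t).

Let g i := V i f.
Let h i j := V j (V i f).
Let tg i : test_function (g i). Proof. exact: test_V. Qed.
Let th i j : test_function (h i j). Proof. by do 2 apply: test_V. Qed.

(** The coarse mesh; the fine mesh [dl N q] cuts every coarse interval into [q] pieces. *)
Let Dl (N : nat) : R := t / N%:R.
Let dl (N q : nat) : R := t / (N * q)%:R.
Let Hl i j N q l w := h i j (X (l%:R * dl N q) w).
Let bl i N q l w := B i (l.+1%:R * dl N q) w - B i (l%:R * dl N q) w.
Let DB i N k w := B i (k.+1%:R * Dl N) w - B i (k%:R * Dl N) w.

Let Dl_gt0 N : (0 < N)%N -> 0 < Dl N. Proof. by move=> N0; rewrite divr_gt0// ltr0n. Qed.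
Let dl_gt0 N q : (0 < N)%N -> (0 < q)%N -> 0 < dl N q.
Proof. by move=> N0 q0; rewrite divr_gt0// ltr0n muln_gt0 N0. Qed.
Let NDl N : (0 < N)%N -> N%:R * Dl N = t.
Proof. by move=> N0; rewrite mulrC divfK// pnatr_eq0 -lt0n. Qed.
Let Ndl N q : (0 < N)%N -> (0 < q)%N -> (N * q)%:R * dl N q = t.
Proof. by move=> N0 q0; rewrite mulrC divfK// pnatr_eq0 -lt0n muln_gt0 N0. Qed.
Let kdl N q k : (0 < N)%N -> (0 < q)%N -> (k * q)%:R * dl N q = k%:R * Dl N.
Proof.
move=> N0 q0; rewrite /dl /Dl !natrM invfM; have q1 : q%:R != 0 :> R by rewrite pnatr_eq0 -lt0n.
have n1 : N%:R != 0 :> R by rewrite pnatr_eq0 -lt0n.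
by field; rewrite q1 n1.
Qed.
Let qdl N q : (0 < N)%N -> (0 < q)%N -> q%:R * dl N q = Dl N.
Proof. by move=> N0 q0; have := @kdl N q 1 N0 q0; rewrite mul1n mul1r. Qed.

(** The terms of the expansion. [coarse] is the error of the equation for [f] on the coarse grid,
    and [err i k] that of the equation for [V i f] on the fine grid up to the coarse time [k]. The
    centered left endpoint sums form [mart]. Products of two increments over a coarse interval,
    expanded on the fine grid, give [diag] and [cross], and [osc] arises from the replacement of
    fine trapezoid averages by left endpoints. *)
Let coarse N (q : nat) w := f (X t w) - f x -
  \sum_(i < m) trapezoid_sum (fun s w => g i (X s w)) (B i) (grid (Dl N) N) w.
Let err i k N q w := g i (X (k%:R * Dl N) w) - g i x -
  \sum_(j < m) trapezoid_sum (fun s w => h i j (X s w)) (B j) (grid (dl N q) (k * q)) w.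
Let errsum i N q w := \sum_(k < N) (err i k.+1 N q w - err i k N q w) * DB i N k w.
Let cross i j N q w := \sum_(l < N * q)
  (block_partial (fun p => Hl i j N q p w * bl j N q p w) q l * bl i N q l w +
   block_partial (fun p => bl i N q p w) q l * (Hl i j N q l w * bl j N q l w)).
Let osc i j N q w := \sum_(k < N)
  (\sum_(p < q) (Hl i j N q (k * q + p).+1 w - Hl i j N q (k * q + p)%N w) * bl j N q (k * q + p)%N w) *
  (\sum_(p < q) bl i N q (k * q + p)%N w).
Let mart i N (q : nat) w := \sum_(k < N) g i (X (k%:R * Dl N) w) * DB i N k w.
Let diag i j N q w := \sum_(l < N * q) (Hl i j N q l w * bl j N q l w) * bl i N q l w.

Let remainder N q w := f (X t w) - f x - \sum_(i < m) mart i N q w -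
  2^-1 * \sum_(i < m) \sum_(j < m) diag i j N q w.

(** A trapezoid average is the left endpoint value plus half the increment of [g i] over the coarse
    interval. That increment is in turn replaced by its fine trapezoid sums, which involve [h i j],
    up to a difference of [err] terms. *)
Let expansion N q w : (0 < N)%N -> (0 < q)%N -> remainder N q w =
  coarse N q w + 2^-1 * \sum_(i < m) errsum i N q w +
  2^-1 * \sum_(i < m) \sum_(j < m) (cross i j N q w + 2^-1 * osc i j N q w).
Proof.
move=> N0 q0; rewrite /remainder /coarse.
suff E i : trapezoid_sum (fun s w => g i (X s w)) (B i) (grid (Dl N) N) w =
    mart i N q w + 2^-1 * errsum i N q w +
    2^-1 * (\sum_(j < m) diag i j N q w + \sum_(j < m) (cross i j N q w + 2^-1 * osc i j N q w)).
  rewrite (eq_bigr _ (fun i _ => E i)) !big_split /= -!big_distrr /= big_split /=.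
  by field.
rewrite trapezoid_grid.
have incE k : (k < N)%N -> g i (X (k.+1%:R * Dl N) w) - g i (X (k%:R * Dl N) w) =
    err i k.+1 N q w - err i k N q w + \sum_(j < m) \sum_(p < q)
      (Hl i j N q (k * q + p)%N w + Hl i j N q (k * q + p).+1 w) / 2 * bl j N q (k * q + p)%N w.
  move=> kN; rewrite /err.
  have -> : \sum_(j < m) trapezoid_sum (fun s w => h i j (X s w)) (B j) (grid (dl N q) (k.+1 * q)) w =
      \sum_(j < m) trapezoid_sum (fun s w => h i j (X s w)) (B j) (grid (dl N q) (k * q)) w +
      \sum_(j < m) \sum_(p < q)
      (Hl i j N q (k * q + p)%N w + Hl i j N q (k * q + p).+1 w) / 2 * bl j N q (k * q + p)%N w.
    rewrite -big_split /=; apply: eq_bigr => j _; rewrite !trapezoid_grid.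
    pose a l := (Hl i j N q l w + Hl i j N q l.+1 w) / 2 * bl j N q l w.
    by rewrite -(sum_blocks a) -(sum_blocks a) big_ord_recr.
  by ring.
have DBE k : \sum_(p < q) bl i N q (k * q + p)%N w = DB i N k w.
  rewrite (sum_shift (fun l => bl i N q l w)) /bl.
  rewrite (@telescope_sumr _ (k * q) _ (fun l => B i (l%:R * dl N q) w)) ?leq_addr//.
  by rewrite /DB !(kdl _ N0 q0) addnC -mulSn (kdl _ N0 q0).
rewrite (eq_bigr (fun k : 'I_N => g i (X (k%:R * Dl N) w) * DB i N k w +
   2^-1 * ((err i k.+1 N q w - err i k N q w) * DB i N k w) +
   2^-1 * \sum_(j < m) ((\sum_(p < q) Hl i j N q (k * q + p)%N w * bl j N q (k * q + p)%N w) *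
      (\sum_(p < q) bl i N q (k * q + p)%N w) +
   2^-1 * ((\sum_(p < q) (Hl i j N q (k * q + p).+1 w - Hl i j N q (k * q + p)%N w) *
      bl j N q (k * q + p)%N w) * (\sum_(p < q) bl i N q (k * q + p)%N w))))); last first.
  move=> k _; have := incE k (ltn_ord k).
  set S := \sum_(j < m) \sum_(p < q) _; set e1 := err _ _ _ _ _ - _ => E1.
  rewrite (_ : (_ + _) / 2 = g i (X (k%:R * Dl N) w) + 2^-1 * (e1 + S)); last first.
    by rewrite -E1; field.
  rewrite -[B i _ w - _]/(DB i N k w).
  rewrite [X in _ = _ + 2^-1 * X](_ : _ = S * DB i N k w); first by ring.
  rewrite /S big_distrl /=; apply: eq_bigr => j _; rewrite DBE mulrA -mulrDl; congr (_ * _).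
  rewrite big_distrr -big_split /=; apply: eq_bigr => p _.
  by field.
rewrite !big_split /= -!big_distrr /=; congr (_ + _ + 2^-1 * _).
rewrite exchange_big /= [in RHS]big_distrr -!big_split /=; apply: eq_bigr => j _.
rewrite big_split /= -big_distrr /= [RHS]addrA; congr (_ + _).
rewrite (mul_block_sums (fun l => Hl i j N q l w * bl j N q l w) (fun l => bl i N q l w)).
by rewrite /diag /cross -big_split /=; apply: eq_bigr => l _; rewrite addrA.
Qed.

Let gB i : exists M, 0 <= M /\ forall y, `|g i y| <= M. Proof. exact: test_bounded. Qed.
Let hB i j : exists M, 0 <= M /\ forall y, `|h i j y| <= M. Proof. exact: test_bounded. Qed.

Let FH i j N q l : (0 < N)%N -> (0 < q)%N -> Fmeas F (l%:R * dl N q) (Hl i j N q l).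
Proof.
move=> N0 q0; apply: Fmeas_sde; first exact: test_continuous.
by rewrite mulr_ge0// ltW// dl_gt0.
Qed.

Let small_coarse : small2 P coarse.
Proof.
move=> e e0; have := near_right_seq t_gt0 (sde_grid tf (ltW t_gt0) e0).
apply: filterS2 (nbhs_infty_gt 0) => N N0 H; apply: nearW => q.
by apply: H; exact: NDl.
Qed.

Let near_small (c e : R) : 0 <= c -> 0 < e -> \forall N \near \oo, c * Dl N <= e.
Proof.
move=> c0 e0; near=> N; have N0 : 0 < N%:R :> R by rewrite ltr0n; near: N; exact: nbhs_infty_gt.
rewrite /Dl mulrA ler_pdivrMr// -ler_pdivrMl//.
by near: N; exact: nbhs_infty_ger.
Unshelve. all: by end_near. Qed.

(** The second moment is of the order of the coarse mesh, uniformly in [q]. *)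
Let small_cross i j : small2 P (cross i j).
Proof.
have [C [C0 hC]] := hB i j; move=> e e0; have e2 : 0 < e ^+ 2 by rewrite exprn_gt0.
have c0 : 0 <= 4 * (C ^+ 2 * t) by rewrite !mulr_ge0// ?sqr_ge0// ltW.
apply: filterS2 (nbhs_infty_gt 0) (near_small c0 (mulr_gt0 e0 e2)) => N N0 Ne.
apply: filterS (nbhs_infty_gt 0) => q q0.
have [sS _ ES] := cross_term_bound FF BM (dl_gt0 N0 q0) (H := Hl i j N q) i j (N * q) q0
  (fun l => @FH i j N q l N0 q0) (fun l w => hC (X (l%:R * dl N q) w)).
rewrite (qdl N0 q0) (Ndl N0 q0) in ES.
apply: Pbound_le (Pbound_sqrt sS ES e0) => //.
rewrite ler_pdivrMr//; apply: le_trans Ne.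
by rewrite le_eqVlt; apply/orP; left; apply/eqP; ring.
Qed.

Let small_osc i j : small2 P (osc i j).
Proof.
move=> e e0; have e2 : 0 < e / 2 by rewrite divr_gt0.
have [K HK] := tight_sqvar_semimartingale FF (sde_semimartingale SX (th i j)) t_gt0 e2.
have K1 : 0 < `|K| + 1 by rewrite ltr_wpDl.
(* [eta] makes the sum of squares contribute at most [e / 2], and [s] then makes [s / (4 eta)] equal
   to [e / 2]. The remaining exceptional probability is of the order of the coarse mesh. *)
pose eta := e / 2 / (`|K| + 1); have eta0 : 0 < eta by rewrite divr_gt0.
pose s := 2 * eta * e; have s0 : 0 < s by rewrite !mulr_gt0.
have c0 : 0 <= 3 * t by rewrite mulr_ge0// ltW.
apply: filterS2 (nbhs_infty_gt 0) (near_small c0 (mulr_gt0 e2 s0)) => N N0 Ne.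
apply: filterS (nbhs_infty_gt 0) => q q0.
have := integrand_increment_bound FF BM (dl_gt0 N0 q0) (H := Hl i j N q) i j q0 eta0 s0
  (HK (N * q)%N (dl N q) (dl_gt0 N0 q0) (Ndl N0 q0)).
rewrite (qdl N0 q0) -natrM (Ndl N0 q0); apply: Pbound_le.
  rewrite [leRHS]splitr; apply: lerD.
    rewrite /eta mulrAC ler_pdivrMr// ler_wpM2l ?(ltW e2)//.
    by rewrite (le_trans (ler_norm K))// lerDl.
  by rewrite /s le_eqVlt; apply/orP; left; apply/eqP; field; rewrite gt_eqF.
by rewrite [leRHS]splitr lerD2l ler_pdivrMr.
Qed.

(** This term makes the limit an iterated one. For fixed [N] there are finitely many coarse Brownian
    increments, each bounded in probability, and the errors that multiply them vanish as [q] tends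
    to infinity. *)
Let small_err i : small2 P (errsum i).
Proof.
move=> e e0; apply: filterS (nbhs_infty_gt 0) => N N0.
have N1 : 0 < N%:R :> R by rewrite ltr0n.
pose e' := e / N%:R; have e'0 : 0 < e' by rewrite divr_gt0.
have errP k e1 : 0 < e1 -> \forall q \near \oo, Pbound P (err i k N q) e1 e1.
  move=> e10; have kD : 0 <= k%:R * Dl N by rewrite mulr_ge0// ltW// Dl_gt0.
  have := near_right_seq (Dl_gt0 N0) (sde_grid (tg i) kD e10).
  apply: filterS2 (nbhs_infty_gt 0) => q q0.
  have -> : Dl N / q%:R = dl N q.
    by rewrite -(qdl N0 q0) mulrC mulKf// pnatr_eq0 -lt0n.
  by apply; exact: kdl.
have H : \forall q \near \oo, forall k : 'I_N,
    Pbound P (fun w => (err i k.+1 N q w - err i k N q w) * DB i N k w) e' e'.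
  apply: filter_forall => k.
  have mDB : measurable_fun setT (DB i N k).
    by apply: measurable_funB; apply: measurable_B; rewrite mulr_ge0// ltW// Dl_gt0.
  have e2 : 0 < e' / 2 by rewrite divr_gt0.
  have [|K /(_ 0) HK] := Pbound_pointwise P (fun=> mDB) _ e2.
    by move=> w; exists `|DB i N k w| => _.
  have K1 : 0 < `|K| + 1 by rewrite ltr_wpDl.
  pose e1 := Num.min (e' / 4) (e' / 2 / (`|K| + 1)).
  have e10 : 0 < e1 by rewrite lt_min !divr_gt0.
  have e14 : e1 <= e' / 4 by rewrite ge_min lexx.
  have e1K : e1 * (`|K| + 1) <= e' / 2 by rewrite -ler_pdivlMr// ge_min lexx orbT.
  apply: filterS2 (errP k.+1 _ e10) (errP k _ e10) => q P1 P2.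
  have P3 : Pbound P (fun w => err i k.+1 N q w - err i k N q w) (e1 + e1) (e1 + e1).
    by apply: Pbound2 P1 P2 => w h1 h2; rewrite (le_trans (ler_normB _ _))// lerD.
  have : Pbound P (fun w => (err i k.+1 N q w - err i k N q w) * DB i N k w) e' (e1 + e1 + e' / 2).
    apply: Pbound2 P3 HK => w h1 h2; rewrite normrM.
    apply: (@le_trans _ _ ((e1 + e1) * (`|K| + 1))).
      by rewrite ler_pM// (le_trans h2)// (le_trans (ler_norm K))// lerDl.
    by rewrite mulrDl [leRHS]splitr lerD.
  by apply: Pbound_le => //; lra.
apply: filterS H => q H.
have sN : size (index_enum 'I_N) = N by rewrite -sum1_size sum_nat_const card_ord muln1.
have := Pbound_sum (index_enum 'I_N) H; rewrite sN.
have -> : N%:R * e' = e by rewrite mulrC divfK// gt_eqF.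
by [].
Qed.

Let small_remainder : small2 P remainder.
Proof.
apply: (@small2_eq _ _ _ _ (fun N q w => coarse N q w + 2^-1 * \sum_(i < m) errsum i N q w +
  2^-1 * \sum_(i < m) \sum_(j < m) (cross i j N q w + 2^-1 * osc i j N q w))).
  by move=> N q w N0 q0; rewrite expansion.
apply: small2D; first apply: small2D => //.
  by apply: small2Z; apply: small2_sum => i; exact: small_err.
apply: small2Z; apply: small2_sum => i; apply: small2_sum => j.
by apply: small2D; [exact: small_cross|apply: small2Z; exact: small_osc].
Qed.

(** A bound in L2 uniform over all pairs of grids, to be paired with smallness in probability in
    [small2_expectation]. *)
Let unif (Z : nat -> nat -> Omega -> R) := exists M, forall N q, (0 < N)%N -> (0 < q)%N ->
  sqint P (Z N q) /\ \int[P]_w (Z N q w ^+ 2) <= M.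

Let unifD Z1 Z2 : unif Z1 -> unif Z2 -> unif (fun N q w => Z1 N q w + Z2 N q w).
Proof.
move=> [M1 H1] [M2 H2]; exists (2 * M1 + 2 * M2) => N q N0 q0.
have [s1 E1] := H1 N q N0 q0; have [s2 E2] := H2 N q N0 q0.
split; first exact: sqintD.
by apply: (le_trans (sqint_normD_le s1 s2)); apply: lerD; rewrite ler_wpM2l.
Qed.

Let unifZ c Z : unif Z -> unif (fun N q w => c * Z N q w).
Proof.
move=> [M H]; exists (c ^+ 2 * M) => N q N0 q0; have [sZ E] := H N q N0 q0.
split; first exact: sqintZ.
under eq_Rintegral do rewrite exprMn.
by have [_ iZ] := sZ; rewrite RintegralZl// ler_wpM2l// sqr_ge0.
Qed.

Let unif_sum I (s : seq I) (Z : I -> nat -> nat -> Omega -> R) : (forall i, unif (Z i)) ->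
  unif (fun N q w => \sum_(i <- s) Z i N q w).
Proof.
move=> uZ; elim: s => [|i s [M H]].
  exists 0 => N q N0 q0.
  have -> : (fun w : Omega => \sum_(i <- [::]) Z i N q w) = fun=> 0.
    by apply/funext => w; rewrite big_nil.
  under eq_Rintegral do rewrite big_nil expr0n /=.
  rewrite Rintegral_cst_prob; split=> //.
  by apply: (@sqint_bounded _ _ _ _ _ 0) => // w; rewrite normr0.
have uS : unif (fun N q w => \sum_(j <- s) Z j N q w) by exists M.
have [M' H'] := unifD (uZ i) uS; exists M' => N q N0 q0.
rewrite (_ : (fun w => \sum_(j <- i :: s) Z j N q w) =
  (fun w => Z i N q w + \sum_(j <- s) Z j N q w)); last by apply/funext => w; rewrite big_cons.
under eq_Rintegral do rewrite big_cons.
exact: H'.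
Qed.

Let mart_bound i N (q : nat) (C : R) : 0 <= C -> (forall y, `|g i y| <= C) -> (0 < N)%N ->
  [/\ sqint P (mart i N q), \int[P]_w mart i N q w = 0 & \int[P]_w (mart i N q w ^+ 2) <= C ^+ 2 * t].
Proof.
move=> C0 gC N0; pose Z k w := g i (X (k%:R * Dl N) w).
have pD k : 0 <= k%:R * Dl N by rewrite mulr_ge0// ltW// Dl_gt0.
have FZ k : Fmeas F (k%:R * Dl N) (Z k) by apply: Fmeas_sde => //; exact: test_continuous.
have mZ k : measurable_fun setT (Z k) by exact: (Fmeas_measurable FF (pD k) (FZ k)).
have sZ k : sqint P (Z k) by apply: (@sqint_bounded _ _ _ _ _ C) => // w; exact: gC.
have EZ k : \int[P]_w (Z k w ^+ 2) <= C ^+ 2.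
  rewrite -[leRHS](Rintegral_cst_prob P); apply: le_Rintegral => //; first by have [] := sZ k.
    exact: finite_measure_integrable_cst.
  move=> w _; rewrite -[Z k w ^+ 2]ger0_norm ?sqr_ge0// normrX lerXn2r//.
  exact: gC.
have := discrete_ito_bound FF BM (Dl_gt0 N0) i N FZ sZ EZ.
by rewrite (NDl N0).
Qed.

Let diag_bound i j N q (C : R) : (forall y, `|h i j y| <= C) -> (0 < N)%N -> (0 < q)%N ->
  [/\ sqint P (diag i j N q), \int[P]_w diag i j N q w =
      (if i == j then \sum_(l < N * q) (\int[P]_w Hl i j N q l w) * dl N q else 0) &
      \int[P]_w (diag i j N q w ^+ 2) <= 3 * (C * t) ^+ 2].
Proof.
move=> hC N0 q0.
have := diagonal_term_bound FF BM (dl_gt0 N0 q0) (H := Hl i j N q) i j (N * q) (fun l => @FH i j N q l N0 q0)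
  (fun l w => hC (X (l%:R * dl N q) w)).
by rewrite (Ndl N0 q0).
Qed.

Let sqint_ft : sqint P (fun w => f (X t w) - f x).
Proof.
have [M [M0 fM]] := test_bounded tf.
apply: (@sqint_bounded _ _ _ _ _ (M + M)).
  by apply: measurable_funB => //; apply: measurable_sde; [exact: test_continuous|exact: ltW].
by move=> w; rewrite (le_trans (ler_normB _ _))// lerD.
Qed.

Let remainderE N q : remainder N q = fun w => (f (X t w) - f x) + -1 * \sum_(i < m) mart i N q w +
  - 2^-1 * \sum_(i < m) \sum_(j < m) diag i j N q w.
Proof. by apply/funext => w; rewrite /remainder mulN1r mulNr. Qed.

Let unif_remainder : unif remainder.
Proof.
have u1 : unif (fun _ _ w => f (X t w) - f x) by eexists; split; first exact: sqint_ft.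
have u2 : unif (fun N q w => -1 * \sum_(i < m) mart i N q w).
  apply: unifZ; apply: unif_sum => i; have [C [C0 gC]] := gB i.
  by exists (C ^+ 2 * t) => N q N0 q0; have [] := @mart_bound i N q C C0 gC N0.
have u3 : unif (fun N q w => - 2^-1 * \sum_(i < m) \sum_(j < m) diag i j N q w).
  apply: unifZ; apply: unif_sum => i; apply: unif_sum => j; have [C [C0 hC]] := hB i j.
  by exists (3 * (C * t) ^+ 2) => N q N0 q0; have [] := @diag_bound i j N q C hC N0 q0.
have [M H] := unifD (unifD u1 u2) u3; exists M => N q N0 q0.
by rewrite remainderE; exact: H.
Qed.

Let E_remainder N q : (0 < N)%N -> (0 < q)%N -> \int[P]_w remainder N q w =
  \int[P]_w f (X t w) - f x - \sum_(l < N * q) (\int[P]_w sublap f (X (l%:R * dl N q) w)) * dl N q.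
Proof.
move=> N0 q0; rewrite remainderE.
have sm i : sqint P (mart i N q) /\ \int[P]_w mart i N q w = 0.
  by have [C [C0 gC]] := gB i; have [] := @mart_bound i N q C C0 gC N0.
have sd i j : sqint P (diag i j N q) /\ \int[P]_w diag i j N q w =
    (if i == j then \sum_(l < N * q) (\int[P]_w Hl i j N q l w) * dl N q else 0).
  by have [C [C0 hC]] := hB i j; have [] := @diag_bound i j N q C hC N0 q0.
have i1 := sqint_integrable sqint_ft.
have i2 : P.-integrable setT (EFin \o (fun w => \sum_(i < m) mart i N q w)).
  by apply: integrableR_sum => // i; apply: sqint_integrable; have [] := sm i.
have i3' i : P.-integrable setT (EFin \o (fun w => \sum_(j < m) diag i j N q w)).
  by apply: integrableR_sum => // j; apply: sqint_integrable; have [] := sd i j.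
have i3 : P.-integrable setT (EFin \o (fun w => \sum_(i < m) \sum_(j < m) diag i j N q w)).
  exact: integrableR_sum.
rewrite RintegralD//; last 2 first.
- by apply: integrableRD => //; exact: integrableRZ.
- exact: integrableRZ.
rewrite RintegralD//; last exact: integrableRZ.
rewrite !RintegralZl// RintegralB//; last 2 first.
- exact: integrable_sde (ltW t_gt0).
- exact: finite_measure_integrable_cst.
rewrite Rintegral_cst_prob Rintegral_sum//; last by move=> i; apply: sqint_integrable; have [] := sm i.
rewrite big1 ?mulr0 ?addr0; last by move=> i _; have [] := sm i.
rewrite Rintegral_sum// mulNr; congr (_ - _).
rewrite big_distrr /=.
have -> : \sum_(l < N * q) (\int[P]_w sublap f (X (l%:R * dl N q) w)) * dl N q =
    \sum_(l < N * q) \sum_(i < m) 2^-1 * ((\int[P]_w Hl i i N q l w) * dl N q).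
  apply: eq_bigr => l _; have l0 : 0 <= l%:R * dl N q by rewrite mulr_ge0// ltW// dl_gt0.
  have ih i : P.-integrable setT (EFin \o (fun w => Hl i i N q l w)) by exact: integrable_sde.
  rewrite /sublap RintegralZl//; last exact: integrableR_sum.
  have -> : \int[P]_w (\sum_(i < m) V i (V i f) (X (l%:R * dl N q) w)) =
      \sum_(i < m) \int[P]_w Hl i i N q l w by rewrite -Rintegral_sum.
  by rewrite -mulrA big_distrl big_distrr.
rewrite exchange_big /=; apply: eq_bigr => i _.
rewrite Rintegral_sum; [|by []|by move=> j; apply: sqint_integrable; have [] := sd i j].
rewrite (bigD1 i)//= big1 ?addr0; last by move=> j ji; rewrite (sd i j).2 eq_sym (negPf ji).
by rewrite (sd i i).2 eqxx big_distrr.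
Qed.

(** The left side is the mean of [remainder]: [mart] has mean 0, and the diagonal terms with [i = j]
    sum to the Riemann sum of the means of [sublap V f]. *)
Lemma dynkin_riemann e : 0 < e -> \forall N \near \oo, \forall q \near \oo,
  `|\int[P]_w f (X t w) - f x -
    \sum_(l < N * q) (\int[P]_w sublap f (X (l%:R * (t / (N * q)%:R)) w)) * (t / (N * q)%:R)| <= e.
Proof.
move=> e0; have [M uM] := unif_remainder.
apply: filterS2 (nbhs_infty_gt 0) (small2_expectation small_remainder uM e0) => N N0.
by apply: filterS2 (nbhs_infty_gt 0) => q q0; rewrite E_remainder.
Qed.

End expansion.
End sde.

(** * Riemann sums *)

Section riemann_sums.
Context {R : realType}.
Notation leb := (@lebesgue_measure R).

(** Continuity on the half line in terms of sequences: values at negative times are arbitrary, and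
    the continuity of expectations comes from dominated convergence, which concerns sequences. *)
Definition seq_continuous_ge0 (phi : R -> R) := forall (s : R) (u : nat -> R), 0 <= s ->
  (forall k, 0 <= u k) -> u @ \oo --> s -> phi (u k) @[k --> \oo] --> phi s.

(** The Riemann sums are the integrals of the step functions [step k], which converge to [phi]
    pointwise and are bounded by [M]; measurability of [phi] comes with the limit. *)
Lemma riemann_sum_cvg (phi : R -> R) (t M : R) : 0 < t ->
  (forall s, 0 <= s -> `|phi s| <= M) -> seq_continuous_ge0 phi ->
  leb.-integrable `[0, t] (EFin \o phi) /\
  \sum_(l < k) phi (l%:R * (t / k%:R)) * (t / k%:R) @[k --> \oo] --> \int[leb]_(s in `[0, t]) phi s.
Proof.
move=> t0 phiM cphi.
pose T := measurableTypeR R.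
pose D : set T := `[0, t]%classic; have mD : measurable D by exact: measurable_itv.
pose J k (l : nat) : set T := `[l%:R * (t / k%:R), l.+1%:R * (t / k%:R)[%classic.
have mJ k l : measurable (J k l) by exact: measurable_itv.
have mt : measurable [set t : T] by [].
(* The half-open cells miss the endpoint [t]; the last term sets the value there and does not
   contribute to the integral. *)
pose step k (s : T) : R := \sum_(l < k) phi (l%:R * (t / k%:R)) * \1_(J k l) s + phi t * \1_[set t : T] s.
have mstep k : measurable_fun setT (step k).
  apply: measurable_funD; last by apply: measurable_funM.
  by apply: measurable_sum => l; apply: measurable_funM => //; exact: measurable_indic.
have stepE k (s : R) : (0 < k)%N -> 0 <= s < t ->
    step k s = phi ((Num.trunc (s / (t / k%:R)))%:R * (t / k%:R)).
  move=> k0 /andP[s0 st]; have dk : 0 < t / k%:R by rewrite divr_gt0// ltr0n.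
  set j := Num.trunc _; have /andP[j1 j2] : j%:R <= s / (t / k%:R) < j.+1%:R.
    by apply: truncn_itv; rewrite divr_ge0// ltW.
  rewrite ler_pdivlMr// in j1; rewrite ltr_pdivrMr// in j2.
  have jk : (j < k)%N.
    rewrite -(ltr_nat R) -(ltr_pM2r dk) (le_lt_trans j1)// (lt_le_trans st)//.
    by rewrite mulrC divfK// pnatr_eq0 -lt0n.
  rewrite /step (bigD1 (Ordinal jk))//= big1.
    rewrite addr0 indicE mem_set ?mulr1; last by rewrite /J /= in_itv /= j1.
    by rewrite indicE memNset ?mulr0 ?addr0//= => E; rewrite E ltxx in st.
  move=> l lj; rewrite indicE memNset ?mulr0// /J /= in_itv /= => /andP[l1 l2].
  move: lj; rewrite -val_eqE /= => /eqP; apply; apply/eqP; rewrite eqn_leq; apply/andP; split.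
    by rewrite -ltnS -(ltr_nat R) -(ltr_pM2r dk) (le_lt_trans l1).
  by rewrite -ltnS -(ltr_nat R) -(ltr_pM2r dk) (le_lt_trans j1).
have step_t k : step k t = phi t.
  rewrite /step [\1_[set t : T] t]indicE mem_set// mulr1 big1 ?add0r// => l _.
  rewrite indicE memNset ?mulr0// /J /= in_itv /= => /andP[_].
  have k0 : (0 < k)%N by apply: leq_ltn_trans (ltn_ord l).
  rewrite ltNge => /negP; apply; rewrite -[leRHS](divfK (_ : k%:R != 0)) ?pnatr_eq0 -?lt0n//.
  by rewrite mulrC ler_pM2l ?divr_gt0 ?ltr0n// ler_nat.
have M0 : 0 <= M by exact: le_trans (phiM 0 (lexx _)).
have iM : leb.-integrable D (EFin \o (fun=> M)).
  apply: continuous_compact_integrable; first exact: segment_compact.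
  by apply: continuous_subspaceT => ?; exact: cvg_cst.
have [| | |iphi C] := @dominated_cvg_Rintegral _ _ _ leb D step phi (fun=> M) mD _ _ iM.
- by move=> k; exact: measurable_funTS.
- move=> s; rewrite /D /= in_itv /= => /andP[s0]; rewrite le_eqVlt => /predU1P[->|st].
    by under eq_fun do rewrite step_t; exact: cvg_cst.
  have H : phi ((Num.trunc (s / (t / k.+1%:R)))%:R * (t / k.+1%:R)) @[k --> \oo] --> phi s.
    apply: cphi => //; first by move=> k; rewrite mulr_ge0// divr_ge0// ltW.
    apply/cvgrPdist_le => e e0; near=> k.
    have dk : 0 < t / k.+1%:R by rewrite divr_gt0// ltr0n.
    have /andP[j1 j2] := truncn_itv (divr_ge0 s0 (ltW dk)).
    rewrite ler_pdivlMr// in j1; rewrite ltr_pdivrMr// in j2.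
    rewrite ger0_norm ?subr_ge0// lerBlDl (le_trans (ltW j2))//.
    rewrite -natr1 mulrDl mul1r lerD2l ler_pdivrMr ?ltr0n// -ler_pdivrMl//.
    rewrite (@le_trans _ _ k%:R)// ?ler_nat//.
    by near: k; exact: nbhs_infty_ger.
  rewrite -(cvg_shiftS (step^~ s)).
  by under eq_fun do rewrite stepE ?s0//.
- move=> k s; rewrite /D /= in_itv /= => /andP[s0]; rewrite le_eqVlt => /predU1P[->|st].
    by rewrite step_t phiM// ltW.
  case: k => [|k]; last by rewrite stepE ?s0// phiM// mulr_ge0// divr_ge0// ltW.
  by rewrite /step big_ord0 add0r indicE memNset ?mulr0 ?normr0//= => E; rewrite E ltxx in st.
split=> //.
have i1 : leb.-integrable D (EFin \o (fun=> 1)).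
  apply: continuous_compact_integrable; first exact: segment_compact.
  by apply: continuous_subspaceT => ?; exact: cvg_cst.
have iind (A : set T) : measurable A -> leb.-integrable D (EFin \o (\1_A : T -> R)).
  move=> mA; apply: integrable_bounded_by i1 _ => //.
  by move=> s _; rewrite indicE; case: (_ \in _); rewrite /= ?normr1 ?normr0.
have IJ k (l : nat) : (l < k)%N -> \int[leb]_(s in D) \1_(J k l) s = t / k%:R.
  move=> lk; have k0 : (0 < k)%N by apply: leq_ltn_trans lk.
  have dk : 0 < t / k%:R by rewrite divr_gt0// ltr0n.
  rewrite /Rintegral integral_indic// setIidl; last first.
    move=> s; rewrite /J /D /= !in_itv /= => /andP[s1 s2].
    apply/andP; split; first by rewrite (le_trans _ s1)// mulr_ge0// ltW.
    rewrite (le_trans (ltW s2))//.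
    rewrite -[leRHS](divfK (_ : k%:R != 0)) ?pnatr_eq0 -?lt0n//.
    by rewrite [leRHS]mulrC ler_pM2r// ler_nat.
  have mJE : lebesgue_measure (J k l) = (t / k%:R)%:E.
    rewrite /J lebesgue_measure_itv /= lte_fin ltr_pM2r// ltr_nat ltnSn /=.
    by rewrite -EFinB -natr1 mulrDl mul1r addrAC subrr add0r.
  exact: (congr1 fine mJE).
have It : \int[leb]_(s in D) \1_[set t : T] s = 0.
  by rewrite /Rintegral integral_indic// (@subset_measure0 _ _ _ leb _ [set t : T])//; [exact: measurableI|exact: lebesgue_measure_set1].
have E k : \int[leb]_(s in D) step k s = \sum_(l < k) phi (l%:R * (t / k%:R)) * (t / k%:R).
  rewrite RintegralD//; last 2 first.
  - by apply: integrableR_sum => // l; apply: integrableRZ => //; exact: iind.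
  - by apply: integrableRZ => //; exact: iind.
  rewrite RintegralZl// ?It ?mulr0 ?addr0; last exact: iind.
  rewrite Rintegral_sum//; last by move=> l; apply: integrableRZ => //; exact: iind.
  by apply: eq_bigr => l _; rewrite RintegralZl// ?IJ//; exact: iind.
by under eq_fun do rewrite -E.
Unshelve. all: by end_near. Qed.

End riemann_sums.

(** * Dynkin's formula in integral form *)

Section dynkin.
Context {R : realType} {n : nat} {G : lieGroupType R n}.
Variables (m : nat) (V : 'I_m -> operator G).
Hypothesis V_left : forall i, left_invariant_vector_field (V i).
Context d (Omega : measurableType d) (P : probability Omega R).
Variables (F : R -> set (set Omega)) (FF : filtration F).
Variables (B : 'I_m -> R -> Omega -> R) (BM : brownian_motion P F B).
Variables (x : G) (X : R -> Omega -> G) (SX : sde_solution P F V B x X).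
Notation leb := (@lebesgue_measure R).

Lemma path_seq_continuous w (s : R) (u : nat -> R) : 0 <= s -> (forall k, 0 <= u k) ->
  u @ \oo --> s -> X (u k) w @[k --> \oo] --> X s w.
Proof.
move=> s0 u0 us; have cX : {within `[0, +oo[, continuous (X ^~ w)} by exact: (sde_continuous SX).
have /subspace_continuousP/(_ s) H := cX.
have := H _; rewrite /= in_itv /= andbT => /(_ s0) C.
apply: cvg_trans C; move=> A /= [e e0 HA].
have /cvgrPdist_lt/(_ e e0) us' := us; apply: filterS us' => k /= uk.
by apply: HA => //=; rewrite in_itv /= andbT.
Qed.

Lemma expectation_seq_continuous (H : nat -> G -> R) (H0 : G -> R) (M s : R) (u : nat -> R) :
  (forall k, continuous (H k)) -> (forall k y, `|H k y| <= M) -> 0 <= s -> (forall k, 0 <= u k) ->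
  (forall w, H k (X (u k) w) @[k --> \oo] --> H0 (X s w)) ->
  \int[P]_w H k (X (u k) w) @[k --> \oo] --> \int[P]_w H0 (X s w).
Proof.
move=> cH HM s0 u0 HH.
have [| | | |_ //] := @dominated_cvg_Rintegral _ _ _ P setT (fun k w => H k (X (u k) w))
  (fun w => H0 (X s w)) (fun=> M) measurableT.
- by move=> k; exact: (measurable_sde FF SX (cH k) (u0 k)).
- by move=> w _; exact: HH.
- exact: finite_measure_integrable_cst.
- by [].
Qed.

Lemma expectation_continuous f : test_function f ->
  seq_continuous_ge0 (fun s => \int[P]_w f (X s w)).
Proof.
move=> tf s u s0 u0 us; have cf := test_continuous tf; have [M [_ fM]] := test_bounded tf.
apply: (@expectation_seq_continuous (fun=> f) f M) => // w.
by apply: continuous_cvg; [exact: cf|exact: path_seq_continuous].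
Qed.

Lemma expectation_bound f (M s : R) : continuous f -> 0 <= s -> (forall y, `|f y| <= M) ->
  `|\int[P]_w f (X s w)| <= M.
Proof.
move=> cf s0 fM; rewrite -[leRHS](Rintegral_cst_prob P); apply: Rintegral_norm_le => //.
  exact: (measurable_sde FF SX cf s0).
exact: finite_measure_integrable_cst.
Qed.

Lemma dynkin f (t : R) : test_function f -> 0 <= t ->
  \int[P]_w f (X t w) = f x + \int[leb]_(s in `[0, t]) \int[P]_w sublap V f (X s w).
Proof.
move=> tf; rewrite le_eqVlt => /predU1P[<-|t0].
  rewrite set_itv1 Rintegral_set1 addr0 -[RHS](Rintegral_cst_prob P).
  by apply: eq_Rintegral => w _; rewrite (sde_start SX).
have tL := test_sublap V_left tf; have [M [M0 LM]] := test_bounded tL.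
have LM' (s : R) : 0 <= s -> `|\int[P]_w sublap V f (X s w)| <= M.
  by move=> s0; apply: expectation_bound LM => //; exact: test_continuous.
have [_ C] := riemann_sum_cvg t0 LM' (expectation_continuous tL).
apply/eqP; rewrite -subr_eq0 opprD addrA -normr_eq0 -[X in X == _]ger0_norm//; apply/eqP/normr0P.
rewrite -normr_le0; apply/ler_addgt0Pr => e e0; rewrite add0r normr_id.
have e2 : 0 < e / 2 by rewrite divr_gt0.
have [N [N0 H]] : exists N, (0 < N)%N /\ \forall q \near \oo, `|\int[P]_w f (X t w) - f x -
    \sum_(l < N * q) (\int[P]_w sublap V f (X (l%:R * (t / (N * q)%:R)) w)) * (t / (N * q)%:R)| <= e / 2.
  have [N1 _ HN] := filterI (nbhs_infty_gt 0) (dynkin_riemann V_left FF BM SX tf t0 e2).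
  by exists N1; have [] := HN N1 (leqnn _).
have /cvgrPdist_le/(_ _ e2)[k1 _ Hk] := C.
have [q1 _ Hq] := H.
(* [N] is now fixed; [q] passes the threshold of the inner limit and, as [N] is positive, [N * q]
   passes that of the Riemann sums. *)
pose q := maxn q1 (maxn k1 1).
have := Hq q (leq_maxl _ _).
have /Hk /= : (k1 <= N * q)%N.
  by rewrite (leq_trans _ (leq_pmull _ N0))// /q !leq_max leqnn orbT.
set I := \int[leb]_(_ in _) _; set S := \sum_(_ < _) _; set a := _ - f x => h1 h2.
rewrite [leRHS]splitr (_ : a - I = (a - S) - (I - S)); last by ring.
by rewrite (le_trans (ler_normB _ _))// lerD.
Qed.

End dynkin.

(** * Calculus along sequences *)

Section seq_calculus.
Context {R : realType}.
Notation leb := (@lebesgue_measure R).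
Implicit Types (f h : R -> R) (s t : R).

Lemma seq_continuous_for f s : seq_continuous_ge0 f -> 0 < s -> {for s, continuous f}.
Proof.
move=> cf s0; apply/(@cvg_nbhsP _ R^o) => u us.
have upos : \forall k \near \oo, 0 < u k by exact: (@cvgr_gt R nat \oo _ _ _ us _ s0).
(* The sequence is eventually positive; truncation at 0 makes all of its terms admissible. *)
have us' : Num.max (u k) 0 @[k --> \oo] --> s.
  apply: cvg_trans us; apply: near_eq_cvg; move: upos.
  by apply: filterS => k uk; rewrite max_l// ltW.
have u0 k : 0 <= Num.max (u k) 0 by rewrite le_max lexx orbT.
have := cf s _ (ltW s0) u0 us'; apply: cvg_trans; apply: near_eq_cvg; move: upos.
by apply: filterS => k uk; rewrite max_l// ltW.
Qed.

Lemma seq_continuous_right0 f : seq_continuous_ge0 f -> f @ 0^'+ --> f 0.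
Proof.
move=> cf; apply/cvg_at_rightP => u [u0 us]; apply: cf => // k.
by rewrite ltW.
Qed.

Lemma seq_continuous_within f t : seq_continuous_ge0 f -> 0 < t -> {within `[0, t], continuous f}.
Proof.
move=> cf t0; apply/continuous_within_itvP => //; split.
- by move=> s; rewrite in_itv /= => /andP[s0 _]; exact: seq_continuous_for.
- exact: seq_continuous_right0.
- exact/cvg_at_left_filter/seq_continuous_for.
Qed.

Lemma seq_continuous_integrable f t : seq_continuous_ge0 f -> 0 <= t ->
  leb.-integrable `[0, t] (EFin \o f).
Proof.
move=> cf; rewrite le_eqVlt => /predU1P[<-|t0]; last first.
  by apply: continuous_compact_integrable; [exact: segment_compact|exact: seq_continuous_within].
apply: continuous_compact_integrable; first exact: segment_compact.
by rewrite set_itv1; exact: continuous_subspace1.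
Qed.

Definition derive_ge0 f h := [/\ seq_continuous_ge0 f, seq_continuous_ge0 h &
  forall s, 0 < s -> is_derive s 1 f (h s)].

Lemma FTC_ge0 f h t : seq_continuous_ge0 f -> seq_continuous_ge0 h ->
  (forall s : R, 0 < s < t -> is_derive s 1 f (h s)) -> 0 <= t ->
  f t - f 0 = \int[leb]_(s in `[0, t]) h s.
Proof.
move=> cf ch dfh; rewrite le_eqVlt => /predU1P[<-|t0].
  by rewrite subrr set_itv1 Rintegral_set1.
rewrite /Rintegral (@continuous_FTC2 _ h f)//.
- exact: seq_continuous_within.
- split; first by move=> s; rewrite in_itv /= => sI; have [] := dfh s sI.
  + exact: seq_continuous_right0.
  + exact/cvg_at_left_filter/seq_continuous_for.
- by move=> s; rewrite in_itv /= => sI; rewrite derive1E; have [_ ->] := dfh s sI.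
Qed.

Lemma derive_ge0_integral f h c : seq_continuous_ge0 f -> seq_continuous_ge0 h ->
  (forall t, 0 <= t -> f t = c + \int[leb]_(s in `[0, t]) h s) -> derive_ge0 f h.
Proof.
move=> cf ch fE; split=> // s s0.
have s1 : s < s + 1 by rewrite ltrDl.
have [d1 d2] := continuous_FTC1_closed s1 (seq_continuous_integrable ch (ltW (lt_trans s0 s1)))
  s0 (seq_continuous_for ch s0).
have key (I : R -> R) : derivable I s 1 -> derive1 I s = h s -> is_derive s 1 (fun x => c + I x) (h s).
  move=> dI EI; have dI' : is_derive s 1 I (h s) by apply: DeriveDef; [exact: dI|rewrite -EI derive1E].
  suff : is_derive s 1 (cst c + I) (h s) by [].
  by apply: is_derive_eq; rewrite add0r.
have dI := key _ d1 d2.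
apply: near_eq_is_derive dI; near=> t; rewrite fE// ltW//.
near: t; exact: lt_nbhsr.
Unshelve. all: by end_near. Qed.

Lemma is_derive_Rintegral d (T : measurableType d) (nu : {measure set T -> \bar R})
    (f h : R -> T -> R) (g : T -> R) s : 0 < s ->
  (forall r : R, 0 < r -> nu.-integrable setT (EFin \o f r)) ->
  (forall (r : R) y, 0 < r -> is_derive r 1 (f ^~ y) (h r y)) ->
  nu.-integrable setT (EFin \o g) -> (forall (r : R) y, 0 < r < s + 1 -> `|h r y| <= g y) ->
  is_derive s 1 (fun r => \int[nu]_y f r y) (\int[nu]_y h s y).
Proof.
move=> s0 fi fh gi hg.
have sI : [set` `]0, s + 1[ ] s by rewrite /= in_itv /= s0 ltrDl ltr01.
have g0 y : 0 <= g y by apply: (le_trans (normr_ge0 (h s y))); apply: hg; rewrite s0 ltrDl ltr01.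
have fI r : [set` `]0, s + 1[ ] r -> nu.-integrable setT (EFin \o f r).
  by rewrite /= in_itv /= => /andP[r0 _]; exact: fi.
have dI r y : [set` `]0, s + 1[ ] r -> setT y -> derivable (f ^~ y) r 1.
  by rewrite /= in_itv /= => /andP[r0 _] _; have [] := fh r y r0.
have hE r y : 0 < r -> derive1 (f ^~ y) r = h r y.
  by move=> r0; rewrite derive1E; have [_ ->] := fh r y r0.
have bI r y : [set` `]0, s + 1[ ] r -> setT y -> `|derive1 (f ^~ y) r| <= g y.
  by rewrite /= in_itv /= => rI _; have /andP[r0 _] := rI; rewrite hE// hg.
have := cvg_differentiation_under_integral measurableT sI fI dI g0 gi bI.
have -> : \int[nu]_y derive1 (f ^~ y) s = \int[nu]_y h s y.
  by apply: eq_Rintegral => y _; rewrite hE.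
move=> C; apply: DeriveDef.
  by apply/cvg_ex; exists (\int[nu]_y h s y); under eq_fun do rewrite scaler1.
by rewrite /derive; under eq_fun do rewrite scaler1; exact: cvg_lim.
Qed.

(* Two-variable chain rule along the diagonal, for partial derivatives that are
   jointly continuous along sequences. *)
Lemma is_derive_diag (A a b : R -> R -> R) s (T : R) : 0 < s < T ->
  (forall r r' : R, 0 < r < T -> 0 < r' < T -> is_derive r 1 (A ^~ r') (a r r')) ->
  (forall r r' : R, 0 < r < T -> 0 < r' < T -> is_derive r' 1 (A r) (b r r')) ->
  (forall u v : nat -> R, (forall k, 0 < u k < T) -> (forall k, 0 < v k < T) ->
     u @ \oo --> s -> v @ \oo --> s ->
     a (u k) (v k) @[k --> \oo] --> a s s /\ b (u k) (v k) @[k --> \oo] --> b s s) ->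
  is_derive s 1 (fun r => A r r) (a s s + b s s).
Proof.
move=> sT dA dB cab.
have mvt (f h : R -> R) (x y : R) : 0 < x < T -> 0 < y < T ->
    (forall r : R, 0 < r < T -> is_derive r 1 f (h r)) ->
    exists c, [/\ 0 < c < T, `|c - x| <= `|y - x| & f y - f x = h c * (y - x)].
  move=> /andP[x0 xT] /andP[y0 yT] df.
  have cf r : 0 < r < T -> {for r, continuous f}.
    by move=> rT; apply/differentiable_continuous/derivable1_diffP; have [] := df r rT.
  have [xy|yx|->] := ltgtP x y; last by exists y; rewrite !subrr mulr0 y0 yT.
    have [||c] := @MVT R f h x y xy.
    - move=> r; rewrite in_itv /= => /andP[r1 r2]; apply: df.
      by rewrite (lt_trans x0 r1) (lt_trans r2 yT).
    - by apply: continuous_in_subspaceT => r; rewrite inE /= in_itv /= => /andP[r1 r2];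
        apply: cf; rewrite (lt_le_trans x0 r1) (le_lt_trans r2 yT).
    - rewrite in_itv /= => /andP[c1 c2] E; exists c; split=> //.
        by rewrite (lt_trans x0 c1) (lt_trans c2 yT).
      by rewrite !gtr0_norm ?subr_gt0// lerD2r ltW.
  have [||c] := @MVT R f h y x yx.
  - move=> r; rewrite in_itv /= => /andP[r1 r2]; apply: df.
    by rewrite (lt_trans y0 r1) (lt_trans r2 xT).
  - by apply: continuous_in_subspaceT => r; rewrite inE /= in_itv /= => /andP[r1 r2];
      apply: cf; rewrite (lt_le_trans y0 r1) (le_lt_trans r2 xT).
  - rewrite in_itv /= => /andP[c1 c2] E; exists c; split.
    + by rewrite (lt_trans y0 c1) (lt_trans c2 xT).
    + by rewrite !ltr0_norm ?subr_lt0// !opprB lerD2l lerN2 ltW.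
    + by rewrite -opprB E -mulrN opprB.
suff C : h^-1 *: (A (h + s) (h + s) - A s s) @[h --> 0^'] --> a s s + b s s.
  apply: DeriveDef.
    by apply/cvg_ex; exists (a s s + b s s); under eq_fun do rewrite scaler1.
  by rewrite /derive; under eq_fun do rewrite scaler1; exact: cvg_lim.
apply/cvgr_dnbhsP => u [un0 u0].
have us : u k + s @[k --> \oo] --> s by rewrite -[X in _ --> X]add0r; apply: cvgD => //; exact: cvg_cst.
(* Increments that leave the interval []0, T[] are replaced by 0, which leaves the tail of the
   sequence unchanged and lets the mean value theorem apply at every index. *)
pose u' k := if 0 < u k + s < T then u k else 0.
have u'T k : 0 < u' k + s < T by rewrite /u'; case: ifP => //; rewrite add0r.
have uu' : \forall k \near \oo, u' k = u k.
  have /andP[s0 sT'] := sT.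
  have P1 : \forall k \near \oo, 0 < u k + s by exact: (@cvgr_gt R nat \oo _ _ _ us _ s0).
  have P2 : \forall k \near \oo, u k + s < T by exact: (@cvgr_lt R nat \oo _ _ _ us _ sT').
  by apply: filterS2 P1 P2 => k h1 h2; rewrite /u' h1 h2.
(* The increment along the diagonal is split at [(s, u' k + s)]: first the first variable moves,
   with intermediate point [c k], then the second, with [e k]. *)
have [c cP] : exists c : nat -> R, forall k, [/\ 0 < c k < T, `|c k - s| <= `|u' k + s - s| &
    A (u' k + s) (u' k + s) - A s (u' k + s) = a (c k) (u' k + s) * (u' k + s - s)].
  have H k := mvt (A ^~ (u' k + s)) (a ^~ (u' k + s)) _ _ sT (u'T k) (fun r rT => dA r _ rT (u'T k)).
  by exists (fun k => sval (cid (H k))) => k; exact: (svalP (cid (H k))).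
have [e eP] : exists e : nat -> R, forall k, [/\ 0 < e k < T, `|e k - s| <= `|u' k + s - s| &
    A s (u' k + s) - A s s = b s (e k) * (u' k + s - s)].
  have H k := mvt (A s) (b s) _ _ sT (u'T k) (fun r rT => dB s r sT rT).
  by exists (fun k => sval (cid (H k))) => k; exact: (svalP (cid (H k))).
have u'0 : u' @ \oo --> (0 : R).
  by apply: cvg_trans u0; apply: near_eq_cvg; exact: filterS uu' => k.
have near_s (z : nat -> R) : (forall k, `|z k - s| <= `|u' k + s - s|) -> z @ \oo --> s.
  move=> zs; apply/cvgrPdist_le => eps eps0.
  have /cvgrPdist_le/(_ eps eps0) := u'0; apply: filterS => k /= ku.
  by rewrite distrC (le_trans (zs k))// addrK -normrN -[- u' k]add0r.
have [c1 c2] : c @ \oo --> s /\ e @ \oo --> s.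
  by split; apply: near_s => k; [have [] := cP k|have [] := eP k].
have u's : u' k + s @[k --> \oo] --> s.
  by apply: near_s => k.
have C1 := (cab c (fun k => u' k + s) (fun k => (let: And3 h _ _ := cP k in h)) u'T c1 u's).1.
have cs : (fun _ : nat => s) @ \oo --> s by exact: cvg_cst.
have C2 := (cab (fun=> s) e (fun=> sT) (fun k => (let: And3 h _ _ := eP k in h)) cs c2).2.
have C : a (c k) (u' k + s) + b s (e k) @[k --> \oo] --> a s s + b s s by exact: cvgD.
apply: cvg_trans C; apply: near_eq_cvg; apply: filterS uu' => k ku.
have [_ _ E1] := cP k; have [_ _ E2] := eP k.
rewrite /GRing.scale /= -ku (_ : A _ _ - A s s =
  (A (u' k + s) (u' k + s) - A s (u' k + s)) + (A s (u' k + s) - A s s)); last by ring.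
by rewrite E1 E2 addrK -mulrDl mulrC mulfK// ku un0.
Qed.

End seq_calculus.

(** * Commuting derivations and inversion *)

Section iterated_derivations.
Context {R : realType} {n : nat} {G : lieGroupType R n}.
Variables (mu : {measure set (borel G) -> \bar R}) (mu_haar : right_haar mu).
Implicit Types (f h : G -> R) (x y z : G) (H : G -> G -> R).

Let mu_compact (K : set G) : compact K -> (mu K < +oo)%E.
Proof. exact: (haar_compact mu_haar). Qed.

Lemma smooth2_cst f : smooth f -> smooth2 (fun (_ : G) y => f y).
Proof.
move=> sf c1 c2 a1 a2 k.
apply: (@Ck_on_comp_affine _ _ _ _ k _ _ snd snd) (sf c2 a2 k) => //.
- exact: open_cod2.
- by move=> z; have [] := is_diff_snd z.
- by move=> z w; have [d E] := is_diff_snd z; rewrite (deriveE w d) E.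
- by move=> z [].
Qed.

Lemma proper_testM f H : test_function f -> proper_support (fun x y => f y * H x y).
Proof.
move=> /test_functionP[_ [K cK fK]] C _; exists K => // x y _ /fK ->.
by rewrite mul0r.
Qed.

(** For a bump [b] at the identity, testing against [b * f] gives a vanishing integral of
    [b f^2]. *)
Lemma smooth_eq0_test f : smooth f -> (forall h, test_function h -> \int[mu]_y (h y * f y) = 0) ->
  f 1%g = 0.
Proof.
move=> sf H; apply/eqP/negPn/negP => f1.
have [b [tb b0 b1 _]] := ex_test_bump openT (I : setT (1%g : G)).
have tbf := test_smoothM tb sf.
have := @Rintegral_test_gt0 _ _ _ _ mu_haar _ (test_smoothM tbf sf).
have -> : \int[mu]_x (b x * f x * f x) = 0 by exact: H.
rewrite ltxx => K; suff : false by []; apply: K => [x|].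
  by rewrite -mulrA mulr_ge0// -expr2 sqr_ge0.
by rewrite -mulrA mulr_gt0// -expr2 lt_neqAle sqr_ge0 eq_sym sqrf_eq0 f1.
Qed.

Section commutation.
Variable D E : operator G.
Hypothesis D_smooth : forall f, smooth f -> smooth (D f).
Hypothesis D_linear : forall (c : R) f h, smooth f -> smooth h ->
  forall x, D (fun y => c * f y + h y) x = c * D f x + D h x.
Hypothesis D_leibniz : forall f h, smooth f -> smooth h ->
  forall x, D (fun y => f y * h y) x = f x * D h x + D f x * h x.
Hypothesis E_left : left_invariant_vector_field E.

Lemma smooth2_vf_snd H : smooth2 H -> smooth2 (fun x y => E (H x) y).
Proof.
move=> /smooth2_swap /(smooth2_derivation (vf_smooth E_left) (vf_linear E_left) (vf_leibniz E_left)).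
exact: smooth2_swap.
Qed.

(* Tested against h(y), both sides become -D(a |-> \int H(a, y) E h(y) dy)(x). *)
Lemma derivation_vf_comm H x : smooth2 H ->
  D (fun a => E (H a) 1%g) x = E (fun b => D (H ^~ b) x) 1%g.
Proof.
move=> sH; have sEH := smooth2_vf_snd sH; have sDH := smooth2_derivation D_smooth D_linear D_leibniz sH.
have s1 : smooth (fun b => D (fun a => E (H a) b) x).
  exact: (smooth2_fixl x (smooth2_derivation D_smooth D_linear D_leibniz sEH)).
have s2 : smooth (fun b => D (H ^~ b) x) by exact: (smooth2_fixl x sDH).
have s2' := vf_smooth E_left s2.
apply/eqP; rewrite -subr_eq0; apply/eqP.
apply: (@smooth_eq0_test (fun b => D (fun a => E (H a) b) x - E (fun b => D (H ^~ b) x) b)).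
  exact: smoothB.
move=> h th; have tEh := test_vf E_left th.
have int f k : test_function f -> smooth k -> mu.-integrable setT (EFin \o (fun y => f y * k y)).
  by move=> tf sk; apply: integrable_test => //; exact: test_smoothM.
have E1 : \int[mu]_y (h y * D (fun a => E (H a) y) x) =
    D (fun a => \int[mu]_y (h y * E (H a) y)) x.
  have sh : smooth2 (fun a y => h y * E (H a) y).
    by apply: smooth2M sEH; apply: smooth2_cst; case: th.
  rewrite (derivation_conv measurableT mu_compact D_linear D_leibniz x sh (proper_testM _ th)).
  apply: eq_Rintegral => y _; rewrite (derivationZ D_linear)//.
  exact: (smooth2_fixr y sEH).
have E2 : (fun a => \int[mu]_y (h y * E (H a) y)) = (fun a => -1 * \int[mu]_y (E h y * H a y)).
  apply/funext => a; rewrite mulN1r -[LHS]opprK -(integration_by_parts_vf mu_haar E_left th); last first.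
    exact: smooth2_fixl.
  by congr (- _); apply: eq_Rintegral => y _; rewrite mulrC.
have E3 : D (fun a => \int[mu]_y (E h y * H a y)) x = \int[mu]_y (E h y * D (H ^~ y) x).
  have sh : smooth2 (fun a y => E h y * H a y).
    by apply: smooth2M sH; apply: smooth2_cst; case: tEh.
  rewrite (derivation_conv measurableT mu_compact D_linear D_leibniz x sh (proper_testM _ tEh)).
  apply: eq_Rintegral => y _; rewrite (derivationZ D_linear)//.
  exact: (smooth2_fixr y sH).
have sI : smooth (fun a => \int[mu]_y (E h y * H a y)).
  apply: (smooth_conv measurableT mu_compact (H := fun a y => E h y * H a y)).
    by apply: smooth2M sH; apply: smooth2_cst; case: tEh.
  exact: proper_testM.
under eq_Rintegral do rewrite mulrBr.
rewrite RintegralB//; [|exact: int|exact: int].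
rewrite E1 E2 (derivationZ D_linear)// E3 mulN1r.
have -> : \int[mu]_y (E h y * D (H ^~ y) x) = \int[mu]_y (D (H ^~ y) x * E h y).
  by apply: eq_Rintegral => y _; rewrite mulrC.
by rewrite (integration_by_parts_vf mu_haar E_left th s2) opprK subrr.
Qed.

End commutation.

Section inversion.
Variables (D : operator G) (D_left : left_invariant_vector_field D).
Let Ds := vf_smooth D_left.
Let Dl := vf_linear D_left.
Let DL := vf_leibniz D_left.

(** Left invariance moves the point [x] to the identity, where [derivation_inv] applies. *)
Lemma vf_inv f x : smooth f -> D (fun y => f y^-1%g) x = - D (fun y => f (y * x^-1)%g) 1%g.
Proof.
move=> sf; rewrite -[x in LHS]mulg1 -(vf_translate D_left); last exact: smooth_inv.
rewrite -(derivation_inv Dl DL); last exact: smooth_rtrans.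
by congr (D _ _); apply/funext => y; rewrite invgM.
Qed.

(* D acts on y |-> f(y^-1) as minus the right invariant field with the same
   value at the identity, and it commutes with that field. *)
Lemma vf_sq_inv f x z : smooth f ->
  D (D (fun y => f (z * y^-1)%g)) x = D (D (fun y => f (y * x^-1)%g)) z.
Proof.
move=> sf; pose f1 y := f (z * y)%g; have sf1 : smooth f1 by exact: smooth_ltrans.
have s2 : smooth2 (fun b a => f1 (b * a)%g) by exact: smooth2_mul.
pose W y := D (fun b => f1 (b * y)%g) 1%g.
have sW : smooth W by exact: (smooth2_fixl 1%g (smooth2_derivation Ds Dl DL s2)).
have -> : D (fun y => f (z * y^-1)%g) = (fun y => -1 * W y^-1%g).
  by apply/funext => y; rewrite (vf_inv _ sf1) mulN1r.
rewrite (derivationZ Dl); last exact: smooth_inv.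
rewrite vf_inv// mulN1r opprK /W.
have sf2 : smooth (fun y => f1 (y * x^-1)%g) by exact: smooth_rtrans.
have s3 : smooth2 (fun a b => f1 (b * a * x^-1)%g) by exact: smooth2_swap (smooth2_mul sf2).
have -> : (fun y => D (fun b => f1 (b * (y * x^-1))%g) 1%g) =
    (fun a => D (fun b => f1 (b * a * x^-1)%g) 1%g).
  by apply/funext => y; congr (D _ _); apply/funext => b; rewrite mulgA.
rewrite (derivation_vf_comm Ds Dl DL D_left 1%g s3).
have -> : (fun b => D (fun a => f1 (b * a * x^-1)%g) 1%g) = D (fun y => f1 (y * x^-1)%g).
  by apply/funext => b; rewrite (vf_translate D_left b 1%g sf2) mulg1.
have sf3 : smooth (fun y => f (y * x^-1)%g) by exact: smooth_rtrans.
have -> : D (fun y => f1 (y * x^-1)%g) = (fun b => D (fun y => f (y * x^-1)%g) (z * b)%g).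
  apply/funext => b; rewrite -(vf_translate D_left z b sf3); congr (D _ _).
  by apply/funext => y; rewrite /f1 mulgA.
by rewrite (vf_translate D_left)// ?mulg1//; exact: Ds.
Qed.

End inversion.

End iterated_derivations.

(** * Heat solutions *)

Lemma exists_law d1 d2 (T1 : measurableType d1) (T2 : measurableType d2) (R : realType)
    (m : {measure set T1 -> \bar R}) (f : T1 -> T2) : measurable_fun setT f ->
  exists m' : {measure set T2 -> \bar R}, forall A, measurable A -> m (f @^-1` A) = m' A.
Proof.
by move=> mf; unshelve eexists (pushforward m f : {measure set T2 -> \bar R}).
Qed.

Section heat_solutions.
Context {R : realType} {n : nat} {G : lieGroupType R n}.
Implicit Types (f h : G -> R) (x y z : G) (r s t : R) (K : R -> G -> R) (H : G -> G -> R).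

(* [G] is second countable, so that sequences detect joint continuity. *)
Definition regular K :=
  (forall r z (u : nat -> R) (y : nat -> G), 0 <= r -> (forall k, 0 <= u k) ->
     u @ \oo --> r -> y @ \oo --> z -> K (u k) (y k) @[k --> \oo] --> K r z) /\
  (forall C : set G, compact C -> exists M, forall r z, 0 <= r -> C z -> `|K r z| <= M).

Lemma regular_test f : test_function f -> regular (fun=> f).
Proof.
move=> tf; split=> [r z u y _ _ _ yz|C _].
  by apply: continuous_cvg yz; exact: smooth_continuous (test_smooth tf) z.
by have [M [_ fM]] := test_bounded tf; exists M.
Qed.

Lemma regularD K K' : regular K -> regular K' -> regular (fun r z => K r z + K' r z).
Proof.
move=> [cK bK] [cK' bK']; split=> [r z u y r0 u0 ur yz|C cC].
  by apply: cvgD; [exact: cK|exact: cK'].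
have [[M KM] [M' KM']] := (bK C cC, bK' C cC); exists (M + M') => r z r0 Cz.
by rewrite (le_trans (ler_normD _ _))// lerD// ?KM ?KM'.
Qed.

Lemma regularM K K' : regular K -> regular K' -> regular (fun r z => K r z * K' r z).
Proof.
move=> [cK bK] [cK' bK']; split=> [r z u y r0 u0 ur yz|C cC].
  by apply: cvgM; [exact: cK|exact: cK'].
have [[M KM] [M' KM']] := (bK C cC, bK' C cC); exists (M * M') => r z r0 Cz.
by rewrite normrM ler_pM// ?KM ?KM'.
Qed.

Lemma regularZ (c : R) K : regular K -> regular (fun r z => c * K r z).
Proof.
move=> [cK bK]; split=> [r z u y r0 u0 ur yz|C cC].
  by apply: cvgM; [exact: cvg_cst|exact: cK].
have [M KM] := bK C cC; exists (`|c| * M) => r z r0 Cz.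
by rewrite normrM ler_wpM2l// KM.
Qed.

Lemma regular_sum I (l : seq I) (K : I -> R -> G -> R) : (forall i, regular (K i)) ->
  regular (fun r z => \sum_(i <- l) K i r z).
Proof.
move=> rK; elim: l => [|i l IH].
  split=> [r z u y r0 u0 ur yz|C cC].
    by rewrite big_nil; under eq_fun do rewrite big_nil; exact: cvg_cst.
  by exists 0 => r z _ _; rewrite big_nil normr0.
rewrite (_ : (fun r z => _) = fun r z => K i r z + \sum_(i <- l) K i r z); first exact: regularD.
by apply/funext => r; apply/funext => z; rewrite big_cons.
Qed.

Lemma regular_shift K c : 0 <= c -> regular K -> regular (fun r => K (c + r)).
Proof.
move=> c0 [cK bK]; split=> [r z u y r0 u0 ur yz|C cC].
  apply: (cK (c + r) z (fun k => c + u k)) => //; first exact: addr_ge0.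
    by move=> k; exact: addr_ge0.
  by apply: cvgD => //; exact: cvg_cst.
by have [M KM] := bK C cC; exists M => r z r0 Cz; apply: KM => //; exact: addr_ge0.
Qed.

Variables (m : nat) (V : 'I_m -> operator G).
Hypothesis V_left : forall i, left_invariant_vector_field (V i).

(** Continuity and local boundedness are required of [u] and of its first and second derivatives
    along the fields: after multiplication by a test function these are the integrands of Dynkin's
    formula, and the product is then globally bounded. *)
Record heat_solution (u : R -> G -> R) : Prop := {
  hs_smooth : forall r, 0 <= r -> smooth (u r) ;
  hs_regular : regular u ;
  hs_regular1 : forall i, regular (fun r => V i (u r)) ;
  hs_regular2 : forall i, regular (fun r => V i (V i (u r))) ;
  hs_derive : forall (r : R) z, 0 < r -> is_derive r 1 (u ^~ z) (sublap V (u r) z) }.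

Lemma heat_solution_shift u c : 0 <= c -> heat_solution u -> heat_solution (fun r => u (c + r)).
Proof.
move=> c0 [su r0 r1 r2 du]; split.
- by move=> r r_ge0; apply: su; exact: addr_ge0.
- exact: regular_shift.
- by move=> i; exact: (@regular_shift (fun r => V i (u r))).
- by move=> i; exact: (@regular_shift (fun r => V i (V i (u r)))).
- move=> r z r_gt0; have d1 := du _ z (ltr_wpDl c0 r_gt0).
  have d2 : is_derive r 1 (fun r : R => c + r) (1 : R).
    suff : is_derive r 1 (cst c + id) (1 : R) by [].
    by apply: is_derive_eq; rewrite add0r.
  have := @is_derive1_comp _ (u ^~ z) (fun r : R => c + r) r _ _ d1 d2.
  by rewrite mulr1.
Qed.

Lemma regular_sublap u : heat_solution u -> regular (fun r => sublap V (u r)).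
Proof. by move=> hu; apply: regularZ; apply: regular_sum => i; exact: hs_regular2. Qed.

Section reversed_process.
Variables (mu : {measure set (borel G) -> \bar R}) (mu_haar : right_haar mu).
Context d (Omega : measurableType d) (P : probability Omega R).
Variables (F : R -> set (set Omega)) (FF : filtration F).
Variables (B : 'I_m -> R -> Omega -> R) (BM : brownian_motion P F B).
Variables (Z : R -> Omega -> G) (SZ : sde_solution P F V B 1%g Z).

Lemma sde_measurable_process x (X : R -> Omega -> G) s : sde_solution P F V B x X -> 0 <= s ->
  measurable_fun setT (X s : Omega -> borel G).
Proof.
move=> SX s0 _ A mA; rewrite setTI.
exact: (filtration_sub FF s0 (sde_adapted SX s0 mA)).
Qed.

(** For fixed [r] this is an integral of [H z] against the law of the inverse of [Z r], a finite
    measure, so the results on properly supported integrands give its smoothness and its derivatives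
    in [z]. *)
Definition reversed H r z := \int[P]_w H z (Z r w)^-1%g.

Let rev_law r : 0 <= r -> exists nu : {measure set (borel G) -> \bar R},
  (forall C : set G, compact C -> (nu C < +oo)%E) /\
  (forall h, continuous h -> \int[P]_w h (Z r w)^-1%g = \int[nu]_y h y).
Proof.
move=> r0; have mZ : measurable_fun setT (fun w => (Z r w)^-1%g : borel G).
  apply: (@measurableT_comp _ _ _ _ _ _ (fun y : borel G => (y^-1)%g : borel G)).
    by apply: continuous_borel_map; exact: lie_inv_continuous.
  exact: sde_measurable_process SZ r0.
have [nu nuE] := exists_law P mZ; exists nu; split=> [C cC|h ch].
  have mC := compact_borel cC; rewrite -[nu C]nuE//.
  by rewrite (le_lt_trans (probability_le1 P _)) ?ltry// -[X in measurable X]setTI; exact: mZ.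
by rewrite (Rintegral_law mZ nuE)//; exact: continuous_borel.
Qed.

Lemma continuous_reversed H z : smooth2 H -> continuous (fun y => H z y^-1%g).
Proof.
move=> sH y; apply: (@continuous_comp _ _ _ (fun y : G => y^-1%g) (H z)).
  exact: lie_inv_continuous.
exact: smooth_continuous (smooth2_fixl z sH) _.
Qed.

Lemma integrable_reversed H r z : smooth2 H -> proper_support H -> 0 <= r ->
  P.-integrable setT (EFin \o (fun w => H z (Z r w)^-1%g)).
Proof.
move=> sH pH r0; have [M _ HM] := proper_bounded (smooth2_continuous sH) pH (@compact_set1 _ z).
apply: (@integrable_of_bounded _ _ _ P _ M); last by move=> w; exact: HM.
exact: (measurable_sde (u := fun y => H z y^-1%g) FF SZ (continuous_reversed (z := z) sH) r0).
Qed.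

Lemma smooth_reversed H r : smooth2 H -> proper_support H -> 0 <= r -> smooth (reversed H r).
Proof.
move=> sH pH r0; have [nu [nuC nuE]] := rev_law r0.
have -> : reversed H r = fun z => \int[nu]_(y in setT) H z y.
  by apply/funext => z; apply: nuE; exact: smooth_continuous (smooth2_fixl z sH).
exact: smooth_conv.
Qed.

Lemma derivation_reversed (D : operator G) H r : left_invariant_vector_field D ->
  smooth2 H -> proper_support H -> 0 <= r ->
  D (reversed H r) = reversed (fun z y => D (H ^~ y) z) r.
Proof.
move=> [Ds Dl DL _] sH pH r0; have [nu [nuC nuE]] := rev_law r0; apply/funext => z.
have -> : reversed H r = fun z => \int[nu]_(y in setT) H z y.
  by apply/funext => z'; apply: nuE; exact: smooth_continuous (smooth2_fixl z' sH).
rewrite (derivation_conv measurableT nuC Dl DL z sH pH) /reversed (nuE (fun y => D (H ^~ y) z))//.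
exact: smooth_continuous (smooth2_fixl z (smooth2_derivation Ds Dl DL sH)).
Qed.

Lemma regular_reversed H : smooth2 H -> proper_support H -> regular (reversed H).
Proof.
move=> sH pH; have cH := smooth2_continuous sH; split=> [r z u y r0 u0 ur yz|C cC]; last first.
  have [M _ HM] := proper_bounded cH pH cC; exists M => r z r0 Cz.
  apply: (expectation_bound (f := fun y => H z y^-1%g) FF SZ) => //; last by move=> y; exact: HM.
  exact: continuous_reversed.
have [b [sb _ bz [C [cC _ bC]]]] := exists_bump openT (I : setT z).
have nC : \forall k \near \oo, C (y k).
  have : b (y k) @[k --> \oo] --> b z by apply: continuous_cvg yz; exact: smooth_continuous sb z.
  move=> /(@cvgr_gt R nat \oo _ _ _)/(_ 0 bz); apply: filterS => k bk.
  by apply: contrapT => /bC E; rewrite E ltxx in bk.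
have [M _ HM] := proper_bounded cH pH cC.
(* Convergence concerns the tail only; the modified sequence stays in the compact set [C], over
   which [H] has a uniform bound. *)
pose y' k := if pselect (C (y k)) then y k else z.
have Cz : C z by apply: contrapT => /bC E; rewrite E ltxx in bz.
have y'E : {near \oo, y =1 y'}.
  by apply: filterS nC => k Ck; rewrite /y'; case: pselect.
have y'z : y' @ \oo --> z by apply: cvg_trans yz; apply: near_eq_cvg; apply: filterS y'E => k.
have Cy' k : C (y' k) by rewrite /y'; case: pselect.
suff : reversed H (u k) (y' k) @[k --> \oo] --> reversed H r z.
  by apply: cvg_trans; apply: near_eq_cvg; apply: filterS y'E => k ->.
apply: (expectation_seq_continuous FF SZ (H := fun k x => H (y' k) x^-1%g)
  (H0 := fun x => H z x^-1%g) (M := M)) => //.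
- by move=> k; exact: continuous_reversed.
- by move=> k x; exact: HM.
- move=> w; apply: (@continuous2_cvg _ _ _ _ _ _ (fun k => y' k) (fun k => (Z (u k) w)^-1%g) H z (Z r w)^-1%g) => //.
    exact: (cH (z, (Z r w)^-1%g)).
  apply: continuous_cvg; first exact: lie_inv_continuous.
  exact: (path_seq_continuous SZ).
Qed.

Lemma heat_solution_reversed f : test_function f ->
  heat_solution (reversed (fun z y => f (z * y)%g)).
Proof.
move=> tf; have sf := test_smooth tf.
have s0 := smooth2_mul sf; have p0 := proper_mul tf.
pose H1 i z y := V i (fun z => f (z * y)%g) z.
pose H2 i z y := V i (H1 i ^~ y) z.
have sV i H : smooth2 H -> smooth2 (fun z y => V i (H ^~ y) z).
  by have [Ds Dl DL _] := V_left i; exact: smooth2_derivation.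
have pV i H : smooth2 H -> proper_support H -> proper_support (fun z y => V i (H ^~ y) z).
  by have [Ds Dl DL _] := V_left i; exact: proper_derivation.
have s1 i : smooth2 (H1 i) by exact: sV.
have p1 i : proper_support (H1 i) by exact: pV.
have s2 i : smooth2 (H2 i) by exact: sV.
have p2 i : proper_support (H2 i) by exact: pV.
have E1 i r : 0 <= r -> V i (reversed (fun z y => f (z * y)%g) r) = reversed (H1 i) r.
  by move=> r0; exact: derivation_reversed.
have E2 i r : 0 <= r -> V i (V i (reversed (fun z y => f (z * y)%g) r)) = reversed (H2 i) r.
  by move=> r0; rewrite E1//; exact: derivation_reversed.
have regular_eq K K' : (forall r, 0 <= r -> K r = K' r) -> regular K' -> regular K.
  move=> KE [cK bK]; split=> [r z u y r0 u0 ur yz|C /bK[M KM]].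
    by rewrite KE//; under eq_fun do rewrite KE//; exact: cK.
  by exists M => r z r0 Cz; rewrite KE// KM.
split.
- by move=> r; exact: smooth_reversed.
- exact: regular_reversed.
- by move=> i; apply: (regular_eq _ _ (E1 i)); exact: regular_reversed.
- by move=> i; apply: (regular_eq _ _ (E2 i)); exact: regular_reversed.
- move=> r z r0; pose eta y := f (z * y^-1)%g.
  have teta : test_function eta by exact: test_inv (test_ltrans z tf).
  have dE := derive_ge0_integral (expectation_continuous FF SZ teta)
    (expectation_continuous FF SZ (test_sublap V_left teta))
    (@dynkin _ _ _ _ _ V_left _ _ _ _ FF _ BM _ _ SZ _ ^~ teta).
  have [_ _ /(_ r r0)] := dE; rewrite [X in is_derive _ _ _ X](_ : _ =
    sublap V (reversed (fun z y => f (z * y)%g) r) z)//.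
  rewrite /sublap; under [X in _ = _ * X]eq_bigr do rewrite (E2 _ _ (ltW r0)).
  rewrite /reversed -Rintegral_sum//; last first.
    by move=> i; apply: integrable_reversed => //; exact: ltW.
  rewrite -RintegralZl//; last first.
    by apply: integrableR_sum => // i; apply: integrable_reversed => //; exact: ltW.
  apply: eq_Rintegral => w _; congr (_ * _); apply: eq_bigr => i _.
  by rewrite (vf_sq_inv mu_haar (V_left i)).
Qed.

End reversed_process.

End heat_solutions.

(** * Dynkin's formula for time dependent functions *)

Section verification.
Context {R : realType} {n : nat} {G : lieGroupType R n}.
Implicit Types (f h : G -> R) (y z : G) (r s : R) (K : R -> G -> R).
Variables (m : nat) (V : 'I_m -> operator G).
Hypothesis V_left : forall i, left_invariant_vector_field (V i).
Context d (Omega : measurableType d) (P : probability Omega R).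
Variables (F : R -> set (set Omega)) (FF : filtration F).
Variables (B : 'I_m -> R -> Omega -> R) (BM : brownian_motion P F B).
Variables (x : G) (X : R -> Omega -> G) (SX : sde_solution P F V B x X).
Notation leb := (@lebesgue_measure R).
Notation L := (sublap V).

(** The integrands for which [E K(r, X_s)] is defined and continuous in both times: continuity in
    space gives measurability, and the global bound gives domination. *)
Definition good K := [/\ forall r, 0 <= r -> continuous (K r), regular K &
  exists M, forall r z, 0 <= r -> `|K r z| <= M].

Lemma good_cst f (M : R) : continuous f -> (forall z, `|f z| <= M) -> good (fun=> f).
Proof.
move=> cf fM; split=> //; last by exists M.
split=> [r z u y _ _ _ yz|C _]; last by exists M.
by apply: continuous_cvg yz; exact: cf.
Qed.

Lemma goodD K K' : good K -> good K' -> good (fun r z => K r z + K' r z).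
Proof.
move=> [cK rK [M KM]] [cK' rK' [M' KM']]; split.
- by move=> r r0 z; apply: cvgD; [exact: cK|exact: cK'].
- exact: regularD.
- by exists (M + M') => r z r0; rewrite (le_trans (ler_normD _ _))// lerD// ?KM ?KM'.
Qed.

Lemma goodZ (c : R) K : good K -> good (fun r z => c * K r z).
Proof.
move=> [cK rK [M KM]]; split.
- by move=> r r0 z; apply: cvgM; [exact: cvg_cst|exact: cK].
- exact: regularZ.
- by exists (`|c| * M) => r z r0; rewrite normrM ler_wpM2l// KM.
Qed.

Lemma good_sum I (l : seq I) (K : I -> R -> G -> R) : (forall i, good (K i)) ->
  good (fun r z => \sum_(i <- l) K i r z).
Proof.
move=> gK; elim: l => [|i l IH].
  rewrite (_ : (fun r z => _) = fun r z => 0); last by apply/funext => r; apply/funext => z; rewrite big_nil.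
  by apply: (@good_cst (fun=> 0) 0) => [|z]; [exact: cst_continuous|rewrite normr0].
rewrite (_ : (fun r z => _) = fun r z => K i r z + \sum_(i <- l) K i r z); first exact: goodD.
by apply/funext => r; apply/funext => z; rewrite big_cons.
Qed.

Lemma good_testM f K : test_function f -> (forall r, 0 <= r -> continuous (K r)) -> regular K ->
  good (fun r z => f z * K r z).
Proof.
move=> tf cK rK; split.
- by move=> r r0 z; apply: cvgM; [exact: (test_continuous tf)|exact: cK].
- exact: regularM (regular_test tf) rK.
- have /test_functionP[_ [C cC fC]] := tf.
  have [M fKM] := (regularM (regular_test tf) rK).2 C cC.
  exists (Num.max M 0) => r z r0; rewrite le_max; have [Cz|nCz] := pselect (C z).
    by rewrite fKM.
  by rewrite fC// mul0r normr0 lexx orbT.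
Qed.

Lemma good_expectation K (r s : nat -> R) (r0 s0 : R) : good K ->
  (forall k, 0 <= r k) -> (forall k, 0 <= s k) -> 0 <= r0 -> 0 <= s0 ->
  r @ \oo --> r0 -> s @ \oo --> s0 ->
  \int[P]_w K (r k) (X (s k) w) @[k --> \oo] --> \int[P]_w K r0 (X s0 w).
Proof.
move=> [cK [rK _] [M KM]] rk sk r0_ge0 s0_ge0 rr ss.
apply: (expectation_seq_continuous FF SX (H := fun k => K (r k)) (M := M)) => //.
- by move=> k; exact: cK.
- by move=> k y; exact: KM.
- by move=> w; apply: rK => //; exact: (path_seq_continuous SX).
Qed.

Lemma good_integrable K r s : good K -> 0 <= r -> 0 <= s ->
  P.-integrable setT (EFin \o (fun w => K r (X s w))).
Proof.
move=> [cK _ [M KM]] r0 s0; apply: (@integrable_of_bounded _ _ _ P _ M).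
  exact: (measurable_sde FF SX (cK r r0) s0).
by move=> w; exact: KM.
Qed.

Lemma sublapM f h z : smooth f -> smooth h ->
  L (fun y => f y * h y) z = f z * L h z + Gamma V f h z + h z * L f z.
Proof.
move=> sf sh; rewrite /sublap /Gamma !mulr_sumr -!big_split/=; apply: eq_bigr => i _.
have [Ds Dl DL _] := V_left i.
have -> : V i (fun y => f y * h y) = fun y => f y * V i h y + V i f y * h y.
  by apply/funext => y; exact: DL.
rewrite (derivationD Dl); [|by apply: smoothM => //; exact: Ds..].
by rewrite !DL//; [field|exact: Ds..].
Qed.

Lemma smooth_sublap f : smooth f -> smooth (L f).
Proof.
by move=> sf; apply: smoothZ; apply: smooth_sum => i; do 2 apply: (vf_smooth (V_left i)).
Qed.

Section horizon.
Variables (t : R) (t0 : 0 <= t).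
(** The remaining time, truncated at 0 because integrands are controlled at nonnegative times. *)
Let rho s : R := Num.max (t - s) 0.

Let rho_ge0 s : 0 <= rho s. Proof. by rewrite /rho le_max lexx orbT. Qed.

Let rho_cvg (s : R) (u : nat -> R) : u @ \oo --> s -> rho (u k) @[k --> \oo] --> rho s.
Proof.
move=> us; have c : {for s, continuous rho}.
  apply: (@continuous_max R R (fun s => t - s) (fun=> 0)); last exact: cvg_cst.
  by apply: cvgB; [exact: cvg_cst|exact: cvg_id].
by apply: continuous_cvg us; exact: c.
Qed.

Definition occupation K := \int[leb]_(s in `[0, t]) \int[P]_w K (Num.max (t - s) 0) (X s w).

Lemma good_seq_continuous K : good K ->
  seq_continuous_ge0 (fun s => \int[P]_w K (rho s) (X s w)).
Proof. by move=> gK s u s0 u0 us; apply: good_expectation => //; exact: rho_cvg. Qed.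

Lemma good_occupation K : good K ->
  leb.-integrable `[0, t] (EFin \o (fun s => \int[P]_w K (rho s) (X s w))).
Proof. by move=> gK; apply: seq_continuous_integrable => //; exact: good_seq_continuous. Qed.

Lemma occupationD K K' : good K -> good K' ->
  occupation (fun r z => K r z + K' r z) = occupation K + occupation K'.
Proof.
move=> gK gK'; rewrite /occupation -RintegralD//; [|exact: good_occupation..].
apply: eq_Rintegral => s; rewrite inE /= in_itv /= => /andP[s0 _].
by rewrite RintegralD//; [exact: (good_integrable gK (rho_ge0 s))|exact: (good_integrable gK' (rho_ge0 s))].
Qed.

Lemma occupationZ (c : R) K : good K -> occupation (fun r z => c * K r z) = c * occupation K.
Proof.
move=> gK; rewrite /occupation -RintegralZl//; last exact: good_occupation.
apply: eq_Rintegral => s; rewrite inE /= in_itv /= => /andP[s0 _].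
by rewrite RintegralZl//; exact: (good_integrable gK (rho_ge0 s)).
Qed.

Lemma occupation_le K K' : good K -> good K' -> (forall r z, 0 <= r -> K r z <= K' r z) ->
  occupation K <= occupation K'.
Proof.
move=> gK gK' KK'; apply: le_Rintegral => //; [exact: good_occupation..|].
move=> s; rewrite /= in_itv /= => /andP[s0 _].
apply: le_Rintegral => //; [exact: (good_integrable gK (rho_ge0 s))|exact: (good_integrable gK' (rho_ge0 s))|].
by move=> w _; apply: KK'; exact: rho_ge0.
Qed.

Lemma occupation_norm_le K K' : good K -> good K' -> (forall r z, 0 <= r -> `|K r z| <= K' r z) ->
  `|occupation K| <= occupation K'.
Proof.
move=> gK gK' KK'; rewrite ler_norml; apply/andP; split.
  rewrite -mulN1r -occupationZ//; apply: occupation_le => //; first exact: goodZ.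
  by move=> r z r0; have := KK' r z r0; rewrite ler_norml mulN1r => /andP[].
by apply: occupation_le => // r z r0; exact: le_trans (ler_norm _) (KK' r z r0).
Qed.

(** In [A s s'] the time of the process and the time of the function are separated: the derivative
    in [s] is Dynkin's formula at a frozen function, the one in [s'] is taken under the expectation.
    The chain rule on the diagonal joins the two, with a minus sign from the reversed time. *)
Lemma dynkin_evolution (q q' : R -> G -> R) :
  (forall r, 0 <= r -> test_function (q r)) -> good q -> good q' ->
  good (fun r => L (q r)) -> (forall (r : R) z, 0 < r -> is_derive r 1 (q ^~ z) (q' r z)) ->
  \int[P]_w q 0 (X t w) - q t x = occupation (fun r z => L (q r) z + -1 * q' r z).
Proof.
move=> tq gq gq' gL dq; have gh := goodD gL (goodZ (-1) gq').
pose A s s' := \int[P]_w q (rho s') (X s w).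
have -> : \int[P]_w q 0 (X t w) - q t x = A t t - A 0 0.
  rewrite /A /rho subrr subr0 maxxx max_l//; congr (_ - _).
  rewrite -[LHS](Rintegral_cst_prob P); apply: eq_Rintegral => w _.
  by rewrite (sde_start SX).
apply: (FTC_ge0 (f := fun s => A s s)) => //.
- exact: good_seq_continuous.
- exact: (good_seq_continuous gh).
move=> s st; have [s0 s_t] := andP st.
have -> : \int[P]_w (L (q (Num.max (t - s) 0)) (X s w) + -1 * q' (Num.max (t - s) 0) (X s w)) =
    \int[P]_w L (q (rho s)) (X s w) + -1 * \int[P]_w q' (rho s) (X s w).
  have i1 := good_integrable gL (rho_ge0 s) (ltW s0).
  have i2 := good_integrable gq' (rho_ge0 s) (ltW s0).
  by rewrite -RintegralZl// -RintegralD//; exact: (integrableRZ _ measurableT i2).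
apply: (@is_derive_diag R A (fun s s' => \int[P]_w L (q (rho s')) (X s w))
  (fun s s' => -1 * \int[P]_w q' (rho s') (X s w)) s t st).
- move=> r r' /andP[r0 _] _.
  have tr := tq _ (rho_ge0 r').
  have [_ _ /(_ r r0)//] := derive_ge0_integral (expectation_continuous FF SX tr)
    (expectation_continuous FF SX (test_sublap V_left tr))
    (@dynkin _ _ _ _ _ V_left _ _ _ _ FF _ BM _ _ SX _ ^~ tr).
- move=> r r' /andP[r0 _] /andP[r'0 r't].
  have [_ _ [M q'M]] := gq'.
  have tr' : 0 < t - r' by rewrite subr_gt0.
  have d1 : is_derive (t - r') 1 (fun s' => \int[P]_w q s' (X r w)) (\int[P]_w q' (t - r') (X r w)).
    apply: (@is_derive_Rintegral _ _ _ P (fun s' w => q s' (X r w)) (fun s' w => q' s' (X r w)) (fun=> M)) => //.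
    + by move=> s' s'0; apply: good_integrable => //; exact: ltW.
    + exact: finite_measure_integrable_cst.
    + by move=> s' w /andP[s'0 _]; apply: q'M; exact: ltW.
  have d2 : is_derive r' 1 (fun s' : R => t - s') (-1 : R).
    suff : is_derive r' 1 (cst t - id) (-1 : R) by [].
    by apply: is_derive_eq; rewrite sub0r.
  have := @is_derive1_comp _ (fun s' => \int[P]_w q s' (X r w)) (fun s' : R => t - s') r' _ _ d1 d2.
  rewrite mulrC (_ : rho r' = t - r'); last by rewrite /rho max_l// ltW.
  apply: near_eq_is_derive; near=> s'; rewrite /A /rho max_l// subr_ge0 ltW//.
  near: s'; exact: lt_nbhsl.
- move=> u v u0 v0 us vs.
  have u_ge0 k : 0 <= u k by have /andP[/ltW] := u0 k.
  have C1 := good_expectation gL (fun k => rho_ge0 (v k)) u_ge0 (rho_ge0 s) (ltW s0) (rho_cvg vs) us.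
  have C2 := good_expectation gq' (fun k => rho_ge0 (v k)) u_ge0 (rho_ge0 s) (ltW s0) (rho_cvg vs) us.
  by split=> //; apply: cvgM C2; exact: cvg_cst.
Unshelve. all: by end_near. Qed.

(** The product [chi v] is a test function at each time, and [L (chi v)] is
    [chi L v + Gamma(chi, v) + v L chi]. The two [good] clauses allow the occupation integral to be
    split afterwards into a main term and a cutoff term. *)
Lemma dynkin_cutoff (chi : G -> R) (v v' : R -> G -> R) : test_function chi ->
  (forall r, 0 <= r -> smooth (v r)) -> (forall r, 0 <= r -> continuous (v' r)) ->
  regular v -> (forall i, regular (fun r => V i (v r))) -> regular (fun r => L (v r)) ->
  regular v' -> (forall (r : R) z, 0 < r -> is_derive r 1 (v ^~ z) (v' r z)) ->
  \int[P]_w (chi (X t w) * v 0 (X t w)) - chi x * v t x =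
  occupation (fun r z => chi z * (L (v r) z - v' r z) +
                         (Gamma V chi (v r) z + L chi z * v r z)) /\
  good (fun r z => chi z * (L (v r) z - v' r z)) /\
  good (fun r z => Gamma V chi (v r) z + L chi z * v r z).
Proof.
move=> tchi sv cv' rv rVv rLv rv' dv; have schi := test_smooth tchi.
have cV f r i : 0 <= r -> continuous (V i (v r)).
  by move=> r0; apply: smooth_continuous; apply: (vf_smooth (V_left i)); exact: sv.
have cL r : 0 <= r -> continuous (L (v r)).
  by move=> r0; apply: smooth_continuous; apply: smooth_sublap; exact: sv.
have cv r : 0 <= r -> continuous (v r) by move=> r0; apply: smooth_continuous; exact: sv.
have gq : good (fun r z => chi z * v r z) by exact: good_testM.
have gq' : good (fun r z => chi z * v' r z) by exact: good_testM.
have gL : good (fun r z => chi z * L (v r) z) by exact: good_testM.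
have gG : good (fun r z => Gamma V chi (v r) z + L chi z * v r z).
  apply: goodD; last by apply: good_testM => //; exact: test_sublap.
  by apply: good_sum => i; apply: good_testM => //; [exact: test_V|move=> r; exact: cV].
have gD : good (fun r z => chi z * (L (v r) z - v' r z)).
  rewrite (_ : (fun r z => _) = (fun r z => chi z * L (v r) z + -1 * (chi z * v' r z))).
    by apply: goodD => //; exact: goodZ.
  by apply/funext => r; apply/funext => z; rewrite mulN1r mulrBr.
have LE r z : 0 <= r -> L (fun y => chi y * v r y) z =
    chi z * L (v r) z + (Gamma V chi (v r) z + L chi z * v r z).
  by move=> r0; rewrite sublapM// ?[v r z * _]mulrC ?addrA//; exact: sv.
have gLq : good (fun r => L (fun z => chi z * v r z)).
  have [c1 [r1 r1'] [M M1]] := goodD gL gG; split.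
  - move=> r r0; rewrite (_ : L _ = fun z => chi z * L (v r) z + (Gamma V chi (v r) z + L chi z * v r z)).
      exact: c1.
    by apply/funext => z; exact: LE.
  - split=> [r z u y r0 u0 ur yz|C cC].
      by rewrite LE//; under eq_fun do rewrite LE//; exact: r1.
    by have [M' M'1] := r1' C cC; exists M' => r z r0 Cz; rewrite LE// M'1.
  - by exists M => r z r0; rewrite LE// M1.
have tq r : 0 <= r -> test_function (fun z => chi z * v r z).
  by move=> r0; apply: test_smoothM => //; exact: sv.
have dq (r : R) z : 0 < r -> is_derive r 1 (fun r => chi z * v r z) (chi z * v' r z).
  move=> r0; have dr := dv r z r0.
  suff : is_derive r 1 (chi z \*: (v ^~ z)) (chi z * v' r z) by [].
  exact: is_deriveZ.
split; last by split.
rewrite (dynkin_evolution tq gq gq' gLq dq).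
rewrite /occupation; apply: eq_Rintegral => s _; apply: eq_Rintegral => w _.
by rewrite LE ?rho_ge0// mulN1r mulrBr addrAC.
Qed.

End horizon.

End verification.

(** * Removal of the cutoff *)

Section heat_representation.
Context {R : realType} {n : nat} {G : lieGroupType R n}.
Implicit Types (f h : G -> R) (y z : G) (r s eps : R) (K : R -> G -> R) (rho : G -> R).
Variables (mu : {measure set (borel G) -> \bar R}) (mu_haar : right_haar mu).
Variables (m : nat) (V : 'I_m -> operator G).
Hypothesis V_left : forall i, left_invariant_vector_field (V i).
Context d (Omega : measurableType d) (P : probability Omega R).
Variables (F : R -> set (set Omega)) (FF : filtration F).
Variables (B : 'I_m -> R -> Omega -> R) (BM : brownian_motion P F B).
Variables (x : G) (X : R -> Omega -> G) (SX : sde_solution P F V B x X).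
Variables (t : R) (t0 : 0 <= t).
Variables (u : R -> G -> R) (hu : heat_solution V u).
Variables (M : R) (uM : forall r z, 0 <= r -> `|u r z| <= M).
Notation leb := (@lebesgue_measure R).
Notation L := (sublap V).
Notation occ := (occupation P X t).
Notation sqr f := (fun z => f z * f z).

Let M_ge0 : 0 <= M. Proof. exact: le_trans (normr_ge0 _) (uM 1%g (lexx 0)). Qed.

Definition energy rho := occ (fun r z => rho z * rho z * Gamma V (u r) (u r) z).

(** [Gamma V rho rho] is what Young's inequality leaves of the cross term, and [L] of the squared
    cutoff multiplies the bounded function [u]. *)
Definition cutoff_error rho z := Gamma V rho rho z + `|L (sqr rho) z|.

Definition error rho := occ (fun=> cutoff_error rho).

Let test_sqr' rho : test_function rho -> test_function (sqr rho).
Proof. by move=> trho; exact: testM. Qed.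

Let V_sqr i h z : smooth h -> V i (sqr h) z = 2 * (h z * V i h z).
Proof. by move=> sh; rewrite (vf_leibniz (V_left i))//; ring. Qed.

Lemma L_sqr h z : smooth h -> L (sqr h) z = 2 * (h z * L h z) + Gamma V h h z.
Proof. by move=> sh; rewrite (sublapM V_left)//; ring. Qed.

Lemma Gamma_ge0 h z : 0 <= Gamma V h h z.
Proof. by apply: sumr_ge0 => i _; rewrite -expr2 sqr_ge0. Qed.

Lemma test_Gamma f h : test_function f -> smooth h -> test_function (Gamma V f h).
Proof.
move=> tf sh; apply: test_sum => i; apply: test_smoothM; first exact: test_vf.
exact: (vf_smooth (V_left i)).
Qed.

Lemma smooth_Gamma f h : smooth f -> smooth h -> smooth (Gamma V f h).
Proof.
by move=> sf sh; apply: smooth_sum => i; apply: smoothM; exact: (vf_smooth (V_left i)).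
Qed.

(** The cutoff is squared because [V i] of [rho^2] is [2 rho V i rho]: a factor [rho] remains to
    accompany the derivative of [h], which is not bounded globally. *)
Lemma Gamma_young rho h eps z : smooth rho -> 0 < eps ->
  `|Gamma V (sqr rho) h z| <= eps * (rho z * rho z * Gamma V h h z) + eps^-1 * Gamma V rho rho z.
Proof.
move=> sr e0; rewrite /Gamma !mulr_sumr -big_split/=.
apply: le_trans (ler_norm_sum _ _ _) _; apply: ler_sum => i _; rewrite V_sqr//.
set a := V i rho z; set b := V i h z; set c := rho z.
have key (s : R) : s ^+ 2 = 1 -> s * (2 * (c * a) * b) <= eps * (c * c * (b * b)) + eps^-1 * (a * a).
  move=> s1; rewrite -subr_ge0 (_ : _ - _ = eps^-1 * (eps * c * b - s * a) ^+ 2).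
    by rewrite mulr_ge0 ?sqr_ge0// invr_ge0 ltW.
  have -> : (eps * c * b - s * a) ^+ 2 =
      eps ^+ 2 * (c * b) ^+ 2 - 2 * eps * c * b * s * a + s ^+ 2 * a ^+ 2 by ring.
  by rewrite s1; field; rewrite gt_eqF.
rewrite ler_norml lerNl; apply/andP; split.
  by have := key (-1); rewrite mulN1r; apply; rewrite sqrrN expr1n.
by have := key 1; rewrite mul1r; apply; rewrite expr1n.
Qed.

Let regular_Gamma : regular (fun r => Gamma V (u r) (u r)).
Proof. by apply: regular_sum => i; apply: regularM; exact: hs_regular1. Qed.

Let continuous_Gamma r : 0 <= r -> continuous (Gamma V (u r) (u r)).
Proof. by move=> r0; apply: smooth_continuous; apply: smooth_Gamma; exact: (hs_smooth hu). Qed.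

Let continuous_L r : 0 <= r -> continuous (L (u r)).
Proof. by move=> r0; apply: smooth_continuous; apply: (smooth_sublap V_left); exact: (hs_smooth hu). Qed.

Let good_energy rho : test_function rho ->
  good (fun r z => rho z * rho z * Gamma V (u r) (u r) z).
Proof. by move=> tr; apply: good_testM => //; exact: test_sqr'. Qed.

Let good_error rho : test_function rho -> good (fun=> cutoff_error rho).
Proof.
move=> tr; have tG := test_Gamma tr (test_smooth tr).
have tL := test_sublap V_left (test_sqr' tr).
have [[C1 [_ G1]] [C2 [_ L2]]] := (test_bounded tG, test_bounded tL).
apply: (@good_cst _ _ _ _ (C1 + C2)) => z.
  apply: cvgD; first exact: (test_continuous tG).
  by apply: cvg_norm; exact: (test_continuous tL).
by rewrite (le_trans (ler_normD _ _))// normr_id lerD.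
Qed.

Let bound rho eps : R := eps * energy rho + (eps^-1 + M) * error rho.

Let good_bound rho eps : test_function rho ->
  good (fun r z => eps * (rho z * rho z * Gamma V (u r) (u r) z) + (eps^-1 + M) * cutoff_error rho z).
Proof.
move=> tr; apply: goodD; first exact: (goodZ eps (good_energy tr)).
exact: (goodZ (eps^-1 + M) (good_error tr)).
Qed.

Let boundE rho eps : test_function rho -> occ (fun r z =>
  eps * (rho z * rho z * Gamma V (u r) (u r) z) + (eps^-1 + M) * cutoff_error rho z) = bound rho eps.
Proof.
move=> tr; have g1 := good_energy tr; have g2 := good_error tr.
rewrite (occupationD FF SX t0 (goodZ eps g1) (goodZ (eps^-1 + M) g2)).
by rewrite (occupationZ FF SX t0 eps g1) (occupationZ FF SX t0 (eps^-1 + M) g2).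
Qed.

(** Common to the two cutoff estimates: [A] is 1 for [u] and [2 * M] for its square. *)
Let pointwise rho eps r z (a b A : R) : test_function rho -> 0 < eps -> 0 <= r ->
  `|a| <= A -> `|b| <= A * M ->
  `|a * Gamma V (sqr rho) (u r) z + L (sqr rho) z * b| <=
  A * (eps * (rho z * rho z * Gamma V (u r) (u r) z) + (eps^-1 + M) * cutoff_error rho z).
Proof.
move=> tr e0 r0 aA bA; have sr := test_smooth tr.
apply: le_trans (ler_normD _ _) _; rewrite normrM [X in _ + X]normrM.
have A0 := le_trans (normr_ge0 _) aA.
have H1 := ler_pM (normr_ge0 a) (normr_ge0 _) aA (Gamma_young (u r) z sr e0).
have G0 := Gamma_ge0 rho z; have N0 := normr_ge0 (L (sqr rho) z).
have H2 := ler_wpM2l N0 bA.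
apply: le_trans (lerD H1 H2) _; have ei : 0 <= eps^-1 by rewrite invr_ge0 ltW.
rewrite /cutoff_error -subr_ge0 (_ : _ - _ =
  A * (M * Gamma V rho rho z + eps^-1 * `|L (sqr rho) z|)); last by ring.
by rewrite mulr_ge0// addr_ge0// mulr_ge0.
Qed.

(** As [u] solves the heat equation, the main term of [dynkin_cutoff] vanishes and the cutoff terms
    alone are left. *)
Lemma cutoff_estimate rho eps : test_function rho -> 0 < eps ->
  `|\int[P]_w (rho (X t w) * rho (X t w) * u 0 (X t w)) - rho x * rho x * u t x| <=
  eps * energy rho + (eps^-1 + M) * error rho.
Proof.
move=> tr e0.
have [E [g1 g2]] := dynkin_cutoff V_left FF BM SX t0 (test_sqr' tr)
  (@hs_smooth _ _ _ _ _ _ hu) continuous_L (hs_regular hu) (hs_regular1 hu) (regular_sublap hu)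
  (regular_sublap hu) (hs_derive hu).
rewrite E -[leRHS](boundE eps tr); apply: (occupation_norm_le FF SX t0 (goodD g1 g2) (good_bound eps tr)) => r z r0.
rewrite subrr mulr0 add0r -[leRHS]mul1r -[Gamma _ _ _ _]mul1r.
by apply: pointwise; rewrite ?normr1 ?mul1r ?uM.
Qed.

(** For the square of [u] the main term is [Gamma(u, u)], by [L (u^2) = 2 u L u + Gamma(u, u)], and
    its occupation integral is the energy. The energy thus stands on both sides, on the right with
    the small factor [eps]. *)
Lemma cutoff_energy_estimate rho eps : test_function rho -> 0 < eps ->
  `|\int[P]_w (rho (X t w) * rho (X t w) * (u 0 (X t w) * u 0 (X t w)))
    - rho x * rho x * (u t x * u t x) - energy rho| <=
  2 * M * (eps * energy rho + (eps^-1 + M) * error rho).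
Proof.
move=> tr e0; have ru := hs_regular hu; have rL := regular_sublap hu.
have su r : 0 <= r -> smooth (u r) by exact: (hs_smooth hu).
have regular_eq K K' : (forall r z, 0 <= r -> K r z = K' r z) -> regular K' -> regular K.
  move=> KE [cK bK]; split=> [r z v y r0 v0 vr yz|C /bK[M' KM]].
    by rewrite KE//; under eq_fun do rewrite KE//; exact: cK.
  by exists M' => r z r0 Cz; rewrite KE// KM.
have rV i : regular (fun r => V i (sqr (u r))).
  apply: (regular_eq _ (fun r z => 2 * (u r z * V i (u r) z))).
    by move=> r z r0; apply: V_sqr; exact: su.
  by apply: regularZ; apply: regularM => //; exact: (hs_regular1 hu).
have rLs : regular (fun r => L (sqr (u r))).
  apply: (regular_eq _ (fun r z => 2 * (u r z * L (u r) z) + Gamma V (u r) (u r) z)).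
    by move=> r z r0; apply: L_sqr; exact: su.
  by apply: regularD => //; apply: regularZ; exact: regularM.
have rv' : regular (fun r z => 2 * (u r z * L (u r) z)).
  by apply: regularZ; exact: regularM.
have cv' r : 0 <= r -> continuous (fun z => 2 * (u r z * L (u r) z)).
  move=> r0 z; apply: cvgM; first exact: cvg_cst.
  by apply: cvgM; [exact: (smooth_continuous (su r r0))|exact: continuous_L].
have dv (r : R) z : 0 < r -> is_derive r 1 (fun r => u r z * u r z) (2 * (u r z * L (u r) z)).
  move=> r0; have dr := hs_derive hu z r0.
  suff : is_derive r 1 ((u ^~ z) * (u ^~ z)) (2 * (u r z * L (u r) z)) by [].
  by apply: is_derive_eq; rewrite /GRing.scale /=; ring.
have [E [g1 g2]] := dynkin_cutoff V_left FF BM SX t0 (test_sqr' tr)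
  (fun r (r0 : 0 <= r) => smoothM (su r r0) (su r r0)) cv' (regularM ru ru) rV rLs rv' dv.
have E2 : occ (fun r z => rho z * rho z * (L (sqr (u r)) z - 2 * (u r z * L (u r) z))) = energy rho.
  rewrite /energy /occupation; apply: eq_Rintegral => s; rewrite inE /= in_itv /= => /andP[s0 _].
  apply: eq_Rintegral => w _; rewrite L_sqr; last by apply: su; rewrite le_max lexx orbT.
  by rewrite addrAC subrr add0r.
rewrite E (occupationD FF SX t0 g1 g2) E2 addrAC subrr add0r -[X in _ <= _ * X](boundE eps tr).
rewrite -(occupationZ FF SX t0 _ (good_bound eps tr)).
apply: (occupation_norm_le FF SX t0 g2 (goodZ _ (good_bound eps tr))) => r z r0.
have -> : Gamma V (sqr rho) (sqr (u r)) z = 2 * u r z * Gamma V (sqr rho) (u r) z.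
  by rewrite /Gamma mulr_sumr; apply: eq_bigr => i _; rewrite (V_sqr i z (su r r0)); ring.
have ur := uM z r0; have M0 := M_ge0.
apply: pointwise => //; rewrite !normrM ?(ger0_norm (_ : 0 <= 2 :> R))//.
  by rewrite ler_pM2l.
apply: le_trans (ler_pM _ _ ur ur) _ => //.
by rewrite ler_wpM2r// ler_peMl// ler1n.
Qed.

(** [cutoff_error] is bounded uniformly and tends to 0 pointwise along the cutoffs, so dominated
    convergence applies under the expectation and then in time. *)
Let exists_small_cutoff : exists rho : nat -> G -> R, [/\ forall k, test_function (rho k),
  forall k z, 0 <= rho k z <= 1, forall z, rho k z @[k --> \oo] --> (1 : R) &
  error (rho k) @[k --> \oo] --> (0 : R)].
Proof.
have [rho [C [tr r01 r1 rC rV]]] := exists_cutoff mu_haar V_left; exists rho; split=> //.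
have sr k := test_smooth (tr k).
pose C' := `|C|; have C'0 : 0 <= C' := normr_ge0 C.
have VC k i z : `|V i (rho k) z| <= C' by exact: le_trans (rC k i z).1 (ler_norm _).
have VVC k i z : `|V i (V i (rho k)) z| <= C' by exact: le_trans (rC k i z).2 (ler_norm _).
have G1 k z : Gamma V (rho k) (rho k) z <= m%:R * (C' * C').
  have -> : m%:R * (C' * C') = \sum_(i < m) C' * C' by rewrite sumr_const card_ord mulr_natl.
  apply: ler_sum => i _; apply: le_trans (ler_norm _) _.
  by rewrite normrM ler_pM.
have L1 k z : `|L (rho k) z| <= 2^-1 * (m%:R * C').
  have -> : m%:R * C' = \sum_(i < m) C' by rewrite sumr_const card_ord mulr_natl.
  rewrite /sublap normrM ger0_norm// ler_wpM2l//.
  by apply: le_trans (ler_norm_sum _ _ _) _; apply: ler_sum => i _.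
(* The first summand bounds [Gamma], the other two bound [2 rho L rho + Gamma], which is [L] of the
   squared cutoff. *)
pose Q := m%:R * (C' * C') + (2 * (2^-1 * (m%:R * C')) + m%:R * (C' * C')).
have E0 k z : 0 <= cutoff_error (rho k) z by rewrite addr_ge0 ?Gamma_ge0.
have EQ k z : `|cutoff_error (rho k) z| <= Q.
  rewrite ger0_norm// /cutoff_error lerD//.
  rewrite L_sqr// (le_trans (ler_normD _ _))// lerD//; last by rewrite ger0_norm ?Gamma_ge0.
  rewrite normrM ger0_norm// ler_pM2l// normrM; have /andP[a0 a1] := r01 k z.
  by rewrite -[leRHS]mul1r ler_pM// ger0_norm.
have sum0 (h : 'I_m -> nat -> R) : (forall i, h i k @[k --> \oo] --> (0 : R)) ->
    \sum_i h i k @[k --> \oo] --> (0 : R).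
  move=> h0; elim: (index_enum _) => [|i l IH].
    by under eq_fun do rewrite big_nil; exact: cvg_cst.
  by rewrite -[X in _ --> X]addr0; under eq_fun do rewrite big_cons; exact: cvgD.
have VV0 i z : V i (rho k) z * V i (rho k) z @[k --> \oo] --> (0 : R).
  by rewrite -[X in _ --> X](mulr0 0); apply: cvgM; exact: (rV i z).1.
have G0 z : Gamma V (rho k) (rho k) z @[k --> \oo] --> (0 : R) by exact: sum0.
have L0 z : L (sqr (rho k)) z @[k --> \oo] --> (0 : R).
  have -> : (fun k => L (sqr (rho k)) z) = fun k => 2 * (rho k z * L (rho k) z) + Gamma V (rho k) (rho k) z.
    by apply/funext => k; exact: L_sqr.
  rewrite -[X in _ --> X]addr0; apply: cvgD => //.
  rewrite -[X in _ --> X](mulr0 2); apply: cvgM; first exact: cvg_cst.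
  rewrite -[X in _ --> X](mulr0 1); apply: cvgM; first exact: r1.
  rewrite -[X in _ --> X](mulr0 2^-1); apply: cvgM; first exact: cvg_cst.
  by apply: sum0 => i; exact: (rV i z).2.
have K0 z : cutoff_error (rho k) z @[k --> \oo] --> (0 : R).
  by rewrite -[X in _ --> X]addr0; apply: cvgD => //; rewrite -[X in _ --> X](normr0 R); exact: cvg_norm.
have cE k : continuous (cutoff_error (rho k)) by have [c _ _] := good_error (tr k); exact: (c 0 (lexx 0)).
have EE (s : R) : 0 <= s -> \int[P]_w cutoff_error (rho k) (X s w) @[k --> \oo] --> (0 : R).
  move=> s0; rewrite [X in _ --> X](_ : 0 = \int[P]_w (0 : R)); last by rewrite Rintegral0.
  exact: (@expectation_seq_continuous _ _ _ _ _ _ _ _ _ FF _ _ _ SX _ (fun=> 0) Q s (fun=> s) cE EQ s0 (fun=> s0) (fun w => K0 (X s w))).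
have mI : measurable (`[0, t]%classic : set (measurableTypeR R)) by exact: measurable_itv.
have iQ : leb.-integrable `[0, t] (EFin \o (fun=> Q)).
  apply: continuous_compact_integrable; first exact: segment_compact.
  by apply: continuous_subspaceT => ?; exact: cvg_cst.
have mE k : measurable_fun (`[0, t]%classic : set (measurableTypeR R))
    (fun s => \int[P]_w cutoff_error (rho k) (X s w)).
  by have /integrableP[/measurable_EFinP] := good_occupation FF SX t0 (good_error (tr k)).
have EE' (s : R) : `[0, t]%classic s -> \int[P]_w cutoff_error (rho k) (X s w) @[k --> \oo] --> (0 : R).
  by rewrite /= in_itv /= => /andP[s0 _]; exact: EE.
have EB k (s : R) : `[0, t]%classic s -> `|\int[P]_w cutoff_error (rho k) (X s w)| <= Q.
  rewrite /= in_itv /= => /andP[s0 _].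
  exact: (expectation_bound (f := cutoff_error (rho k)) FF SX).
by have [_] := dominated_cvg_Rintegral mI mE EE' iQ EB; rewrite Rintegral0.
Qed.

Let cvg_sqr1M (a : nat -> R) (c : R) : a @ \oo --> (1 : R) -> a k * a k * c @[k --> \oo] --> c.
Proof.
move=> a1; have : a k * a k * c @[k --> \oo] --> 1 * 1 * c.
  by apply: cvgM; [exact: cvgM|exact: cvg_cst].
by rewrite !mul1r.
Qed.

Let expectation_cutoff (rho : nat -> G -> R) f : (forall k, test_function (rho k)) ->
  (forall k z, 0 <= rho k z <= 1) -> (forall z, rho k z @[k --> \oo] --> (1 : R)) ->
  continuous f -> (exists C, forall z, `|f z| <= C) ->
  \int[P]_w (rho k (X t w) * rho k (X t w) * f (X t w)) @[k --> \oo] --> \int[P]_w f (X t w).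
Proof.
move=> tr r01 r1 cf [C fC].
apply: (expectation_seq_continuous FF SX (H := fun k z => rho k z * rho k z * f z) (M := C) (u := fun=> t)) => //.
- move=> k z; apply: cvgM; last exact: cf.
  by apply: cvgM; exact: (test_continuous (tr k)).
- move=> k z; have /andP[a0 a1] := r01 k z; rewrite normrM ger0_norm ?mulr_ge0//.
  by rewrite -[leRHS]mul1r ler_pM ?mulr_ge0// mulr_ile1.
- by move=> w; exact: cvg_sqr1M.
Qed.

Let u0_continuous : continuous (u 0).
Proof. by apply: smooth_continuous; exact: (hs_smooth hu). Qed.

Let energy_ge0 rho : test_function rho -> 0 <= energy rho.
Proof.
move=> tr; apply: Rintegral_ge0 => // s _; apply: Rintegral_ge0 => // w _.
by rewrite mulr_ge0 ?Gamma_ge0// -expr2 sqr_ge0.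
Qed.

Let energy_bounded (rho : nat -> G -> R) : (forall k, test_function (rho k)) ->
  (forall k z, 0 <= rho k z <= 1) -> error (rho k) @[k --> \oo] --> (0 : R) ->
  exists2 C : R, 0 <= C & \forall k \near \oo, energy (rho k) <= C.
Proof.
move=> tr r01 er; have M0 := M_ge0.
(* With [4 * M * eps <= 1] the energy on the right side of the estimate is at most half of the
   energy on the left and is absorbed. *)
pose eps := (4 * M + 1)^-1; have e0 : 0 < eps by rewrite invr_gt0 ltr_wpDl// mulr_ge0.
exists (4 * M ^+ 2 + 4 * M * (eps^-1 + M)).
  by rewrite addr_ge0// ?mulr_ge0 ?sqr_ge0// addr_ge0// invr_ge0 ltW.
have er1 : \forall k \near \oo, error (rho k) < 1 by exact: (@cvgr_lt R nat \oo _ _ _ er 1 ltr01).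
apply: filterS er1 => k ek.
have H := cutoff_energy_estimate (tr k) e0.
set I := energy (rho k) in H *; have I0 : 0 <= I by exact: energy_ge0.
have uu r z : 0 <= r -> 0 <= u r z * u r z <= M ^+ 2.
  move=> r0; rewrite -expr2 sqr_ge0/= -real_normK ?num_real// lerXn2r ?nnegrE//; exact: uM.
have r2 z : 0 <= rho k z * rho k z <= 1.
  by have /andP[a0 a1] := r01 k z; rewrite mulr_ge0//= mulr_ile1.
have A1 : `|\int[P]_w (rho k (X t w) * rho k (X t w) * (u 0 (X t w) * u 0 (X t w)))| <= M ^+ 2.
  apply: (expectation_bound (f := fun z => rho k z * rho k z * (u 0 z * u 0 z)) FF SX) => //.
    move=> z; apply: cvgM; apply: cvgM; [exact: (test_continuous (tr k))..|exact: u0_continuous|exact: u0_continuous].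
  move=> z; have /andP[a0 a1] := r2 z; have /andP[b0 b1] := uu 0 z (lexx 0).
  rewrite ger0_norm; last by rewrite mulr_ge0.
  by rewrite -[M ^+ 2]mul1r; apply: ler_pM.
have A2 : 0 <= rho k x * rho k x * (u t x * u t x).
  by have /andP[a0 _] := r2 x; have /andP[b0 _] := uu t x t0; rewrite mulr_ge0.
have A3 : 4 * M * eps <= 1.
  by rewrite /eps ler_pdivrMr ?mul1r ?lerDl// ltr_wpDl// mulr_ge0.
have A4 : 2 * M * (eps * I) <= I / 2.
  rewrite (_ : 2 * M * (eps * I) = 4 * M * eps * (I / 2)); last by field.
  by rewrite -[leRHS]mul1r ler_wpM2r// divr_ge0.
have A5 : 2 * M * ((eps^-1 + M) * error (rho k)) <= 2 * M * (eps^-1 + M).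
  rewrite ler_wpM2l ?mulr_ge0// -[leRHS]mulr1 ler_wpM2l ?ltW//.
  by rewrite ltr_wpDr// invr_gt0.
move: H A1; rewrite !ler_norml => /andP[H _] /andP[_ A1]; move: H; rewrite mulrDr; have := sqr_ge0 M.
lra.
Qed.

(** With the energies bounded by [C], the estimate tends to [eps * C] along the cutoffs for fixed
    [eps], and [eps] is arbitrary. *)
Lemma heat_solution_expectation : \int[P]_w u 0 (X t w) = u t x.
Proof.
have M0 := M_ge0; have [rho [tr r01 r1 er]] := exists_small_cutoff.
have [C C0 EC] := energy_bounded tr r01 er.
have E1 := expectation_cutoff tr r01 r1 u0_continuous (ex_intro _ M (fun z => uM z (lexx 0))).
have E2 := @cvg_sqr1M (fun k => rho k x) (u t x) (r1 x).
apply/eqP; rewrite -subr_eq0 -normr_le0; apply/ler_addgt0Pr => e e0; rewrite add0r.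
have e'0 : 0 < e / (C + 1) by rewrite divr_gt0// ltr_wpDl.
have E3 : e / (C + 1) * C + ((e / (C + 1))^-1 + M) * error (rho k) @[k --> \oo] --> e / (C + 1) * C.
  rewrite -[X in _ --> X]addr0; apply: cvgD; first exact: cvg_cst.
  by rewrite -[X in _ --> X](mulr0 ((e / (C + 1))^-1 + M)); apply: cvgM => //; exact: cvg_cst.
apply: (@le_trans _ _ (e / (C + 1) * C)); last first.
  by rewrite mulrAC ler_pdivrMr ?ltr_wpDl// ler_pM2l// lerDl.
apply: ler_cvg_to (cvg_norm (cvgB E1 E2)) E3 _; apply: filterS EC => k Ik.
apply: le_trans (cutoff_estimate (tr k) e'0) _.
by rewrite lerD2r ler_wpM2l// ltW.
Qed.

Lemma heat_solution_variance (J : R) :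
  (forall rho, test_function rho -> (forall z, 0 <= rho z <= 1) -> energy rho <= J) ->
  \int[P]_w (u 0 (X t w) * u 0 (X t w)) - u t x * u t x <= J.
Proof.
move=> HJ; have M0 := M_ge0; have [rho [tr r01 r1 er]] := exists_small_cutoff.
have [C C0 EC] := energy_bounded tr r01 er.
have cuu : continuous (fun z => u 0 z * u 0 z) by move=> z; apply: cvgM; exact: u0_continuous.
have buu : exists C, forall z, `|u 0 z * u 0 z| <= C.
  by exists (M * M) => z; rewrite normrM ler_pM// uM.
have E1 := expectation_cutoff tr r01 r1 cuu buu.
have E2 := @cvg_sqr1M (fun k => rho k x) (u t x * u t x) (r1 x).
(* [D] exceeds [2 * M * C], so that the parameter [e / D] leaves an error of at most [e]. *)
apply/ler_addgt0Pr => e e0; pose D := 2 * M * C + 1.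
have D0 : 0 < D by rewrite ltr_wpDl// !mulr_ge0.
have e'0 : 0 < e / D by rewrite divr_gt0.
have E3 : J + 2 * M * (e / D * C + ((e / D)^-1 + M) * error (rho k)) @[k --> \oo] --> J + 2 * M * (e / D * C).
  apply: cvgD; first exact: cvg_cst.
  apply: cvgM; first exact: cvg_cst.
  rewrite -[X in _ --> X]addr0; apply: cvgD; first exact: cvg_cst.
  by rewrite -[X in _ --> X](mulr0 ((e / D)^-1 + M)); apply: cvgM => //; exact: cvg_cst.
apply: (@le_trans _ _ (J + 2 * M * (e / D * C))); last first.
  rewrite lerD2l (_ : 2 * M * (e / D * C) = e * (2 * M * C) / D); last by ring.
  by rewrite ler_pdivrMr// ler_pM2l// lerDl.
apply: ler_cvg_to (cvgB E1 E2) E3 _; apply: filterS EC => k Ik.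
have := cutoff_energy_estimate (tr k) e'0; rewrite ler_norml => /andP[_].
rewrite lerBlDl => H; apply: le_trans H _; apply: lerD; first exact: HJ.
by rewrite ler_wpM2l ?mulr_ge0// lerD2r ler_wpM2l// ltW.
Qed.

End heat_representation.

(** * Spectral gaps and local estimates *)

Section main.
Context {R : realType} {n : nat} {G : lieGroupType R n}.
Implicit Types (f h : G -> R) (g x y z : G) (r s t : R).
Variables (mu : {measure set (borel G) -> \bar R}) (mu_haar : right_haar mu).
Variables (m : nat) (V : 'I_m -> operator G).
Hypothesis V_left : forall i, left_invariant_vector_field (V i).
Context d (Omega : measurableType d) (P : probability Omega R).
Variables (F : R -> set (set Omega)) (FF : filtration F).
Variables (B : 'I_m -> R -> Omega -> R) (BM : brownian_motion P F B).
Variables (X : G -> R -> Omega -> G) (SX : forall x, sde_solution P F V B x (X x)).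
Notation leb := (@lebesgue_measure R).
Notation Q := (semigroup P X).
Notation heat f := (reversed P (X 1%g) (fun z y => f (z * y)%g)).

Let heat_sol f : test_function f -> heat_solution V (heat f).
Proof. exact: (heat_solution_reversed V_left mu_haar FF BM (SX 1%g)). Qed.

Let heat0 f : heat f 0 = f.
Proof.
apply/funext => z; rewrite -[RHS](Rintegral_cst_prob P); apply: eq_Rintegral => w _.
by rewrite (sde_start (SX 1%g)) invg1 mulg1.
Qed.

Let heat_bound f (M : R) : test_function f -> (forall z, `|f z| <= M) ->
  forall r z, 0 <= r -> `|heat f r z| <= M.
Proof.
move=> tf fM r z r0; apply: (expectation_bound (f := fun y => f (z * y^-1)%g) FF (SX 1%g)) => //.
exact: (continuous_reversed (smooth2_mul (test_smooth tf))).
Qed.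

(** The solution started at [g] and the one started at the identity are compared through the same
    heat solution. The right side depends on the starting point by left translation only, which
    gives the equivariance of the semigroup. *)
Lemma semigroup_heat f t : test_function f -> 0 <= t -> Q t f = heat f t.
Proof.
move=> tf t0; apply/funext => g; have [M [_ fM]] := test_bounded tf.
rewrite -(heat_solution_expectation mu_haar V_left FF BM (SX g) t0 (heat_sol tf) (heat_bound tf fM)).
by rewrite heat0.
Qed.

Lemma semigroup_ltrans f g x t : test_function f -> 0 <= t ->
  Q t (fun y => f (g * y)%g) x = Q t f (g * x)%g.
Proof.
move=> tf t0; rewrite !semigroup_heat//; last exact: test_ltrans.
by apply: eq_Rintegral => w _; rewrite mulgA.
Qed.

(** A time shift of a heat solution is a heat solution with initial value [heat f t], whose
    expectation is therefore known as well. *)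
Lemma Chapman_Kolmogorov f s t x : test_function f -> 0 <= s -> 0 <= t ->
  Q s (heat f t) x = Q (t + s) f x.
Proof.
move=> tf s0 t0; have [M [_ fM]] := test_bounded tf; rewrite (semigroup_heat tf) ?addr_ge0//.
rewrite -(heat_solution_expectation mu_haar V_left FF BM (SX x) s0
  (heat_solution_shift t0 (heat_sol tf)) (M := M)); first by rewrite addr0.
by move=> r z r0; apply: heat_bound => //; exact: addr_ge0.
Qed.

Lemma Gamma_ltrans f g x : smooth f ->
  Gamma V (fun y => f (g * y)%g) (fun y => f (g * y)%g) x = Gamma V f f (g * x)%g.
Proof. by move=> sf; apply: eq_bigr => i _; rewrite (vf_translate (V_left i)). Qed.

Lemma local_estimate_translate (a : R -> R) (g h : G) :
  local_estimate P V X a g -> local_estimate P V X a h.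
Proof.
move=> E f tf t t0; have t0' := ltW t0; have sf := test_smooth tf.
have := E _ (test_ltrans (h * g^-1)%g tf) t t0.
rewrite (semigroup_ltrans (h * g^-1)%g g (test_sqr tf) t0') (semigroup_ltrans _ _ tf t0').
have -> : Gamma V (fun x => f (h * g^-1 * x)%g) (fun x => f (h * g^-1 * x)%g) =
    fun x => Gamma V f f (h * g^-1 * x)%g by apply/funext => x; exact: Gamma_ltrans.
rewrite (semigroup_ltrans _ _ (test_Gamma V_left tf sf) t0').
by rewrite -mulgA mulVg mulg1.
Qed.

Section density.
Variables (p : R -> G -> R) (p_kernel : heat_kernel P mu (X 1%g) p).

Lemma semigroup_density (k : G -> R) (t : R) : continuous k -> 0 < t ->
  \int[mu]_x (k x * expR (- - ln (p t x))) = Q t k 1%g.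
Proof.
move=> ck t0; have [sp p0 pE] := p_kernel t0; have cp := smooth_continuous sp.
have mZ := sde_measurable_process FF (SX 1%g) (ltW t0).
have [nu nuE] := exists_law P mZ.
rewrite /semigroup -(Rintegral_law mZ nuE); last exact: continuous_borel.
have nuE' A : measurable A -> nu A = (\int[mu]_(x in A) (p t x)%:E)%E.
  by move=> mA; have := pE A mA; rewrite nuE.
rewrite (Rintegral_density (continuous_borel cp) _ nuE' (continuous_borel ck)); last first.
  by move=> x; exact: ltW.
by apply: eq_Rintegral => x _; rewrite opprK lnK// posrE.
Qed.

Lemma spectral_gap_local_estimate (a : R -> R) :
  (forall t, 0 < t -> ou_spectral_gap V mu (fun x => - ln (p t x)) (a t)) <->
  local_estimate P V X a 1%g.
Proof.
split=> [gap f tf t t0|E t t0 f tf]; last first.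
  have sf := test_smooth tf; have cf := smooth_continuous sf.
  rewrite !semigroup_density//; last 2 first.
  - exact: (test_continuous (test_Gamma V_left tf sf)).
  - exact: (test_continuous (test_sqr tf)).
  by move=> f0; have := E f tf t t0; rewrite f0 expr0n/= subr0.
have t0' := ltW t0; have sf := test_smooth tf; have cf := smooth_continuous sf.
have [rho [C [tr r01 r1 rC rV]]] := exists_cutoff mu_haar V_left.
have [M [M0 fM]] := test_bounded tf.
pose c := Q t f 1%g; pose e k := Q t (rho k) 1%g.
have iX k : test_function k -> P.-integrable setT (EFin \o (fun w => k (X 1%g t w))).
  by move=> tk; exact: (integrable_sde FF (SX 1%g)).
have cM : `|c| <= M by exact: (expectation_bound FF (SX 1%g)).
have DCT (H : nat -> G -> R) H0 M' : (forall k, continuous (H k)) -> (forall k y, `|H k y| <= M') ->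
    (forall z, H k z @[k --> \oo] --> H0 z) -> Q t (H k) 1%g @[k --> \oo] --> Q t H0 1%g.
  move=> cH HM HH; apply: (@expectation_seq_continuous _ _ _ _ _ _ _ _ _ FF _ _ _ (SX 1%g) H H0 M' t (fun=> t)) => // w.
have rho1 k y : `|rho k y| <= 1 by have /andP[a0 a1] := r01 k y; rewrite ger0_norm.
have e1 : e @ \oo --> (1 : R).
  rewrite -[X in _ --> X](Rintegral_cst_prob P); apply: (DCT rho (fun=> 1) 1) => // k.
  exact: (test_continuous (tr k)).
have eM k : `|e k| <= 1.
  by apply: (expectation_bound FF (SX 1%g)) => //; exact: (test_continuous (tr k)).
(* The factor [e k] in front of [f] makes the mean exactly 0, namely [e k * c - c * e k]. Since
   [e k] tends to 1, [fk k] tends to [f - c]. *)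
pose fk k x := e k * f x + - c * rho k x.
have tfk k : test_function (fk k) by apply: testD; apply: testZ.
have Vfk k i x : V i (fk k) x = e k * V i f x + - c * V i (rho k) x.
  have [_ Dl _ _] := V_left i.
  rewrite (derivationD Dl) ?(derivationZ Dl)//; [exact: test_smooth|apply: smoothZ => //|apply: smoothZ; exact: test_smooth].
have fk0 k : Q t (fk k) 1%g = 0.
  rewrite /semigroup RintegralD//; [|by apply: (iX (fun x => e k * f x)); exact: testZ|].
    rewrite !RintegralZl//; [|exact: iX..].
    by rewrite -/(Q t f 1%g) -/(Q t (rho k) 1%g) -/c -/(e k) mulrC mulNr subrr.
  by apply: (iX (fun x => - c * rho k x)); exact: testZ.
have ineq k : 2 * a t * Q t (fun x => fk k x ^+ 2) 1%g <= Q t (Gamma V (fk k) (fk k)) 1%g.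
  have := gap t t0 _ (tfk k); rewrite !semigroup_density//.
  - by apply.
  - exact: (test_continuous (test_Gamma V_left (tfk k) (test_smooth (tfk k)))).
  - exact: (test_continuous (test_sqr (tfk k))).
  - exact: (test_continuous (tfk k)).
have bd (b1 b2 c1 c2 : R) : `|b1| <= c1 -> `|b2| <= c2 -> forall k, `|e k * b1 + - c * b2| <= c1 + M * c2.
  move=> AA BB k; rewrite (le_trans (ler_normD _ _))// !normrM normrN lerD//; last by rewrite ler_pM.
  by rewrite -[leRHS]mul1r ler_pM.
have lim (A : R) (Bk : nat -> R) B0 : Bk @ \oo --> B0 ->
    e k * A + - c * Bk k @[k --> \oo] --> A - c * B0.
  move=> CB; rewrite -[A in X in _ --> X]mul1r -mulNr; apply: cvgD; apply: cvgM => //; exact: cvg_cst.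
have C1 : Q t (fun x => fk k x ^+ 2) 1%g @[k --> \oo] --> Q t (fun x => (f x - c) ^+ 2) 1%g.
  apply: (DCT _ _ ((M + M * 1) ^+ 2)).
  - by move=> k; exact: (test_continuous (test_sqr (tfk k))).
  - move=> k y; rewrite normrX lerXn2r ?nnegrE ?addr_ge0 ?mulr_ge0//; exact: bd.
  - move=> z; rewrite expr2 -[c in X in _ --> X]mulr1; under eq_fun do rewrite expr2.
    by apply: cvgM; exact: lim.
have [Mi MiP] : exists Mi : 'I_m -> R, forall i, 0 <= Mi i /\ forall z, `|V i f z| <= Mi i.
  have H i := test_bounded (test_vf (V_left i) tf).
  by exists (fun i => sval (cid (H i))) => i; exact: (svalP (cid (H i))).
have C2 : Q t (Gamma V (fk k) (fk k)) 1%g @[k --> \oo] --> Q t (Gamma V f f) 1%g.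
  apply: (DCT _ _ (\sum_(i < m) (Mi i + M * C) * (Mi i + M * C))).
  - by move=> k; exact: (test_continuous (test_Gamma V_left (tfk k) (test_smooth (tfk k)))).
  - move=> k y; apply: le_trans (ler_norm_sum _ _ _) _; apply: ler_sum => i _.
    by rewrite normrM Vfk ler_pM// bd//; [exact: (MiP i).2|exact: (rC k i y).1|exact: (MiP i).2|exact: (rC k i y).1].
  - move=> z; rewrite /Gamma; elim: (index_enum _) => [|i l IH].
      by under eq_fun do rewrite big_nil; rewrite big_nil; exact: cvg_cst.
    under eq_fun do rewrite big_cons; rewrite big_cons; apply: cvgD => //.
    under eq_fun do rewrite Vfk.
    have := lim (V i f z) _ _ (rV i z).1; rewrite mulr0 subr0 => L.
    exact: cvgM.
have -> : Q t (fun x => f x ^+ 2) 1%g - Q t f 1%g ^+ 2 = Q t (fun x => (f x - c) ^+ 2) 1%g.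
  have E2 : (fun w => (f (X 1%g t w) - c) ^+ 2) =
      (fun w => (f (X 1%g t w) ^+ 2 + (- (2 * c)) * f (X 1%g t w)) + c ^+ 2).
    by apply/funext => w; ring.
  have i1 := iX _ (test_sqr tf); have i2 := integrableRZ (- (2 * c)) measurableT (iX _ tf).
  rewrite {3}/semigroup E2 RintegralD//; last 2 first.
  - exact: integrableRD.
  - exact: finite_measure_integrable_cst.
  rewrite RintegralD// RintegralZl//; last exact: iX.
  rewrite Rintegral_cst_prob -/(Q t f 1%g) -/c -/(Q t (fun x => f x ^+ 2) 1%g); ring.
apply: ler_cvg_to (_ : 2 * a t * Q t (fun x => fk k x ^+ 2) 1%g @[k --> \oo] --> _) C2 _.
  by apply: cvgM => //; exact: cvg_cst.
exact: nearW.
Qed.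

End density.

(** The variance of [f] under [P_t] is bounded by any common bound for the cutoff energies, so it
    suffices to bound these by [J * Q t (Gamma V f f) 1]; the normalization [a t * J = 1 / 2]
    concludes. *)
Lemma gradient_bound_local_estimate (a phi : R -> R) :
  (forall t, 0 <= t -> 0 < phi t) ->
  (forall T, 0 <= T -> leb.-integrable `[0, T] (EFin \o phi)) ->
  (forall f, test_function f -> forall t, 0 <= t ->
     Gamma V (Q t f) (Q t f) 1%g <= phi t * Q t (Gamma V f f) 1%g) ->
  (forall t, 0 < t -> a t * \int[leb]_(s in `[0, t]) phi (t - s) = 1 / 2) ->
  local_estimate P V X a 1%g.
Proof.
move=> phi0 iphi grad aE f tf t t0; have t0' := ltW t0; have sf := test_smooth tf.
have tG := test_Gamma V_left tf sf; have [M [_ fM]] := test_bounded tf.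
(* The gradient bound is given at the identity only; applied to left translates of [f] it holds at
   every point. *)
have grad' r z : 0 <= r -> Gamma V (heat f r) (heat f r) z <= phi r * Q r (Gamma V f f) z.
  move=> r0; have := grad _ (test_ltrans z tf) r r0.
  have -> : Q r (fun y => f (z * y)%g) = fun y => heat f r (z * y)%g.
    by apply/funext => y; rewrite semigroup_ltrans// semigroup_heat.
  have -> : Gamma V (fun y => f (z * y)%g) (fun y => f (z * y)%g) = fun y => Gamma V f f (z * y)%g.
    by apply/funext => y; exact: Gamma_ltrans.
  rewrite Gamma_ltrans; last exact: (hs_smooth (heat_sol tf)).
  by rewrite semigroup_ltrans// mulg1.
pose I : set (measurableTypeR R) := `[0, t]%classic.
have mI : measurable I by exact: measurable_itv.
have mphi : measurable_fun I (fun s => phi (t - s)).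
  have /integrableP[/measurable_EFinP m1 _] := iphi t t0'.
  apply: (measurable_comp mI _ m1); last by apply: measurable_funB => //; exact: measurable_funTS.
  by move=> _ [s Is <-]; move: Is; rewrite /I /= !in_itv /= subr_ge0 gerBl => /andP[-> ->].
have aI := aE t t0; set J := \int[leb]_(s in `[0, t]) phi (t - s) in aI.
have phi_ge0 s : I s -> 0 <= phi (t - s).
  by rewrite /I /= in_itv /= => /andP[_ st]; rewrite ltW// phi0// subr_ge0.
have iphi' : leb.-integrable I (EFin \o (fun s => phi (t - s))).
  apply/integrableP; split; first exact/measurable_EFinP.
  have E : (\int[leb]_(s in I) `|(EFin \o (fun s => phi (t - s)%R)) s| = \int[leb]_(s in I) (phi (t - s)%R)%:E)%E.
    by apply: eq_integral => s; rewrite inE => Is; rewrite gee0_abs// lee_fin phi_ge0.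
  (* Were the integral infinite, its real part would be 0 by convention, against [a t * J = 1 / 2].
     This yields integrability of the reversed function from the normalization. *)
  rewrite E ltey; apply/eqP => oo; move: aI; rewrite /J /Rintegral oo /= mulr0 => /esym/eqP.
  by rewrite mulf_eq0 oner_eq0 invr_eq0 pnatr_eq0.
have iheat k r s : test_function k -> 0 <= r -> 0 <= s ->
    P.-integrable setT (EFin \o (fun w => heat k r (X 1%g s w))).
  move=> tk r0 s0; have [M' [_ kM]] := test_bounded tk.
  apply: (@integrable_of_bounded _ _ _ P _ M'); last by move=> w; exact: heat_bound.
  apply: (measurable_sde FF (SX 1%g)) => //; apply: smooth_continuous.
  exact: (hs_smooth (heat_sol tk)).
have bound rho : test_function rho -> (forall z, 0 <= rho z <= 1) ->
    energy V P (X 1%g) t (heat f) rho <= J * Q t (Gamma V f f) 1%g.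
  move=> tr r01; have hs := heat_sol tf.
  have ge : good (fun r z => rho z * rho z * Gamma V (heat f r) (heat f r) z).
    apply: good_testM; first exact: testM.
      move=> r r0; apply: smooth_continuous; apply: (smooth_Gamma V_left); exact: (hs_smooth hs).
    by apply: regular_sum => i; apply: regularM; exact: (hs_regular1 hs).
  rewrite /J mulrC -RintegralZl//; apply: le_Rintegral => //.
  - exact: (good_occupation FF (SX 1%g) t0' ge).
  - exact: integrableRZ.
  move=> s Is; have := Is; rewrite /I /= in_itv /= => /andP[s0 st].
  have ts : 0 <= t - s by rewrite subr_ge0.
  (* Writing [t] as [(t - s) + s], the Chapman-Kolmogorov equation turns [Q t (Gamma V f f) 1] into
     the expectation at time [s] of the same heat solution that bounds the gradient. *)
  rewrite max_l// mulrC -[t in Q t _ _](subrK s) -Chapman_Kolmogorov//.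
  have ih := iheat _ _ _ tG ts s0.
  rewrite /semigroup -RintegralZl//.
  apply: le_Rintegral => //.
  + exact: (good_integrable FF (SX 1%g) ge).
  + exact: integrableRZ.
  move=> w _; set z := X 1%g s w.
  have /andP[a0 a1] := r01 z; have H := grad' (t - s) z ts; rewrite semigroup_heat// in H.
  apply: le_trans H; rewrite -[leRHS]mul1r.
  by apply: ler_wpM2r; [exact: Gamma_ge0|exact: mulr_ile1].
have := heat_solution_variance mu_haar V_left FF BM (SX 1%g) t0' (heat_sol tf) (heat_bound tf fM) bound.
rewrite heat0 -semigroup_heat// -[_ * _ in X in _ - X]expr2 => H.
have J0 : 0 <= J by exact: Rintegral_ge0.
have at_gt0 : 0 < a t.
  rewrite lt0r; apply/andP; split.
    by apply/eqP => at0; move: aI; rewrite at0 mul0r => /esym/eqP; rewrite mulf_eq0 oner_eq0 invr_eq0 pnatr_eq0.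
  rewrite leNgt; apply/negP => alt; have := mulr_le0_ge0 (ltW alt) J0; rewrite aI leNgt divr_gt0//.
apply: le_trans (ler_wpM2l _ H) _; first by rewrite mulr_ge0// ltW.
by rewrite mulrA -[2 * _ * _]mulrA aI mulrA mulr1 divff ?mul1r// pnatr_eq0.
Qed.

End main.

Theorem theorem4p1 (R : realType) (n : nat) (G : lieGroupType R n)
  (G_connected : connected [set: G])
  (mu : {measure set borel G -> \bar R}) (mu_haar : right_haar mu)
  (d : nat) (V : 'I_d -> operator G)
  (V_left : forall i, left_invariant_vector_field (V i))
  (V_gen : lie_generating V)
  (disp : measure_display) (Omega : measurableType disp)
  (P : probability Omega R)
  (F : R -> set (set Omega)) (F_filtration : filtration F)
  (B : 'I_d -> R -> Omega -> R) (B_brownian : brownian_motion P F B)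
  (X : G -> R -> Omega -> G)
  (X_solution : forall x, sde_solution P F V B x (X x))
  (p : R -> G -> R) (p_kernel : heat_kernel P mu (X 1%g) p)
  (a : R -> R) (a_gt0 : forall t, 0 < t -> 0 < a t) :
  let W t x := - ln (p t x) in
  let assertion_i := forall t, 0 < t -> ou_spectral_gap V mu (W t) (a t) in
  [/\ assertion_i <-> (exists g, local_estimate P V X a g),
      (exists g, local_estimate P V X a g) <->
        (forall g, local_estimate P V X a g) &
      forall phi : R -> R,
        (forall t, 0 <= t -> 0 < phi t) ->
        (forall T, 0 <= T ->
           lebesgue_measure.-integrable `[0, T] (EFin \o phi)) ->
        (forall f, test_function f -> forall t, 0 <= t ->
           Gamma V (semigroup P X t f) (semigroup P X t f) 1%g <=
           phi t * semigroup P X t (Gamma V f f) 1%g) ->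
        (forall t, 0 < t ->
           a t * \int[lebesgue_measure]_(s in `[0, t]) phi (t - s) = 1 / 2) ->
        assertion_i /\ (forall g, local_estimate P V X a g)].
Proof.
have HT g h : local_estimate P V X a g -> local_estimate P V X a h.
  exact: (local_estimate_translate mu_haar V_left F_filtration B_brownian X_solution).
have gapP : (forall t, 0 < t -> ou_spectral_gap V mu (fun x => - ln (p t x)) (a t)) <->
    local_estimate P V X a 1%g.
  exact: (spectral_gap_local_estimate mu_haar V_left F_filtration X_solution p_kernel).
move=> W assertion_i; split.
- by split=> [/gapP E|[g E]]; [exists 1%g|apply/gapP; exact: HT E].
- by split=> [[g E] h|E]; [exact: HT E|exists 1%g].
- move=> phi phi0 iphi grad aE.
  have E : local_estimate P V X a 1%g.
    exact: (gradient_bound_local_estimate mu_haar V_left F_filtration B_brownian X_solution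
      phi0 iphi grad aE).
  by split=> [|g]; [apply/gapP|exact: HT E].
Qed.
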